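(* Assume $A$ is symmetrizable and even. Let $\lambda\in P^+$ and $S\subset I$, and put $\tilde S=\{(i,1)\}_{i\in S\cap I^{re}}\sqcup\{(i,m)\}_{i\in S\cap I^{im},m\in\mathbb Z_{\ge1}}$. Then, as $\mathfrak g_S$-crystals, $$\mathbb B(\lambda)\ \cong\ \bigsqcup_{\substack{\pi\in\mathbb B(\lambda)\\ \tilde\pi\ \tilde{\mathfrak g}_{\tilde S}\text{-dominant}}}\mathbb B_S\bigl(\pi(1)\bigr),$$ where $\tilde\pi$ is the image of $\pi$ under $\mathbb B(\lambda)\to\tilde{\mathbb B}(\tilde\lambda)$, $F_{\mathbf i}\pi_\lambda\mapsto F_{(\mathbf i,\mathbf m)}\pi_{\tilde\lambda}$, and $\tilde\pi$ is $\tilde{\mathfrak g}_{\tilde S}$-dominant if $\tilde\alpha^\vee_{(i,m)}(\tilde\pi(t))\ge0$ for all $(i,m)\in\tilde S$ and $t\in[0,1]$.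
   Context: Same setting as follows. Borcherds–Cartan datum $(A,\{\alpha_i\}_{i\in I},\{\alpha_i^\vee\}_{i\in I},P,P^\vee)$: $I$ countable; $a_{ii}=2$ or $a_{ii}\in\mathbb Z_{\le0}$, $a_{ij}\in\mathbb Z_{\le0}$ ($i\neq j$), $a_{ij}=0\iff a_{ji}=0$; symmetrizable and even ($a_{ii}\in2\mathbb Z$); $\alpha_i^\vee(\alpha_j)=a_{ij}$; simple roots, coroots linearly independent; $I^{re}=\{a_{ii}=2\}$, $I^{im}=I\setminus I^{re}$. $r_i(\mu)=\mu-\alpha_i^\vee(\mu)\alpha_i$; $\mathcal W_{re}=\langle r_i:i\in I^{re}\rangle$; $\Delta^+_{re}$ positive real roots; $\Delta_{im}=\mathcal W_{re}\{\alpha_i\}_{i\in I^{im}}$; $\beta^\vee=w\alpha_i^\vee$, $r_\beta=wr_iw^{-1}$. Monoid $\mathcal W$ generated by $r_i$ with $r_i^2=1$ (real $i$), $(r_ir_j)^m=(r_jr_i)^m=1$ for real $i\ne j$ with $\mathrm{ord}(r_ir_j)=m\in\{2,3,4,6\}$, $r_ir_j=r_jr_i$ for $i\in I^{im},j\neq i,a_{ij}=0$. Order $\ge$ on $\mathcal W\lambda$, covering arrows $\xleftarrow\beta$, $a$-chains, GLS paths of shape $\lambda$ and the set $\mathbb B(\lambda)$ of them, root operators $f_i,e_i$ on piecewise-linear paths, the monoid $\mathcal F$ of the $f_i$, $F_{\mathbf i}=f_{i_k}\cdots f_{i_1}$, $\pi_\lambda(t)=t\lambda$ ($\mathbb B(\lambda)=\mathcal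 F\pi_\lambda\setminus\{\mathbf 0\}$), and the crystal structure on $\mathbb B(\lambda)$ ($\mathrm{wt}=\pi(1)$; $\varepsilon_i=-m_i^\pi$, $\varphi_i=H_i^\pi(1)-m_i^\pi$ for real $i$, where $H_i^\pi=\alpha_i^\vee\circ\pi$ and $m_i^\pi$ is the minimum of its integer values; $\varepsilon_i=0$, $\varphi_i=\alpha_i^\vee(\pi(1))$ for imaginary $i$; $f_i$ and real $e_i$ the root operators; imaginary $e_i$ the root operator cut off to $\mathbf0$ when leaving $\mathbb B(\lambda)$) are as in Joseph–Lamprou's path model: $f_i\pi$ is $\mathbf0$ if $f_+^i:=\max\{t:H_i^\pi(t)=m_i^\pi\}=1$, else it equals $\pi$ on $[0,f_+^i]$, $\pi-(H_i^\pi-m_i^\pi)\alpha_i$ on $[f_+^i,f_-^i]$ with $f_-^i=\min\{t\ge f_+^i:H_i^\pi=m_i^\pi+1\}$, $\pi-\alpha_i$ after; real $e_i$ is defined symmetrically from $e_+^i=\min\{t:H_i^\pi=m_i^\pi\}$ (zero if $e_+^i=0$), $e_-^i=\max\{t\le e_+^i:H_i^\pi=m_i^\pi+1\}$, adding $-(H_i^\pi-m_i^\pi-1)\alpha_i$ on $[e_-^i,e_+^i]$ and $\alpha_i$ after; imaginary $e_i$: $e_-^i=f_+^i$, zero if $e_-^i=1$ or $H_i^\pi<m_i^\pi+1-a_{ii}$ on $[e_-^i,1]$, else $e_+^i=\min\{t\ge e_-^i:H_i^\pi=m_i^\pi+1-a_{ii}\}$, zero if $H_i^\pi(s)\le m_i^\pi-a_{ii}$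 for some $s\ge e_+^i$, else add $\frac{1}{1-a_{ii}}(H_i^\pi-m_i^\pi)\alpha_i$ on $[e_-^i,e_+^i]$ and $\alpha_i$ after. A GLS path $(\lambda_1>\dots>\lambda_k;0=a_0<\dots<a_k=1)$ requires $\lambda_s\in\mathcal W\lambda$, an $a_s$-chain for $(\lambda_s,\lambda_{s+1})$ and a 1-chain for $(\lambda_k,\lambda)$, where an $a$-chain $\mu=\nu_0\xleftarrow{\beta_1}\cdots\xleftarrow{\beta_k}\nu_k=\nu$ consists of covering relations $\nu_{s-1}=r_{\beta_s}\nu_s$, $\beta_s^\vee(\nu_s)>0$ for the order generated by such relations, with $a\beta_s^\vee(\nu_s)\in\mathbb Z_{>0}$ (real) or $=1$ (imaginary). Levi part: $\mathfrak g_S$ is the generalized Kac–Moody algebra of the datum $((a_{ij})_{i,j\in S},\{\alpha_i\}_{i\in S},\{\alpha_i^\vee\}_{i\in S},P,P^\vee)$; $\mathbb B_S(\mu)$ is the set of GLS paths of shape $\mu$ for this datum (defined for $\mu$ with $\alpha_i^\vee(\mu)\ge0$, $i\in S$); ''as $\mathfrak g_S$-crystals'' means only $e_i,f_i,\varepsilon_i,\varphi_i$ for $i\in S$ and $\mathrm{wt}$ are considered. Kac–Moody side: $\tilde I=\{(i,1)\}_{i\in I^{re}}\sqcup\{(i,m)\}_{i\in I^{im},m\ge1}$, $\tilde A$ with $2$ on the diagonal and $\tilde a_{(i,m),(j,n)}=a_{ij}$ otherwise, a Cartan datum $(\tilde A,\{\tilde\alpha_{(i,m)}\},\{\tilde\alpha^\vee_{(i,m)}\},\tilde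 P,\tilde P^\vee)$, Kac–Moody algebra $\tilde{\mathfrak g}$ with Levi subalgebra $\tilde{\mathfrak g}_{\tilde S}$; $\tilde\lambda\in\tilde P$ fixed with $\tilde\alpha^\vee_{(i,m)}(\tilde\lambda)=\alpha_i^\vee(\lambda)$; $\tilde{\mathbb B}(\tilde\lambda)$ LS paths for $\tilde{\mathfrak g}$, root operators $f_{(i,m)}$. For $\mathbf i=(i_k,\ldots,i_1)$, $m_s=1$ if $i_s$ real and $m_s=\#\{t\le s:i_t=i_s\}$ if $i_s$ imaginary; $F_{(\mathbf i,\mathbf m)}=f_{(i_k,m_k)}\cdots f_{(i_1,m_1)}$. The map $F_{\mathbf i}\pi_\lambda\mapsto F_{(\mathbf i,\mathbf m)}\pi_{\tilde\lambda}$ is well defined and injective. *)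

(* Defs.v *)
From HB Require Import structures.
From mathcomp Require Import all_boot all_order all_algebra.
From mathcomp Require Import boolp classical_sets reals.
Set Implicit Arguments.
Unset Strict Implicit.
Unset Printing Implicit Defensive.
Import Order.TTheory GRing.Theory Num.Theory.
Local Open Scope ring_scope.

(* Generic (raw) root datum: index set, Cartan matrix, simple roots in a real *)
(* vector space V (= R (x)_Z P), simple coroots as functionals on V.          *)
Section Raw.
Variable R : realType.

Definition I01 := {t : R | (0 <= t <= 1)}.
Lemma one01_proof : (0 <= (1 : R) <= 1). Proof. by rewrite ler01 lexx. Qed.
Definition one01 : I01 := exist _ 1 one01_proof.

Variable V : lmodType R.

Definition rpath := I01 -> V.

Record rdat := RDat {
  idx : Type;
  cm : idx -> idx -> int;
  sroot : idx -> V;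
  scoroot : idx -> V -> R }.

Variable D : rdat.

Definition is_real (i : idx D) : bool := cm i i == 2%:Z.

Definition refl (i : idx D) (mu : V) : V := mu - scoroot i mu *: sroot i.
Definition wact (w : seq (idx D)) (mu : V) : V := foldr refl mu w.

(* root beta = w alpha_i (w in W_re), its coroot beta^v = w alpha_i^v, and r_beta *)
Definition root_of (w : seq (idx D)) (i : idx D) : V := wact w (sroot i).
Definition corootf (w : seq (idx D)) (i : idx D) (mu : V) : R :=
  scoroot i (wact (rev w) mu).
Definition rrefl (w : seq (idx D)) (i : idx D) (mu : V) : V :=
  wact w (refl i (wact (rev w) mu)).

Definition posQ (beta : V) : Prop :=
  exists s : seq (idx D * nat), beta = \sum_(p <- s) (p.2)%:R *: sroot p.1.

(* (w,i) describes a root of Delta^+_re (i real) or Delta_im (i imaginary) *)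
Definition root_data (w : seq (idx D)) (i : idx D) : Prop :=
  all is_real w /\ (is_real i -> posQ (root_of w i)).

Inductive orbit (lam : V) : V -> Prop :=
| orbit_base : orbit lam lam
| orbit_step (i : idx D) (mu : V) : orbit lam mu -> orbit lam (refl i mu).

Definition gen_rel (lam mu nu : V) : Prop :=
  orbit lam mu /\ orbit lam nu /\
  exists w i, root_data w i /\ mu = rrefl w i nu /\ 0 < corootf w i nu.

Inductive ord_ge (lam : V) : V -> V -> Prop :=
| ord_ge_refl mu : ord_ge lam mu mu
| ord_ge_step mu ka nu : gen_rel lam mu ka -> ord_ge lam ka nu -> ord_ge lam mu nu.

Definition ord_gt (lam mu nu : V) : Prop := ord_ge lam mu nu /\ mu <> nu.

Definition covers (lam mu nu : V) : Prop :=
  ord_gt lam mu nu /\ ~ (exists ka, ord_gt lam mu ka /\ ord_gt lam ka nu).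

Definition arrow (lam : V) (a : R) (mu nu : V) : Prop :=
  covers lam mu nu /\
  exists w i, root_data w i /\ mu = rrefl w i nu /\ 0 < corootf w i nu /\
    (if is_real i then exists n : nat, (0 < n)%N /\ a * corootf w i nu = n%:R
     else a * corootf w i nu = 1).

Inductive achain (lam : V) (a : R) : V -> V -> Prop :=
| achain_nil mu : achain lam a mu mu
| achain_cons mu ka nu : arrow lam a mu ka -> achain lam a ka nu -> achain lam a mu nu.

(* GLS rpath data: l = [:: (lam_1, a_1); ...; (lam_k, a_k)] *)
Definition lams (l : seq (V * R)) : seq V := map fst l.
Definition avals (l : seq (V * R)) : seq R := 0 :: map snd l.

Definition gls_fun (l : seq (V * R)) : rpath := fun u =>
  \sum_(s < size l)
     (Num.min (nth 0 (map snd l) s) (Num.max (nth 0 (avals l) s) (val u))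
        - nth 0 (avals l) s) *: nth 0 (lams l) s.

Definition is_gls (lam : V) (l : seq (V * R)) : Prop :=
  (0 < size l)%N /\
  sorted <%R (avals l) /\ last 0 (avals l) = 1 /\
  (forall s, (s < size l)%N -> orbit lam (nth 0 (lams l) s)) /\
  (forall s, (s.+1 < size l)%N ->
     ord_gt lam (nth 0 (lams l) s) (nth 0 (lams l) s.+1) /\
     achain lam (nth 0 (map snd l) s) (nth 0 (lams l) s) (nth 0 (lams l) s.+1)) /\
  achain lam 1 (nth 0 (lams l) (size l).-1) lam.

Definition Bset (lam : V) : set rpath :=
  fun pi => exists l, is_gls lam l /\ pi = gls_fun l.

Definition pi_lam (lam : V) : rpath := fun u => val u *: lam.

Definition Hf (i : idx D) (pi : rpath) : I01 -> R := fun u => scoroot i (pi u).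

Definition mmin i pi : R :=
  inf (fun x : R => exists u, Hf i pi u = x /\ exists n : int, x = n%:~R).

Definition fplus i pi : R :=
  sup (fun t : R => exists u : I01, val u = t /\ Hf i pi u = mmin i pi).
Definition fminus i pi : R :=
  inf (fun t : R => exists u : I01, val u = t /\ fplus i pi <= t /\
                                   Hf i pi u = mmin i pi + 1).

Definition froot (i : idx D) (pi : rpath) : option rpath :=
  if fplus i pi == 1 then None else
  Some (fun u => if val u <= fplus i pi then pi u
                 else if val u <= fminus i pi
                      then pi u - (Hf i pi u - mmin i pi) *: sroot i
                      else pi u - sroot i).

Definition eplus i pi : R :=
  inf (fun t : R => exists u : I01, val u = t /\ Hf i pi u = mmin i pi).
Definition eminus i pi : R :=
  sup (fun t : R => exists u : I01, val u = t /\ t <= eplus i pi /\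
                                   Hf i pi u = mmin i pi + 1).

Definition eroot_re (i : idx D) (pi : rpath) : option rpath :=
  if eplus i pi == 0 then None else
  Some (fun u => if val u <= eminus i pi then pi u
                 else if val u <= eplus i pi
                      then pi u - (Hf i pi u - mmin i pi - 1) *: sroot i
                      else pi u + sroot i).

Definition eroot_im (i : idx D) (pi : rpath) : option rpath :=
  let aii : R := (cm i i)%:~R in
  let m := mmin i pi in
  let em := fplus i pi in
  if (em == 1) || `[< forall u : I01, em <= val u -> Hf i pi u < m + 1 - aii >]
  then None else
  let ep := inf (fun t : R => exists u : I01, val u = t /\ em <= t /\
                                            Hf i pi u = m + 1 - aii) in
  if `[< exists u : I01, ep <= val u /\ Hf i pi u <= m - aii >] then None else
  Some (fun u => if val u <= em then pi u
                 else if val u <= ep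
                      then pi u + ((1 - aii)^-1 * (Hf i pi u - m)) *: sroot i
                      else pi u + sroot i).

(* crystal structure on a set B of paths (B = B(lam)); None stands for 0 *)
Definition cf (i : idx D) (p : option rpath) : option rpath := obind (froot i) p.

Definition ce (B : set rpath) (i : idx D) (p : option rpath) : option rpath :=
  obind (fun pi =>
    if is_real i then eroot_re i pi
    else match eroot_im i pi with
         | Some pi' => if `[< B pi' >] then Some pi' else None
         | None => None
         end) p.

Definition wt (pi : rpath) : V := pi one01.

Definition ceps (i : idx D) (pi : rpath) : R :=
  if is_real i then - mmin i pi else 0.
Definition cphi (i : idx D) (pi : rpath) : R :=
  if is_real i then Hf i pi one01 - mmin i pi else scoroot i (pi one01).

Definition Fword (w : seq (idx D)) (p : option rpath) : option rpath :=
  foldl (fun q i => cf i q) p w.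

End Raw.

Definition levi (R : realType) (V : lmodType R) (D : rdat V) (S : pred (idx D))
  : rdat V :=
  @RDat R V {i : idx D | S i} (fun i j => cm (val i) (val j))
        (fun i => sroot (val i)) (fun i => scoroot (val i)).

Section DatumConds.
Variables (R : realType) (V : lmodType R) (J : eqType).
Variables (a : J -> J -> int) (alpha : J -> V) (coroot : J -> V -> R) (P : set V).

Definition BC_datum : Prop :=
  (forall i j, coroot i (alpha j) = (a i j)%:~R) /\
  (forall i, a i i = 2%:Z \/ a i i <= 0) /\
  (forall i j, i != j -> a i j <= 0) /\
  (forall i j, a i j = 0 <-> a j i = 0) /\
  (forall (s : seq J) (c : J -> R), uniq s ->
     \sum_(i <- s) c i *: alpha i = 0 -> forall i, i \in s -> c i = 0) /\
  (forall (s : seq J) (c : J -> R), uniq s ->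
     (forall v, \sum_(i <- s) c i * coroot i v = 0) -> forall i, i \in s -> c i = 0) /\
  (forall i (c : R) (x y : V), coroot i (c *: x + y) = c * coroot i x + coroot i y) /\
  P 0 /\ (forall x y, P x -> P y -> P (x - y)) /\
  (forall i, P (alpha i)) /\
  (forall i x, P x -> exists n : int, coroot i x = n%:~R).

Definition symmetrizable : Prop :=
  exists d : J -> rat, (forall i, 0 < d i) /\
    (forall i j, d i * (a i j)%:~R = d j * (a j i)%:~R).

Definition even_cm : Prop := forall i, ~~ odd `|a i i|%N.

End DatumConds.

Section Tilde.
Variables (I : countType) (a : I -> I -> int).

Definition Itil := {p : I * nat | (0 < p.2)%N && ((a p.1 p.1 == 2%:Z) ==> (p.2 == 1%N))}.

Definition Atil (p q : Itil) : int :=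
  if p == q then 2%:Z else a (val p).1 (val q).1.

Fixpoint mseq_aux (seen : seq I) (w : seq I) : seq (I * nat) :=
  match w with
  | [::] => [::]
  | i :: w' => (i, if a i i == 2%:Z then 1%N else (count_mem i seen).+1)
                 :: mseq_aux (i :: seen) w'
  end.
Definition mseq (w : seq I) := mseq_aux [::] w.
Definition lift_word (w : seq I) : seq Itil := pmap insub (mseq w).
End Tilde.

(* Main.v *)
(* A root operator sees a path only through its height functions
   t |-> coroot i (pi t), so a word of operators applied to a straight path can
   be lifted letter by letter from the given datum to the one indexed by [Itil],
   where every index is real.  There it suffices to know that the component of a
   path depends only on the endpoint of its dominant path.  In rank two this is
   a statement about pairs of height functions: raising maximally in alternating
   directions is a sequence of Pitman transforms, whose two orders end at the
   same dominant pair, and the string parameters of one order determine those of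
   the other by a Chebyshev recursion.  Newman's diamond argument, by induction
   on the height, extends this to all ranks, for any set of integral paths stable
   under the operators (a "normal set"); the GLS paths form such a set.

   A path b of shape lam is reached by a word in S from a path pi whose lift is
   dominant for S.  The dominant path is unique, and the word, applied to the
   straight path ending at pi(1) for the Levi datum, gives a path rho that only
   depends on b; the isomorphism sends b to (pi, rho). *)
Require Import Defs.
From HB Require Import structures.
From mathcomp Require Import all_boot all_order all_algebra.
From mathcomp Require Import boolp classical_sets reals.
From mathcomp Require Import functions topology normedtype derive.
From mathcomp Require Import ring lra zify.
(* [fingraph] also defines [orbit] *)
Require Import Defs.
Set Implicit Arguments.
Unset Strict Implicit.
Unset Printing Implicit Defensive.
Import Order.TTheory GRing.Theory Num.Theory.
Import numFieldNormedType.Exports.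
Local Open Scope ring_scope.

(** * Lipschitz functions and their running minima *)

Section UnitInterval.
Variable R : realType.
Implicit Types (f g : R -> R) (r s t u v : R).

(** Imaginary [e_i] is cut off at the boundary of the crystal, so words in the [f_i] are the basic
    objects, and [e_i b = b'] is always handled as: [b'] lies in the crystal and [f_i b' = b]. Two
    questions of well-definedness shape the lift. Several words may reach one path, while imaginary
    labels count occurrences; but successive uses of an imaginary letter subtract multiples
    [min 1 (n * t)] with nondecreasing [n], so their sum determines the sequence. Above a dominant
    path, the component for the smaller datum consists of LS paths of the wrong shape for that
    datum; hence the comparison is made between normal sets, not between sets of LS paths. In rank
    two the constant is [c = sqrt (a_ij * a_ji)]. Since [c ^ 2] is an integer, the Chebyshev values
    stay positive or reach zero exactly, which separates infinite from finite dihedral type. Rank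
    two confluence of straight paths also replaces Coxeter theory: it puts orbits below a dominant
    weight and makes every real root positive or negative. *)

Definition clamp t : R := Num.min 1 (Num.max 0 t).

Lemma clamp01 t : 0 <= clamp t <= 1.
Proof. rewrite /clamp; case: (leP 0 t) => h1; case: (leP 1 _) => h2; lra. Qed.

Lemma clamp_id t : 0 <= t <= 1 -> clamp t = t.
Proof. rewrite /clamp => /andP[h0 h1]; by rewrite (max_idPr h0) (min_idPr h1). Qed.

Lemma clamp_lip s t : `|clamp s - clamp t| <= `|s - t|.
Proof.
wlog st : s t / s <= t.
  move=> H; case: (leP s t) => [|/ltW] st; first exact: H.
  by rewrite distrC [leRHS]distrC; exact: H.
rewrite [leRHS]distrC [leRHS]ger0_norm ?subr_ge0// distrC ler_norml /clamp.
by case: (leP 0 t) => h1; case: (leP 1 _) => h2; case: (leP 0 s) => h3;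
   case: (leP 1 _) => h4; apply/andP; split; lra.
Qed.

Definition lip f := exists2 K, 0 <= K &
  forall s t, 0 <= s <= 1 -> 0 <= t <= 1 -> `|f s - f t| <= K * `|s - t|.

Lemma lip_cst k : lip (fun=> k).
Proof. by exists 0 => // s t _ _; rewrite subrr normr0 mul0r. Qed.

Lemma lip_id : lip id.
Proof. by exists 1 => // s t _ _; rewrite mul1r. Qed.

Lemma lip_add f g : lip f -> lip g -> lip (fun s => f s + g s).
Proof.
move=> [K K0 Kf] [L L0 Lg]; exists (K + L); first exact: addr_ge0.
move=> s t hs ht.
have -> : f s + g s - (f t + g t) = (f s - f t) + (g s - g t) by ring.
by apply: (le_trans (ler_normD _ _)); rewrite mulrDl; apply: lerD; [apply: Kf|apply: Lg].
Qed.

Lemma lip_scale k f : lip f -> lip (fun s => k * f s).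
Proof.
move=> [K K0 Kf]; exists (`|k| * K); first exact: mulr_ge0.
move=> s t hs ht; rewrite -mulrBr normrM -mulrA ler_wpM2l//; exact: Kf.
Qed.

Lemma lip_opp f : lip f -> lip (fun s => - f s).
Proof.
move=> [K K0 Kf]; exists K => // s t hs ht.
by rewrite -opprD normrN; exact: Kf.
Qed.

Lemma lip_sub f g : lip f -> lip g -> lip (fun s => f s - g s).
Proof. by move=> hf hg; apply: lip_add => //; apply: lip_opp. Qed.

Lemma lip_min f g : lip f -> lip g -> lip (fun s => Num.min (f s) (g s)).
Proof.
move=> [K K0 Kf] [L L0 Lg]; exists (K + L); first exact: addr_ge0.
move=> s t hs ht.
have := Kf _ _ hs ht; have := Lg _ _ hs ht; rewrite mulrDl.
have : 0 <= K * `|s - t| by exact: mulr_ge0.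
have : 0 <= L * `|s - t| by exact: mulr_ge0.
move: (K * _) (L * _) => k l l0 k0; rewrite !ler_norml => /andP[a1 a2] /andP[b1 b2].
by case: (leP (f s) _) => h1; case: (leP (f t) _) => h2; apply/andP; split; lra.
Qed.

Lemma lip_reparam f T : 0 <= T <= 1 -> lip f -> lip (fun s => f (T * s)).
Proof.
move=> /andP[T0 T1] [K K0 Kf]; exists K => // s t hs ht.
have hb x : 0 <= x <= 1 -> 0 <= T * x <= 1.
  by move=> /andP[x0 x1]; rewrite mulr_ge0//= mulr_ile1.
apply: (le_trans (Kf _ _ (hb _ hs) (hb _ ht))); rewrite ler_wpM2l// -mulrBr normrM.
by rewrite ger0_norm// ler_piMl.
Qed.

(** [lip] constrains [f] on the unit interval only; composing with [clamp] makes the function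
    continuous on the whole line, where the extreme value theorem applies. *)
Lemma lip_continuous f : lip f -> continuous (fun t => f (clamp t)).
Proof.
move=> [K K0 Kf] x; apply/cvgrPdist_lt => e e0.
near=> y.
apply: (@le_lt_trans _ _ (K * `|x - y|)).
  apply: (le_trans (Kf _ _ (clamp01 _) (clamp01 _))).
  by rewrite ler_wpM2l// clamp_lip.
apply: (@le_lt_trans _ _ ((K + 1) * `|x - y|)).
  by rewrite ler_wpM2r// lerDl.
rewrite mulrC -ltr_pdivlMr; last by rewrite ltr_wpDl.
near: y; apply/nbhs_ballP; exists (e / (K + 1)) => //=; by rewrite divr_gt0// ltr_wpDl.
Unshelve. all: by end_near. Qed.

Lemma lip_argmin f r s : lip f -> 0 <= r -> r <= s -> s <= 1 ->
  exists2 u, r <= u <= s & forall v, r <= v <= s -> f u <= f v.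
Proof.
move=> hf r0 rs s1.
have [u] := EVT_min rs (@continuous_subspaceT _ _ _ _ (lip_continuous hf)).
rewrite in_itv/= => hu Hu; exists u => // v hv.
have /Hu : v \in `[r, s]%R by rewrite in_itv.
by rewrite !clamp_id//; lra.
Qed.

Definition mn f r s := inf [set f u | u in [set u | r <= u <= s]%classic]%classic.

Section Mn.
Variables (f : R -> R) (r s : R).
Hypotheses (hf : lip f) (r0 : 0 <= r) (rs : r <= s) (s1 : s <= 1).

Lemma mn_attained : exists2 u, r <= u <= s & mn f r s = f u.
Proof.
have [u hu Hu] := lip_argmin hf r0 rs s1.
exists u => //; apply/eqP; rewrite eq_le; apply/andP; split.
  apply: ge_inf; last by exists u.
  by exists (f u) => _ [v hv <-]; exact: Hu.
apply: lb_le_inf; first by exists (f u), u.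
by move=> _ [v hv <-]; exact: Hu.
Qed.

Lemma mn_le u : r <= u <= s -> mn f r s <= f u.
Proof.
move=> hu; have [v hv Hv] := lip_argmin hf r0 rs s1.
apply: ge_inf; last by exists u.
by exists (f v) => _ [w hw <-]; exact: Hv.
Qed.

Lemma mn_ge k : (forall u, r <= u <= s -> k <= f u) -> k <= mn f r s.
Proof. by move=> H; have [u hu ->] := mn_attained; exact: H. Qed.

Lemma mn_eq k : (forall u, r <= u <= s -> k <= f u) ->
  (exists2 u, r <= u <= s & f u <= k) -> mn f r s = k.
Proof.
move=> H [u hu fu]; apply/eqP; rewrite eq_le mn_ge// andbT.
by apply: le_trans fu; exact: mn_le.
Qed.

End Mn.

Lemma eq_mn f g r s : (forall u, r <= u <= s -> f u = g u) -> mn f r s = mn g r s.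
Proof.
by move=> H; congr inf; apply/seteqP; split=> _ [u /= hu <-]; exists u; rewrite ?H.
Qed.

Lemma mn_split f r s t : lip f -> 0 <= r -> r <= s -> s <= t -> t <= 1 ->
  mn f r t = Num.min (mn f r s) (mn f s t).
Proof.
move=> hf r0 rs st t1; have s0 := le_trans r0 rs; have s1 := le_trans st t1.
have [u hu Eu] := mn_attained hf r0 rs s1.
have [v hv Ev] := mn_attained hf s0 st t1.
apply: mn_eq => //; first exact: le_trans st.
- move=> w hw; rewrite ge_min; case: (leP w s) => h.
    by apply/orP; left; apply: mn_le => //; lra.
  by apply/orP; right; apply: mn_le => //; lra.
- rewrite Eu Ev; case: (leP (f u) (f v)) => h; [exists u|exists v] => //; lra.
Qed.

Lemma mn_addr f k r s : lip f -> 0 <= r -> r <= s -> s <= 1 ->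
  mn (fun u => f u + k) r s = mn f r s + k.
Proof.
move=> hf r0 rs s1; have [u hu Eu] := mn_attained hf r0 rs s1.
apply: mn_eq => //; first by apply: lip_add => //; exact: lip_cst.
  by move=> v hv; rewrite lerD2r; exact: mn_le.
by exists u => //; rewrite Eu.
Qed.

Lemma mn_scale f k r s : lip f -> 0 <= k -> 0 <= r -> r <= s -> s <= 1 ->
  mn (fun u => k * f u) r s = k * mn f r s.
Proof.
move=> hf k0 r0 rs s1; have [u hu Eu] := mn_attained hf r0 rs s1.
apply: mn_eq => //; first exact: lip_scale.
  by move=> v hv; rewrite ler_wpM2l//; exact: mn_le.
by exists u => //; rewrite Eu.
Qed.

Lemma mn_min f g r s : lip f -> lip g -> 0 <= r -> r <= s -> s <= 1 ->
  mn (fun u => Num.min (f u) (g u)) r s = Num.min (mn f r s) (mn g r s).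
Proof.
move=> hf hg r0 rs s1.
have [u hu Eu] := mn_attained hf r0 rs s1.
have [v hv Ev] := mn_attained hg r0 rs s1.
apply: mn_eq => //; first exact: lip_min.
  move=> w hw; rewrite le_min !ge_min (mn_le hf r0 rs s1 hw) (mn_le hg r0 rs s1 hw).
  by rewrite orbT.
rewrite Eu Ev; case: (leP (f u) (g v)) => h; [exists u|exists v] => //;
  by rewrite ge_min lexx ?orbT.
Qed.

(* moving the endpoint of the interval moves the minimum at most K times as far *)
Lemma lip_run f : lip f -> lip (fun s => mn f 0 s).
Proof.
move=> hf; have [K K0 Kf] := hf; exists K => //.
have main s t : 0 <= s -> s <= t -> t <= 1 ->
    `|mn f 0 s - mn f 0 t| <= K * `|s - t|.
  move=> s0 st t1; have s1 := le_trans st t1.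
  rewrite (mn_split hf (lexx _) s0 st t1).
  have [u hu Eu] := mn_attained hf s0 st t1.
  have h1 : mn f 0 s <= f s by apply: mn_le => //; rewrite s0 lexx.
  have h2 : `|f s - f u| <= K * `|s - t|.
    apply: (le_trans (Kf _ _ _ _)); try lra.
    by rewrite ler_wpM2l// !ler0_norm ?subr_le0//; lra.
  move: h2; rewrite Eu ler_norml => /andP[h2 h3].
  have : 0 <= K * `|s - t| by exact: mulr_ge0.
  by case: (leP (mn f 0 s)) => h4; rewrite ler_norml; lra.
move=> s t /andP[s0 s1] /andP[t0 t1]; case: (leP s t) => [|/ltW] st; first exact: main.
by rewrite distrC [X in K * X]distrC; exact: main.
Qed.

Lemma lip_suf f : lip f -> lip (fun s => mn f s 1).
Proof.
move=> hf; have [K K0 Kf] := hf; exists K => //.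
have main s t : 0 <= s -> s <= t -> t <= 1 ->
    `|mn f s 1 - mn f t 1| <= K * `|s - t|.
  move=> s0 st t1; have t0 := le_trans s0 st.
  rewrite (mn_split hf s0 st t1 (lexx _)).
  have [u hu Eu] := mn_attained hf s0 st t1.
  have h1 : mn f t 1 <= f t by apply: mn_le => //; rewrite t1 lexx.
  have h2 : `|f u - f t| <= K * `|s - t|.
    apply: (le_trans (Kf _ _ _ _)); try lra.
    by rewrite ler_wpM2l// !ler0_norm ?subr_le0//; lra.
  move: h2; rewrite Eu ler_norml => /andP[h2 h3].
  have : 0 <= K * `|s - t| by exact: mulr_ge0.
  by case: (leP (f u)) => h4; rewrite ler_norml; lra.
move=> s t /andP[s0 s1] /andP[t0 t1]; case: (leP s t) => [|/ltW] st; first exact: main.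
by rewrite distrC [X in K * X]distrC; exact: main.
Qed.

(** The hitting time is the infimum of the times at which [f] is at most [y]. The Lipschitz bound
    rules out both a value above [y] and a value below [y] there. *)
Lemma first_hit_strict f r s y : lip f -> 0 <= r -> r <= s -> s <= 1 ->
  y <= f r -> (exists2 v, r <= v <= s & f v <= y) ->
  exists2 u, r <= u <= s & f u = y /\ forall v, r <= v -> v < u -> y < f v.
Proof.
move=> [K K0 Kf] r0 rs s1 fr [v0 hv0 fv0].
pose A := [set u | r <= u <= s /\ f u <= y]%classic.
have A0 : (A !=set0)%classic by exists v0.
have Alb : has_lbound A by exists r => u [/andP[]].
pose u := inf A.
have ru : r <= u by apply: lb_le_inf => // w [/andP[]].
have us : u <= s by apply: (@le_trans _ _ v0); [exact: ge_inf|case/andP: hv0].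
have below v : r <= v -> v < u -> y < f v.
  move=> rv vu; rewrite ltNge; apply/negP => fv.
  have : u <= v by apply: ge_inf => //; split => //; lra.
  by rewrite leNgt vu.
have fu1 : f u <= y.
  rewrite leNgt; apply/negP => fu.
  (* Dividing by [K + 1] avoids the case [K = 0]. *)
  pose d := (f u - y) / (K + 1).
  have K1 : 0 < K + 1 by rewrite ltr_wpDl.
  have d0 : 0 < d by rewrite divr_gt0// subr_gt0.
  have [w [hw fw] wu] : exists2 w, A w & w < u + d by apply: inf_adherent.
  have uw : u <= w by exact: ge_inf.
  have : `|f u - f w| <= K * `|u - w| by apply: Kf; lra.
  have : K * `|u - w| < f u - y.
    apply: (@le_lt_trans _ _ ((K + 1) * `|u - w|)); first by rewrite ler_wpM2r// lerDl.
    rewrite ler0_norm ?subr_le0// opprB mulrC -ltr_pdivlMr// ltrBlDr addrC; exact: wu.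
  by rewrite ler_norml; lra.
have fu2 : y <= f u.
  move: ru; rewrite le_eqVlt => /orP[/eqP <-//|ru].
  rewrite leNgt; apply/negP => fu.
  pose d := (y - f u) / (K + 1).
  have K1 : 0 < K + 1 by rewrite ltr_wpDl.
  have d0 : 0 < d by rewrite divr_gt0// subr_gt0.
  pose v := Num.max r (u - d).
  have vu : v < u by rewrite gt_max ru; lra.
  have rv : r <= v by rewrite le_max lexx.
  have dv : u - d <= v by rewrite le_max lexx orbT.
  have := below _ rv vu.
  have : `|f v - f u| <= K * `|v - u| by apply: Kf; lra.
  have : K * `|v - u| <= y - f u.
    apply: (@le_trans _ _ ((K + 1) * `|v - u|)); first by rewrite ler_wpM2r// lerDl.
    by rewrite ltr0_norm ?subr_lt0// opprB mulrC -ler_pdivlMr// lerBlDl -lerBlDr.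
  by rewrite ler_norml; lra.
exists u; first by rewrite ru us.
by split=> //; apply/eqP; rewrite eq_le fu1 fu2.
Qed.

Lemma first_hit f r s y : lip f -> 0 <= r -> r <= s -> s <= 1 ->
  y <= f r -> (exists2 v, r <= v <= s & f v <= y) ->
  exists2 u, r <= u <= s & f u = y /\ forall v, r <= v <= u -> y <= f v.
Proof.
move=> hf r0 rs s1 fr hv; have [u hu [fu H]] := first_hit_strict hf r0 rs s1 fr hv.
exists u => //; split=> // v /andP[rv]; rewrite le_eqVlt => /orP[/eqP ->//|vu]; first by rewrite fu.
exact/ltW/H.
Qed.

Lemma lip_rev f : lip f -> lip (fun t => f (1 - t)).
Proof.
move=> [K K0 Kf]; exists K => // s t hs ht; have := Kf (1 - s) (1 - t).
have -> : 1 - s - (1 - t) = - (s - t) by ring.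
by rewrite normrN; apply; lra.
Qed.

Lemma last_hit f r s y : lip f -> 0 <= r -> r <= s -> s <= 1 ->
  y <= f s -> (exists2 v, r <= v <= s & f v <= y) ->
  exists2 u, r <= u <= s & f u = y /\ forall v, u < v -> v <= s -> y < f v.
Proof.
move=> hf r0 rs s1 fs [v hv fv].
have A1 : 0 <= 1 - s by lra.
have A2 : 1 - s <= 1 - r by lra.
have A3 : 1 - r <= 1 by lra.
have A4 : y <= f (1 - (1 - s)) by rewrite subKr.
have A5 : exists2 v, 1 - s <= v <= 1 - r & f (1 - v) <= y by exists (1 - v); [lra|rewrite subKr].
have [u hu [fu H]] := first_hit_strict (lip_rev hf) A1 A2 A3 A4 A5.
exists (1 - u); first lra.
by split=> // x ux xs; rewrite -(subKr 1 x); apply: H; lra.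
Qed.

(** Both sides are the minimum of [f t + g t'] over [r <= t <= t' <= 1], with the two variables
    minimised in either order. *)
Lemma mn_swap f g r : lip f -> lip g -> 0 <= r -> r <= 1 ->
  mn (fun s => f s + mn g s 1) r 1 = mn (fun s => g s + mn f r s) r 1.
Proof.
move=> hf hg r0 r1.
have lF : lip (fun s => f s + mn g s 1) by apply: lip_add => //; exact: lip_suf.
have [s hs Es] := mn_attained lF r0 r1 (lexx _).
have [s0 s1] : 0 <= s /\ s <= 1 by lra.
have [s' hs' Es'] := mn_attained hg s0 s1 (lexx _).
rewrite Es Es'; symmetry.
set m := f s + g s'.
have H t t' : r <= t -> t <= t' -> t' <= 1 -> m <= f t + g t'.
  move=> rt tt t1; have t0 := le_trans r0 rt.
  rewrite /m -Es' -Es; apply: (@le_trans _ _ (f t + mn g t 1)).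
    by apply: mn_le => //; lra.
  by rewrite lerD2l; apply: mn_le => //; lra.
have at' u : r <= u -> u <= 1 -> exists2 t, r <= t <= u & mn f r u = f t.
  by move=> ru u1; exact: mn_attained.
(* The infimum is computed by hand: for [s < r] the interval in [mn f r s] is empty, so this
   function of [s] need not be Lipschitz. *)
suff : inf [set g u + mn f r u | u in [set u | r <= u <= 1]%classic]%classic = m by [].
apply/eqP; rewrite eq_le; apply/andP; split.
  apply: (@le_trans _ _ (g s' + mn f r s')).
    apply: ge_inf; last by exists s' => //=; lra.
    exists m => _ [u /= /andP[ru u1] <-]; have [t ht ->] := at' _ ru u1.
    by rewrite addrC; apply: H; lra.
  have rs' : r <= s' by lra.
  have s'1 : s' <= 1 by lra.
  by rewrite /m addrC lerD2r; apply: mn_le => //; lra.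
apply: lb_le_inf; first by exists (g r + mn f r r), r => //=; rewrite lexx.
move=> _ [u /= /andP[ru u1] <-]; have [t ht ->] := at' _ ru u1.
by rewrite addrC; apply: H; lra.
Qed.

End UnitInterval.

(** * Pitman transforms of a pair of heights *)

Lemma min_bound (R : realType) (b k m : R) : m < b -> m + k < 0 ->
  Num.min b (- k) - 2 * Num.min 0 (Num.min b (- k) + k) <= m - Num.min 0 (b + k) - Num.min 0 (m + k).
Proof.
move=> mb mk; rewrite (min_idPr (ltW mk)).
case: (leP b (- k)) => h; case: (leP 0 (b + k)) => h'; try lra.
  by rewrite (min_idPr _); lra.
Qed.

Section Clip.
Variable R : realType.
Implicit Types (f : R -> R).

(** The part of the running minimum below level [- kap]. Reflecting by [f - 2 * clip] raises [f]
    until its minimum is [- kap] (if it was lower), which is what a power of a raising operator does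
    to a height. *)
Definition clip f kap : R -> R := fun s => Num.min 0 (mn f 0 s + kap).

Lemma lip_clip f kap : lip f -> lip (clip f kap).
Proof.
move=> hf; apply: lip_min; first exact: lip_cst.
by apply: lip_add; [exact: lip_run|exact: lip_cst].
Qed.

Lemma mn_start f s : lip f -> f 0 = 0 -> 0 <= s -> s <= 1 -> mn f 0 s <= 0.
Proof.
move=> hf f0 s0 s1; have := @mn_le _ _ _ _ hf (lexx 0) s0 s1 0.
by rewrite f0 lexx s0; apply.
Qed.

Lemma mn_pt f r : lip f -> 0 <= r -> r <= 1 -> mn f r r = f r.
Proof.
move=> hf r0 r1; have [u hu ->] := mn_attained hf r0 (lexx r) r1.
by congr f; lra.
Qed.

Lemma clip_start f kap : lip f -> f 0 = 0 -> 0 <= kap -> clip f kap 0 = 0.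
Proof.
move=> hf f0 k0; rewrite /clip mn_pt// f0 add0r; by case: (leP 0 kap); lra.
Qed.

Lemma run_nincr f r s : lip f -> 0 <= r -> r <= s -> s <= 1 -> mn f 0 s <= mn f 0 r.
Proof. by move=> hf r0 rs s1; rewrite (mn_split hf (lexx _) r0 rs s1) ge_min lexx. Qed.

Lemma min_step (kap a b : R) : b <= a ->
  0 <= Num.min 0 (a + kap) - Num.min 0 (b + kap) <= a - b.
Proof. by case: (leP 0 (a + kap)) => h1; case: (leP 0 (b + kap)) => h2; lra. Qed.

(* The identity behind every rank two formula below: on each interval the
   correction terms of the reflection [f - 2 w] telescope. *)
Lemma mn_bracket f kap r s : lip f -> 0 <= r -> r <= s -> s <= 1 ->
  mn (fun x => f x - 2 * clip f kap x) r s + clip f kap r + clip f kap s = mn f r s.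
Proof.
move=> hf r0 rs s1; have s0 := le_trans r0 rs; have r1 := le_trans rs s1.
set w := clip f kap; set m := mn f r s.
have lw : lip w by exact: lip_clip.
have lF : lip (fun x => f x - 2 * w x) by apply: lip_sub => //; exact: lip_scale.
have runs : mn f 0 s = Num.min (mn f 0 r) m by rewrite -(mn_split hf).
have wE x : w x = Num.min 0 (mn f 0 x + kap) by [].
suff -> : mn (fun x => f x - 2 * w x) r s = m - w r - w s by ring.
apply: mn_eq => //.
  move=> x /andP[rx xs].
  have x0 := le_trans r0 rx; have x1 := le_trans xs s1.
  have a1 : mn f 0 x <= mn f 0 r by exact: run_nincr.
  have a2 : mn f 0 s <= mn f 0 x by exact: run_nincr.
  have a3 : mn f 0 x <= f x by apply: mn_le => //; rewrite x0 lexx.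
  have a4 : m <= f x by apply: mn_le => //; rewrite rx.
  have := min_step kap a1; have := min_step kap a2; rewrite -!wE.
  by move: a4 runs; case: (leP (mn f 0 r) m) => h0 a4 runs; lra.
have [u0 hu0 Eu0] := mn_attained hf r0 rs s1; rewrite -/m in Eu0.
have mono x : r <= x <= s -> mn f 0 s <= mn f 0 x <= mn f 0 r.
  by move=> hx; rewrite !run_nincr//; lra.
case: (leP (mn f 0 r) m) => h0.
  exists u0 => //; have := mono _ hu0; move: runs; rewrite (min_idPl h0) => runs hm.
  rewrite -Eu0 !wE; have -> : mn f 0 u0 = mn f 0 r by lra.
  by rewrite runs; lra.
move: runs; rewrite (min_idPr (ltW h0)) => runs.
case: (leP 0 (m + kap)) => h1.
  exists u0 => //; have := mono _ hu0 => hm.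
  by rewrite !wE -Eu0 !(min_idPl _); lra.
(* Below [y] the running minimum on [[0, s]] both moves and is clipped, so the reflected function
   attains its minimum at the first time [f] reaches [y]. *)
set y := Num.min (mn f 0 r) (- kap).
have my : m <= y by rewrite /y le_min; apply/andP; split; lra.
have yfr : y <= f r.
  by apply: (@le_trans _ _ (mn f 0 r)); rewrite ?ge_min ?lexx//; apply: mn_le => //; rewrite r0 lexx.
have [u hu [fu Hu]] : exists2 u, r <= u <= s & f u = y /\ forall v, r <= v <= u -> y <= f v.
  by apply: first_hit => //; exists u0 => //; rewrite -Eu0.
exists u => //.
have Iu : mn f 0 u = y.
  apply: mn_eq => //; try lra.
    move=> v hv; case: (leP r v) => rv; first by apply: Hu; lra.
    apply: (@le_trans _ _ (mn f 0 r)); first by rewrite ge_min lexx.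
    by apply: mn_le => //; lra.
  by exists u; rewrite ?fu//; lra.
rewrite !wE Iu fu runs.
exact: min_bound.
Qed.

Lemma run_clip f kap s : lip f -> f 0 = 0 -> 0 <= kap -> 0 <= s -> s <= 1 ->
  mn (fun x => f x - 2 * clip f kap x) 0 s = mn f 0 s - clip f kap s.
Proof.
move=> hf f0 k0 s0 s1; have := mn_bracket kap hf (lexx 0) s0 s1.
by rewrite (clip_start hf f0 k0); lra.
Qed.

(* a function is recovered from its Pitman transform [f - 2 I] and the final value of [I] *)
Lemma run_from_future f s : lip f -> f 0 = 0 -> 0 <= s -> s <= 1 ->
  - mn f 0 s = Num.min (- mn f 0 1) (mn (fun x => f x - 2 * mn f 0 x) s 1).
Proof.
move=> hf f0 s0 s1.
have lF : lip (fun x => f x - 2 * mn f 0 x).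
  by apply: lip_sub => //; apply: lip_scale; exact: lip_run.
have h1 : mn f 0 1 <= mn f 0 s by exact: run_nincr.
have h2 : - mn f 0 s <= mn (fun x => f x - 2 * mn f 0 x) s 1.
  apply: mn_ge => // u hu.
  have : mn f 0 u <= mn f 0 s by apply: run_nincr => //; lra.
  have : mn f 0 u <= f u by apply: mn_le => //; lra.
  by lra.
move: h1; rewrite le_eqVlt => /orP[/eqP E|h1].
  by rewrite E (min_idPl h2).
have [u hu [fu Hu]] : exists2 u, s <= u <= 1 & f u = mn f 0 s /\ forall v, s <= v <= u -> mn f 0 s <= f v.
  apply: first_hit => //; first by apply: mn_le => //; lra.
  have [v hv Ev] := mn_attained hf s0 s1 (lexx _).
  exists v => //; rewrite -Ev; move: h1.
  by rewrite (mn_split hf (lexx _) s0 s1 (lexx _)); case: (leP (mn f 0 s) (mn f s 1)) => h3 h4; lra.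
have Iu : mn f 0 u = mn f 0 s.
  apply: mn_eq => //; try lra.
    move=> v hv; case: (leP s v) => sv; first by apply: Hu; lra.
    by apply: mn_le => //; lra.
  by exists u; rewrite ?fu//; lra.
have h3 : mn (fun x => f x - 2 * mn f 0 x) s 1 <= - mn f 0 s.
  by apply: (le_trans (mn_le lF s0 s1 (lexx _) hu)); rewrite fu Iu; lra.
by rewrite (min_idPr _); lra.
Qed.

End Clip.

(** * Alternating minima and the Chebyshev recursion *)

Section RankTwo.
Variables (R : realType) (c : R).

(** Chebyshev polynomials of the second kind at [c / 2]. For [c = 2 cos (pi / m)] the value is
    [sin ((n+1) pi / m) / sin (pi / m)], first zero at [n = m - 1]. *)
Fixpoint cheb n : R :=
  if n is n'.+1 then if n' is n''.+1 then c * cheb n' - cheb n'' else c else 1.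
Local Notation T := cheb.

Lemma chebSS n : T n.+2 = c * T n.+1 - T n. Proof. by []. Qed.

Lemma cheb_det n : T n.+1 ^+ 2 - T n.+2 * T n = 1.
Proof.
elim: n => [|n IH]; first by rewrite /=; ring.
by rewrite -{}IH !chebSS; ring.
Qed.
Implicit Types (h : bool -> R -> R) (j : bool).

Definition good h := (forall b, lip (h b)) /\ (forall b, h b 0 = 0).

(* the effect of [e_j] on the pair of heights; [kap = 0] is the Pitman transform *)
Definition tr h j kap : bool -> R -> R := fun b =>
  if b == j then fun s => h j s - 2 * clip (h j) kap s
  else fun s => h b s + c * clip (h j) kap s.

Lemma tr_eq h j kap : tr h j kap j = fun s => h j s - 2 * clip (h j) kap s.
Proof. by rewrite /tr eqxx. Qed.

Lemma tr_neq h j kap : tr h j kap (~~ j) = fun s => h (~~ j) s + c * clip (h j) kap s.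
Proof. by rewrite /tr; case: j. Qed.

Lemma good_tr h j kap : 0 <= kap -> good h -> good (tr h j kap).
Proof.
move=> k0 [hl h0]; have lc := lip_clip kap (hl j).
have cs := clip_start (hl j) (h0 j) k0.
split=> b; rewrite /tr; case: eqP => _.
- by apply: lip_sub; [|exact: lip_scale].
- by apply: lip_add; [|exact: lip_scale].
- by rewrite cs h0; lra.
- by rewrite cs h0; lra.
Qed.

Fixpoint V h j k (r : R) : R :=
  if k is k'.+1 then mn (fun s => T k' * h j s + V h (~~ j) k' s) r 1 else 0.

Lemma lip_V h j k : good h -> lip (V h j k).
Proof.
move=> [hl _]; elim: k j => [|k IH] j /=; first exact: lip_cst.
by apply: lip_suf; apply: lip_add => //; exact: lip_scale.
Qed.

Lemma lip_Vs h j k : good h -> lip (fun s => T k * h j s + V h (~~ j) k s).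
Proof.
by move=> gh; have [hl _] := gh; apply: lip_add; [exact: lip_scale|exact: lip_V].
Qed.

Lemma VS h j k r : V h j k.+1 r = mn (fun s => T k * h j s + V h (~~ j) k s) r 1.
Proof. by []. Qed.

Definition posto k := forall m, (m <= k)%N -> 0 <= T m.

Lemma posto_le k m : (m <= k)%N -> posto k -> posto m.
Proof. by move=> mk H l lm; apply: H; exact: leq_trans mk. Qed.

Section TrV.
Variables (h : bool -> R -> R) (j : bool) (kap : R).
Hypotheses (gh : good h) (kap0 : 0 <= kap).

Let w := clip (h j) kap.

(** The boundary term at time 1, present when the last of the [k + 1] alternating directions is
    [j]. *)
Let w1 k := if odd k then 0 else w 1.

Let lw : lip w. Proof. by apply: lip_clip; case: gh. Qed.

(** The two formulas feed each other. In the first, [mn_swap] brings the minimum of [h j - 2 * w]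
    inside, where [mn_bracket] replaces it by that of [h j] and leaves only the boundary term at
    [r]. In the second, the coefficients of [w] add up to [c * T k.+1 - T k = T k.+2]. Nonnegativity
    of the [T] lets them pass through minima. *)
Lemma V_tr k r : posto k -> 0 <= r -> r <= 1 ->
  V (tr h j kap) j k.+1 r = V h j k.+1 r - T k * w r - w1 k /\
  V (tr h j kap) (~~ j) k.+1 r =
    mn (fun s => T k * h (~~ j) s + V h j k s + T k.+1 * w s) r 1 - w1 k.+1.
Proof.
have gt := good_tr j kap0 gh; have [hl h0] := gh.
elim: k r => [|k IH] r pk r0 r1.
  split; rewrite !VS.
    rewrite tr_eq /w1 /=.
    have lF : lip (fun s => h j s - 2 * w s) by apply: lip_sub => //; exact: lip_scale.
    transitivity (mn (fun s => h j s - 2 * w s) r 1).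
      by apply: eq_mn => u _; rewrite mul1r addr0.
    rewrite -/w.
    have -> : mn (fun s => 1 * h j s + 0) r 1 = mn (h j) r 1.
      by apply: eq_mn => u _; rewrite mul1r addr0.
    have := mn_bracket kap (hl j) r0 r1 (lexx 1); rewrite -/w; lra.
  by rewrite tr_neq negbK /w1 /= subr0; apply: eq_mn => u _; rewrite -/w; ring.
have pk' : posto k by apply: posto_le pk.
have T0 : 0 <= T k.+1 by apply: pk.
have lQ : lip (fun s => T k * h (~~ j) s + V h j k s).
  by apply: lip_add; [exact: lip_scale|exact: lip_V].
have lG : lip (fun s => T k * h (~~ j) s + V h j k s + T k.+1 * w s).
  by apply: lip_add => //; exact: lip_scale.
have lp : lip (fun s => h j s - 2 * w s) by apply: lip_sub => //; exact: lip_scale.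
split.
  rewrite [in LHS]VS tr_eq.
  transitivity (mn (fun s => (T k.+1 * (h j s - 2 * w s) +
      mn (fun s => T k * h (~~ j) s + V h j k s + T k.+1 * w s) s 1) - w1 k.+1) r 1).
    by apply: eq_mn => u hu; rewrite (IH u pk' _ _).2; [rewrite -/w; ring|lra|lra].
  rewrite mn_addr//; last by apply: lip_add; [exact: lip_scale|exact: lip_suf].
  rewrite mn_swap//; last exact: lip_scale.
  congr (_ - _).
  set g := fun s => T k * h (~~ j) s + V h j k s.
  set f := fun s => T k.+1 * h j s.
  have lf : lip f by exact: lip_scale.
  have lfk : lip (fun s => f s - T k.+1 * w r) by apply: lip_sub => //; exact: lip_cst.
  transitivity (mn (fun u => g u + mn (fun s => f s - T k.+1 * w r) r u) r 1).
    apply: eq_mn => u /andP[ru u1].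
    rewrite mn_addr// !mn_scale//.
    have := mn_bracket kap (hl j) r0 ru u1; rewrite -/w => <-; rewrite /g; ring.
  rewrite -mn_swap//.
  transitivity (mn (fun s => (f s + mn g s 1) - T k.+1 * w r) r 1).
    by apply: eq_mn => u hu; ring.
  rewrite mn_addr//; last by apply: lip_add => //; exact: lip_suf.
  by congr (_ - _); rewrite VS; apply: eq_mn => u hu; rewrite VS negbK.
rewrite [in LHS]VS tr_neq negbK.
transitivity (mn (fun s => (T k.+1 * h (~~ j) s + V h j k.+1 s + T k.+2 * w s) - w1 k) r 1).
  by apply: eq_mn => u hu; rewrite (IH u pk' _ _).1; [rewrite -/w chebSS; ring|lra|lra].
rewrite mn_addr//; last by apply: lip_add; [apply: lip_add; [exact: lip_scale|exact: lip_V]|exact: lip_scale].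
by rewrite /w1 /= negbK.
Qed.

End TrV.

End RankTwo.

(** * String parameters *)

Section Strings.
Variables (R : realType) (c : R).
Local Notation T := (cheb c).
Local Notation V := (V c).
Local Notation tr := (tr c).
Local Notation posto := (posto c).
Implicit Types (h : bool -> R -> R) (j i b : bool).

Lemma V0_start h j k : good h -> V h j k.+1 0 <= V h (~~ j) k 0.
Proof.
move=> gh; have := @mn_le _ _ _ _ (lip_Vs c j k gh) (lexx 0) ler01 (lexx 1) 0.
rewrite -VS gh.2 mulr0 add0r; apply; lra.
Qed.

Lemma V_mono h j k r s : good h -> 0 <= r -> r <= s -> s <= 1 -> V h j k r <= V h j k s.
Proof.
move=> gh r0 rs s1; case: k => [|k]; first by rewrite /= lexx.
by rewrite !VS (mn_split (lip_Vs c j k gh) r0 rs s1 (lexx _)) ge_min lexx orbT.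
Qed.

Lemma V_cheb0 h j k : good h -> T k = 0 -> V h j k.+1 0 = V h (~~ j) k 0.
Proof.
move=> gh Tk; rewrite VS; apply: mn_eq => //; first exact: lip_Vs.
  by move=> u /andP[u0 u1]; rewrite Tk mul0r add0r; exact: V_mono.
by exists 0; rewrite ?lexx ?ler01// gh.2 mulr0 add0r.
Qed.

Definition eps h j := - mn (h j) 0 1.

Definition D h j k := - V h j k 0.

Lemma DE h j k : D h j k = - V h j k 0. Proof. by []. Qed.

Definition pit h j := tr h j 0.

Lemma eps_ge0 h j : good h -> 0 <= eps h j.
Proof. by move=> gh; rewrite /eps oppr_ge0 mn_start ?gh.2 ?ler01//; apply: gh.1. Qed.

Lemma D0 h j : D h j 0 = 0. Proof. by rewrite /D /= oppr0. Qed.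

Lemma D1 h j : D h j 1 = eps h j.
Proof.
by rewrite /D /eps VS; congr (- _); apply: eq_mn => u _; rewrite /= mul1r addr0.
Qed.

Lemma clip0 (f : R -> R) s : lip f -> f 0 = 0 -> 0 <= s -> s <= 1 -> clip f 0 s = mn f 0 s.
Proof.
by move=> hf f0 s0 s1; rewrite /clip addr0 (min_idPr _)//; exact: mn_start.
Qed.

Lemma good_pit h j : good h -> good (pit h j).
Proof. by move=> gh; exact: good_tr. Qed.

Lemma pit_eq h j s : good h -> 0 <= s -> s <= 1 ->
  pit h j j s = h j s - 2 * mn (h j) 0 s.
Proof. by move=> gh s0 s1; rewrite /pit tr_eq clip0 ?gh.2//; exact: gh.1. Qed.

Lemma pit_neq h j s : good h -> 0 <= s -> s <= 1 ->
  pit h j (~~ j) s = h (~~ j) s + c * mn (h j) 0 s.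
Proof. by move=> gh s0 s1; rewrite /pit tr_neq clip0 ?gh.2//; exact: gh.1. Qed.

Lemma eps_pit h j : good h -> eps (pit h j) j = 0.
Proof.
move=> gh; rewrite /eps /pit tr_eq run_clip ?gh.2 ?ler01//; last exact: gh.1.
by rewrite clip0 ?gh.2 ?ler01//; [rewrite subrr oppr0|exact: gh.1].
Qed.

Section Flow.
Variables (h : bool -> R -> R) (j : bool) (t : R).
Hypotheses (gh : good h) (t0 : 0 <= t) (td : t <= eps h j).

Let kap := eps h j - t.

Let kap0 : 0 <= kap. Proof. by rewrite subr_ge0. Qed.

Lemma clip_end : clip (h j) kap 1 = - t.
Proof.
have -> : clip (h j) kap 1 = Num.min 0 (- t) by rewrite /clip /kap /eps; congr Num.min; ring.
by rewrite (min_idPr _)// oppr_le0.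
Qed.

Lemma D_flow_same k : posto k ->
  D (tr h j kap) j k = D h j k - (if odd k then t else 0).
Proof.
case: k => [|k] pk; first by rewrite !D0 subr0.
have pk' : posto k by exact: posto_le pk.
rewrite /D (V_tr _ gh kap0 pk' (lexx 0) ler01).1 clip_start ?gh.2//; last exact: gh.1.
by rewrite mulr0 subr0 clip_end /=; case: (odd k) => /=; lra.
Qed.

(** The clipped term in [V_tr] is a minimum of [0] and a running minimum plus [kap], so the whole
    minimum splits in two: the old value for the other letter, and the longer value for [j] shifted
    by [T k * kap]. As a function of [t], the maximum has a single break. *)
Lemma D_flow k : posto k ->
  D (tr h j kap) (~~ j) k + (if odd k then 0 else t) =
  Num.max (D h (~~ j) k) (D h j k.+1 - T k * kap).
Proof.
case: k => [|k] pk.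
  rewrite !D0 D1 /kap /=.
  rewrite add0r mul1r (_ : eps h j - (eps h j - t) = t); last by ring.
  by rewrite (max_idPr t0).
rewrite {1}/D (V_tr _ gh kap0 (posto_le (leqnSn k) pk) (lexx 0) ler01).2 clip_end.
have T0 : 0 <= T k.+1 by exact: pk.
set w := clip (h j) kap.
have lw : lip w by apply: lip_clip; exact: gh.1.
have lQ : lip (fun s => T k * h (~~ j) s + V h j k s).
  by have := lip_Vs c (~~ j) k gh; rewrite negbK.
have lR : lip (fun s => mn (h j) 0 s) by apply: lip_run; exact: gh.1.
have E : mn (fun s => T k * h (~~ j) s + V h j k s + T k.+1 * w s) 0 1 =
    Num.min (V h (~~ j) k.+1 0) (V h j k.+2 0 + T k.+1 * kap).
  transitivity (mn (fun s => Num.min (T k * h (~~ j) s + V h j k s)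
      ((T k * h (~~ j) s + V h j k s) + T k.+1 * mn (h j) 0 s + T k.+1 * kap)) 0 1).
    apply: eq_mn => u _; rewrite /w /clip.
    have [h1|h1] := leP 0 (mn (h j) 0 u + kap).
      rewrite mulr0 addr0 (min_idPl _)// -addrA -mulrDr lerDl mulr_ge0//.
    rewrite mulrDr addrA (min_idPr _)//.
    rewrite -[X in X <= _]addrA gerDl -mulrDr; apply: mulr_ge0_le0 => //; exact: ltW.
  rewrite mn_min//; last first.
    by apply: lip_add; [apply: lip_add => //; exact: lip_scale|exact: lip_cst].
  rewrite mn_addr//; last by apply: lip_add => //; exact: lip_scale.
  congr (Num.min _ (_ + _)); first by rewrite VS negbK.
  rewrite VS.
  transitivity (mn (fun s => (T k * h (~~ j) s + V h j k s) + mn (fun s => T k.+1 * h j s) 0 s) 0 1).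
    by apply: eq_mn => u /andP[u0 u1]; rewrite mn_scale//; exact: gh.1.
  rewrite -mn_swap//; last by apply: lip_scale; exact: gh.1.
  by apply: eq_mn => u _; rewrite VS negbK.
rewrite E /D /=; case: (odd k) => /=; case: leP => h1; case: leP => h2; lra.
Qed.

Lemma eps_flow : eps (tr h j kap) j = eps h j - t.
Proof.
rewrite /eps tr_eq run_clip ?gh.2 ?ler01//; last exact: gh.1.
by rewrite clip_end; lra.
Qed.

End Flow.

Lemma eps_clip1 h j : tr h j (eps h j - eps h j) = pit h j.
Proof. by rewrite subrr. Qed.

Lemma D_pit h j k : good h -> posto k ->
  D h j k.+1 = D (pit h j) (~~ j) k + (if odd k then 0 else eps h j).
Proof.
move=> gh pk; have e0 := eps_ge0 j gh.
rewrite -(eps_clip1 h j) (D_flow gh e0 (lexx _) pk) subrr mulr0 subr0.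
by rewrite (max_idPr _)// /D lerN2; exact: V0_start.
Qed.

Definition lt_ j n := j (+) odd n.

Fixpoint pits h j n := if n is n'.+1 then pit (pits h j n') (lt_ j n') else h.

Definition str h j n := eps (pits h j n) (lt_ j n).

Lemma strE h j n : str h j n = eps (pits h j n) (lt_ j n). Proof. by []. Qed.

Lemma lt_S j n : lt_ j n.+1 = ~~ lt_ j n.
Proof. by rewrite /lt_ /=; case: j; case: (odd n). Qed.

Lemma lt_neg j n : lt_ (~~ j) n = ~~ lt_ j n.
Proof. by rewrite /lt_; case: j; case: (odd n). Qed.

Lemma lt_0 j : lt_ j 0 = j. Proof. by rewrite /lt_ addbF. Qed.

Lemma pitsS h j n : pits h j n.+1 = pits (pit h j) (~~ j) n.
Proof.
elim: n => [|n IH]; first by rewrite /= lt_0.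
by rewrite [LHS]/= -/pits -[pit (pits h j n) _]/(pits h j n.+1) IH /= lt_neg -lt_S.
Qed.

Lemma strS h j n : str h j n.+1 = str (pit h j) (~~ j) n.
Proof. by rewrite /str pitsS lt_S lt_neg. Qed.

Lemma str0 h j : str h j 0 = eps h j.
Proof. by rewrite /str /= lt_0. Qed.

Lemma good_pits h j n : good h -> good (pits h j n).
Proof. by move=> gh; elim: n => //= n IH; exact: good_pit. Qed.

Lemma str_ge0 h j n : good h -> 0 <= str h j n.
Proof. by move=> gh; apply: eps_ge0; exact: good_pits. Qed.

Lemma D_str h j n : good h -> posto n.+1 -> D h j n.+2 = str h j n.+1 + D h j n.
Proof.
elim: n h j => [|n IH] h j gh pn.
  by rewrite D_pit//= D1 strS str0 D0.
have gp := good_pit j gh; have p1 : posto n.+1 by exact: posto_le pn.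
have p2 : posto n by exact: posto_le p1.
by rewrite (D_pit j gh pn) (IH _ _ gp p1) (D_pit j gh p2) [str h j n.+2]strS oddS oddS negbK addrA.
Qed.

(* the string parameters bound [eps] of the other letter; see [eps_from_string] *)
Definition lin h i k := T k * str h i k.+1 - T k.+1 * str h i k.

(** For [(u, v) = (0, 1)] this is [- eps h (~~ i)]. Each Pitman transform splits off one bound
    [- lin] and moves [(u, v)] one step along the Chebyshev sequence. *)
Definition Nfun h i u v := mn (fun s => v * h (~~ i) s + u * mn (h i) 0 s) 0 1.

(** The integrand is rewritten through the Pitman transform: [run_from_future] recovers the old
    running minimum as a minimum of two terms. One gives the linear bound; the other, after
    [mn_swap], has the original shape with the two letters exchanged. *)
Lemma Nfun_step h i u v : good h -> 0 <= v -> 0 <= c * v - u ->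
  Nfun h i u v = Num.min (- (v * eps (pit h i) (~~ i) - (c * v - u) * eps h i))
     (Nfun (pit h i) (~~ i) v (c * v - u)).
Proof.
move=> gh v0 q0; set q := c * v - u; have gp := good_pit i gh.
have lR : lip (fun s => mn (h i) 0 s) by apply: lip_run; exact: gh.1.
have lpi : lip (pit h i i) by exact: gp.1.
have lpj : lip (pit h i (~~ i)) by exact: gp.1.
have lS : lip (fun s => mn (pit h i i) s 1) by exact: lip_suf.
transitivity (mn (fun s => Num.min (v * pit h i (~~ i) s + q * eps h i)
    (v * pit h i (~~ i) s + q * mn (pit h i i) s 1)) 0 1).
  apply: eq_mn => s /andP[s0 s1].
  have -> : v * h (~~ i) s + u * mn (h i) 0 s = v * pit h i (~~ i) s + q * (- mn (h i) 0 s).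
    by rewrite pit_neq// /q; ring.
  rewrite run_from_future ?gh.2//; last exact: gh.1.
  have -> : mn (fun x => h i x - 2 * mn (h i) 0 x) s 1 = mn (pit h i i) s 1.
    by apply: eq_mn => x hx; rewrite pit_eq//; lra.
  rewrite -/(eps h i).
  case: (leP (eps h i)) => hh.
    by rewrite (min_idPl _)// lerD2l ler_wpM2l.
  by rewrite (min_idPr _)// lerD2l ler_wpM2l// ltW.
rewrite mn_min ?ler01//; last first.
- by apply: lip_add; exact: lip_scale.
- by apply: lip_add; [exact: lip_scale|exact: lip_cst].
congr Num.min.
  rewrite mn_addr ?ler01//; last exact: lip_scale.
  by rewrite mn_scale ?ler01// /eps; ring.
rewrite /Nfun negbK.
transitivity (mn (fun s => v * pit h i (~~ i) s + mn (fun s => q * pit h i i s) s 1) 0 1).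
  by apply: eq_mn => s /andP[s0 s1]; rewrite mn_scale.
rewrite mn_swap ?ler01//; try exact: lip_scale.
by apply: eq_mn => s /andP[s0 s1]; rewrite mn_scale.
Qed.

Definition chebp k := if k is k'.+1 then T k' else 0.

Lemma chebS k : T k.+1 = c * T k - chebp k.
Proof. by case: k => [|k] //=; rewrite mulr1 subr0. Qed.

Lemma Nfun_eps h i : Nfun h i 0 1 = - eps h (~~ i).
Proof.
by rewrite /Nfun /eps opprK; apply: eq_mn => s _; rewrite mul1r mul0r addr0.
Qed.

Lemma Nfun_iter h i K : good h -> posto K ->
  let NK := Nfun (pits h i K) (lt_ i K) (chebp K) (T K) in
  (forall k, (k < K)%N -> lin h i k <= eps h (~~ i)) /\
  ((exists2 k, (k < K)%N & lin h i k = eps h (~~ i)) \/ NK = - eps h (~~ i)) /\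
  - eps h (~~ i) <= NK.
Proof.
move=> gh; elim: K => [|K IH] pK /=.
  by split=> //; rewrite lt_0 Nfun_eps; split; [right|rewrite lexx].
have [I1 [I2 I3]] := IH (posto_le (leqnSn K) pK).
have E := @Nfun_step (pits h i K) (lt_ i K) (chebp K) (T K) (good_pits i K gh) (pK _ (leqnSn _)).
rewrite -chebS in E; have {E} := E (pK _ (leqnn _)).
rewrite -[pit (pits h i K) _]/(pits h i K.+1) -lt_S -/(str h i K) -/(str h i K.+1).
rewrite -/(lin h i K) => E; rewrite E in I2 I3.
set N' := Nfun (pits h i K.+1) _ _ _ in I2 I3 *.
move: I3; rewrite le_min => /andP[I3 I4].
split.
  move=> k; rewrite ltnS leq_eqVlt => /orP[/eqP ->|kK]; [lra|exact: I1].
split; last exact: I4.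
case: I2 => [[k kK Ek]|I2]; first by left; exists k => //; lia.
move: I2; case: (leP (- lin h i K) N') => h1 I2; last by right.
by left; exists K => //; lra.
Qed.

Lemma Nfun_dom h i u v : good h -> 0 <= u -> 0 <= v -> eps h i = 0 -> eps h (~~ i) = 0 ->
  Nfun h i u v = 0.
Proof.
move=> gh u0 v0 e1 e2; have li := gh.1 i; have lj := gh.1 (~~ i).
apply: mn_eq; rewrite ?lexx ?ler01//.
- by apply: lip_add; apply: lip_scale => //; exact: lip_run.
- move=> s /andP[s0 s1].
  have h1 : mn (h i) 0 1 <= mn (h i) 0 s by exact: run_nincr.
  have h2 : mn (h (~~ i)) 0 1 <= h (~~ i) s by apply: mn_le => //; rewrite ?ler01// s0.
  by apply: addr_ge0; apply: mulr_ge0 => //; move: e1 e2; rewrite /eps; lra.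
- by exists 0; rewrite ?lexx ?ler01// mn_pt ?ler01// !gh.2; lra.
Qed.

Lemma Nfun_flat h i u : good h -> 0 <= u -> Nfun h i u 0 = - (u * eps h i).
Proof.
move=> gh u0; have li := gh.1 i.
transitivity (mn (fun s => u * mn (h i) 0 s) 0 1).
  by apply: eq_mn => s _; rewrite mul0r add0r.
rewrite mn_scale ?ler01//; last exact: lip_run.
suff -> : mn (fun s => mn (h i) 0 s) 0 1 = mn (h i) 0 1 by rewrite /eps; ring.
apply: mn_eq; rewrite ?ler01//.
- exact: lip_run.
- by move=> s /andP[s0 s1]; exact: run_nincr.
- by exists 1; rewrite ?lexx ?ler01.
Qed.

(* breakpoints along an [e_j]-string are nondecreasing; see [D_flow] *)
Lemma V_ratio h i n r s : good h -> (forall m, (m <= n.+1)%N -> 0 < T m) ->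
  0 <= r -> r <= s -> s <= 1 ->
  T n * (V h i n.+1 s - V h i n.+1 r) >= T n.+1 * (V h i n s - V h i n r).
Proof.
move=> gh; elim: n i r s => [|n IH] i r s pT r0 rs s1.
  rewrite [X in T 1 * X](_ : _ = 0) ?mulr0; last by rewrite /= subrr.
  by rewrite mul1r subr_ge0; exact: V_mono.
have {}IH := IH _ _ _ (fun m hm => pT m (leqW hm)).
have T0 : 0 < T n by apply: pT; lia.
have T1 : 0 < T n.+1 by apply: pT; lia.
have T2 : 0 < T n.+2 by apply: pT.
set phi := fun x => T n.+1 * h i x + V h (~~ i) n.+1 x.
set psi := fun x => T n * h i x + V h (~~ i) n x.
have lphi : lip phi by exact: lip_Vs.
have lpsi : lip psi by exact: lip_Vs.
have key x y : r <= x -> x <= y -> y <= 1 -> T n.+1 * (psi y - psi x) <= T n * (phi y - phi x).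
  move=> rx xy y1; have x0 := le_trans r0 rx.
  have := IH (~~ i) x y x0 xy y1; rewrite /phi /psi; lra.
have r1 := le_trans rs s1; have s0 := le_trans r0 rs.
rewrite (VS c h i n.+1) (VS c h i n) -/phi -/psi.
have main : T n.+1 * (mn psi s 1 - mn psi r 1) <= T n * (mn phi s 1 - mn phi r 1).
  have [x1 hx1 E1] := mn_attained lphi s0 s1 (lexx _).
  have [x2 hx2 E2] := mn_attained lpsi r0 r1 (lexx _).
  have hphi : mn phi r 1 <= mn phi s 1.
    by rewrite (mn_split lphi r0 rs s1 (lexx _)) ge_min lexx orbT.
  case: (leP s x2) => sx2.
    have h1 : mn psi s 1 <= mn psi r 1 by rewrite E2; apply: mn_le => //; lra.
    apply: (@le_trans _ _ 0); first by rewrite pmulr_rle0// subr_le0.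
    by apply: mulr_ge0; [exact: ltW|rewrite subr_ge0].
  have h1 : mn psi s 1 <= psi x1 by apply: mn_le => //; lra.
  have h2 : mn phi r 1 <= phi x2 by apply: mn_le => //; lra.
  have h3 := key x2 x1 _ _ _.
  apply: (@le_trans _ _ (T n.+1 * (psi x1 - psi x2))).
    by apply: ler_wpM2l; [exact: ltW|lra].
  apply: (le_trans (h3 _ _ _)); try lra.
  by apply: ler_wpM2l; [exact: ltW|lra].
have hphi : 0 <= mn phi s 1 - mn phi r 1.
  by rewrite subr_ge0 (mn_split lphi r0 rs s1 (lexx _)) ge_min lexx orbT.
(* After multiplication by [T n.+1], the bound [main] suffices because [T n.+1 ^+ 2] exceeds
   [T n.+2 * T n] by exactly 1 and [Y] is nonnegative. *)
have det := cheb_det c n.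
move: main hphi; set X := _ - _; set Y := _ - _ => main hY.
rewrite -(ler_pM2l T1); apply: (@le_trans _ _ (T n.+2 * (T n * Y))).
  by rewrite mulrCA ler_wpM2l// ltW.
have -> : T n.+1 * (T n.+1 * Y) = T n.+1 ^+ 2 * Y by ring.
have -> : T n.+1 ^+ 2 = 1 + T n.+2 * T n by lra.
by rewrite (_ : (1 + T n.+2 * T n) * Y = Y + T n.+2 * (T n * Y)); [rewrite lerDr|ring].
Qed.

Lemma D_ratio h j n : good h -> (forall m, (m <= n.+1)%N -> 0 < T m) ->
  T n * (D h j n.+2 - D h (~~ j) n.+1) <= T n.+1 * (D h j n.+1 - D h (~~ j) n).
Proof.
move=> gh pT.
have T0 : 0 < T n by apply: pT; lia.
have T1 : 0 < T n.+1 by apply: pT.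
have [s hs E] := mn_attained (lip_Vs c j n.+1 gh) (lexx 0) ler01 (lexx 1).
have h1 : V h j n.+1 0 <= T n * h j s + V h (~~ j) n s.
  by rewrite VS; apply: mn_le; rewrite ?ler01//; exact: lip_Vs.
have s0 : 0 <= s by lra.
have s1 : s <= 1 by lra.
have h2 := V_ratio (~~ j) gh pT (lexx 0) s0 s1.
rewrite /D (VS c h j n.+1) E.
have h3 := ler_wpM2l (ltW T1) h1.
move: h2 h3; move: (V h (~~ j) n.+1 s) (V h (~~ j) n.+1 0) (V h (~~ j) n s) (V h (~~ j) n 0).
move: (V h j n.+1 0) (h j s) => a b x1 x2 x3 x4; nra.
Qed.

End Strings.

(** * Piecewise linear levels determine their breakpoints *)

Section Uniqueness.
Variables (R : realType) (c : R).
Local Notation T := (cheb c).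
Variables (dom : pred nat) (E : nat -> R) (d : R).
Hypothesis dom0 : dom 0.
Hypothesis dom_down : forall n, dom n.+1 -> dom n.
Hypothesis dom_pos : forall n, dom n -> 0 < T n.
Hypothesis dom_next : forall n, dom n -> 0 <= T n.+1.
Implicit Types (tau : nat -> R).

Definition hinge tau n t := if dom n then T n * Num.max 0 (t - tau n) else 0.

Definition sgp tau n t := if n is m.+1 then hinge tau m t else 0.

(** The value of the [k]-th linear form [lin] after raising by [t] in the other direction
    ([lin_ht]), written through the breakpoints [tau]; [sgp] is the hinge of index [k - 1]. *)
Definition lev tau k t := E k + T k * (hinge tau k.+2 t - hinge tau k t)
  - T k.+1 * (hinge tau k.+1 t - sgp tau k t).

(** The last two clauses say that the maximum of the levels is [d - t]: raising by [t] lowers the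
    depth [d] of that direction by [t], and the depth is the maximum of the forms [lin]. *)
Definition breaks tau := [/\ tau 0%N = 0,
  forall n, dom n.+1 -> tau n <= tau n.+1,
  forall n, dom n -> tau n <= d,
  forall t k, 0 <= t <= d -> dom k -> lev tau k t <= d - t &
  forall t, 0 <= t <= d -> exists2 k, dom k & lev tau k t = d - t].

(* rate of [lev] while exactly the levels up to [m] are on their sloped part *)
Let act m p : R := if (p <= m)%N then T p else 0.

Let actp m p : R := if p is q.+1 then act m q else 0.

Let rate m k := T k * (act m k.+2 - act m k) - T k.+1 * (act m k.+1 - actp m k).

Lemma rate_lt m k : dom m -> (k < m)%N -> rate m k < -1.
Proof.
move=> dm km; have Tm := dom_pos dm.
have actE p : (p <= m)%N -> act m p = T p by rewrite /act => ->.
have actN p : (m < p)%N -> act m p = 0 by move=> h; rewrite /act leqNgt h.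
case: k km => [|k] km; rewrite /rate.
  rewrite (actE 0%N) ?(actE 1%N)//=; case: (ltnP 1%N m) => h; first by rewrite actE//=; lra.
  rewrite actN//.
  have Em : m = 1%N by lia.
  by move: Tm; rewrite Em /= => Tm; nra.
rewrite [actp _ _]/= (actE k) ?(actE k.+1) ?(actE k.+2); try lia.
have d1 := cheb_det c k; have d2 := cheb_det c k.+1.
case: (ltnP k.+2 m) => h; first by rewrite actE//; nra.
rewrite actN; last lia.
have Ek : m = k.+2 by lia.
by move: Tm; rewrite Ek => Tm; nra.
Qed.

Lemma rate_eq m : rate m m = -1.
Proof.
have actE p : (p <= m)%N -> act m p = T p by rewrite /act => ->.
have actN p : (m < p)%N -> act m p = 0 by move=> h; rewrite /act leqNgt h.
rewrite /rate (actE m)// !actN; try lia.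
case: (posnP m) => [->|m0]; first by rewrite /=; lra.
case: m m0 actE actN => // m _ actE actN; rewrite [actp _ _]/= actE//.
have := cheb_det c m; nra.
Qed.

Lemma rate_gt m k : dom k -> (m < k)%N -> 0 <= rate m k.
Proof.
move=> dk mk; have actN p : (m < p)%N -> act m p = 0 by move=> h; rewrite /act leqNgt h.
rewrite /rate !actN; try lia.
case: k dk mk => [|k] dk mk //; rewrite [actp _ _]/= /act.
case: ifP => h; last by lra.
have := dom_next dk; have := dom_pos (dom_down dk) => h1 h2; nra.
Qed.

Lemma dom_le n p : (p <= n)%N -> dom n -> dom p.
Proof. by elim: n => [|n IH]; [rewrite leqn0 => /eqP ->|rewrite leq_eqVlt => /orP[/eqP ->//|pn] /dom_down]; auto. Qed.

Lemma breaks_mono tau n p : breaks tau -> (p <= n)%N -> dom n -> tau p <= tau n.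
Proof.
move=> [_ H _ _ _]; elim: n => [|n IH]; first by rewrite leqn0 => /eqP ->.
rewrite leq_eqVlt => /orP[/eqP -> //|pn] dn.
by apply: le_trans (H _ dn); apply: IH => //; exact: dom_down.
Qed.

(** Just after [tau' n], let [q >= n] be the last sloped level for [tau']. By the slopes [rate],
    only level [q] can follow [d - t], so it equals [d - t] at [tau' n] as well. For [tau] the
    sloped levels stop at [n - 1 < q], so level [q] starts from the same value and does not
    decrease, thus exceeds [d - t]. *)
Lemma breaks_not_lt tau tau' n : breaks tau -> breaks tau' -> dom n ->
  (forall p, (p < n)%N -> tau p = tau' p) -> tau' n < tau n -> False.
Proof.
move=> b b' dn eqp lt_t.
have [z0 _ led levle _] := b; have [z0' _ led' levle' levex'] := b'.
have n0 : (0 < n)%N by case: (posnP n) lt_t => // ->; rewrite z0 z0' ltxx.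
set t0 := tau' n.
have t00 : 0 <= t0 by rewrite -z0'; exact: breaks_mono.
have t0d : t0 < d by apply: lt_le_trans lt_t _; exact: led.
pose P p := dom p && (tau' p <= t0).
have Pn : P n by rewrite /P dn lexx.
have Pdown p q : (p <= q)%N -> P q -> P p.
  move=> pq /andP[dq tq]; rewrite /P (dom_le pq dq)/=.
  by apply: le_trans tq; exact: breaks_mono.
have sgE (tt : nat -> R) m t1 t : (forall p, (p <= m)%N -> dom p /\ tt p <= t0) ->
    (forall p, (m < p)%N -> dom p -> t1 <= tt p) -> t0 <= t -> t <= t1 ->
    forall p, hinge tt p t = hinge tt p t0 + (t - t0) * act m p.
  move=> H1 H2 h0 h1 p; rewrite /hinge /act; case: (leqP p m) => pm.
    have [-> tp] := H1 _ pm.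
    by rewrite !(max_idPr _) ?subr_ge0//; [ring|exact: le_trans h0].
  case: ifP => dp; last by rewrite mulr0 addr0.
  have := H2 _ pm dp => tp.
  by rewrite !(max_idPl _) ?subr_le0 ?(le_trans _ tp)// ?(le_trans h0)// !mulr0 addr0.
have levE (tt : nat -> R) m t1 t k : (forall p, (p <= m)%N -> dom p /\ tt p <= t0) ->
    (forall p, (m < p)%N -> dom p -> t1 <= tt p) -> t0 <= t -> t <= t1 ->
    lev tt k t = lev tt k t0 + (t - t0) * rate m k.
  move=> H1 H2 h0 h1; rewrite /lev !(sgE _ _ _ _ H1 H2 h0 h1) /rate.
  have -> : sgp tt k t = sgp tt k t0 + (t - t0) * actp m k.
    by case: k => [|k] /=; [rewrite mulr0 addr0|exact: sgE H2 h0 h1 _].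
  ring.
(* Either there is a last sloped level, or all levels are sloped from [t0] to [d]; in the latter
   case each has slope -2 by two instances of [cheb_det], and none can equal [d - t] at [d]. *)
case: (pselect (exists q, P q /\ forall p, (q < p)%N -> ~~ P p)) => [[q [Pq Hq]]|unb]; last first.
  have allP p : P p.
    apply: contrapT => /negP nPp; apply: unb.
    have exP : exists q, P q by exists n.
    have ubP q : P q -> (q <= p)%N.
      by move=> Pq; rewrite leqNgt; apply/negP => pq; move/negP: nPp; apply; apply: Pdown Pq; exact: ltnW.
    exists (ex_maxn exP ubP); case: ex_maxnP => q Pq Hq; split=> // r qr.
    by apply/negP => /Hq; rewrite leqNgt qr.
  case: (lerP 0 d) => d0; last by move: t00 t0d d0; lra.
  have hd : 0 <= d <= d by rewrite lexx d0.
  have [k dk Ek] := levex' d hd.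
  rewrite /lev in Ek *.
  have sgA p : hinge tau' p d = hinge tau' p t0 + (d - t0) * T p.
    have /andP[dp tp] := allP p.
    by rewrite /hinge dp !(max_idPr _) ?subr_ge0//; [ring|exact: led'].
  have sgpA : sgp tau' k d = sgp tau' k t0 + (d - t0) * chebp c k.
    by case: (k) => [|k'] /=; [rewrite mulr0 addr0|exact: sgA].
  move: Ek; rewrite !sgA sgpA.
  have h0 : lev tau' k t0 <= d - t0 by apply: levle' => //; rewrite t00 ltW.
  have rt : T k * (T k.+2 - T k) - T k.+1 * (T k.+1 - chebp c k) = -2.
    case: (k) => [|k'] /=; first by ring.
    have := cheb_det c k'; have := cheb_det c k'.+1.
    by rewrite /= -/(cheb c k'.+2) -/(cheb c k'.+1); lra.
  move: h0; rewrite /lev => h0 Ek.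
  have : (d - t0) * (T k * (T k.+2 - T k) - T k.+1 * (T k.+1 - chebp c k)) = - 2 * (d - t0).
    by rewrite rt mulrC.
  by move=> h2; lra.
have nq : (n <= q)%N by rewrite leqNgt; apply/negP => /Hq; rewrite Pn.
have [dq tq] := andP Pq.
pose t1 := Num.min (tau n) (if dom q.+1 then tau' q.+1 else d).
have t01 : t0 < t1.
  rewrite lt_min lt_t /=; case: ifP => // dq1.
  by have := Hq q.+1 (leqnn _); rewrite /P dq1/= -ltNge.
have t1d : t1 <= d by apply: le_trans (led _ dn); rewrite ge_min lexx.
have H1' p : (p <= q)%N -> dom p /\ tau' p <= t0.
  by move=> pq; have /andP[] := Pdown _ _ pq Pq.
have H2' p : (q < p)%N -> dom p -> t1 <= tau' p.
  move=> qp dp; apply: (@le_trans _ _ (tau' q.+1)); last exact: breaks_mono.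
  by rewrite /t1 (dom_le qp dp) ge_min lexx orbT.
have H1 p : (p <= n.-1)%N -> dom p /\ tau p <= t0.
  move=> pn; have pn' : (p < n)%N by rewrite -(prednK n0) ltnS.
  rewrite eqp//; split; first exact: dom_le (ltnW pn') dn.
  by apply: breaks_mono => //; exact: ltnW.
have H2 p : (n.-1 < p)%N -> dom p -> t1 <= tau p.
  rewrite prednK// => np dp; apply: (@le_trans _ _ (tau n)); first by rewrite ge_min lexx.
  exact: breaks_mono.
have sg0 p : hinge tau p t0 = hinge tau' p t0.
  rewrite /hinge; case: ifP => // dp; case: (ltnP p n) => pn; first by rewrite eqp.
  have h1 : t0 <= tau' p by exact: breaks_mono.
  have h2 : t0 <= tau p by apply: le_trans (ltW lt_t) _; exact: breaks_mono.
  by rewrite !(max_idPl _) ?subr_le0.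
have lev0 k : lev tau k t0 = lev tau' k t0.
  by rewrite /lev !sg0; case: k => //= k; rewrite !sg0.
have lev0le k : dom k -> lev tau' k t0 <= d - t0.
  by move=> dk; apply: levle' => //; rewrite t00 ltW.
pose t := (t0 + t1) / 2.
have [h1 h2] : t0 < t /\ t < t1 by rewrite /t; split; lra.
have ht : 0 <= t <= d by lra.
have [k dk Ek] := levex' t ht.
(* Levels below [q] fall faster than [d - t] and so lie strictly below it; a level above [q] does
   not fall, and would cross [d - t] before [t1]. *)
have kq : k = q.
  case: (ltngtP k q) => // kq; exfalso.
    have := rate_lt dq kq => rk; have := lev0le _ dk => l0.
    move: Ek; rewrite (levE _ _ _ _ _ H1' H2' (ltW h1) (ltW h2)).
    have : (t - t0) * rate q k < (t - t0) * -1 by rewrite ltr_pM2l// subr_gt0.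
    lra.
  have := rate_gt dk kq => rk.
  have ht1 : 0 <= t1 <= d by lra.
  have := levle' _ _ ht1 dk.
  move: Ek; rewrite (levE _ _ _ _ _ H1' H2' (ltW h1) (ltW h2)).
  rewrite (levE _ _ _ _ _ H1' H2' (ltW t01) (lexx _)).
  have : (t - t0) * rate q k <= (t1 - t0) * rate q k by rewrite ler_wpM2r//; lra.
  lra.
move: Ek; rewrite kq (levE _ _ _ _ _ H1' H2' (ltW h1) (ltW h2)) rate_eq => Ek.
have ht1 : 0 <= t1 <= d by lra.
have := levle _ _ ht1 dq.
rewrite (levE _ _ _ _ _ H1 H2 (ltW t01) (lexx _)) lev0.
have : 0 <= (t1 - t0) * rate n.-1 q.
  apply: mulr_ge0; first by rewrite subr_ge0 ltW.
  by apply: rate_gt => //; rewrite prednK.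
move: (_ * rate _ _) => x x0 hx; clear - x0 hx t01 Ek; lra.
Qed.

Lemma breaks_unique tau tau' n : breaks tau -> breaks tau' -> dom n -> tau n = tau' n.
Proof.
move=> b b'; elim/ltn_ind: n => n IH dn.
have eqp p : (p < n)%N -> tau p = tau' p.
  by move=> pn; apply: IH => //; exact: dom_le (ltnW pn) dn.
case: (ltgtP (tau n) (tau' n)) => // h; exfalso.
  by apply: (breaks_not_lt b' b dn _ h) => p pn; rewrite eqp.
exact: (breaks_not_lt b b' dn eqp h).
Qed.

End Uniqueness.

(** * One string determines the other *)

Section Universality.
Variables (R : realType) (c : R).
Local Notation T := (cheb c).
Variable dom : pred nat.
Hypothesis dom0 : dom 0.
Hypothesis dom_down : forall n, dom n.+1 -> dom n.
Hypothesis dom_pos : forall n, dom n -> 0 < T n.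
Hypothesis dom_end : forall n, dom n -> ~~ dom n.+1 -> T n.+1 = 0.
Local Notation D := (D c).
Local Notation tr := (tr c).
Local Notation str := (str c).
Local Notation pits := (pits c).
Local Notation pit := (pit c).
Implicit Types (h : bool -> R -> R) (i b : bool).

(* the indices of string parameters that can be nonzero *)
Definition rng n := if n is m.+1 then dom m else true.

Lemma rng_ge0 n : rng n -> 0 <= T n.
Proof.
case: n => [|n] dn; first by rewrite /= ler01.
case: (boolP (dom n.+1)) => [/dom_pos/ltW//|nd].
by rewrite dom_end.
Qed.

Lemma dom_rng n : dom n -> rng n.
Proof. by case: n => //= n /dom_down. Qed.

Lemma dom_leq n p : (p <= n)%N -> dom n -> dom p.
Proof. by elim: n => [|n IH]; [rewrite leqn0 => /eqP ->|rewrite leq_eqVlt => /orP[/eqP ->//|pn] /dom_down]; auto. Qed.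

Lemma rng_leq n p : (p <= n)%N -> rng n -> rng p.
Proof. by case: p n => [|p] [|n] //=; rewrite ltnS; exact: dom_leq. Qed.

Lemma rng_posto n : rng n -> posto c n.
Proof. by move=> rn m mn; apply: rng_ge0; exact: rng_leq rn. Qed.

Lemma dom_next n : dom n -> 0 <= T n.+1.
Proof. by move=> dn; exact: (@rng_ge0 n.+1). Qed.

Lemma dom_finite : ~ (forall n, dom n) ->
  exists N, [/\ dom N, ~~ dom N.+1 & T N.+1 = 0].
Proof.
move=> nall; have [n0 /negP nd0] : exists n, ~ dom n by apply/existsNP.
have ex : exists n, ~~ dom n by exists n0.
case: (ex_minnP ex) => -[|N] ndN minN; first by rewrite dom0 in ndN.
exists N; have dN : dom N by apply: contraT => /minN; rewrite ltnn.
by split=> //; exact: dom_end.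
Qed.

Definition term h i := exists K, forall n, (K <= n)%N -> str h i n = 0.

(** In the finite dihedral case the recursion stops at a zero of [T]; only when all [T n] are
    positive must the string be known to end. *)
Definition fin_or_term h i := (forall n, dom n) -> term h i.

Lemma D_incr h i n : good h -> D h i n <= D h (~~ i) n.+1.
Proof. by move=> gh; rewrite !DE lerN2; have := V0_start c (~~ i) n gh; rewrite negbK. Qed.

Lemma all_posto : (forall n, dom n) -> forall m, posto c m.
Proof. by move=> all m; apply: rng_posto; case: m => //= m; exact: all. Qed.
Arguments all_posto : clear implicits.

Lemma term_stable h i K m : good h -> (forall n, dom n) ->
  (forall n, (K <= n)%N -> str h i n = 0) -> (K <= m)%N ->
  D h (~~ i) m.+1 = D h i m.
Proof.
move=> gh all HK Km; have pos := all_posto all.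
have := D_incr i m gh; have := D_incr (~~ i) m.+1 gh; rewrite negbK.
rewrite (D_str i gh (pos m.+1)) HK; last exact: leqW.
by rewrite add0r => h1 h2; apply/eqP; rewrite eq_le h1 h2.
Qed.

Lemma term_swap h i : good h -> (forall n, dom n) -> term h i -> term h (~~ i).
Proof.
move=> gh all [K HK]; exists K.+2 => n Kn.
case: n Kn => // -[//|n] Kn; have Kn' : (K <= n)%N by lia.
have E1 := D_str (~~ i) gh (all_posto all n.+2).
have E2 := D_str i gh (all_posto all n.+1).
have E3 := term_stable gh all HK Kn'.
have E4 := @term_stable h i K n.+2 gh all HK (leqW (leqW Kn')).
move: E2; rewrite HK; last exact: leqW. by move=> E2; lra.
Qed.

Lemma eps_pit0 h i : good h -> eps h i = 0 -> forall b, eps (pit h i) b = eps h b.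
Proof.
move=> gh e0 b; have li := gh.1 i.
have I0 s : 0 <= s <= 1 -> mn (h i) 0 s = 0.
  move=> /andP[s0 s1]; apply/eqP; rewrite eq_le mn_start ?gh.2//=.
  by have := run_nincr li s0 s1 (lexx _); move: e0; rewrite /eps; lra.
rewrite /eps; congr (- _); apply: eq_mn => s hs; have /andP[s0 s1] := hs.
have [->|/eqP bi] := eqVneq b i; first by rewrite pit_eq// I0// mulr0 subr0.
have -> : b = ~~ i by case: b i bi {gh e0 li I0} => -[].
by rewrite pit_neq// I0// mulr0 addr0.
Qed.

(* [eps] of a letter is read off from the string starting with the other letter *)
Lemma eps_lin h i : good h -> fin_or_term h i ->
  (forall k, dom k -> lin c h i k <= eps h (~~ i)) /\
  (exists2 k, dom k & lin c h i k = eps h (~~ i)).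
Proof.
move=> gh tm; split=> [k dk|].
  have pk : posto c k.+1 by exact: (rng_posto (n := k.+1)).
  by have [H _] := Nfun_iter i gh pk; apply: H.
case: (pselect (forall n, dom n)) => [all|/dom_finite [N [dN ndN TN]]].
  have [K HK] := tm all.
  have pK := all_posto all K.
  have [_ [[[k _ Ek]|E] _]] := Nfun_iter i gh pK; first by exists k.
  exists K => //; rewrite /lin (HK K (leqnn _)) (HK K.+1 (leqnSn _)).
  rewrite !mulr0 subr0.
  have gK := good_pits c i K gh.
  have e1 : eps (pits h i K) (lt_ i K) = 0 by exact: HK.
  have e2 : eps (pits h i K) (~~ lt_ i K) = 0.
    have := HK K.+1 (leqnSn _); rewrite !strE lt_S.
    by rewrite -[pits h i K.+1]/(pit (pits h i K) (lt_ i K)) eps_pit0.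
  move: E; rewrite Nfun_dom//; first by move=> /eqP; rewrite eq_sym oppr_eq0 => /eqP.
    by case: (K) pK => [|k] pk; [rewrite /=|exact: (pk k (leqnSn k))].
  exact: pK.
have pN : posto c N.+1 by exact: (rng_posto (n := N.+1)).
have [_ [[[k kN Ek]|E] _]] := Nfun_iter i gh pN.
  by exists k => //; exact: dom_leq dN.
exists N => //; rewrite /lin TN mul0r subr0.
move: E; rewrite TN Nfun_flat; last 2 first.
- exact: good_pits.
- exact/ltW/dom_pos.
by rewrite -/(str h i N.+1) => /oppr_inj.
Qed.

Lemma str_cheb0 h i n : good h -> T n = 0 -> D h i n.+1 = D h (~~ i) n.
Proof. by move=> gh Tn; rewrite !DE V_cheb0. Qed.

Lemma str_D g b n : good g -> (if n is m.+1 then rng n else true) ->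
  str g b n = D g b n.+1 - (if n is m.+1 then D g b m else 0).
Proof.
move=> gg; case: n => [|n] rn; first by rewrite str0 D1 subr0.
by rewrite (D_str b gg (rng_posto rn)) addrK.
Qed.

Section OneFlow.
Variables (h : bool -> R -> R) (i : bool).
Hypotheses (gh : good h) (tm : fin_or_term h i).

Let j := ~~ i.

Let d := eps h j.

Let ht t := tr h j (d - t).

(** The value of [t] at which the two arguments of the maximum in [D_flow] agree. *)
Definition tau n := d - (D h j n.+1 - D h i n) / T n.

Let nj : ~~ j = i. Proof. by rewrite /j negbK. Qed.

Lemma good_ht t : t <= d -> good (ht t).
Proof. by move=> td; apply: good_tr => //; rewrite subr_ge0. Qed.

Lemma D_ht t n : 0 <= t <= d -> rng n ->
  D (ht t) i n + (if odd n then 0 else t) = D h i n + hinge c dom tau n t.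
Proof.
move=> /andP[t0 td] rn; have pn := rng_posto rn.
have := D_flow gh t0 td pn; rewrite -/j nj -/d -/(ht t) => ->.
rewrite /hinge; case: ifP => dn.
  have Tn := dom_pos dn.
  have -> : D h j n.+1 - T n * (d - t) = D h i n + T n * (t - tau n).
    by rewrite /tau; field; rewrite gt_eqF.
  case: (lerP 0 (t - tau n)) => hh.
    by rewrite (max_idPr _)// lerDl mulr_ge0//; exact: ltW.
  by rewrite mulr0 addr0 (max_idPl _)// gerDl pmulr_rle0// ltW.
have Tn : T n = 0.
  case: n rn dn {pn} => [|n] rn dn; first by rewrite dom0 in dn.
  by apply: dom_end => //; rewrite dn.
by rewrite Tn mul0r subr0 addr0 (str_cheb0 j gh Tn) nj maxxx.
Qed.

Lemma D_ht_last t n : 0 <= t <= d -> dom n -> ~~ dom n.+1 ->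
  D (ht t) i n.+2 + (if odd n.+2 then 0 else t) = D h i n.+2.
Proof.
move=> /andP[t0 td] dn nd; have Tn := dom_end dn nd.
have pn : posto c n.+1 by exact: (rng_posto (n := n.+1)).
rewrite (str_cheb0 i (good_ht td) Tn) (str_cheb0 i gh Tn).
have := D_flow_same gh t0 td pn; rewrite -/j -/d -/(ht t) => ->.
by rewrite !oddS; case: (odd n) => /=; lra.
Qed.

Lemma D_ht' t n : 0 <= t <= d -> (if n is m.+2 then dom m else true) ->
  D (ht t) i n + (if odd n then 0 else t) = D h i n + hinge c dom tau n t.
Proof.
move=> ht0 dn; case: (boolP (rng n)) => rn; first exact: D_ht.
case: n dn rn => [|[|n]] //=; first by rewrite dom0.
move=> dn rn; have := D_ht_last ht0 dn rn => /= ->; rewrite /hinge ifN ?addr0//.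
by apply: contra rn => /dom_down.
Qed.

Lemma term_ht t : 0 <= t <= d -> fin_or_term (ht t) i.
Proof.
move=> ht0 all; have /andP[t0 td] := ht0.
have [K HK] := term_swap gh all (tm all).
have pos := all_posto all.
have gt := good_ht td.
rewrite -nj; apply: (term_swap gt all); exists K.+2 => n Kn.
case: n Kn => [|[|n]] // Kn.
have E0 := D_flow_same gh t0 td (pos n.+3); rewrite -/j -/d -/(ht t) in E0.
have E1 := D_flow_same gh t0 td (pos n.+1); rewrite -/j -/d -/(ht t) in E1.
have E2 := D_str j gt (pos n.+2); have E3 := D_str j gh (pos n.+2).
have := HK n.+2; rewrite -/j => e; rewrite e in E3; last by lia.
rewrite E0 E1 E3 add0r in E2; apply: (addIr (D h j n.+1 - (if odd n.+1 then t else 0))).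
by rewrite add0r; apply: esym; move: E2; rewrite !oddS negbK.
Qed.

Lemma lin_ht t k : 0 <= t <= d -> dom k ->
  lin c (ht t) i k = lev c dom (lin c h i) tau k t.
Proof.
move=> ht0 dk; have /andP[t0 td] := ht0; have gt := good_ht td.
rewrite /lin /lev.
have dk0 := dom_rng dk.
have dk1 : if k is m.+1 then rng k else true by case: (k) dk0.
rewrite !(@str_D _ _ k.+1)// !(@str_D _ _ k)//.
have E1 := D_ht' (n := k.+2) ht0 dk.
have E2 : D (ht t) i k + (if odd k then 0 else t) = D h i k + hinge c dom tau k t by exact: D_ht.
have E3 : D (ht t) i k.+1 + (if odd k.+1 then 0 else t) = D h i k.+1 + hinge c dom tau k.+1 t by exact: D_ht.
have E4 : (if k is m.+1 then D (ht t) i m else 0) + (if k is m.+1 then if odd m then 0 else t else 0) =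
    (if k is m.+1 then D h i m else 0) + sgp c dom tau k t.
  case: (k) dk0 => [|m] rm; first by rewrite addr0.
  by apply: D_ht => //; exact: dom_rng.
have -> : D (ht t) i k.+2 - D (ht t) i k = D h i k.+2 - D h i k + (hinge c dom tau k.+2 t - hinge c dom tau k t).
  by move: E1 E2; rewrite !oddS negbK; case: (odd k) => E1 E2; lra.
have -> : D (ht t) i k.+1 - (if k is m.+1 then D (ht t) i m else 0) =
    D h i k.+1 - (if k is m.+1 then D h i m else 0) + (hinge c dom tau k.+1 t - sgp c dom tau k t).
  move: E3 E4; case: (k) => [|m] E3 E4; first by move: E3 E4 => /=; lra.
  by move: E3 E4; rewrite !oddS negbK; case: (odd m) => E3 E4; lra.
all: try by move: dk0; case: (k).
ring.
Qed.

Lemma breaks_tau : breaks c dom (lin c h i) d tau.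
Proof.
have d0 : 0 <= d by exact: eps_ge0.
split.
- by rewrite /tau D0 D1 -/d /=; field.
- move=> n dn; have T1 := dom_pos dn; have T0 := dom_pos (dom_down dn).
  have := @D_ratio _ c h j n gh (fun m mn => dom_pos (dom_leq mn dn)); rewrite nj => H.
  rewrite /tau lerD2l lerN2 ler_pdivrMr// mulrAC ler_pdivlMr//.
  by rewrite [leLHS]mulrC [leRHS]mulrC.
- move=> n dn; rewrite /tau lerBlDr lerDl divr_ge0//; last exact/ltW/dom_pos.
  by rewrite subr_ge0; exact: D_incr.
- move=> t k ht0 dk; rewrite -lin_ht//; have /andP[t0 td] := ht0.
  have [H _] := eps_lin (good_ht td) (term_ht ht0).
  by apply: le_trans (H _ dk) _; rewrite -/j /ht eps_flow.
- move=> t ht0; have /andP[t0 td] := ht0.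
  have [_ [k dk Ek]] := eps_lin (good_ht td) (term_ht ht0).
  by exists k => //; rewrite -lin_ht// Ek -/j /ht eps_flow.
Qed.

End OneFlow.

(** The string in direction [i] gives the forms [lin], whose maximum is the depth in the other
    direction. The same holds after every partial raising in that direction, so both pairs have
    breakpoints satisfying the same conditions [breaks]; by uniqueness they agree, and they
    determine the values [D] of the other direction, whose differences are its string. *)
Theorem string_univ h h' i : good h -> good h' -> fin_or_term h i -> fin_or_term h' i ->
  (forall n, rng n -> str h i n = str h' i n) ->
  forall n, rng n -> str h (~~ i) n = str h' (~~ i) n.
Proof.
move=> gh gh' tm tm' Es.
have EL k : dom k -> lin c h i k = lin c h' i k.
  by move=> dk; rewrite /lin !Es//; exact: dom_rng.
have Ee : eps h (~~ i) = eps h' (~~ i).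
  have [H1 [k1 d1 E1]] := eps_lin gh tm; have [H2 [k2 d2 E2]] := eps_lin gh' tm'.
  apply/eqP; rewrite eq_le; apply/andP; split.
    by rewrite -E1 EL//; exact: H2.
  by rewrite -E2 -EL//; exact: H1.
have ED n : (if n is m.+1 then rng m else true) -> D h i n = D h' i n.
  elim/ltn_ind: n => -[|[|n]] IH rn; first by rewrite !D0.
    by have := Es 0%N isT; rewrite !str0 !D1.
  rewrite (D_str i gh (rng_posto rn)) (D_str i gh' (rng_posto rn)) Es// IH//; try lia.
  by case: (n) rn => //= m dm; exact/dom_rng/dom_down.
have b := breaks_tau gh tm; have b' := breaks_tau gh' tm'.
have b2 : breaks c dom (lin c h i) (eps h (~~ i)) (tau h' i).
  have levE t k : dom k -> lev c dom (lin c h i) (tau h' i) k t = lev c dom (lin c h' i) (tau h' i) k t.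
    by move=> dk; rewrite /lev EL.
  case: b' => b1 b2 b3 b4 b5; split=> //; rewrite Ee//.
  - by move=> t k ht dk; rewrite levE//; exact: b4.
  - by move=> t ht; have [k dk E] := b5 t ht; exists k => //; rewrite levE.
have Ft n : dom n -> D h (~~ i) n.+1 = D h' (~~ i) n.+1.
  move=> dn; have := breaks_unique dom0 dom_down dom_pos dom_next b b2 dn.
  have Tn := dom_pos dn; have Tn0 : T n != 0 by rewrite gt_eqF.
  rewrite /tau Ee => /addrI /oppr_inj /(mulIf (invr_neq0 Tn0)).
  by rewrite (ED n)//; [move/addIr|case: (n) dn => //= m /dom_down; exact: dom_rng].
have ED' n : (if n is m.+1 then rng m else true) -> D h (~~ i) n = D h' (~~ i) n.
  case: n => [|n] rn; first by rewrite !D0.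
  case: (boolP (dom n)) => dn; first exact: Ft.
  have Tn : T n = 0 by case: n rn dn => [|n] rn dn; [rewrite dom0 in dn|exact: dom_end].
  rewrite !(str_cheb0 (~~ i))// negbK; apply: ED.
  by case: n rn dn {Tn} => //= n dn _; exact: dom_rng.
move=> [|n] rn; first by rewrite !str0.
rewrite !(@str_D _ _ n.+1)// (ED' n.+2)// ED'//.
by case: (n) rn => //= m dm; exact/dom_rng/dom_down.
Qed.

End Universality.

(** * Confluence in rank two *)

Section ChebDomain.
Variables (R : realType) (c : R).
Local Notation T := (cheb c).

Definition chdom n := all (fun m => 0 < T m) (iota 0 n.+1).

Lemma chdomP n : reflect (forall m, (m <= n)%N -> 0 < T m) (chdom n).
Proof.
apply: (iffP allP) => H m; first by move=> mn; apply: H; rewrite mem_iota.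
by rewrite mem_iota /= add0n ltnS => mn; exact: H.
Qed.

Lemma chdom0 : chdom 0.
Proof. by apply/chdomP => m; rewrite leqn0 => /eqP ->; rewrite /= ltr01. Qed.

Lemma chdom_down n : chdom n.+1 -> chdom n.
Proof. by move=> /chdomP H; apply/chdomP => m mn; apply: H; exact: leqW. Qed.

Lemma chdom_pos n : chdom n -> 0 < T n.
Proof. by move=> /chdomP; apply. Qed.
Variable p : nat.
Hypotheses (c0 : 0 <= c) (cp : c ^+ 2 = p%:R).

Lemma cheb_grow n : (4 <= p)%N -> 1 <= T n /\ T n <= T n.+1.
Proof.
move=> p4; have c2 : 2 <= c.
  have h : 4 <= c * c by rewrite -expr2 cp ler_nat.
  rewrite leNgt; apply/negP => c2.
  have : 0 <= c * (2 - c) by apply: mulr_ge0 => //; lra.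
  by rewrite mulrBr; lra.
elim: n => [|n [IH1 IH2]]; first by split=> //=; lra.
split; first lra.
by rewrite chebSS; nra.
Qed.

(** Integrality of [c ^ 2] enters here. For [c ^ 2] equal to 0, 1, 2, 3 the first zero has index 1,
    2, 3, 5 (the types A1 x A1, A2, B2, G2); for [c ^ 2 >= 4] the sequence is nondecreasing. *)
Lemma chdom_end n : chdom n -> ~~ chdom n.+1 -> T n.+1 = 0.
Proof.
have stop N : T N = 0 -> (forall m, (m < N)%N -> 0 < T m) -> chdom n -> ~~ chdom n.+1 -> T n.+1 = 0.
  move=> TN TP /chdomP dn nd.
  have nN : (n < N)%N by rewrite ltnNge; apply/negP => /dn; rewrite TN ltxx.
  have [nN'|nN'] := eqVneq n.+1 N; first by rewrite nN'.
  exfalso; move/negP: nd; apply; apply/chdomP => m mn; apply: TP; lia.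
have [p4|p3] := leqP 4 p.
  by move=> _ /negP[]; apply/chdomP => m _; have [h _] := cheb_grow m p4; lra.
have cc : c * c = p%:R by rewrite -expr2.
have cpos : (0 < p)%N -> 0 < c.
  by move=> p0; rewrite lt0r c0 andbT; apply/eqP => c00; move: cc; rewrite c00 mul0r => /eqP; rewrite eq_sym pnatr_eq0; lia.
case: p p3 cc cpos => [|[|[|[|//]]]] _ cc cpos.
- apply: (stop 1%N) => /=; first by move: cc => /eqP; rewrite mulf_eq0 orbb => /eqP.
  by case=> //= _; rewrite ltr01.
- have c1 : c = 1 by have := cpos isT => h; nra.
  apply: (stop 2%N) => /=; first by rewrite c1; ring.
  by case=> [|[|]] //= _; rewrite ?ltr01// c1 ltr01.
- have := cpos isT => h.
  apply: (stop 3%N) => /=; first by rewrite cc; ring.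
  by case=> [|[|[|]]] //= _; lra.
- have := cpos isT => h.
  have e2 : c * c - 1 = 2 by rewrite cc; ring.
  apply: (stop 5%N) => /=.
    by rewrite e2; transitivity (c * (c * c - 3%:R)); [ring|rewrite cc subrr mulr0].
  by case=> [|[|[|[|[|]]]]] //= _; rewrite ?e2; nra.
Qed.

End ChebDomain.

(** * From final values to whole paths *)

Section Coefficients.
Variables (R : realType) (c : R).
Local Notation T := (cheb c).
Local Notation D := (D c).
Local Notation str := (str c).
Local Notation pits := (pits c).
Local Notation pit := (pit c).
Local Notation tr := (tr c).
Implicit Types (h : bool -> R -> R) (i b : bool).

(** The pair stopped at time [q] and rescaled to the unit interval. Pitman transforms commute with
    stopping, so an identity between final values holds at every time. *)
Definition rp (q : R) h : bool -> R -> R := fun b s => h b (q * s).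

Lemma mn_rp (f : R -> R) q s : 0 < q -> mn (fun x => f (q * x)) 0 s = mn f 0 (q * s).
Proof.
move=> q0; congr inf; apply/seteqP; split=> _ [u /= /andP[u0 us] <-].
  by exists (q * u) => //=; rewrite mulr_ge0 ?(ltW q0)//= ler_pM2l.
exists (u / q) => /=; last by congr f; rewrite mulrC divfK ?gt_eqF.
by rewrite divr_ge0 ?(ltW q0)//= ler_pdivrMr// mulrC.
Qed.

Lemma pit_rp q h j : 0 < q -> pit (rp q h) j = rp q (pit h j).
Proof.
move=> q0; apply/funext => b; apply/funext => s.
by rewrite /pit /tr /rp; case: ifP => _; rewrite /clip mn_rp.
Qed.

Lemma pits_rp q h j n : 0 < q -> pits (rp q h) j n = rp q (pits h j n).
Proof. by move=> q0; elim: n => //= n ->; rewrite pit_rp. Qed.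

Lemma good_rp q h : 0 < q -> q <= 1 -> good h -> good (rp q h).
Proof.
move=> q0 q1 [hl h0]; split=> b; last by rewrite /rp mulr0.
by apply: lip_reparam => //; rewrite (ltW q0).
Qed.

Lemma str_rp q h j n : 0 < q -> str (rp q h) j n = - mn (pits h j n (lt_ j n)) 0 q.
Proof. by move=> q0; rewrite !strE pits_rp// /eps /rp mn_rp// mulr1. Qed.

(* the total multiple of the root [b] added at time [s] by the first [n] Pitman transforms *)
Fixpoint pcoef h j n b (s : R) :=
  if n is n'.+1 then pcoef h j n' b s + (if b == lt_ j n' then - mn (pits h j n' b) 0 s else 0)
  else 0.

Lemma pits_cf h j n b s : good h -> 0 <= s <= 1 ->
  pits h j n b s = h b s + 2 * pcoef h j n b s - c * pcoef h j n (~~ b) s.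
Proof.
move=> gh hs; have /andP[s0 s1] := hs; elim: n b => [|n IH] b /=; first by rewrite mulr0 addr0 mulr0 subr0.
have gn := good_pits c j n gh.
have [->|/eqP bl] := eqVneq b (lt_ j n).
  have -> : (~~ lt_ j n == lt_ j n) = false by case: (lt_ j n).
  by rewrite pit_eq// IH addr0; ring.
have -> : b = ~~ lt_ j n by case: b (lt_ j n) bl => -[].
by rewrite pit_neq// IH negbK eqxx addr0; ring.
Qed.

Lemma cf_D h j n s : good h -> 0 < s -> s <= 1 -> posto c n ->
  pcoef h j n.+1 (lt_ j n) s = D (rp s h) j n.+1 /\
  pcoef h j n.+1 (~~ lt_ j n) s = D (rp s h) j n.
Proof.
move=> gh s0 s1; have gr := good_rp s0 s1 gh.
elim: n => [|n IH] pn.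
  rewrite /= lt_0 eqxx !add0r D1 D0 -(str0 c) str_rp//= lt_0; split=> //.
  by case: j.
have pn' : posto c n by apply: posto_le pn.
have [IH1 IH2] := IH pn'.
have neq : (~~ lt_ j n.+1 == lt_ j n.+1) = false by case: (lt_ j n.+1).
split; last first.
  by rewrite [LHS]/= -/(pcoef h j n.+1 _ s) neq addr0 lt_S negbK.
have IH2' : pcoef h j n.+1 (lt_ j n.+1) s = D (rp s h) j n by rewrite lt_S.
have -> : pcoef h j n.+2 (lt_ j n.+1) s = pcoef h j n.+1 (lt_ j n.+1) s - mn (pits h j n.+1 (lt_ j n.+1)) 0 s.
  by rewrite [LHS]/= eqxx.
by rewrite IH2' D_str// str_rp// addrC.
Qed.

Lemma cf0 h j n b : good h -> pcoef h j n b 0 = 0.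
Proof.
move=> gh; elim: n => //= n ->; case: ifP => _; rewrite ?addr0// mn_pt//; last first.
  by apply: (good_pits c j n gh).1.
by rewrite (good_pits c j n gh).2 oppr0 addr0.
Qed.

Lemma str_rp_le q h j n : good h -> 0 < q -> q <= 1 -> str h j n = 0 -> str (rp q h) j n = 0.
Proof.
move=> gh q0 q1 e; apply/eqP; rewrite eq_le str_ge0 ?andbT; last exact: good_rp.
rewrite str_rp//; move: e; rewrite !strE /eps => e.
have := run_nincr ((good_pits c j n gh).1 (lt_ j n)) (ltW q0) q1 (lexx _); lra.
Qed.
Variable p : nat.
Hypotheses (c0 : 0 <= c) (cp : c ^+ 2 = p%:R).
Local Notation dom := (chdom c).

Let dom0 := chdom0 c.

Let dom_down := @chdom_down R c.

Let dom_pos := @chdom_pos R c.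

Let dom_end := chdom_end c0 cp.

(** At a zero of [T] the outermost minimum of [V] is attained at its left end and drops out
    ([str_cheb0]). Thus the two sequences of length [N + 2] have the same pair of total
    coefficients. *)
Lemma cf_fin h j N b s : good h -> dom N -> ~~ dom N.+1 -> 0 <= s <= 1 ->
  pcoef h j N.+2 b s = pcoef h (~~ j) N.+2 b s.
Proof.
move=> gh dN ndN /andP[s0 s1]; have TN := dom_end dN ndN.
move: s0; rewrite le_eqVlt => /orP[/eqP <-|s0]; first by rewrite !cf0.
have pN : posto c N.+1 by exact: (rng_posto dom_down dom_pos dom_end (n := N.+1)).
have gr := good_rp s0 s1 gh.
have [E1 E2] := cf_D j gh s0 s1 pN; have [E3 E4] := cf_D (~~ j) gh s0 s1 pN.
rewrite lt_neg negbK in E3 E4.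
have F1 := str_cheb0 j gr TN; have F2 := str_cheb0 (~~ j) gr TN; rewrite negbK in F2.
have [->|/eqP bl] := eqVneq b (lt_ j N.+1); first by rewrite E1 E4 F1.
have -> : b = ~~ lt_ j N.+1 by case: b (lt_ j N.+1) bl => -[].
by rewrite E2 E3 F2.
Qed.

(** Once the string parameters vanish, [D_incr] is an equality in both directions, and the sequence
    starting with the other letter lags by one step. *)
Lemma cf_inf h j K m b s : good h -> (forall n, dom n) ->
  (forall n, (K <= n)%N -> str h j n = 0) -> (K <= m)%N -> 0 <= s <= 1 ->
  pcoef h j m.+1 b s = pcoef h (~~ j) m.+2 b s.
Proof.
move=> gh all HK Km /andP[s0 s1].
move: s0; rewrite le_eqVlt => /orP[/eqP <-|s0]; first by rewrite !cf0.
have pos := @all_posto R c dom dom_down dom_pos dom_end all.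
have gr := good_rp s0 s1 gh.
have HK' n : (K <= n)%N -> str (rp s h) j n = 0 by move=> Kn; apply: str_rp_le => //; exact: HK.
have [E1 E2] := cf_D j gh s0 s1 (pos m); have [E3 E4] := cf_D (~~ j) gh s0 s1 (pos m.+1).
rewrite lt_S lt_neg negbK in E3 E4.
have F1 := term_stable dom_down dom_pos dom_end gr all HK' Km.
have F2 := term_stable dom_down dom_pos dom_end gr all HK' (leqW Km).
have [->|/eqP bl] := eqVneq b (lt_ j m); first by rewrite E1 E3 F2.
have -> : b = ~~ lt_ j m by case: b (lt_ j m) bl => -[].
by rewrite E2 E4 F1.
Qed.

Lemma eps_last h j n : good h -> eps (pits h j n.+1) (lt_ j n) = 0.
Proof. by move=> gh /=; rewrite eps_pit//; exact: good_pits. Qed.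

Lemma eq_eps h h' b b' : (forall s, 0 <= s <= 1 -> h b s = h' b' s) -> eps h b = eps h' b'.
Proof. by move=> H; rewrite /eps; congr (- _); exact: eq_mn. Qed.

(* the two alternating sequences of Pitman transforms end at the same dominant pair *)
Theorem confluence h j : good h -> fin_or_term c dom h j ->
  exists m n, [/\ forall b s, 0 <= s <= 1 -> pcoef h j m b s = pcoef h (~~ j) n b s &
    forall b, eps (pits h j m) b = 0].
Proof.
move=> gh tm.
case: (pselect (forall n, dom n)) => [all|nall].
  have [K HK] := tm all; exists K.+1, K.+2; split=> [b s hs|b].
    exact: (cf_inf _ gh all HK).
  have e1 := eps_last j K gh.
  have [->//|/eqP bl] := eqVneq b (lt_ j K).
  have -> : b = lt_ j K.+1 by rewrite lt_S; case: b (lt_ j K) bl => -[].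
  exact: (HK K.+1 (leqnSn K)).
have [N [dN ndN _]] := dom_finite dom0 dom_end nall.
exists N.+2, N.+2; have E b s := @cf_fin h j N b s gh dN ndN; split=> // b.
have [->|/eqP bl] := eqVneq b (lt_ j N.+1); first exact: eps_last.
have -> : b = lt_ (~~ j) N.+1 by rewrite lt_neg; case: b (lt_ j N.+1) bl => -[].
rewrite -(eps_last (~~ j) N.+1 gh); apply: eq_eps => s hs.
by rewrite !pits_cf// !E.
Qed.

(** After [N + 2] transforms the last letter has depth 0; the sequence of the other order ends at
    the same pair with the other letter last, so both depths are 0 and stay so. *)
Lemma str_beyond h j n : good h -> ~~ dom n -> str h j n.+1 = 0.
Proof.
move=> gh ndn; have nall : ~ (forall n, dom n) by move=> /(_ n); rewrite (negbTE ndn).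
have [N [dN ndN _]] := dom_finite dom0 dom_end nall.
have E b s := @cf_fin h j N b s gh dN ndN.
have z b : eps (pits h j N.+2) b = 0.
  have [->|/eqP bl] := eqVneq b (lt_ j N.+1); first exact: eps_last.
  have -> : b = lt_ (~~ j) N.+1 by rewrite lt_neg; case: b (lt_ j N.+1) bl => -[].
  rewrite -(eps_last (~~ j) N.+1 gh); apply: eq_eps => s hs.
  by rewrite !pits_cf// !E.
have Nn : (N.+1 <= n)%N.
  rewrite ltnNge; apply/negP => nN; move/negP: ndn; apply.
  exact: (dom_leq dom_down nN dN).
rewrite !strE; move: (lt_ j n.+1) => b.
elim: n Nn b {ndn} => // n IH; rewrite ltnS leq_eqVlt => /orP[/eqP <- b|Nn b]; first exact: z.
have gn := good_pits c j n.+1 gh.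
by rewrite -[pits h j n.+2]/(pit (pits h j n.+1) (lt_ j n.+1)) eps_pit0//; exact: IH.
Qed.

End Coefficients.

(** * Rank two paths *)

Section RankTwoPaths.
Variables (R : realType) (V : lmodType R) (c : R) (p : nat).
Variables (f : bool -> V -> R) (al : bool -> V) (sg : bool -> R).
Hypotheses (c0 : 0 <= c) (cp : c ^+ 2 = p%:R).
Hypothesis f_lin : forall b k x y, f b (k *: x + y) = k * f b x + f b y.
Hypothesis f_al : forall b, f b (al b) = 2.
Hypothesis sg_pos : forall b, 0 < sg b.
Hypothesis sg_al : forall b, sg (~~ b) * f (~~ b) (al b) = - (c * sg b).
Local Notation dom := (chdom c).
Implicit Types (x y : R -> V) (j b : bool).

(* heights rescaled so that the two off-diagonal Cartan entries become equal *)
Definition hts x b s := sg b * f b (x s).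

Definition pe x j kap s := x s - ((sg j)^-1 * clip (hts x j) kap s) *: al j.

Definition eqp x y := forall s, 0 <= s <= 1 -> x s = y s.

Lemma fB b (x : V) (k : R) (y : V) : f b (x - k *: y) = f b x - k * f b y.
Proof. by rewrite addrC -scaleNr f_lin; ring. Qed.

Lemma hts_pe x j kap : hts (pe x j kap) = tr c (hts x) j kap.
Proof.
apply/funext => b; apply/funext => s; have s0 := sg_pos j.
have s1 : sg j != 0 by rewrite gt_eqF.
case: (eqVneq b j) => [->|bj].
  by rewrite tr_eq /hts /pe fB f_al; field.
have -> : b = ~~ j by case: b j bj {s0 s1} => -[].
rewrite tr_neq {1}/hts /pe fB mulrBr; congr (_ + _).
have -> : sg (~~ j) * ((sg j)^-1 * clip (hts x j) kap s * f (~~ j) (al j)) =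
  (sg (~~ j) * f (~~ j) (al j)) * (sg j)^-1 * clip (hts x j) kap s by ring.
by rewrite sg_al; field.
Qed.

Fixpoint ppits x j n := if n is n'.+1 then pe (ppits x j n') (lt_ j n') 0 else x.

Lemma hts_ppits x j n : hts (ppits x j n) = pits c (hts x) j n.
Proof. by elim: n => //= n <-; rewrite hts_pe. Qed.

Lemma ppits_cf x j n s : good (hts x) -> 0 <= s <= 1 ->
  ppits x j n s = x s + ((sg true)^-1 * pcoef c (hts x) j n true s) *: al true
    + ((sg false)^-1 * pcoef c (hts x) j n false s) *: al false.
Proof.
move=> gh hs; elim: n => [|n IH] /=; first by rewrite !mulr0 !scale0r !addr0.
have gn := good_pits c j n gh; have /andP[s0 s1] := hs.
rewrite /pe hts_ppits clip0 ?gn.2//; last exact: gn.1.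
rewrite IH; case: (lt_ j n) => /=; move: (mn _ _ _) => m; rewrite ?addr0 mulrDr scalerDl mulrN scaleNr !addrA//.
by rewrite [RHS]addrAC.
Qed.

Theorem path_confluence x j : good (hts x) -> fin_or_term c dom (hts x) j ->
  exists m n, eqp (ppits x j m) (ppits x (~~ j) n) /\
    forall b, eps (hts (ppits x j m)) b = 0.
Proof.
move=> gh tm; have [m [n [H1 H2]]] := confluence c0 cp gh tm.
exists m, n; split=> [s hs|b]; last by rewrite hts_ppits.
by rewrite !ppits_cf// !H1.
Qed.

Lemma eqp_hts x y b s : eqp x y -> 0 <= s <= 1 -> hts x b s = hts y b s.
Proof. by move=> e hs; rewrite /hts e. Qed.

Lemma eqp_eps x y b : eqp x y -> eps (hts x) b = eps (hts y) b.
Proof. by move=> e; apply: eq_eps => s hs; exact: eqp_hts. Qed.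

Lemma eqp_pe x y j kap : eqp x y -> eqp (pe x j kap) (pe y j kap).
Proof.
move=> e s hs; rewrite /pe e//; congr (_ - (_ * Num.min 0 (_ + _)) *: _).
by apply: eq_mn => u hu; apply: eqp_hts => //; lra.
Qed.

Lemma eqp_trans x y z : eqp x y -> eqp y z -> eqp x z.
Proof. by move=> e1 e2 s hs; rewrite e1// e2. Qed.

Lemma eqp_sym x y : eqp x y -> eqp y x.
Proof. by move=> e s hs; rewrite e. Qed.

Definition line (v : V) : R -> V := fun s => s *: v.

Definition climb j v := if f j v < 0 then v - f j v *: al j else v.

Lemma fZ b (k : R) (v : V) : f b (k *: v) = k * f b v.
Proof.
have f0 : f b 0 = 0 by have := f_lin b 1 0 0; rewrite scaler0 addr0 mul1r => /eqP; rewrite -subr_eq subrr => /eqP <-.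
by have := f_lin b k v 0; rewrite !addr0 f0 addr0.
Qed.

Lemma good_line v : good (hts (line v)).
Proof.
split=> b; last by rewrite /hts /line scale0r -(scale0r 0) fZ mul0r mulr0.
have -> : hts (line v) b = fun s => (sg b * f b v) * s.
  by apply/funext => s; rewrite /hts /line fZ; ring.
by apply: lip_scale; exact: lip_id.
Qed.

Lemma mn_line (k s : R) : 0 <= s <= 1 -> mn (fun t => k * t) 0 s = Num.min 0 k * s.
Proof.
move=> /andP[s0 s1]; apply: mn_eq => //; first by apply: lip_scale; exact: lip_id.
  move=> u /andP[u0 us]; case: (leP 0 k) => k0; first by rewrite mul0r mulr_ge0.
  by rewrite ler_wnM2l// ltW.
case: (leP 0 k) => k0; first by exists 0; rewrite ?lexx ?s0// mulr0 mul0r.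
by exists s; rewrite ?lexx ?s0.
Qed.

Lemma hts_line v b : hts (line v) b = fun s => (sg b * f b v) * s.
Proof. by apply/funext => s; rewrite /hts /line fZ; ring. Qed.

Lemma eps_line v b : eps (hts (line v)) b = sg b * - Num.min 0 (f b v).
Proof.
rewrite /eps hts_line mn_line ?lexx ?ler01// mulr1; have s0 := sg_pos b.
rewrite mulrN; case: (leP 0 (f b v)) => h.
  by rewrite (min_idPl _) ?mulr0// mulr_ge0// ltW.
by rewrite (min_idPr _)// pmulr_rle0// ltW.
Qed.

Lemma pe_line v j : eqp (pe (line v) j 0) (line (climb j v)).
Proof.
move=> s hs; have /andP[s0 s1] := hs; have gl := good_line v.
rewrite /pe clip0 ?gl.2//; last exact: gl.1.
rewrite hts_line mn_line// /line /climb; have sj := sg_pos j.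
case: (ltP (f j v) 0) => h.
  rewrite (min_idPr _); last by rewrite pmulr_rle0// ltW.
  have -> : (sg j)^-1 * (sg j * f j v * s) = s * f j v by field; rewrite gt_eqF.
  by rewrite scalerBr scalerA.
by rewrite (min_idPl _) ?mul0r ?mulr0 ?scale0r ?subr0// mulr_ge0// ltW.
Qed.

Fixpoint climbs v j n := if n is n'.+1 then climb (lt_ j n') (climbs v j n') else v.

Lemma ppits_line v j n : eqp (ppits (line v) j n) (line (climbs v j n)).
Proof.
elim: n => //= n IH; apply: (eqp_trans _ (pe_line _ _)); exact: eqp_pe.
Qed.

(** The Pitman transform of a straight path is the straight path of the reflected vector, or itself
    if the coroot is already nonnegative. Confluence of paths thus becomes confluence of reflections
    in a Weyl orbit. *)
Lemma climb_confluence v j : (exists K, forall n, (K <= n)%N -> 0 <= f (lt_ j n) (climbs v j n)) ->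
  exists m n, climbs v j m = climbs v (~~ j) n /\ forall b, 0 <= f b (climbs v j m).
Proof.
move=> [K HK]; have gl := good_line v.
have tm : fin_or_term c dom (hts (line v)) j.
  move=> _; exists K => n Kn; rewrite /str -hts_ppits (eqp_eps _ (ppits_line v j n)) eps_line.
  by rewrite (min_idPl (HK n Kn)) oppr0 mulr0.
have [m [n [E Z]]] := path_confluence gl tm.
exists m, n; have h1 : (0 : R) <= (1 : R) <= (1 : R) by rewrite ler01 lexx.
split; last first.
  move=> b; have := Z b; rewrite (eqp_eps _ (ppits_line v j m)) eps_line.
  move=> /eqP; rewrite mulf_eq0 gt_eqF//= oppr_eq0 => /eqP <-.
  by case: (leP 0 (f b (climbs v j m))).
have := E 1 h1; rewrite (ppits_line v j m h1) (ppits_line v (~~ j) n h1).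
by rewrite /line !scale1r.
Qed.

End RankTwoPaths.

(** * Root data *)

(** Stated so that it passes to a subset of the indices ([adm_sub]) and survives adjoining formal
    weights ([admW]). The symmetrizer has values in [R], where its square roots exist. *)
Record adm (R : realType) (V : lmodType R) (J : eqType) (a : J -> J -> int)
    (alpha : J -> V) (coroot : J -> V -> R) : Prop := Adm {
  adm_al : forall i j, coroot i (alpha j) = (a i j)%:~R;
  adm_diag : forall i, a i i = 2%:Z \/ a i i <= 0;
  adm_off : forall i j, i != j -> a i j <= 0;
  adm_zero : forall i j, a i j = 0 -> a j i = 0;
  adm_free : forall (s : seq J) (c : J -> R), uniq s ->
     \sum_(i <- s) c i *: alpha i = 0 -> forall i, i \in s -> c i = 0;
  adm_lin : forall i (c : R) (x y : V), coroot i (c *: x + y) = c * coroot i x + coroot i y;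
  adm_sym : exists d : J -> R, (forall i, 0 < d i) /\
     (forall i j, d i * (a i j)%:~R = d j * (a j i)%:~R) }.

Section RootLattice.
Variables (R : realType) (V : lmodType R) (J : eqType) (a : J -> J -> int)
    (alpha : J -> V) (coroot : J -> V -> R).
Hypothesis hA : adm a alpha coroot.
Local Notation D := (@RDat R V J a alpha coroot).
Local Notation rf := (@refl R V D).
Local Notation re := (@is_real R V D).
Implicit Types (s t u : seq J) (i j k : J) (v x y : V).

(** Lists up to permutation stand for the positive cone of the root lattice; [sumr_inj] is the
    independence of the simple roots. *)
Definition sumr s : V := \sum_(j <- s) alpha j.

Lemma sumr_cat s t : sumr (s ++ t) = sumr s + sumr t.
Proof. by rewrite /sumr big_cat. Qed.

Lemma sumr_nil : sumr [::] = 0.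
Proof. by rewrite /sumr big_nil. Qed.

Lemma sumr_cons i s : sumr (i :: s) = alpha i + sumr s.
Proof. by rewrite /sumr big_cons. Qed.

Lemma sumr_nseq n i : sumr (nseq n i) = n%:R *: alpha i.
Proof.
elim: n => [|n IH]; first by rewrite sumr_nil scale0r.
by rewrite /= sumr_cons IH -natr1 scalerDl scale1r addrC.
Qed.

Lemma perm_sumr s t : perm_eq s t -> sumr s = sumr t.
Proof. by move=> h; rewrite /sumr (perm_big _ h). Qed.

Lemma sumr_count s u : uniq u -> {subset s <= u} ->
  sumr s = \sum_(i <- u) (count_mem i s)%:R *: alpha i.
Proof.
move=> uu; elim: s => [|x s IH] hs.
  by rewrite sumr_nil big1 // => i _; rewrite scale0r.
rewrite sumr_cons IH; last by move=> y ys; apply: hs; rewrite inE ys orbT.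
have xu : x \in u by apply: hs; rewrite mem_head.
have -> : alpha x = \sum_(i <- u) (x == i)%:R *: alpha i.
  rewrite (bigD1_seq x)//= eqxx scale1r big1 ?addr0// => i ix.
  by rewrite eq_sym (negbTE ix) scale0r.
by rewrite -big_split /=; apply: eq_bigr => i _; rewrite natrD scalerDl.
Qed.

Lemma sumr_inj s t : sumr s = sumr t -> perm_eq s t.
Proof.
move=> e; set u := undup (s ++ t).
have uu : uniq u by exact: undup_uniq.
have su : {subset s <= u} by move=> x xs; rewrite mem_undup mem_cat xs.
have tu : {subset t <= u} by move=> x xs; rewrite mem_undup mem_cat xs orbT.
have z : \sum_(i <- u) ((count_mem i s)%:R - (count_mem i t)%:R) *: alpha i = 0.
  under eq_bigr do rewrite scalerBl.
  by rewrite sumrB -!sumr_count// e subrr.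
apply/allP => x; rewrite mem_cat => xst.
have := adm_free hA uu z; move=> /(_ x); rewrite mem_undup mem_cat xst => /(_ isT)/eqP.
by rewrite subr_eq0 eqr_nat.
Qed.

Lemma sumr_eq0 s : sumr s = 0 -> s = [::].
Proof. by move=> h; have := @sumr_inj s [::]; rewrite sumr_nil h => /(_ erefl)/perm_nilP. Qed.

Lemma sumr_flat n s : sumr (flatten (nseq n s)) = n%:R *: sumr s.
Proof.
elim: n => [|n IH]; first by rewrite /= sumr_nil scale0r.
by rewrite /= sumr_cat IH -natr1 scalerDl scale1r addrC.
Qed.

Lemma count_flat n s (P : pred J) : count P (flatten (nseq n s)) = (n * count P s)%N.
Proof. by elim: n => //= n IH; rewrite count_cat IH mulSn. Qed.

Definition Qz v := exists s t, v = sumr s - sumr t.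

Lemma Qz0 : Qz 0. Proof. by exists [::], [::]; rewrite subrr. Qed.

Lemma QzD x y : Qz x -> Qz y -> Qz (x + y).
Proof.
move=> [s [t ->]] [s' [t' ->]]; exists (s ++ s'), (t ++ t').
by rewrite !sumr_cat opprD !addrA; congr (_ + _); rewrite addrAC.
Qed.

Lemma QzN x : Qz x -> Qz (- x).
Proof. by move=> [s [t ->]]; exists t, s; rewrite opprB. Qed.

Lemma Qz_sumr s : Qz (sumr s).
Proof. by exists s, [::]; rewrite sumr_nil subr0. Qed.

Lemma QzZ (n : int) x : Qz x -> Qz (n%:~R *: x).
Proof.
move=> hx; have H (m : nat) : Qz (m%:R *: x).
  elim: m => [|m IH]; first by rewrite scale0r; exact: Qz0.
  by rewrite -natr1 scalerDl scale1r; exact: QzD.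
case: n => m; first exact: H.
by rewrite NegzE mulrNz scaleNr; apply: QzN; exact: H.
Qed.

Lemma Qz_al i : Qz (alpha i).
Proof. by have := Qz_sumr [:: i]; rewrite sumr_cons sumr_nil addr0. Qed.

Lemma count_sub s t : (forall j, (count_mem j t <= count_mem j s)%N) ->
  exists u, sumr s - sumr t = sumr u.
Proof.
move=> H; have [t' ts tt'] := iffLR (count_subseqP _ _) H.
have [u hu] := perm_to_subseq ts; exists u.
by rewrite (perm_sumr hu) sumr_cat (perm_sumr tt') addrAC subrr add0r.
Qed.

Lemma Qz_pos v n s : Qz v -> (0 < n)%N -> n%:R *: v = sumr s -> exists u, v = sumr u.
Proof.
move=> [p [q ->]] n0; rewrite scalerBr -!sumr_flat => /eqP; rewrite subr_eq -sumr_cat => /eqP.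
move=> /sumr_inj/permP H; apply: count_sub => x.
have := H (pred1 x); rewrite count_cat !count_flat => e.
by rewrite -(leq_pmul2l n0) e leq_addl.
Qed.

Lemma posQP v : posQ D v <-> exists s, v = sumr s.
Proof.
split=> [[s ->]|[s ->]].
  elim: s => [|[i n] s [u IH]]; first by exists [::]; rewrite big_nil sumr_nil.
  by exists (nseq n i ++ u); rewrite big_cons IH sumr_cat sumr_nseq.
exists [seq (j, 1%N) | j <- s]; rewrite big_map.
by apply: eq_bigr => i _; rewrite /= scale1r.
Qed.

Lemma crD i x y : coroot i (x + y) = coroot i x + coroot i y.
Proof. by have := adm_lin hA i 1 x y; rewrite scale1r mul1r. Qed.

Lemma cr0 i : coroot i 0 = 0.
Proof. by have := crD i 0 0; rewrite addr0 => /eqP; rewrite -subr_eq subrr => /eqP <-. Qed.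

Lemma crZ i (k : R) x : coroot i (k *: x) = k * coroot i x.
Proof. by have := adm_lin hA i k x 0; rewrite !addr0 cr0 addr0. Qed.

Lemma crN i x : coroot i (- x) = - coroot i x.
Proof. by rewrite -scaleN1r crZ mulN1r. Qed.

Lemma crB i x y : coroot i (x - y) = coroot i x - coroot i y.
Proof. by rewrite crD crN. Qed.

Lemma reE i : re i = (a i i == 2%:Z). Proof. by []. Qed.

Lemma re_aii i : re i -> a i i = 2%:Z. Proof. by move/eqP. Qed.

Lemma im_aii i : ~~ re i -> a i i <= 0.
Proof. by rewrite reE => /eqP h; have [|] := adm_diag hA i. Qed.

Lemma rfE i x : rf i x = x - coroot i x *: alpha i. Proof. by []. Qed.

Lemma cr_rf i j x : coroot j (rf i x) = coroot j x - coroot i x * (a j i)%:~R.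
Proof. by rewrite rfE crB crZ (adm_al hA). Qed.

Lemma cr_rf_same i x : re i -> coroot i (rf i x) = - coroot i x.
Proof. by move=> /re_aii h; rewrite cr_rf h; ring. Qed.

Lemma rfK i x : re i -> rf i (rf i x) = x.
Proof. by move=> h; rewrite [LHS]rfE cr_rf_same// rfE scaleNr opprK subrK. Qed.

Lemma rfD i x y : rf i (x + y) = rf i x + rf i y.
Proof. by rewrite !rfE crD scalerDl opprD !addrA; congr (_ + _); rewrite addrAC. Qed.

Lemma rfZ i (k : R) x : rf i (k *: x) = k *: rf i x.
Proof. by rewrite !rfE crZ scalerBr scalerA. Qed.

Lemma rfN i x : rf i (- x) = - rf i x.
Proof. by rewrite -scaleN1r rfZ scaleN1r. Qed.

Lemma rfB i x y : rf i (x - y) = rf i x - rf i y.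
Proof. by rewrite rfD rfN. Qed.

Lemma rf_al i j : rf i (alpha j) = alpha j - (a i j)%:~R *: alpha i.
Proof. by rewrite rfE (adm_al hA). Qed.

Lemma Qz_rf i x : Qz x -> Qz (rf i x).
Proof.
have H s : Qz (rf i (sumr s)).
  elim: s => [|j s IH]; first by rewrite sumr_nil rfE cr0 scale0r subr0; exact: Qz0.
  rewrite sumr_cons rfD; apply: QzD => //; rewrite rf_al.
  by apply: QzD; [exact: Qz_al|apply: QzN; apply: QzZ; exact: Qz_al].
by move=> [s [t ->]]; rewrite rfB; apply: QzD => //; exact: QzN.
Qed.

Lemma off_le0 i j : i != j -> (a i j)%:~R <= 0 :> R.
Proof. by move=> h; rewrite lerz0; exact: adm_off hA _ _ h. Qed.

Section Descent.
Variable lam : V.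
Hypothesis lam_nat : forall i, exists n : nat, coroot i lam = n%:R.

(** Vectors reached from [lam] by reflections that each lower the weight, with the list of simple
    roots subtracted. The aim is that the whole orbit is of this form. *)
Inductive desc : seq J -> V -> Prop :=
| desc0 : desc [::] lam
| descS i s v n : desc s v -> (0 < n)%N -> coroot i v = n%:R ->
    desc (nseq n i ++ s) (rf i v).

Lemma descE s v : desc s v -> v = lam - sumr s.
Proof.
elim=> [|i {}s {}v n _ -> n0 e]; first by rewrite sumr_nil subr0.
by rewrite rfE e sumr_cat sumr_nseq opprD addrCA addrC.
Qed.

Lemma desc_size s t v : desc s v -> desc t v -> size s = size t.
Proof.
by move=> /descE -> /descE /addrI/oppr_inj/sumr_inj/perm_size.
Qed.

Lemma cr_sumr_int i s : exists z : int, coroot i (sumr s) = z%:~R.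
Proof.
elim: s => [|j s [z IH]]; first by exists 0; rewrite sumr_nil cr0.
by exists (a i j + z); rewrite sumr_cons crD IH (adm_al hA) intrD.
Qed.

Lemma desc_int i s v : desc s v -> exists z : int, coroot i v = z%:~R.
Proof.
move=> /descE ->; have [n e] := lam_nat i; have [z ez] := cr_sumr_int i s.
by exists (n%:Z - z); rewrite crB e ez intrB.
Qed.

Lemma desc_step i s v : desc s v -> 0 < coroot i v -> exists t, desc t (rf i v) /\ (size s < size t)%N.
Proof.
move=> ds h; have [z e] := desc_int i ds.
move: h; rewrite e ltr0z => z0; exists (nseq `|z|%N i ++ s); split.
  apply: descS => //; first by rewrite absz_gt0 gt_eqF.
  by rewrite e -[RHS]mulrz_nat natz gez0_abs// ltW.
rewrite size_cat size_nseq -[X in (X < _)%N]add0n ltn_add2r absz_gt0; exact: lt0r_neq0.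
Qed.

Lemma nat_stab (g : nat -> nat) : (forall n, (g n.+1 <= g n)%N) ->
  exists K, forall n, (K <= n)%N -> g n.+1 = g n.
Proof.
move: {2}(g 0%N) (erefl (g 0%N)) => m; elim/ltn_ind: m g => m IH g gm gd.
case: (pselect (exists n, (g n < m)%N)) => [[n gn]|H].
  have gd' l : (g (n + l.+1) <= g (n + l))%N by rewrite addnS.
  have [K HK] := IH _ gn (fun l => g (n + l)%N) (congr1 g (addn0 n)) gd'.
  exists (n + K)%N => l nl; have := HK (l - n)%N.
  by rewrite addnS subnKC; [apply; lia|lia].
have gm' n : g n = m.
  apply/eqP; rewrite eqn_leq; apply/andP; split; last first.
    by rewrite leqNgt; apply/negP => h; apply: H; exists n.
  by elim: n => [|n IHn]; [rewrite gm|exact: leq_trans IHn].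
by exists 0%N => n _; rewrite !gm'.
Qed.

Definition pr i p (b : bool) := if b then i else p.

(** The scales [sg] are the square roots of the symmetrizer. They make the off-diagonal entries
    equal to [- c], with [c ^ 2 = a i p * a p i] an integer. *)
Lemma rank2 i p : i != p -> exists (c : R) (q : nat) (sg : bool -> R), [/\ 0 <= c, c ^+ 2 = q%:R,
  forall b, 0 < sg b &
  forall b, sg (~~ b) * coroot (pr i p (~~ b)) (alpha (pr i p b)) = - (c * sg b)].
Proof.
move=> ip; have [d [d0 ds]] := adm_sym hA.
have sq k : 0 < Num.sqrt (d k) by rewrite sqrtr_gt0.
have sqk k : Num.sqrt (d k) * Num.sqrt (d k) = d k by rewrite -expr2 sqr_sqrtr// ltW.
have nz k : Num.sqrt (d k) != 0 by rewrite gt_eqF.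
have o1 := off_le0 ip; have o2 : (a p i)%:~R <= 0 :> R by apply: off_le0; rewrite eq_sym.
exists (- (a i p)%:~R * Num.sqrt (d i) / Num.sqrt (d p)), (absz (a i p * a p i)),
  (fun b => Num.sqrt (d (pr i p b))); split=> [||b|].
- by rewrite divr_ge0 ?mulr_ge0 ?oppr_ge0// ltW.
- rewrite natr_absz ger0_norm; last first.
    by rewrite mulr_le0// ?(adm_off hA)// eq_sym.
  rewrite intrM; apply: (mulIf (mulf_neq0 (nz p) (nz p))).
  transitivity ((a i p)%:~R * (Num.sqrt (d i) * Num.sqrt (d i) * (a i p)%:~R)); first by field.
  by rewrite !sqk ds; ring.
- exact: sq.
move=> [] /=; rewrite (adm_al hA) /pr /=.
  have e : Num.sqrt (d i) * Num.sqrt (d i) * (a i p)%:~R = Num.sqrt (d p) * Num.sqrt (d p) * (a p i)%:~R by rewrite !sqk ds.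
  apply: (mulIf (nz p)). 
  transitivity (Num.sqrt (d p) * Num.sqrt (d p) * (a p i)%:~R); first ring.
  by rewrite -e; field.
by field.
Qed.

Lemma desc_up s t i v : re i -> desc s v -> desc t (rf i v) -> coroot i v < 0 -> (size t < size s)%N.
Proof.
move=> ri ds dt h; have h' : 0 < coroot i (rf i v) by rewrite cr_rf_same// oppr_gt0.
have [u [du ut]] := desc_step dt h'; move: du; rewrite rfK// => du.
by rewrite (desc_size ds du).
Qed.

Lemma desc_inv s v : desc s v -> (s = [::] /\ v = lam) \/
  exists i n u x, [/\ s = nseq n i ++ u, v = rf i x, desc u x, (0 < n)%N & coroot i x = n%:R].
Proof. by case=> [|i t x n dt n0 e]; [left|right; exists i, n, t, x]. Qed.

(** Induction on the height of [lam - v]. Write [v = r_p v1] for the last descent. If [p = i], undo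
    it. Otherwise the coroot is negative on [v1] already, so [i] is real and [r_i v1] is a descent.
    If [p] is imaginary, the reflections commute or the signs are contradictory. If [p] is real,
    climbing from [v] through [p] and [i] stays among descents of smaller height, hence ends; by
    confluence the climb beginning with [i] ends at the same vector, and walking back down along it
    reaches [r_i v]. *)
Lemma desc_closed s v i : desc s v -> coroot i v < 0 -> re i /\ exists t, desc t (rf i v).
Proof.
move: {2}(size s) (leqnn (size s)) => m; elim: m s v i => [|m IH] s v i sm ds hi.
  move: sm hi ds; rewrite leqn0 => /nilP -> hi /desc_inv[[_ e]|[p [n [u [x [e _ _ n0 _]]]]]].
    by move: hi; have [n en] := lam_nat i; rewrite e en ltrn0.
  by case: n n0 e.
case/desc_inv: (ds) => [[_ e]|[p [n [s1 [v1 [es ev ds1 n0 e1]]]]]].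
  by move: hi; have [n en] := lam_nat i; rewrite e en ltrn0.
have sz1 : (size s1 <= m)%N.
  by move: sm; rewrite es size_cat size_nseq; case: n n0 {e1 es} => // n _; lia.
have [pi|pi] := eqVneq p i.
  subst p; have [ri|ni] := boolP (re i).
    by split=> //; exists s1; rewrite ev rfK.
  move: hi; rewrite ev cr_rf e1 -{1}[n%:R]mulr1 -mulrBr ltNge mulr_ge0 ?ler0n//.
  by have := im_aii ni; rewrite -(lerz0 R); lra.
have aip : (a i p)%:~R <= 0 :> R by apply: off_le0; rewrite eq_sym.
have eiv : coroot i v = coroot i v1 - n%:R * (a i p)%:~R by rewrite ev cr_rf e1.
have hi1 : coroot i v1 < 0.
  have : 0 <= n%:R * - (a i p)%:~R :> R by apply: mulr_ge0; rewrite ?ler0n ?oppr_ge0.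
  by rewrite mulrN => h0; move: hi; rewrite eiv; lra.
have [ri [s2 ds2]] := IH _ _ _ sz1 ds1 hi1; split=> //.
have sz2 := desc_up ri ds1 ds2 hi1.
have [rp|np] := boolP (re p); last first.
  have [z ez] := desc_int i ds1; have [q eq] : exists q : nat, coroot i v1 = - q%:R.
    exists `|z|%N; rewrite ez; move: hi1; rewrite ez ltrz0 => z0.
    by rewrite natr_absz ltr0_norm// intrN opprK.
  have h2 : 0 <= coroot p (rf i v1).
    rewrite leNgt; apply/negP => /(IH s2 _ p _ ds2) [|rp _]; first by lia.
    by rewrite rp in np.
  have [a0|a0] := eqVneq (a i p) 0.
    have a0' := adm_zero hA a0.
    exists (nseq n p ++ s2).
    have -> : rf i v = rf p (rf i v1).
      by rewrite !rfE eiv !crB !crZ !(adm_al hA) a0 a0' !mulr0 !subr0 ev rfE e1 addrAC.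
    by apply: descS => //; rewrite cr_rf a0' mulr0 subr0.
  (* With [coroot i v1 = - q], nonnegativity of [coroot p] on [r_i v1] gives [n >= q], while
     [coroot i v < 0] gives [n < q], both off-diagonal entries being at most -1. *)
  exfalso; move: hi; rewrite eiv.
  have : n%:R = coroot p (rf i v1) - q%:R * (a p i)%:~R.
    by rewrite cr_rf -e1 eq; ring.
  have api : (a p i)%:~R <= -1 :> R.
    have : a p i != 0 by apply: contra_neq a0 => /(adm_zero hA).
    have : a p i <= 0 by apply: (adm_off hA).
    move=> h3 h4; have : a p i <= -1 by lia.
    by rewrite -(ler_int R).
  have aip1 : (a i p)%:~R <= -1 :> R.
    have : a i p <= 0 by apply: (adm_off hA); rewrite eq_sym.
    move=> h3; have : a i p <= -1 by lia.
    by rewrite -(ler_int R).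
  have q0 : 0 <= q%:R :> R := ler0n _ _.
  have n0' : 0 <= n%:R :> R := ler0n _ _.
  rewrite eq => en; have k1 : 0 <= q%:R * (- 1 - (a p i)%:~R) :> R by apply: mulr_ge0 => //; lra.
  have k2 : 0 <= n%:R * (- 1 - (a i p)%:~R) :> R by apply: mulr_ge0 => //; lra.
  by move: k1 k2; rewrite !mulrBr; lra.
have ip : i != p by rewrite eq_sym.
have [c [q [sg [c0 cq sg0 sgal]]]] := rank2 ip.
set f := fun b x => coroot (pr i p b) x; set al := fun b => alpha (pr i p b).
have rpr b : re (pr i p b) by case: b.
have f_lin b (k : R) x y : f b (k *: x + y) = k * f b x + f b y by rewrite /f crD crZ.
have f_al b : f b (al b) = 2 by rewrite /f /al (adm_al hA) re_aii.
have climbE x b : climb f al b x = if coroot (pr i p b) x < 0 then rf (pr i p b) x else x by [].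
(* every element reached from [v] by first removing the last step is below [m] in height *)
have E1 : climbs f al v false 1 = v1.
  rewrite /= ?lt_0 climbE /= ev cr_rf_same// e1 oppr_lt0 ltr0n n0.
  by rewrite rfK.
have step n' : exists t, desc t (climbs f al v false n'.+1) /\ (size t <= m)%N.
  elim: n' => [|n' [t [dt st]]]; first by exists s1; rewrite E1.
  rewrite [climbs _ _ _ _ _]/= -/(climbs f al v false n'.+1) climbE.
  case: ifP => h; last by exists t.
  have [_ [u du]] := IH _ _ _ st dt h.
  by exists u; split=> //; have := desc_up (rpr _) dt du h; lia.
have [g Hg] := choice step.
have [K HK] : exists K, forall n', (K <= n')%N -> size (g n'.+1) = size (g n').
  apply: nat_stab => n'; have [d1 z1] := Hg n'; have [d2 z2] := Hg n'.+1.
  move: d2; rewrite [climbs _ _ _ _ _]/= -/(climbs f al v false n'.+1) climbE.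
  case: ifP => h d2; last by rewrite (desc_size d1 d2).
  by rewrite ltnW// (desc_up (rpr _) d1 d2 h).
have tm : exists K, forall n, (K <= n)%N -> 0 <= f (lt_ false n) (climbs f al v false n).
  exists K.+1 => -[//|n'] Kn; rewrite leNgt; apply/negP => h.
  have [d1 z1] := Hg n'; have [d2 z2] := Hg n'.+1; have := HK n' Kn.
  move: d2; rewrite [climbs _ _ _ _ _]/= -/(climbs f al v false n'.+1) climbE h => d2.
  by move=> e; have := desc_up (rpr _) d1 d2 h; rewrite e ltnn.
have [M [N [EMN dominant]]] := climb_confluence c0 cq f_lin f_al sg0 sgal tm.
have [t dt] : exists t, desc t (climbs f al v true N).
  rewrite -EMN; case: M {EMN dominant} => [|M]; first by exists s.
  by have [t []] := step M; exists t.
case: N EMN dt => [|N] EMN dt.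
  by move: (dominant true); rewrite EMN /= leNgt /f /= hi.
(* The common end of both climbs is a descent; each step of the second climb, read backwards, is
   again a descent, down to its first vector [rf i v]. *)
suff H n' : (exists t, desc t (climbs f al v true n'.+1)) -> exists t, desc t (rf i v).
  by apply: (H N); exists t.
elim: n' => [|n' IHn] [u du]; first by move: du; rewrite /= ?lt_0 climbE /= hi; exists u.
apply: IHn; move: du; rewrite [climbs _ _ _ _ _]/= -/(climbs f al v true n'.+1) climbE.
case: ifP => h du; last by exists u.
have h' : 0 < coroot (pr i p (lt_ true n'.+1)) (rf (pr i p (lt_ true n'.+1)) (climbs f al v true n'.+1)).
  by rewrite cr_rf_same// oppr_gt0.
by have [w [dw _]] := desc_step du h'; exists w; move: dw; rewrite rfK.
Qed.

Lemma desc_refl s v i : desc s v -> exists t, desc t (rf i v).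
Proof.
move=> ds; have [h|h|h] := ltgtP (coroot i v) 0.
- by have [_] := desc_closed ds h.
- by have [t [dt _]] := desc_step ds h; exists t.
by exists s; rewrite rfE h scale0r subr0.
Qed.

Lemma desc_orbit v : orbit D lam v -> exists s, desc s v.
Proof.
elim=> [|i u _ [s ds]]; first by exists [::]; exact: desc0.
exact: desc_refl ds.
Qed.

Lemma orbit_wt v : orbit D lam v -> exists s, v = lam - sumr s.
Proof. by move=> /desc_orbit[s /descE]; exists s. Qed.

Lemma orbit_im i v : orbit D lam v -> ~~ re i -> 0 <= coroot i v.
Proof.
move=> /desc_orbit[s ds] ni; rewrite leNgt; apply/negP => /(desc_closed ds)[ri _].
by rewrite ri in ni.
Qed.

Lemma orbit_int i v : orbit D lam v -> exists z : int, coroot i v = z%:~R.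
Proof. by move=> /desc_orbit[s /(desc_int i)]. Qed.

End Descent.

End RootLattice.

Section Words.
Variables (R : realType) (V : lmodType R) (J : eqType) (a : J -> J -> int)
    (alpha : J -> V) (coroot : J -> V -> R).
Hypothesis hA : adm a alpha coroot.
Local Notation D := (@RDat R V J a alpha coroot).
Local Notation rf := (@refl R V D).
Local Notation re := (@is_real R V D).
Local Notation wact := (@wact R V D).
Local Notation root_of := (@root_of R V D).
Local Notation corootf := (@corootf R V D).
Local Notation rrefl := (@rrefl R V D).
Local Notation orbit := (@orbit R V D).
Implicit Types (w : seq J) (i j : J) (x y : V) (k : R).

Lemma wactD w x y : wact w (x + y) = wact w x + wact w y.
Proof. by elim: w => //= i w ->; rewrite (rfD hA). Qed.

Lemma wactZ w k x : wact w (k *: x) = k *: wact w x.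
Proof. by elim: w => //= i w ->; rewrite (rfZ hA). Qed.

Lemma wactN w x : wact w (- x) = - wact w x.
Proof. by rewrite -scaleN1r wactZ scaleN1r. Qed.

Lemma wact_cat w w' x : wact (w ++ w') x = wact w (wact w' x).
Proof. by rewrite /Defs.wact foldr_cat. Qed.

Lemma wact_rcons w i x : wact (rcons w i) x = wact w (rf i x).
Proof. by rewrite /Defs.wact foldr_rcons. Qed.

Lemma wactVK w x : all re w -> wact w (wact (rev w) x) = x.
Proof.
elim: w x => //= i w IH x /andP[ri rw].
by rewrite rev_cons wact_rcons IH// (rfK hA).
Qed.

Lemma wactKV w x : all re w -> wact (rev w) (wact w x) = x.
Proof. by move=> rw; rewrite -{2}(revK w) wactVK// all_rev. Qed.

Lemma corootfD w i x y : corootf w i (x + y) = corootf w i x + corootf w i y.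
Proof. by rewrite /Defs.corootf wactD /= (crD hA). Qed.

Lemma corootfZ w i k x : corootf w i (k *: x) = k * corootf w i x.
Proof. by rewrite /Defs.corootf wactZ /= (crZ hA). Qed.

Lemma corootf_cons i w j x : corootf (i :: w) j x = corootf w j (rf i x).
Proof. by rewrite /Defs.corootf rev_cons wact_rcons. Qed.

Lemma root_cons i w j : root_of (i :: w) j = rf i (root_of w j).
Proof. by []. Qed.

Lemma rreflE w i x : all re w -> rrefl w i x = x - corootf w i x *: root_of w i.
Proof.
move=> rw; rewrite /Defs.rrefl rfE /Defs.corootf -scaleNr wactD wactZ wactVK//.
by rewrite scaleNr.
Qed.

Lemma corootf_root w i : all re w -> corootf w i (root_of w i) = (a i i)%:~R.
Proof. by move=> rw; rewrite /Defs.corootf /Defs.root_of wactKV//= (adm_al hA). Qed.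

Lemma orbit_wact lam w x : orbit lam x -> orbit lam (wact w x).
Proof. by move=> h; elim: w => //= i w IH; exact: orbit_step. Qed.

Lemma Qz_wact w x : Qz alpha x -> Qz alpha (wact w x).
Proof. by move=> h; elim: w => //= i w IH; exact: (Qz_rf hA). Qed.

Lemma rrefl_wact w i x : rrefl w i x = wact (w ++ i :: rev w) x.
Proof. by rewrite wact_cat. Qed.

End Words.

(** * Positive and negative real roots *)

Section FormalWeights.
Variables (R : realType) (V : lmodType R) (J : eqType) (a : J -> J -> int)
    (alpha : J -> V) (coroot : J -> V -> R).
Hypothesis hA : adm a alpha coroot.

(* adjoining formal fundamental weights to [V] *)
Let W := (V * (J -> R^o))%type.

Let alw (j : J) : W := (alpha j, 0).

Let crw (i : J) (x : W) : R := coroot i x.1 + x.2 i.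
Local Notation D := (@RDat R V J a alpha coroot).
Local Notation DW := (@RDat R W J a alw crw).
Local Notation re := (@is_real R V D).

Lemma sum_fst (T : Type) (s : seq T) (F : T -> W) : (\sum_(i <- s) F i).1 = \sum_(i <- s) (F i).1.
Proof. by elim: s => [|x s IH]; rewrite ?big_nil// !big_cons -IH. Qed.

Lemma admW : adm a alw crw.
Proof.
split.
- by move=> i j; rewrite /crw /= addr0 (adm_al hA).
- exact: adm_diag hA.
- exact: adm_off hA.
- exact: adm_zero hA.
- move=> s c us e; apply: (adm_free hA us).
  by have := congr1 fst e; rewrite sum_fst.
- by move=> i c x y; rewrite /crw /= (adm_lin hA) mulrDr; rewrite -!addrA; congr (_ + _); rewrite addrCA.
- exact: adm_sym hA.
Qed.

Definition fw (k : J) : W := (0, fun i => (i == k)%:R).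

Lemma crw_fw i k : crw i (fw k) = (i == k)%:R.
Proof. by rewrite /crw /= (cr0 hA) add0r. Qed.

Lemma fw_nat k i : exists n : nat, crw i (fw k) = n%:R.
Proof. by exists (i == k); rewrite crw_fw. Qed.

Lemma wactW w (x : V) : @wact R W DW w (x, 0) = (@wact R V D w x, 0).
Proof.
elim: w => //= i w ->; rewrite !rfE /alw /crw /= addr0.
by apply: injective_projections; rewrite /= ?scaler0 ?subr0.
Qed.

Lemma corootf_sum w i : exists l : seq (J * R), forall x : W,
  @corootf R W DW w i x = \sum_(q <- l) q.2 * crw q.1 x.
Proof.
elim: w => [|k w [l IH]].
  by exists [:: (i, 1)] => x; rewrite big_cons big_nil addr0 mul1r.
exists ((k, - \sum_(q <- l) q.2 * (a q.1 k)%:~R) :: l) => x.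
rewrite corootf_cons IH big_cons mulNr mulr_suml addrC -sumrB.
by apply: eq_bigr => q _; rewrite (cr_rf admW) /=; ring.
Qed.

(** The coroot is a combination of simple coroots, so its value at [x] is its value at the
    combination of the [fw k] with coefficients [coroot k x]. *)
Lemma fw_separates w i (x : V) : @corootf R V D w i x != 0 ->
  exists k, @corootf R W DW w i (fw k) != 0.
Proof.
move=> nz; apply: contrapT => H.
have z k : @corootf R W DW w i (fw k) = 0 by apply/eqP; apply: contrapT => /negP h; apply: H; exists k.
have [l hl] := corootf_sum w i.
have e : @corootf R V D w i x = \sum_(q <- l) q.2 * coroot q.1 x.
  transitivity (@corootf R W DW w i (x, 0)).
    by rewrite /corootf wactW /= /crw /= addr0.
  by rewrite hl; apply: eq_bigr => q _; rewrite /crw /= addr0.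
set u := undup (map fst l).
have : @corootf R W DW w i (\sum_(k <- u) coroot k x *: fw k) = 0.
  elim: u => [|k u IH]; first by rewrite big_nil -(scale0r 0) (corootfZ admW) mul0r.
  by rewrite big_cons (corootfD admW) (corootfZ admW) z mulr0 add0r.
rewrite hl => e0; move/eqP: nz; apply; rewrite e -[RHS]e0.
apply: eq_big_seq => q ql; congr (_ * _).
have qu : q.1 \in u by rewrite mem_undup map_f.
have uu : uniq u by exact: undup_uniq.
have -> : crw q.1 (\sum_(k <- u) coroot k x *: fw k) = \sum_(k <- u) coroot k x * (q.1 == k)%:R.
  elim: (u) => [|k v IH]; first by rewrite !big_nil (cr0 admW).
  by rewrite !big_cons (crD admW) (crZ admW) IH crw_fw.
rewrite (bigD1_seq q.1)//= eqxx mulr1 big1 ?addr0// => k kq.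
by rewrite eq_sym (negbTE kq) mulr0.
Qed.

(** For a fundamental weight not killed by the coroot of the root [beta], the reflection moves it by
    a nonzero integer multiple of [beta]. The result lies in the orbit of a dominant weight, hence
    below it, so this multiple is a sum of simple roots; its sign decides the sign of [beta]. *)
Theorem root_dich w i : all re w -> re i ->
  (exists s, @root_of R V D w i = sumr alpha s) \/ (exists s, @root_of R V D w i = - sumr alpha s).
Proof.
move=> rw ri.
have [|k ck] := @fw_separates w i (@root_of R V D w i).
  by rewrite (corootf_root hA)// (re_aii ri) intr_eq0.
have oc := orbit_wact (w ++ i :: rev w) (orbit_base DW (fw k)).
have [s es] := orbit_wt admW (fw_nat k) oc.
have [z ez] : exists z : int, @corootf R W DW w i (fw k) = z%:~R.
  apply: (orbit_int admW (fw_nat k)); apply: orbit_wact; exact: orbit_base.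
move: es; rewrite -rrefl_wact (rreflE admW)// => /addrI/oppr_inj.
have -> : @root_of R W DW w i = (@root_of R V D w i, 0) by exact: wactW.
rewrite ez => es.
have e1 : z%:~R *: @root_of R V D w i = sumr alpha s.
  by have := congr1 fst es; rewrite /sumr sum_fst.
have Qr : Qz alpha (@root_of R V D w i) by apply: (Qz_wact hA); exact: Qz_al.
have z0 : z != 0 by apply: contraNneq ck => z0; rewrite ez z0.
case: z z0 e1 {ez es} => [[//|n]|n] _ e1.
  by left; apply: (Qz_pos hA Qr (ltn0Sn n)); exact: e1.
right; have [|u eu] := Qz_pos hA (QzN Qr) (ltn0Sn n) (s := s).
  by rewrite scalerN -scaleNr -e1 NegzE mulrNz.
by exists u; rewrite -eu opprK.
Qed.

End FormalWeights.

(** * Roots, their coroots and their types *)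

Section RootFacts.
Variables (R : realType) (V : lmodType R) (J : eqType) (a : J -> J -> int)
    (alpha : J -> V) (coroot : J -> V -> R).
Hypothesis hA : adm a alpha coroot.
Local Notation D := (@RDat R V J a alpha coroot).
Local Notation rf := (@refl R V D).
Local Notation re := (@is_real R V D).
Local Notation wact := (@wact R V D).
Local Notation root_of := (@root_of R V D).
Local Notation corootf := (@corootf R V D).
Local Notation rrefl := (@rrefl R V D).
Local Notation orbit := (@orbit R V D).
Local Notation sumr := (sumr alpha).
Local Notation rd := (@root_data R V D).
Implicit Types (w : seq J) (i j : J) (x y : V) (k : R).

Lemma root_ne0 w i : all re w -> re i -> root_of w i <> 0.
Proof.
move=> rw ri e; have := corootf_root hA i rw; rewrite e -(scale0r 0) (corootfZ hA) mul0r.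
by rewrite (re_aii ri) => /eqP; rewrite eq_sym intr_eq0.
Qed.

Lemma neg_al_nat j : ~~ re j -> forall i, exists n : nat, coroot i (- alpha j) = n%:R.
Proof.
move=> nj i; exists (absz (a i j)); rewrite (crN hA) (adm_al hA) natr_absz ler0_norm ?intrN//.
by have [->|ij] := eqVneq i j; [exact: im_aii hA _ nj|exact: adm_off hA _ _ ij].
Qed.

(** For imaginary [j] the vector [- alpha j] is dominant, so its orbit lies below it. *)
Lemma root_im w j : all re w -> ~~ re j -> exists s, root_of w j = alpha j + sumr s.
Proof.
move=> rw nj; have [s es] := orbit_wt hA (neg_al_nat nj) (orbit_wact w (orbit_base D _)).
by exists s; move: es; rewrite (wactN hA) -opprD => /oppr_inj.
Qed.

Lemma rd_pos w i : rd w i -> exists2 s, s != [::] & root_of w i = sumr s.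
Proof.
move=> [rw hp]; have [ri|ni] := boolP (re i).
  have /posQP[s es] := hp ri; exists s => //; apply/eqP => s0.
  by apply: (root_ne0 rw ri); rewrite es s0 sumr_nil.
by have [s es] := root_im rw ni; exists (i :: s); rewrite ?sumr_cons.
Qed.

Lemma root_int w i j : all re w -> exists z : int, coroot j (root_of w i) = z%:~R.
Proof.
move=> rw; have [s [t e]] : Qz alpha (root_of w i) by apply: (Qz_wact hA); exact: Qz_al.
have [z1 e1] := cr_sumr_int hA j s; have [z2 e2] := cr_sumr_int hA j t.
by exists (z1 - z2); rewrite e (crB hA) e1 e2 intrB.
Qed.

(* a simple reflection permutes the positive roots other than its own *)
Lemma rd_refl w j i : rd w j -> re i -> root_of w j <> alpha i -> rd (i :: w) j.
Proof.
move=> rd0 ri ne; have [rw hp] := rd0; split; first by rewrite /= ri.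
move=> rj; have [s s0 es] := rd_pos rd0.
have riw : all re (i :: w) by rewrite /= ri.
have [[t et]|[t et]] := root_dich hA riw rj; first by apply/posQP; exists t.
exfalso; have [z ez] := root_int j i rw.
(* The reflection changes only the coefficient of [alpha i], so a positive root that becomes
   negative is a multiple of [alpha i]; the rest shows that the multiple is 1. *)
have E : sumr (s ++ t) = z%:~R *: alpha i.
  rewrite sumr_cat -es; apply/eqP; rewrite -subr_eq0 addrAC -[_ - _]/(_ - _).
  by have := et; rewrite root_cons rfE ez => /eqP; rewrite -addr_eq0 addrAC addrC addrA.
have alls (k : J) : k \in s -> k = i.
  move=> ks; case: z E {ez} => n E.
    have /perm_mem/(_ k) : perm_eq (s ++ t) (nseq n i) by apply: (sumr_inj hA); rewrite E sumr_nseq.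
    by rewrite mem_cat ks mem_nseq /= => /esym/andP[_ /eqP].
  have /(sumr_eq0 hA) : sumr (s ++ t ++ nseq n.+1 i) = 0.
    by rewrite catA sumr_cat E sumr_nseq NegzE mulrNz scaleNr addNr.
  by case: (s) ks.
have es' : s = nseq (size s) i.
  by apply/all_pred1P/allP => k /alls ->; rewrite /= eqxx.
have en : root_of w j = (size s)%:R *: alpha i by rewrite es {1}es' sumr_nseq.
have e1 : alpha j = (size s)%:R *: root_of (rev w) i.
  by rewrite -[LHS](wactKV hA _ rw) -/(root_of w j) en (wactZ hA).
have rw' : all re (rev w) by rewrite all_rev.
have [[u eu]|[u eu]] := root_dich hA rw' ri.
  have /perm_size : perm_eq [:: j] (flatten (nseq (size s) u)).
    by apply: (sumr_inj hA); rewrite sumr_flat -eu -e1 sumr_cons sumr_nil addr0.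
  rewrite size_flatten /shape map_nseq sumn_nseq /= => /esym/eqP; rewrite muln_eq1 => /andP[_ /eqP s1].
  by apply: ne; rewrite en s1 scale1r.
have /(sumr_eq0 hA)// : sumr (j :: flatten (nseq (size s) u)) = 0.
by rewrite sumr_cons sumr_flat e1 eu scalerN addNr.
Qed.

(** A root and its coroot, scaled by the symmetrizer, have the same coefficients on simple roots and
    on scaled simple coroots: this is the invariant bilinear form in coordinates. *)
Lemma sym_coroot (d : J -> R) : (forall i j, d i * (a i j)%:~R = d j * (a j i)%:~R) ->
  forall w j, exists l : seq (J * R), root_of w j = \sum_(p <- l) p.2 *: alpha p.1 /\
    forall x, d j * corootf w j x = \sum_(p <- l) p.2 *: (d p.1 * coroot p.1 x : R^o).
Proof.
move=> ds w j; elim: w => [|i w [l [IH1 IH2]]].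
  by exists [:: (j, 1)]; rewrite big_cons big_nil addr0 scale1r; split=> // x; rewrite big_cons big_nil addr0 scale1r.
exists ((i, - coroot i (root_of w j)) :: l); split=> [|x].
  by rewrite big_cons root_cons rfE IH1 scaleNr addrC.
rewrite big_cons corootf_cons rfE -scaleNr (corootfD hA) (corootfZ hA) mulrDr IH2 addrC.
congr (_ + _); rewrite mulrCA IH2 /= scaleNr.
have -> : \sum_(p <- l) p.2 *: (d p.1 * coroot p.1 (alpha i) : R^o) = d i * coroot i (root_of w j).
  rewrite IH1; elim: (l) => [|p u IH]; first by rewrite !big_nil (cr0 hA) mulr0.
  rewrite !big_cons (crD hA) (crZ hA) mulrDr IH !(adm_al hA) ds.
  by congr (_ + _); rewrite /GRing.scale /=; ring.
by rewrite /GRing.scale /=; ring.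
Qed.

Lemma collect (U : lmodType R) (F : J -> U) (l : seq (J * R)) (u : seq J) : uniq u -> {subset map fst l <= u} ->
  \sum_(p <- l) p.2 *: F p.1 = \sum_(i <- u) (\sum_(p <- l) (p.1 == i)%:R * p.2) *: F i.
Proof.
move=> uu; elim: l => [|p l IH] hl.
  by rewrite big_nil big1// => i _; rewrite big_nil scale0r.
rewrite big_cons IH; last by move=> y yl; apply: hl; rewrite inE yl orbT.
have pu : p.1 \in u by apply: hl; rewrite mem_head.
have -> : p.2 *: F p.1 = \sum_(i <- u) ((p.1 == i)%:R * p.2) *: F i.
  rewrite (bigD1_seq p.1)//= eqxx mul1r big1 ?addr0// => i ip.
  by rewrite eq_sym (negbTE ip) mul0r scale0r.
rewrite -big_split /=; apply: eq_bigr => i _.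
by rewrite big_cons scalerDl.
Qed.

(** Independence of the simple roots transports a relation among them to any family [F]; later uses
    take for [F] heights, coroots or roots of another datum. *)
Lemma collect_eq (U : lmodType R) (F : J -> U) (l l' : seq (J * R)) :
  \sum_(p <- l) p.2 *: alpha p.1 = \sum_(p <- l') p.2 *: alpha p.1 ->
  \sum_(p <- l) p.2 *: F p.1 = \sum_(p <- l') p.2 *: F p.1.
Proof.
set u := undup (map fst l ++ map fst l').
have uu : uniq u by exact: undup_uniq.
have h1 : {subset map fst l <= u} by move=> z zl; rewrite mem_undup mem_cat zl.
have h2 : {subset map fst l' <= u} by move=> z zl; rewrite mem_undup mem_cat zl orbT.
rewrite !(collect _ uu)// => /eqP; rewrite -subr_eq0 -sumrB.
under eq_bigr do rewrite -scalerBl.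
move=> /eqP/(adm_free hA uu) H; apply: eq_big_seq => i iu.
by move: (H i iu) => /eqP; rewrite subr_eq0 => /eqP ->.
Qed.

(** By [sym_coroot] the coroots are proportional. Two real roots are compared at the root itself,
    where both coroots are 2; if one of the roots is imaginary, [root_im] forces the simple indices
    to coincide. *)
Lemma root_eq w j w' j' : rd w j -> rd w' j' -> root_of w j = root_of w' j' ->
  re j = re j' /\ corootf w j =1 corootf w' j'.
Proof.
move=> [rw _] [rw' _] e; have [d [d0 ds]] := adm_sym hA.
have key : forall x, d j * corootf w j x = d j' * corootf w' j' x.
  move=> x; have [l [l1 l2]] := sym_coroot ds w j; have [l' [l1' l2']] := sym_coroot ds w' j'.
  by rewrite l2 l2'; apply: (@collect_eq R^o (fun i => d i * coroot i x)); rewrite -l1 -l1'.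
have fromd : d j = d j' -> corootf w j =1 corootf w' j'.
  by move=> dd x; apply: (mulfI (lt0r_neq0 (d0 j))); rewrite key dd.
have im1 v v' i i' : all re v -> all re v' -> ~~ re i' -> root_of v i = root_of v' i' ->
  exists s, alpha i = alpha i' + sumr s.
  move=> rv rv' ni' ee.
  have -> : alpha i = root_of (rev v ++ v') i'.
    by rewrite /Defs.root_of wact_cat -/(root_of v' i') -ee (wactKV hA).
  by apply: root_im => //; rewrite all_cat all_rev rv.
have one (i i' : J) s : alpha i = alpha i' + sumr s -> i = i'.
  rewrite -sumr_cons -[alpha i]addr0 -(sumr_nil alpha) -sumr_cons => /(sumr_inj hA)/perm_mem/(_ i').
  by rewrite !inE eqxx /= => /eqP.
have [rj|nj] := boolP (re j); have [rj'|nj'] := boolP (re j').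
- split=> //; apply: fromd; have := key (root_of w j).
  by rewrite {2}e !(corootf_root hA)// (re_aii rj) (re_aii rj') => /(mulIf (_ : (2%:Z)%:~R != 0 :> R)); apply; rewrite intr_eq0.
- by have [s /one jj] := im1 _ _ _ _ rw rw' nj' e; rewrite jj (negbTE nj') in rj.
- by have [s /one jj] := im1 _ _ _ _ rw' rw nj (esym e); rewrite jj (negbTE nj) in rj'.
- by split=> //; have [s /one jj] := im1 _ _ _ _ rw rw' nj' e; apply: fromd; rewrite jj.
Qed.

Lemma rd_nil i : rd [::] i.
Proof. by split=> // _; apply/posQP; exists [:: i]; rewrite sumr_cons sumr_nil addr0. Qed.

Lemma root_simple w j i : rd w j -> root_of w j = alpha i ->
  re j = re i /\ corootf w j =1 coroot i.
Proof. by move=> h e; exact: (root_eq h (rd_nil i) e). Qed.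

(** The negatives of the two roots are both dominant and lie in one orbit of the real reflections,
    so each lies below the other. *)
Lemma root_im_min w j : all re w -> ~~ re j -> (forall q, re q -> coroot q (root_of w j) <= 0) ->
  root_of w j = alpha j.
Proof.
move=> rw nj H; set lam := - root_of w j.
have o1 : orbit (- alpha j) lam by rewrite /lam -(wactN hA); apply: orbit_wact; exact: orbit_base.
have ln i : exists n : nat, coroot i lam = n%:R.
  have [z ez] := root_int j i rw.
  have h : 0 <= coroot i lam.
    have [ri|ni] := boolP (re i); first by rewrite (crN hA) oppr_ge0 H.
    exact: (orbit_im hA (neg_al_nat nj) o1).
  by exists (absz z); move: h; rewrite (crN hA) ez oppr_ge0 lerz0 => z0; rewrite natr_absz ler0_norm// intrN.
have [s es] := orbit_wt hA (neg_al_nat nj) o1.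
have o2 : orbit lam (- alpha j).
  have -> : - alpha j = wact (rev w) lam by rewrite (wactN hA) (wactKV hA).
  by apply: orbit_wact; exact: orbit_base.
have [t et] := orbit_wt hA ln o2.
have /(sumr_eq0 hA) : sumr (s ++ t) = 0.
  rewrite sumr_cat; apply/eqP; move/eqP: et; rewrite es -addrA -{1}[- alpha j]addr0 => /eqP/addrI/eqP.
  by rewrite eq_sym -opprD oppr_eq0.
by case: (s) es => // es _; move: es; rewrite sumr_nil subr0 => /oppr_inj.
Qed.

End RootFacts.

(** * The order on an orbit *)

Section BruhatOrder.
Variables (R : realType) (V : lmodType R) (J : eqType) (a : J -> J -> int)
    (alpha : J -> V) (coroot : J -> V -> R).
Hypothesis hA : adm a alpha coroot.
Local Notation D := (@RDat R V J a alpha coroot).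
Local Notation rf := (@refl R V D).
Local Notation re := (@is_real R V D).
Local Notation wact := (@wact R V D).
Local Notation root_of := (@root_of R V D).
Local Notation corootf := (@corootf R V D).
Local Notation rrefl := (@rrefl R V D).
Local Notation orbit := (@orbit R V D).
Local Notation sumr := (sumr alpha).
Local Notation rd := (@root_data R V D).
Variable lam : V.
Hypothesis lam_nat : forall i, exists n : nat, coroot i lam = n%:R.
Local Notation gen_rel := (@gen_rel R V D lam).
Local Notation ge := (@ord_ge R V D lam).
Local Notation gt := (@ord_gt R V D lam).
Local Notation covers := (@covers R V D lam).
Local Notation arrow := (@arrow R V D lam).
Local Notation achain := (@achain R V D lam).
Implicit Types (w s t : seq J) (i j : J) (x y z v : V) (k : R).

Lemma coroot_sym w j i : coroot i (root_of w j) = 0 -> corootf w j (alpha i) = 0.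
Proof.
move=> h; have [d [d0 ds]] := adm_sym hA; have [l [l1 l2]] := sym_coroot hA ds w j.
apply: (mulfI (lt0r_neq0 (d0 j))); rewrite l2 mulr0.
transitivity (d i * coroot i (root_of w j)); last by rewrite h mulr0.
rewrite l1; elim: (l) => [|p u IH]; first by rewrite !big_nil (cr0 hA) mulr0.
rewrite !big_cons (crD hA) (crZ hA) mulrDr IH !(adm_al hA) ds.
by congr (_ + _); rewrite /GRing.scale /=; ring.
Qed.

(** Applying the inverse word makes the simple root [alpha j] equal to [n] times a root that is plus
    or minus a sum of simple roots, which forces [n = 1]. *)
Lemma root_mult w j i n : rd w j -> root_of w j = n%:R *: alpha i -> root_of w j = alpha i.
Proof.
move=> [rw _] en.
have rw' : all re (rev w) by rewrite all_rev.
have e1 : alpha j = n%:R *: root_of (rev w) i.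
  by rewrite -[LHS](wactKV hA _ rw) -/(root_of w j) en (wactZ hA).
have H : (exists u, root_of (rev w) i = sumr u) \/ (exists u, root_of (rev w) i = - sumr u).
  have [ri|ni] := boolP (re i); first exact: (root_dich hA).
  by have [s es] := root_im hA rw' ni; left; exists (i :: s); rewrite sumr_cons.
case: H => [[u eu]|[u eu]].
  have /perm_size : perm_eq [:: j] (flatten (nseq n u)).
    by apply: (sumr_inj hA); rewrite sumr_flat -eu -e1 sumr_cons sumr_nil addr0.
  rewrite size_flatten /shape map_nseq sumn_nseq /= => /esym/eqP; rewrite muln_eq1 => /andP[_ /eqP s1].
  by rewrite en s1 scale1r.
have /(sumr_eq0 hA)// : sumr (j :: flatten (nseq n u)) = 0.
by rewrite sumr_cons sumr_flat e1 eu scalerN addNr.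
Qed.

Lemma sumr_sub_mult s t n i : sumr (s ++ t) = n%:R *: alpha i -> s = nseq (size s) i.
Proof.
rewrite -sumr_nseq => /(sumr_inj hA)/perm_mem H.
apply/all_pred1P/allP => q qs; have := H q.
by rewrite mem_cat qs mem_nseq /= => /esym/andP[_].
Qed.

Lemma gen_orb x y : gen_rel x y -> orbit lam x /\ orbit lam y.
Proof. by case=> h1 [h2 _]. Qed.

Lemma gen_wt x y : gen_rel x y -> exists w j n, [/\ rd w j, (0 < n)%N, corootf w j y = n%:R,
  x = rrefl w j y & x = y - n%:R *: root_of w j].
Proof.
move=> [ox [oy [w [j [rdj [ex pos]]]]]].
have [z ez] : exists z : int, corootf w j y = z%:~R.
  by apply: (orbit_int hA lam_nat); exact: orbit_wact.
move: pos; rewrite ez ltr0z => z0.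
exists w, j, (absz z); have e : corootf w j y = (absz z)%:R by rewrite ez natr_absz gtr0_norm.
split=> //; first by rewrite absz_gt0 gt_eqF.
by rewrite ex (rreflE hA) ?e//; case: rdj.
Qed.

Lemma gen_lt x y : gen_rel x y -> exists2 s, s != [::] & x = y - sumr s.
Proof.
move=> /gen_wt[w [j [n [rdj n0 _ _ ->]]]]; have [s s0 es] := rd_pos hA rdj.
exists (flatten (nseq n s)); last by rewrite sumr_flat es.
by case: n n0 => //= n _; case: s s0 {es}.
Qed.

Lemma ge_wt x y : ge x y -> exists s, x = y - sumr s.
Proof.
elim=> [z|x' z y' /gen_lt[s _ ->] _ [t ->]]; first by exists [::]; rewrite sumr_nil subr0.
by exists (t ++ s); rewrite sumr_cat opprD addrA.
Qed.

Lemma sumr_cancel x s : x = x - sumr s -> s = [::].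
Proof. by move=> /eqP; rewrite -subr_eq0 opprB addrC subrK => /eqP/(sumr_eq0 hA). Qed.

Lemma ord_ge_anti x y : ge x y -> ge y x -> x = y.
Proof.
move=> /ge_wt[s ->] /ge_wt[t]; rewrite -addrA -opprD -sumr_cat => /sumr_cancel.
by case: s => //; rewrite sumr_nil subr0.
Qed.

Lemma gen_neq x y : gen_rel x y -> x <> y.
Proof.
by move=> /gen_lt[s s0 e] exy; move: s0; rewrite (sumr_cancel (s := s) (x := y)) ?eqxx// -e.
Qed.

Lemma ord_ge_trans x y z : ge x y -> ge y z -> ge x z.
Proof. by elim=> // x' v y' h _ IH /IH g; apply: (@ord_ge_step R V D lam _ _ _ h). Qed.

Lemma gen_ge x y : gen_rel x y -> ge x y.
Proof. move=> h; apply: (ord_ge_step h); exact: ord_ge_refl. Qed.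

Lemma gen_gt x y : gen_rel x y -> gt x y.
Proof. by move=> h; split; [exact: gen_ge|exact: gen_neq]. Qed.

Lemma gt_gen x y : gt x y -> exists2 z, gen_rel x z & ge z y.
Proof. by case=> h ne; case: h ne => // x' z y' h1 h2 _; exists z. Qed.

Lemma gt_orb x y : gt x y -> orbit lam x /\ orbit lam y.
Proof.
move=> [h]; elim: h => // x' z y' /gen_orb[ox oz] _ IH _; split=> //.
by have [<-//|/IH[]] := pselect (z = y').
Qed.

Lemma covers_gen x y : covers x y -> gen_rel x y.
Proof.
move=> [h nb]; have [z xz zy] := gt_gen h.
have [<-//|ne] := pselect (z = y); case: nb; exists z; split=> //; exact: gen_gt.
Qed.

Lemma covers_between x y z : covers x y -> ge x z -> ge z y -> z = x \/ z = y.
Proof.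
move=> [h nb] xz zy; have [->|n1] := pselect (z = x); first by left.
have [->|n2] := pselect (z = y); first by right.
by case: nb; exists z; split; split=> // e; apply: n1.
Qed.

Lemma rf_ge i v : orbit lam v -> 0 <= coroot i v -> ge (rf i v) v.
Proof.
move=> ov; rewrite le_eqVlt => /orP[/eqP e|h].
  by rewrite rfE -e scale0r subr0; exact: ord_ge_refl.
apply: gen_ge; split; first exact: orbit_step.
by split=> //; exists [::], i; split; first exact: rd_nil.
Qed.

Lemma rf_le i v : orbit lam v -> re i -> coroot i v <= 0 -> ge v (rf i v).
Proof.
move=> ov ri h; rewrite -{1}(rfK hA v ri); apply: rf_ge; first exact: orbit_step.
by rewrite (cr_rf_same hA)// oppr_ge0.
Qed.

Lemma rf_neq i v : coroot i v <> 0 -> rf i v <> v.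
Proof.
move=> h e; apply: h; move: e; rewrite rfE => /eqP; rewrite -subr_eq0 addrAC subrr add0r oppr_eq0 => /eqP e.
have h : \sum_(q <- [:: i]) coroot i v *: alpha q = 0 by rewrite big_seq1.
have hx := adm_free hA (c := fun=> coroot i v) (isT : uniq [:: i]) h. by have := hx i (mem_head _ _).
Qed.

(* the element of [{v, r_i v}] on which the coroot is nonnegative (resp. nonpositive) *)
Definition dn i v := if 0 <= coroot i v then v else rf i v.

Definition up i v := if coroot i v <= 0 then v else rf i v.

Lemma gen_rf i x y : re i -> gen_rel x y -> x <> rf i y -> gen_rel (rf i x) (rf i y).
Proof.
move=> ri [ox [oy [w [j [rdj [ex pos]]]]]] ne.
have rn : root_of w j <> alpha i.
  move=> e; have [_ ec] := root_simple hA rdj e; apply: ne.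
  by rewrite ex (rreflE hA) ?ec ?e//; case: rdj.
split; first exact: orbit_step; split; first exact: orbit_step.
exists (i :: w), j; split; first exact: (rd_refl hA).
rewrite (corootf_cons) (rfK hA)//; split=> //.
by rewrite ex /Defs.rrefl rev_cons wact_rcons /= (rfK hA).
Qed.

(** The lifting property of the Bruhat order. Either [x = r_i y], and both maps identify the two, or
    the relation is preserved by [r_i], and every combination of signs follows by transitivity. *)
Lemma gen_updn i x y : re i -> gen_rel x y -> ge (dn i x) (dn i y) /\ ge (up i x) (up i y).
Proof.
move=> ri g; have [ox oy] := gen_orb g.
have [e|ne] := pselect (x = rf i y).
  have -> : dn i x = dn i y.
    rewrite /dn e (cr_rf_same hA)// oppr_ge0 (rfK hA)//.
    have [h|h|h] := ltgtP (coroot i y) 0; rewrite ?ltW//.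
    by rewrite rfE h scale0r subr0.
  have -> : up i x = up i y.
    rewrite /up e (cr_rf_same hA)// oppr_le0 (rfK hA)//.
    have [h|h|h] := ltgtP (coroot i y) 0; rewrite ?ltW//.
    by rewrite rfE h scale0r subr0.
  by split; exact: ord_ge_refl.
have xy := gen_ge g; have rxy := gen_ge (gen_rf ri g ne).
have up_ v : orbit lam v -> 0 <= coroot i v -> ge (rf i v) v by exact: rf_ge.
have dn_ v : orbit lam v -> coroot i v <= 0 -> ge v (rf i v) by move=> *; exact: rf_le.
have rf0 v : coroot i v = 0 -> rf i v = v by move=> h; rewrite rfE h scale0r subr0.
rewrite /up /dn.
have [hx|hx|hx] := ltgtP (coroot i x) 0; have [hy|hy|hy] := ltgtP (coroot i y) 0;
  rewrite ?(rf0 _ hx) ?(rf0 _ hy) in rxy *; split=> //.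
all: by first [exact: ord_ge_trans rxy (up_ _ oy (ltW hy)) | exact: ord_ge_trans (dn_ _ ox (ltW hx)) rxy
  | exact: ord_ge_trans xy (dn_ _ oy (ltW hy)) | exact: ord_ge_trans (up_ _ ox (ltW hx)) xy
  | exact: ord_ge_trans (up_ _ ox (ltW hx)) (ord_ge_trans xy (dn_ _ oy (ltW hy)))
  | exact: ord_ge_trans (dn_ _ ox (ltW hx)) (ord_ge_trans rxy (up_ _ oy (ltW hy)))].
Qed.

Lemma ge_updn i x y : re i -> ge x y -> ge (dn i x) (dn i y) /\ ge (up i x) (up i y).
Proof.
move=> ri; elim=> [z|x' z y' /(gen_updn ri)[h1 h2] _ [h3 h4]]; first by split; exact: ord_ge_refl.
by split; apply: ord_ge_trans; eassumption.
Qed.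

Lemma dnE i x : 0 <= coroot i x -> dn i x = x. Proof. by rewrite /dn => ->. Qed.

Lemma upE i x : coroot i x <= 0 -> up i x = x. Proof. by rewrite /up => ->. Qed.

Lemma dnr i x : coroot i x <= 0 -> dn i x = rf i x.
Proof.
rewrite /dn le_eqVlt => /orP[/eqP h|h]; last by rewrite leNgt h.
by rewrite h lexx rfE h scale0r subr0.
Qed.

Lemma upr i x : 0 <= coroot i x -> up i x = rf i x.
Proof.
rewrite /up le_eqVlt => /orP[/eqP h|h]; last by rewrite leNgt h.
by rewrite -h lexx rfE -h scale0r subr0.
Qed.

(** Otherwise the maps [up] and [dn] would place [rf i y], respectively [rf i x], strictly between
    [x] and [y]. *)
Lemma cover_sign i x y : re i -> covers x y -> x <> rf i y ->
  (0 < coroot i y -> 0 < coroot i x) /\ (coroot i x < 0 -> coroot i y < 0).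
Proof.
move=> ri cv ne; have [ox oy] := gt_orb cv.1; have [h1 h2] := ge_updn ri cv.1.1.
split=> [hy|hx]; rewrite ltNge; apply/negP => h.
  rewrite upE// upr ?ltW// in h2.
  have [e|e] := covers_between cv h2 (rf_ge oy (ltW hy)); first exact: ne.
  by apply: rf_neq e => e; rewrite e ltxx in hy.
rewrite dnr ?ltW// dnE// in h1.
have [e|e] := covers_between cv (rf_le ox ri (ltW hx)) h1.
  by apply: rf_neq e => e; rewrite e ltxx in hx.
by apply: ne; rewrite -e (rfK hA).
Qed.

(** An element strictly between the reflected ends is pushed by [dn] or [up], according to the sign,
    into the interval between [x] and [y], which has only its ends. *)
Lemma cover_rf i x y : re i -> covers x y -> x <> rf i y ->
  (0 < coroot i x /\ 0 < coroot i y) \/ (coroot i x < 0 /\ coroot i y < 0) ->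
  covers (rf i x) (rf i y).
Proof.
move=> ri cv ne sg; have [ox oy] := gt_orb cv.1.
split; first exact: gen_gt (gen_rf ri (covers_gen cv) ne).
move=> [z [[xz nxz] [zy nzy]]].
have oz : orbit lam z by have [] := gt_orb (conj xz nxz).
have [a1 a2] := ge_updn ri xz; have [b1 b2] := ge_updn ri zy.
have tr v : coroot i (rf i v) = - coroot i v by rewrite (cr_rf_same hA).
case: sg => [[hx hy]|[hx hy]].
  have dx : dn i (rf i x) = x by rewrite dnr ?tr ?oppr_le0 ?ltW// (rfK hA).
  have dy : dn i (rf i y) = y by rewrite dnr ?tr ?oppr_le0 ?ltW// (rfK hA).
  rewrite dx in a1; rewrite dy in b1.
  have [hz|hz] := leP (coroot i z) 0.
    rewrite dnr// in a1 b1; have [e|e] := covers_between cv a1 b1.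
      by apply: nxz; rewrite -e (rfK hA).
    by apply: nzy; rewrite -e (rfK hA).
  rewrite dnE ?ltW// in a1 b1; have [e|e] := covers_between cv a1 b1; subst z.
    have [e|e] := covers_between cv zy (rf_ge oy (ltW hy)); first by apply: ne.
    by apply: rf_neq e => e; rewrite e ltxx in hy.
  have := ord_ge_anti zy (rf_ge oy (ltW hy)) => /esym.
  by apply: rf_neq => e; rewrite e ltxx in hy.
have dx : up i (rf i x) = x by rewrite upr ?tr ?oppr_ge0 ?ltW// (rfK hA).
have dy : up i (rf i y) = y by rewrite upr ?tr ?oppr_ge0 ?ltW// (rfK hA).
rewrite dx in a2; rewrite dy in b2.
have [hz|hz] := leP 0 (coroot i z).
  rewrite upr// in a2 b2; have [e|e] := covers_between cv a2 b2.
    by apply: nxz; rewrite -e (rfK hA).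
  by apply: nzy; rewrite -e (rfK hA).
rewrite upE ?ltW// in a2 b2; have [e|e] := covers_between cv a2 b2; subst z.
  have := ord_ge_anti xz (rf_le ox ri (ltW hx)).
  by apply: rf_neq => e; rewrite e ltxx in hx.
have [e|e] := covers_between cv (rf_le ox ri (ltW hx)) xz.
  by apply: rf_neq e => e; rewrite e ltxx in hx.
by apply: ne; rewrite -e (rfK hA).
Qed.

Lemma gt_gen_last x y : gt x y -> exists2 z, ge x z & gen_rel z y.
Proof.
case=> h; elim: h => // x' z y' g h IH ne.
have [e|/IH[v h1 h2]] := pselect (z = y'); first by subst; exists x' => //; exact: ord_ge_refl.
by exists v => //; exact: (ord_ge_step g h1).
Qed.

(** In any refinement the roots subtracted add up to a multiple of [alpha i], so the last reflection
    of the refinement is already [r_i]. *)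
Lemma simple_cover i v : orbit lam v -> 0 < coroot i v -> covers (rf i v) v.
Proof.
move=> ov h; have gr : gen_rel (rf i v) v.
  split; first exact: orbit_step.
  by split=> //; exists [::], i; split; first exact: rd_nil.
split; first exact: gen_gt.
move=> [z [[xz nxz] zv]]; apply: nxz; apply: ord_ge_anti => //.
have [n en] : exists n : nat, coroot i v = n%:R.
  have [q eq] := orbit_int hA lam_nat i ov; exists (absz q).
  by rewrite eq natr_absz gtr0_norm// -(ltr0z R) -eq.
have [y zy yv] := gt_gen_last zv.
suff <- : y = rf i v by [].
have [s es] := ge_wt (ord_ge_trans xz zy).
have [w [j [m [rdj m0 ec _ ey]]]] := gen_wt yv.
have [r r0 er] := rd_pos hA rdj.
have E : sumr (r ++ (flatten (nseq m.-1 r) ++ s)) = n%:R *: alpha i.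
  rewrite catA sumr_cat -[r ++ _]/(flatten (nseq m.-1.+1 r)) prednK// sumr_flat -er.
  move: es; rewrite ey rfE en -addrA -opprD => /addrI/oppr_inj ->; by [].
have e1 : root_of w j = alpha i.
  by apply: (root_mult rdj (n := size r)); rewrite er {1}(sumr_sub_mult E) sumr_nseq.
have [_ e2] := root_simple hA rdj e1.
by rewrite ey e1 rfE -e2 ec.
Qed.

Lemma sumr_ortho i s : ~~ re i -> coroot i (sumr s) = 0 -> forall j, j \in s -> a i j = 0.
Proof.
move=> ni; have np j : a i j <= 0.
  by have [->|ij] := eqVneq j i; [exact: im_aii hA _ ni|apply: (adm_off hA); rewrite eq_sym].
have np' t : coroot i (sumr t) <= 0.
  elim: t => [|j t IH]; first by rewrite sumr_nil (cr0 hA).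
  rewrite sumr_cons (crD hA) (adm_al hA); have := np j; rewrite -(lerz0 R); lra.
elim: s => // j s IH; rewrite sumr_cons (crD hA) (adm_al hA) => h q.
have h1 := np j; rewrite -(lerz0 R) in h1; have h2 := np' s.
rewrite inE => /orP[/eqP ->|]; last by apply: IH; lra.
by apply/eqP; rewrite -(intr_eq0 R); apply/eqP; lra.
Qed.

Lemma coroot_sumr0 i s : (forall j, j \in s -> a i j = 0) -> coroot i (sumr s) = 0.
Proof.
elim: s => [|j s IH] H; first by rewrite sumr_nil (cr0 hA).
rewrite sumr_cons (crD hA) (adm_al hA) H ?mem_head// add0r; apply: IH => q qs.
by apply: H; rewrite inE qs orbT.
Qed.

(* translating an interval of the order by a simple root orthogonal to all roots involved *)
Lemma ge_shift i k x y s : ~~ re i -> ge x y -> x = y - sumr s -> coroot i (sumr s) = 0 ->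
  orbit lam (y + k *: alpha i) -> orbit lam (x + k *: alpha i) /\ ge (x + k *: alpha i) (y + k *: alpha i).
Proof.
move=> ni h; elim: h s => [z|x' z y' g h IH] s es hs oy; first by split=> //; exact: ord_ge_refl.
have [s1 e1] := ge_wt h; have [w [j [m [rdj m0 ec ex ex']]]] := gen_wt g.
have [r r0 er] := rd_pos hA rdj.
have E : perm_eq (s1 ++ flatten (nseq m r)) s.
  apply: (sumr_inj hA); rewrite sumr_cat sumr_flat -er.
  by apply: oppr_inj; apply: (addrI y'); rewrite -es ex' e1 opprD addrA.
have as_ := sumr_ortho ni hs.
have h1 : coroot i (sumr s1) = 0.
  by apply: coroot_sumr0 => q qs; apply: as_; rewrite -(perm_mem E) mem_cat qs.
have [oz gz] := IH _ e1 h1 oy.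
have hr : coroot i (root_of w j) = 0.
  rewrite er; apply: coroot_sumr0 => q qr; apply: as_; rewrite -(perm_mem E) mem_cat; apply/orP; right.
  by case: m m0 {ec ex ex' E} => // m _; rewrite /= mem_cat qr.
have c0 := coroot_sym hr.
have e2 : x' + k *: alpha i = rrefl w j (z + k *: alpha i).
  have rw := rdj.1.
  by rewrite (rreflE hA)// (corootfD hA) (corootfZ hA) c0 mulr0 addr0 ec ex' addrAC.
have ox : orbit lam (x' + k *: alpha i) by rewrite e2 rrefl_wact; exact: orbit_wact.
split=> //; apply: (ord_ge_step _ gz); split=> //; split=> //; exists w, j; split=> //; split=> //.
by rewrite (corootfD hA) (corootfZ hA) c0 mulr0 addr0 ec ltr0n.
Qed.

(** With equal slopes both ends move by the same multiple of [alpha i], and all simple roots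
    occurring in the interval are orthogonal to [alpha i]; so the interval can be translated back by
    [ge_shift]. *)
Lemma im_cover i x y : ~~ re i -> covers x y -> coroot i x = coroot i y -> covers (rf i x) (rf i y).
Proof.
move=> ni cv e; have [[xy nxy] nb] := cv; have [ox oy] := gt_orb cv.1.
have [s es] := ge_wt xy; set q := coroot i y in e *.
have hs : coroot i (sumr s) = 0 by move: e; rewrite es (crB hA) /q; lra.
have ex : rf i x = x + (- q) *: alpha i by rewrite rfE e scaleNr.
have ey : rf i y = y + (- q) *: alpha i by rewrite rfE scaleNr.
have ory : orbit lam (y + (- q) *: alpha i) by rewrite -ey; exact: orbit_step.
have [orx gxy] := ge_shift ni xy es hs ory.
split; first by split; rewrite ex ey// => /addIr.
move=> [z [[xz nxz] [zy nzy]]].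
have [t et] := ge_wt zy; have [r er] := ge_wt xz.
have E : perm_eq (t ++ r) s.
  apply: (sumr_inj hA); apply: oppr_inj; apply: (addrI y); apply: (addIr (- q *: alpha i)).
  by rewrite -es -ex er et ey sumr_cat opprD !addrA [LHS]addrAC; congr (_ + _); rewrite [LHS]addrAC.
have as_ := sumr_ortho ni hs.
have ht : coroot i (sumr t) = 0 by apply: coroot_sumr0 => p pt; apply: as_; rewrite -(perm_mem E) mem_cat pt.
have hr : coroot i (sumr r) = 0 by apply: coroot_sumr0 => p pt; apply: as_; rewrite -(perm_mem E) mem_cat pt orbT.
have back v : rf i v = v + (- q) *: alpha i -> rf i v + q *: alpha i = v by move=> ->; rewrite scaleNr subrK.
have [oz gz] : orbit lam (z + q *: alpha i) /\ ge (z + q *: alpha i) (rf i y + q *: alpha i).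
  by apply: (ge_shift ni zy et ht); rewrite back.
have [_ gx] := ge_shift ni xz er hr oz.
rewrite back// in gz; rewrite back// in gx.
have [e1|e1] := covers_between cv gx gz.
  by apply: nxz; rewrite ex -e1 scaleNr addrK.
by apply: nzy; rewrite ey -e1 scaleNr addrK.
Qed.

End BruhatOrder.

(** * Integrality and reflection of chains *)

Section Chains.
Variables (R : realType) (V : lmodType R) (J : eqType) (a : J -> J -> int)
    (alpha : J -> V) (coroot : J -> V -> R).
Hypothesis hA : adm a alpha coroot.
Local Notation D := (@RDat R V J a alpha coroot).
Local Notation rf := (@refl R V D).
Local Notation re := (@is_real R V D).
Local Notation root_of := (@root_of R V D).
Local Notation corootf := (@corootf R V D).
Local Notation rrefl := (@rrefl R V D).
Local Notation orbit := (@orbit R V D).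
Local Notation sumr := (sumr alpha).
Local Notation rd := (@root_data R V D).
Variable lam : V.
Hypothesis lam_nat : forall i, exists n : nat, coroot i lam = n%:R.
Local Notation gen_rel := (@gen_rel R V D lam).
Local Notation ge := (@ord_ge R V D lam).
Local Notation gt := (@ord_gt R V D lam).
Local Notation covers := (@covers R V D lam).
Local Notation arrow := (@arrow R V D lam).
Local Notation achain := (@achain R V D lam).
Implicit Types (w s t : seq J) (i j : J) (x y z v : V) (k : R).

Lemma arrow_orb k x y : arrow k x y -> orbit lam x /\ orbit lam y.
Proof. by move=> [cv _]; exact: (gt_orb cv.1). Qed.

Lemma arrow_rf i k x y : re i -> arrow k x y -> x <> rf i y ->
  (0 < coroot i x /\ 0 < coroot i y) \/ (coroot i x < 0 /\ coroot i y < 0) ->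
  arrow k (rf i x) (rf i y).
Proof.
move=> ri [cv [w [j [rdj [ex [pos hk]]]]]] ne sg.
split; first exact: (cover_rf hA).
have rn : root_of w j <> alpha i.
  move=> e; have [_ ec] := root_simple hA rdj e; apply: ne.
  by rewrite ex (rreflE hA) ?ec ?e//; case: rdj.
exists (i :: w), j; split; first exact: (rd_refl hA).
rewrite (corootf_cons) (rfK hA)//; split=> //.
by rewrite ex /Defs.rrefl rev_cons wact_rcons /= (rfK hA).
Qed.

(** The step subtracts an integral multiple of a root after scaling by [k], and a root pairs
    integrally with coroots. Thus heights modulo integers can be read from one slope of a chain. *)
Lemma arrow_cong i k x y : arrow k x y -> k * coroot i x - k * coroot i y \is a Num.int.
Proof.
move=> [cv [w [j [rdj [ex [pos hk]]]]]].
have rw := rdj.1; rewrite ex (rreflE hA)// (crB hA) (crZ hA).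
have [z ez] := root_int hA j i rw.
have -> : k * (coroot i y - corootf w j y * coroot i (root_of w j)) - k * coroot i y =
  - (k * corootf w j y * coroot i (root_of w j)) by ring.
rewrite rpredN ez rpredM ?intr_int//.
by move: hk; case: ifP => _ [n]; [move=> [_ ->]; exact: natr_int|rewrite n; exact: int_num1].
Qed.

(** The arrow may present its root by any word; the difference of the two weights identifies it as
    [alpha i]. *)
Lemma arrow_self i k y : re i -> arrow k (rf i y) y -> 0 < coroot i y -> k * coroot i y \is a Num.int.
Proof.
move=> ri [cv [w [j [rdj [ex [pos hk]]]]]] h.
have [ox oy] := gt_orb cv.1.
have [n en] : exists n : nat, coroot i y = n%:R.
  have [q eq] := orbit_int hA lam_nat i oy; exists (absz q).
  by rewrite eq natr_absz gtr0_norm// -(ltr0z R) -eq.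
have [m em] : exists m : nat, corootf w j y = m%:R.
  have [q eq] : exists q : int, corootf w j y = q%:~R.
    by apply: (orbit_int hA lam_nat); exact: orbit_wact.
  by exists (absz q); rewrite eq natr_absz gtr0_norm// -(ltr0z R) -eq.
have m0 : (0 < m)%N by rewrite -(ltr0n R) -em.
have [r r0 er] := rd_pos hA rdj.
have E : sumr (r ++ flatten (nseq m.-1 r)) = n%:R *: alpha i.
  rewrite -[r ++ _]/(flatten (nseq m.-1.+1 r)) prednK// sumr_flat -er -em.
  by move: ex; rewrite (rreflE hA) ?rfE ?en; [move=> /addrI/oppr_inj ->|case: rdj].
have e1 : root_of w j = alpha i.
  by apply: (root_mult hA rdj (n := size r)); rewrite er {1}(sumr_sub_mult hA E) sumr_nseq.
have [rj ec] := root_simple hA rdj e1.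
by move: hk; rewrite rj ri -ec => -[q [_ ->]]; exact: natr_int.
Qed.

Lemma arrow_simple i k v : orbit lam v -> 0 < k -> 0 < coroot i v ->
  (if re i then k * coroot i v \is a Num.int else k * coroot i v == 1) -> arrow k (rf i v) v.
Proof.
move=> ov k0 h hk; split; first exact: (simple_cover hA).
exists [::], i; split; first exact: rd_nil.
split=> //; split=> //.
rewrite -[corootf [::] i v]/(coroot i v); move: hk.
case: (re i) => [/intrP[z ez]|/eqP//].
have : 0 < k * coroot i v by exact: mulr_gt0.
by rewrite ez ltr0z => z0; exists (absz z); rewrite absz_gt0 gt_eqF// natr_absz gtr0_norm.
Qed.

Lemma achain_trans k x y z : achain k x y -> achain k y z -> achain k x z.
Proof. by elim=> // x' v y' h _ IH /IH; exact: achain_cons h. Qed.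

Lemma achain1 k x y : arrow k x y -> achain k x y.
Proof. by move=> h; apply: (achain_cons h); exact: achain_nil. Qed.

Lemma achain_cong i k x y : achain k x y -> k * coroot i x - k * coroot i y \is a Num.int.
Proof.
elim=> [v|x' v y' h _ IH]; first by rewrite subrr rpred0.
have -> : k * coroot i x' - k * coroot i y' = (k * coroot i x' - k * coroot i v) + (k * coroot i v - k * coroot i y') by ring.
by rewrite rpredD//; exact: arrow_cong.
Qed.

Lemma achain_ge k x y : achain k x y -> ge x y.
Proof.
elim=> [v|x' v y' [cv _] _ IH]; first exact: ord_ge_refl.
exact: ord_ge_trans cv.1.1 IH.
Qed.

Lemma int_cong (x y : R) : x - y \is a Num.int -> (x \is a Num.int) = (y \is a Num.int).
Proof.
move=> h; apply/idP/idP => h'; first by rewrite -(subKr x y) rpredB.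
by rewrite -(subrK y x) rpredD.
Qed.

(* following a chain upwards, the sign of [i]-coroot can only become nonpositive
   through an arrow labelled by [alpha i] *)
Lemma chain_pos i k x y : re i -> 0 < k -> achain k x y -> orbit lam y -> 0 < coroot i y ->
  (coroot i x <= 0 -> achain k x (rf i y) /\ k * coroot i x \is a Num.int) /\
  (0 < coroot i x -> achain k (rf i x) (rf i y)).
Proof.
move=> ri k0; elim=> [v|x' z y' ar ch IH] oy hy.
  by split=> [|_]; [rewrite leNgt hy|exact: achain_nil].
have [IH1 IH2] := IH oy hy; have [ox oz] := arrow_orb ar; have cg := arrow_cong i ar.
have [hz|hz] := leP (coroot i z) 0.
  have [c1 z1] := IH1 hz; have x1 : k * coroot i x' \is a Num.int by rewrite (int_cong cg).
  split=> [hx|hx]; first by split=> //; exact: achain_cons c1.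
  have ar' : arrow k (rf i x') x' by apply: arrow_simple => //; rewrite ri.
  exact: achain_cons ar' (achain_cons ar c1).
have c2 := IH2 hz.
have [e|ne] := pselect (x' = rf i z).
  rewrite e (cr_rf_same hA)// oppr_gt0 oppr_le0; split=> [_|]; last by rewrite ltNge (ltW hz).
  split=> //; rewrite mulrN rpredN; apply: arrow_self => //; by rewrite -e.
have [s1 _] := cover_sign hA ri ar.1 ne; have hx := s1 hz.
split=> [|_]; first by rewrite leNgt hx.
by apply: achain_cons c2; apply: arrow_rf => //; left.
Qed.

(** The counterpart of [chain_pos] that starts from the upper end: a chain leaving the negative side
    must use the reflection [r_i], which can be deleted. *)
Lemma chain_neg i k x y : re i -> 0 < k -> achain k x y -> orbit lam y -> coroot i x < 0 ->
  (0 <= coroot i y -> achain k (rf i x) y /\ k * coroot i y \is a Num.int) /\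
  (coroot i y < 0 -> achain k (rf i x) (rf i y)).
Proof.
move=> ri k0; elim=> [v|x' z y' ar ch IH] oy hx.
  by split=> [|_]; [rewrite leNgt hx|exact: achain_nil].
have [ox oz] := arrow_orb ar.
have [e|ne] := pselect (x' = rf i z).
  have hz : 0 < coroot i z by move: hx; rewrite e (cr_rf_same hA)// oppr_lt0.
  rewrite e (rfK hA)//.
  have iz : k * coroot i z \is a Num.int by apply: arrow_self => //; rewrite -e.
  have iy : k * coroot i y' \is a Num.int by rewrite -(int_cong (achain_cong i ch)).
  split=> [_|hy]; first by split.
  apply: achain_trans ch _; apply: achain1; rewrite -{1}(rfK hA y' ri).
  apply: arrow_simple => //; first exact: orbit_step.
    by rewrite (cr_rf_same hA)// oppr_gt0.
  by rewrite ri (cr_rf_same hA)// mulrN rpredN.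
have [_ s2] := cover_sign hA ri ar.1 ne; have hz := s2 hx.
have [IH1 IH2] := IH oy hz.
have ar' : arrow k (rf i x') (rf i z) by apply: arrow_rf => //; right.
by split=> hy; [have [c1 i1] := IH1 hy; split=> //; exact: achain_cons c1|exact: achain_cons (IH2 hy)].
Qed.

End Chains.

(** * GLS paths *)

Section Pieces.
Variables (R : realType) (V : lmodType R) (J : eqType) (a : J -> J -> int)
    (alpha : J -> V) (coroot : J -> V -> R).
Hypothesis hA : adm a alpha coroot.
Local Notation D := (@RDat R V J a alpha coroot).
Local Notation rf := (@refl R V D).
Local Notation re := (@is_real R V D).
Local Notation orbit := (@orbit R V D).
Variable lam : V.
Hypothesis lam_nat : forall i, exists n : nat, coroot i lam = n%:R.
Local Notation ge := (@ord_ge R V D lam).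
Local Notation gt := (@ord_gt R V D lam).
Local Notation arrow := (@arrow R V D lam).
Local Notation achain := (@achain R V D lam).
Implicit Types (i j : J) (d e v : V) (b p q t k : R) (l : seq (V * R)).

Definition hdir e l := if l is x :: _ then x.1 else e.

(* a GLS path read between the times [a0] and [a1], where it is continued in direction [e];
   consecutive directions may coincide *)
Fixpoint wg a0 l a1 e : Prop := if l is x :: l' then
  [/\ a0 < x.2, orbit lam x.1, achain x.2 x.1 (hdir e l') & wg x.2 l' a1 e] else a0 = a1.

Fixpoint ev a0 l t : V := if l is x :: l' then
  (Num.min x.2 (Num.max a0 t) - a0) *: x.1 + ev x.2 l' t else 0.

Lemma hdir_cat e l l' : hdir e (l ++ l') = hdir (hdir e l') l.
Proof. by case: l. Qed.

Lemma wg_le a0 l a1 e : wg a0 l a1 e -> a0 <= a1.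
Proof. by elim: l a0 => [|x l IH] a0 /= => [->//|[h _ _ /IH h']]; lra. Qed.

Lemma wg_lt a0 x l a1 e : wg a0 (x :: l) a1 e -> a0 < a1.
Proof. by move=> [h _ _ /wg_le h']; lra. Qed.

Lemma ev_before a0 l a1 e t : wg a0 l a1 e -> t <= a0 -> ev a0 l t = 0.
Proof.
elim: l a0 => //= x l IH a0 [h _ _ w] ta; rewrite (IH _ w) ?addr0; last lra.
by rewrite (max_idPl ta) (min_idPr (ltW h)) subrr scale0r.
Qed.

Lemma ev1 a0 x l a1 e t : wg a0 (x :: l) a1 e -> a0 <= t -> t <= x.2 -> ev a0 (x :: l) t = (t - a0) *: x.1.
Proof.
move=> /= [h _ _ w] h1 h2; rewrite (ev_before w)// addr0.
by rewrite (max_idPr h1) (min_idPr h2).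
Qed.

Lemma ev2 a0 x l t : a0 < x.2 -> x.2 <= t -> ev a0 (x :: l) t = (x.2 - a0) *: x.1 + ev x.2 l t.
Proof. by move=> h h1 /=; rewrite (max_idPr _) ?(min_idPl h1)//; lra. Qed.

Lemma ev_after a0 l a1 e t : wg a0 l a1 e -> a1 <= t -> ev a0 l t = ev a0 l a1.
Proof.
elim: l a0 => // x l IH a0 w ta; have w' := w; case: w' => h _ _ w'; have := wg_le w' => le.
by rewrite !ev2 ?(IH _ w')//; lra.
Qed.

Lemma wg_cat a0 l l' a1 e b : wg a0 l b (hdir e l') -> wg b l' a1 e -> wg a0 (l ++ l') a1 e.
Proof.
elim: l a0 => [|x l IH] a0 /= => [->//|[h o c w] w'].
by split=> //; [rewrite hdir_cat|exact: IH].
Qed.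

Lemma ev_cat a0 l l' b e t : wg a0 l b e -> ev a0 (l ++ l') t = ev a0 l t + ev b l' t.
Proof. by elim: l a0 => [|x l IH] a0 /= => [->|[_ _ _ /IH ->]]; rewrite ?add0r// addrA. Qed.

Lemma wg_split a0 l a1 e t : wg a0 l a1 e -> a0 <= t -> t <= a1 -> exists l1 l2,
  [/\ wg a0 l1 t (hdir e l2), wg t l2 a1 e, hdir e (l1 ++ l2) = hdir e l &
    forall s, ev a0 l s = ev a0 l1 s + ev t l2 s].
Proof.
elim: l a0 => [|x l IH] a0 w.
  by move=> h1 h2; exists [::], [::]; split=> //= [||s]; rewrite ?addr0//; move: w => /= ?; lra.
rewrite le_eqVlt => /orP[/eqP <- _|h1 h2].
  by exists [::], (x :: l); split=> //= s; rewrite add0r.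
have [h o c w'] := w; have [tx|xt] := ltP t x.2.
  exists [:: (x.1, t)], ((x.1, x.2) :: l); split=> //=.
  - by split=> //; exact: achain_nil.
  move=> s; rewrite addr0 addrA -scalerDl; congr (_ *: _ + _).
  have -> : Num.max t s = if s <= t then t else s by rewrite maxElt; case: ltgtP => // ->.
  have -> : Num.max a0 s = if s <= a0 then a0 else s by rewrite maxElt; case: ltgtP => // ->.
  case: (lerP s a0) => s0; case: (lerP s t) => s1; rewrite !minElt; (repeat case: ifP); lra.
have [l1 [l2 [e1 e2 e3 e4]]] := IH _ w' xt h2.
exists (x :: l1), l2; split=> //=; last by move=> s; rewrite e4 addrA.
by split=> //; rewrite -hdir_cat e3.
Qed.

Lemma wg_end a0 l a1 e e' : wg a0 l a1 e -> (l = [::] \/ achain a1 (last e (map fst l)) e') -> wg a0 l a1 e'.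
Proof.
elim: l a0 => // x l IH a0 [h o c w] [//|hc]; split=> //; last first.
  by apply: IH => //; case: l hc {c w}; [left|right].
by case: l hc w c {IH} => [|y l] //= hc -> _.
Qed.

Lemma wg_refl i a0 l a1 e e' : re i -> 0 <= a0 -> wg a0 l a1 e -> (forall x, x \in l -> 0 < coroot i x.1) ->
  (forall d, achain a1 d e -> orbit lam d -> 0 < coroot i d -> achain a1 (rf i d) e') ->
  wg a0 [seq (rf i x.1, x.2) | x <- l] a1 e'.
Proof.
move=> ri; elim: l a0 => //= x l IH a0 p0 [h o c w] pos he.
have hx : 0 < coroot i x.1 by apply: pos; rewrite mem_head.
have hl y : y \in l -> 0 < coroot i y.1 by move=> yl; apply: pos; rewrite inE yl orbT.
split=> //; first exact: orbit_step; last by apply: IH => //; lra.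
case: l w c hl {IH pos} => /= [e1|y l [_ oy _ _]] c hl; first by rewrite e1 in c *; exact: he.
have x0 : 0 < x.2 by lra.
by have [_] := chain_pos hA lam_nat ri x0 c oy (hl _ (mem_head _ _)); apply.
Qed.

Lemma wg_refl_neg i a0 l a1 e e' : re i -> 0 <= a0 -> wg a0 l a1 e -> (forall x, x \in l -> coroot i x.1 < 0) ->
  (forall d, achain a1 d e -> orbit lam d -> coroot i d < 0 -> achain a1 (rf i d) e') ->
  wg a0 [seq (rf i x.1, x.2) | x <- l] a1 e'.
Proof.
move=> ri; elim: l a0 => //= x l IH a0 p0 [h o c w] pos he.
have hx : coroot i x.1 < 0 by apply: pos; rewrite mem_head.
have hl y : y \in l -> coroot i y.1 < 0 by move=> yl; apply: pos; rewrite inE yl orbT.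
split=> //; first exact: orbit_step; last by apply: IH => //; lra.
case: l w c hl {IH pos} => /= [e1|y l [_ oy _ _]] c hl; first by rewrite e1 in c *; exact: he.
have x0 : 0 < x.2 by lra.
by have [_] := chain_neg hA lam_nat ri x0 c oy hx; apply; exact: hl _ (mem_head _ _).
Qed.

Lemma ev_refl i a0 l t : ev a0 [seq (rf i x.1, x.2) | x <- l] t = rf i (ev a0 l t).
Proof.
elim: l a0 => [|x l IH] a0 /=; first by rewrite rfE (cr0 hA) scale0r subr0.
by rewrite IH (rfD hA) (rfZ hA).
Qed.

Lemma wg_orb a0 l a1 e x : wg a0 l a1 e -> x \in l -> orbit lam x.1.
Proof. by elim: l a0 => //= y l IH a0 [_ o _ w]; rewrite inE => /orP[/eqP ->//|]; exact: IH w. Qed.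

Lemma hdir_orb a0 l a1 e : wg a0 l a1 e -> orbit lam e -> orbit lam (hdir e l).
Proof. by case: l => //= x l [_]. Qed.
Local Notation H i a0 l t := (coroot i (ev a0 l t)).

(** Summation by parts: each break contributes its time multiplied by a change of slope, an integer
    by [achain_cong]. *)
Lemma ev_cong i a0 l a1 e : wg a0 l a1 e ->
  H i a0 l a1 + a0 * coroot i (hdir e l) - a1 * coroot i e \is a Num.int.
Proof.
elim: l a0 => [|x l IH] a0 w; first by rewrite /= (cr0 hA) add0r w subrr rpred0.
have [h o c w'] := w; rewrite ev2 ?(wg_le w')// (crD hA) (crZ hA) /=.
have c1 := achain_cong hA i c; have c2 := IH _ w'.
have -> : (x.2 - a0) * coroot i x.1 + H i x.2 l a1 + a0 * coroot i x.1 - a1 * coroot i e =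
 (x.2 * coroot i x.1 - x.2 * coroot i (hdir e l)) + (H i x.2 l a1 + x.2 * coroot i (hdir e l) - a1 * coroot i e) by ring.
exact: rpredD.
Qed.

Lemma H1 i a0 x l a1 e t : wg a0 (x :: l) a1 e -> a0 <= t -> t <= x.2 ->
  H i a0 (x :: l) t = (t - a0) * coroot i x.1.
Proof. by move=> w h1 h2; rewrite (ev1 w)// (crZ hA). Qed.

Lemma H2 i a0 x l t : a0 < x.2 -> x.2 <= t ->
  H i a0 (x :: l) t = (x.2 - a0) * coroot i x.1 + H i x.2 l t.
Proof. by move=> h1 h2; rewrite ev2// (crD hA) (crZ hA). Qed.

Lemma seg (k c s L : R) : 0 <= s -> s <= L -> Num.min k (k + L * c) <= k + s * c.
Proof. by move=> s0 sL; case: (leP 0 c) => hc; case: (leP k (k + L * c)) => h; nra. Qed.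

(** Induction from the right. If the slope passes from nonpositive to positive at a break, the chain
    there uses the reflection [r_i], and the height at the break is integral. So the later minimum
    can fail to be integral only when it is the initial value and the path leaves it upwards. *)
Lemma sufmin i a0 l a1 e h : re i -> wg a0 l a1 e -> 0 <= a0 -> orbit lam e -> 0 <= coroot i e ->
  a1 * coroot i e \is a Num.int -> h - a0 * coroot i (hdir e l) \is a Num.int ->
  exists M, [/\ exists2 t, a0 <= t <= a1 & M = h + H i a0 l t,
    forall t, a0 <= t <= a1 -> M <= h + H i a0 l t,
    M < h -> M \is a Num.int,
    coroot i (hdir e l) <= 0 -> M \is a Num.int &
    M = h -> 0 <= coroot i (hdir e l)].
Proof.
move=> ri w p0 oe e0 ie; elim: l a0 h w p0 => [|x l IH] a0 h w p0 ih.
  have e1 : a0 = a1 := w; subst a1; exists h; split=> //=.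
  - by exists a0; rewrite ?lexx// (cr0 hA) addr0.
  - by move=> t _; rewrite (cr0 hA) addr0.
  - by rewrite ltxx.
  - by rewrite (int_cong ih).
have [hx ox cx w'] := w; set h' := h + (x.2 - a0) * coroot i x.1.
have x0 : 0 < x.2 by lra.
have cc := achain_cong hA i cx.
have ih' : h' - x.2 * coroot i (hdir e l) \is a Num.int.
  have -> : h' - x.2 * coroot i (hdir e l) = (h - a0 * coroot i x.1) +
    (x.2 * coroot i x.1 - x.2 * coroot i (hdir e l)) by rewrite /h'; ring.
  exact: rpredD.
have [M' [[t' ht' et'] B1 B2 B3 B4]] := IH _ _ w' (ltW x0) ih'.
have M'h : M' <= h'.
  have := B1 x.2; rewrite lexx (wg_le w') (ev_before w')// (cr0 hA) addr0; exact.
have oh := hdir_orb w' oe.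
have val t : a0 <= t <= a1 -> M' <= h + H i a0 (x :: l) t \/ t <= x.2 /\ h + H i a0 (x :: l) t = h + (t - a0) * coroot i x.1.
  move=> /andP[t0 t1]; have [tx|xt] := leP t x.2; first by right; rewrite (H1 _ w).
  by left; rewrite H2 ?addrA ?B1 ?(ltW xt)//; exact: ltW.
have neg : coroot i x.1 < 0 -> M' \is a Num.int.
  move=> cn; have := M'h; rewrite le_eqVlt => /orP[/eqP e1|/B2//].
  have [A _] := chain_neg hA lam_nat ri x0 cx oh cn; have [_] := A (B4 e1).
  by rewrite e1 (int_cong ih').
have nonpos : coroot i x.1 <= 0 -> M' \is a Num.int.
  move=> cn; have := M'h; rewrite le_eqVlt => /orP[/eqP e1|/B2//].
  have [/B3//|cp] := leP (coroot i (hdir e l)) 0.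
  have [A _] := chain_pos hA lam_nat ri x0 cx oh cp; have [_] := A cn.
  by rewrite e1 (int_cong ih') (int_cong cc).
have att : h + H i a0 (x :: l) t' = M'.
  by have /andP[q1 q2] := ht'; rewrite H2// addrA.
have [hM|Mh] := leP h M'; last first.
  have iM : M' \is a Num.int.
    have := M'h; rewrite le_eqVlt => /orP[/eqP e1|/B2//]; apply: neg.
    rewrite -(pmulr_rlt0 _ (_ : 0 < x.2 - a0)); last by lra.
    by rewrite /h' in e1; lra.
  exists M'; split=> //=.
  - by exists t' => //; move: ht' => /andP[q1 q2]; apply/andP; split=> //; lra.
  - move=> t ht; have [//|[tx ->]] := val t ht; have /andP[t0 _] := ht.
    apply: (le_trans _ (@seg h (coroot i x.1) (t - a0) (x.2 - a0) _ _)); try lra.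
    by rewrite -/h' le_min (ltW Mh) M'h.
  - by move=> e1; rewrite e1 ltxx in Mh.
exists h; split=> //.
- exists a0; first by rewrite lexx (wg_le w).
  by rewrite (ev_before w)// (cr0 hA) addr0.
- move=> t ht; have [h1|[tx ->]] := val t ht; first exact: le_trans h1.
  have /andP[t0 _] := ht.
  have q : h <= h' by lra.
  have := @seg h (coroot i x.1) (t - a0) (x.2 - a0); rewrite -/h' (min_idPl q); apply; lra.
- by rewrite ltxx.
- move=> cn; have e1 : M' = h.
    apply/eqP; rewrite eq_le hM andbT (le_trans M'h)// /h' gerDl.
    by apply: mulr_ge0_le0 => //; lra.
  by rewrite -e1; exact: nonpos.
move=> _; rewrite leNgt; apply/negP => cn.
have : (x.2 - a0) * coroot i x.1 < 0 by rewrite pmulr_rlt0//; lra.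
by rewrite /h' in M'h; lra.
Qed.

End Pieces.

(* the shape of a height function along which [f_i] (resp. [e_i]) acts: [m] is the minimum *)
Definition fstr (R : realType) (H : R -> R) (m p q : R) := [/\ 0 <= p, p < q, q <= 1 &
  [/\ H p = m, H q = m + 1, forall t, 0 <= t <= p -> m <= H t,
   forall s t, p <= s -> s < t -> t <= q -> H s < H t & forall t, q <= t <= 1 -> m + 1 <= H t]].

Definition estr (R : realType) (H : R -> R) (m p q : R) := [/\ 0 <= p, p < q, q <= 1 &
  [/\ H p = m + 1, H q = m, forall t, 0 <= t <= p -> m + 1 <= H t,
   forall s t, p <= s -> s < t -> t <= q -> H t < H s & forall t, q <= t <= 1 -> m <= H t]].

Definition th (R : realType) (H : R -> R) (m p q t : R) : R :=
  if t <= p then 0 else if t <= q then H t - m else 1.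

(** * Minima of heights in real directions *)

Section RealStrings.
Variables (R : realType) (V : lmodType R) (J : eqType) (a : J -> J -> int)
    (alpha : J -> V) (coroot : J -> V -> R).
Hypothesis hA : adm a alpha coroot.
Local Notation D := (@RDat R V J a alpha coroot).
Local Notation rf := (@refl R V D).
Local Notation re := (@is_real R V D).
Local Notation orbit := (@orbit R V D).
Variable lam : V.
Hypothesis lam_nat : forall i, exists n : nat, coroot i lam = n%:R.
Local Notation arrow := (@arrow R V D lam).
Local Notation achain := (@achain R V D lam).
Local Notation wg := (@wg R V J a alpha coroot lam).
Implicit Types (i j : J) (d e v : V) (b p q t k : R) (l : seq (V * R)).
Local Notation H i a0 l t := (coroot i (ev a0 l t)).

(** The mirror of [sufmin], carried from the left: [N] is the minimum so far and [dp] the last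
    direction. It is integral, or it is the current height and the path is still falling. *)
Lemma premin i a0 l a1 e h N dp : re i -> wg a0 l a1 e -> 0 <= a0 -> orbit lam e ->
  achain a0 dp (hdir e l) -> h - a0 * coroot i (hdir e l) \is a Num.int -> N <= h ->
  (N \is a Num.int \/ [/\ 0 < a0, coroot i dp < 0 & N = h]) ->
  exists M, [/\ M <= N, M = N \/ exists2 t, a0 <= t <= a1 & M = h + H i a0 l t,
    forall t, a0 <= t <= a1 -> M <= h + H i a0 l t &
    (M \is a Num.int \/ [/\ 0 < a1, coroot i (last dp (map fst l)) < 0 & M = h + H i a0 l a1])].
Proof.
move=> ri; elim: l a0 h N dp => [|x l IH] a0 h N dp w p0 oe ch ih Nh hN.
  have e1 : a0 = a1 := w; subst a1; exists N; split=> //=; first by left.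
    by move=> t _; rewrite (cr0 hA) addr0.
  by rewrite (cr0 hA) addr0.
have [hx ox cx w'] := w; set h' := h + (x.2 - a0) * coroot i x.1.
have x0 : 0 < x.2 by lra.
have ih' : h' - x.2 * coroot i (hdir e l) \is a Num.int.
  have -> : h' - x.2 * coroot i (hdir e l) = (h - a0 * coroot i x.1) +
    (x.2 * coroot i x.1 - x.2 * coroot i (hdir e l)) by rewrite /h'; ring.
  by apply: rpredD => //; exact: (achain_cong hA i cx).
have K : N \is a Num.int \/ (coroot i x.1 < 0 /\ N = h).
  case: hN => [|[a00 dn e1]]; first by left.
  have [xp|xn] := leP 0 (coroot i x.1); last by right.
  have [A _] := chain_neg hA lam_nat ri a00 ch ox dn; have [_] := A xp.
  by rewrite -(int_cong ih) -e1; left.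
have d0 : 0 < x.2 - a0 by lra.
have N'h : Num.min N h' <= h' by rewrite ge_min lexx orbT.
have hN' : Num.min N h' \is a Num.int \/ [/\ 0 < x.2, coroot i x.1 < 0 & Num.min N h' = h'].
  case: K => [iN|[xn e1]]; last first.
    right; split=> //; apply/min_idPr; rewrite e1 /h' gerDl ltW//.
    by rewrite pmulr_rlt0.
  have [h1|h1] := leP N h'; first by left.
  right; split=> //; rewrite -(pmulr_rlt0 _ d0); rewrite /h' in h1; lra.
have [M [M1 M2 M3 M4]] := IH _ h' _ x.1 w' (ltW x0) oe cx ih' N'h hN'.
have Hx t : a0 <= t -> t <= x.2 -> h + H i a0 (x :: l) t = h + (t - a0) * coroot i x.1.
  by move=> t0 t1; rewrite (H1 hA i w).
have Hl t : x.2 <= t -> h + H i a0 (x :: l) t = h' + H i x.2 l t.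
  by move=> t1; rewrite (H2 hA)// addrA.
have Mh' : M <= h' by exact: le_trans N'h.
have MN : M <= N by apply: le_trans M1 _; rewrite ge_min lexx.
exists M; split=> //.
- case: M2 => [e1|[t /andP[t0 t1] e1]]; last first.
    by right; exists t; [lra|rewrite Hl].
  rewrite e1; have [h1|h1] := leP N h'; first by left.
  right; exists x.2; first by rewrite (ltW hx) (wg_le w').
  by rewrite Hl// (ev_before w')// (cr0 hA) addr0.
- move=> t /andP[t0 t1]; have [tx|xt] := leP t x.2; last first.
    by rewrite Hl ?(ltW xt)//; apply: M3; rewrite (ltW xt).
  rewrite Hx//; apply: (le_trans _ (@seg _ h (coroot i x.1) (t - a0) (x.2 - a0) _ _)); try lra.
  by rewrite -/h' le_min (le_trans MN)// Mh'.
case: M4 => [|[z1 z2 z3]]; first by left.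
by right; split=> //; rewrite z3 Hl// (wg_le w').
Qed.

Lemma wg_catE a0 l l' a1 e : wg a0 (l ++ l') a1 e -> exists b, wg a0 l b (hdir e l') /\ wg b l' a1 e.
Proof.
elim: l a0 => [|x l IH] a0 /=; first by exists a0.
by rewrite hdir_cat => -[h o c /IH[b [w1 w2]]]; exists b.
Qed.

Lemma wg_last a0 l a1 e : wg a0 l a1 e -> l = [::] \/ achain a1 (last e (map fst l)) e.
Proof.
elim: l a0 => [|x l IH] a0; first by left.
move=> [h o c w]; right; move: IH w c; case: l => [_ /= ->//|y l IH w _].
by case: (IH _ w).
Qed.

Lemma wg_int i l t e : wg 0 l t e -> (H i 0 l t \is a Num.int) = (t * coroot i e \is a Num.int).
Proof. by move=> w; have := ev_cong hA i w; rewrite mul0r addr0 => /int_cong. Qed.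

Section OnePath.
Variables (i : J) (l : seq (V * R)).
Hypotheses (ri : re i) (w : wg 0 l 1 lam).
Local Notation h := (fun t => H i 0 l t).

Lemma lam_ge0 : 0 <= coroot i lam. Proof. by have [n ->] := lam_nat i. Qed.

Lemma lam_int : coroot i lam \is a Num.int. Proof. by have [n ->] := lam_nat i; exact: natr_int. Qed.

Lemma h0 : h 0 = 0. Proof. by rewrite /= (ev_before w)// (cr0 hA). Qed.

Lemma lip_ev a0 (l' : seq (V * R)) : lip (fun t => H i a0 l' t).
Proof.
elim: l' a0 => [|x l' IH] a0 /=; first by apply: lip_cst.
have -> : (fun t => coroot i ((Num.min x.2 (Num.max a0 t) - a0) *: x.1 + ev x.2 l' t)) =
  (fun t => coroot i x.1 * (Num.min x.2 (- Num.min (- a0) (- t)) - a0) + H i x.2 l' t).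
  apply/funext => t; rewrite (crD hA) (crZ hA) oppr_min !opprK; ring.
apply: lip_add => //; apply: lip_scale; apply: lip_sub; last exact: lip_cst.
apply: lip_min; first exact: lip_cst.
apply: lip_opp; apply: lip_min; first exact: lip_cst.
by apply: lip_opp; exact: lip_id.
Qed.

Lemma h1_int : h 1 \is a Num.int.
Proof. by rewrite /= (wg_int i w) mul1r lam_int. Qed.

(* a nonpositive slope forces the later minimum to be integral *)
Lemma piece_suffix (l1 l2 : seq (V * R)) x : l = l1 ++ x :: l2 -> exists b,
  [/\ wg 0 l1 b x.1, wg b (x :: l2) 1 lam, h x.2 = h b + (x.2 - b) * coroot i x.1 &
  coroot i x.1 <= 0 -> exists M, [/\ M \is a Num.int,
   exists2 t, b <= t <= 1 & M = h t & forall t, b <= t <= 1 -> M <= h t]].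
Proof.
move=> el; have w0 := w; rewrite el in w0; have [b [w1 w2]] := wg_catE w0; exists b.
have hb t : b <= t -> h t = h b + H i b (x :: l2) t.
  move=> bt; cbv beta; rewrite el !(ev_cat _ _ w1) (ev_before w2 (lexx b)) addr0 (crD hA).
  by rewrite (ev_after w1).
have [bx ox cx w3] := w2.
have x2 : h x.2 = h b + (x.2 - b) * coroot i x.1 by rewrite hb ?(H1 hA i w2) ?(ltW bx).
split=> // xn.
have b0 := wg_le w1.
have hi : h b - b * coroot i (hdir lam (x :: l2)) \is a Num.int.
  have := ev_cong hA i w1; rewrite mul0r addr0.
  by cbv beta; rewrite el (ev_cat _ _ w1) (ev_before w2 (lexx b)) addr0.
have i1 : 1 * coroot i lam \is a Num.int by rewrite mul1r lam_int.
have [M [[t ht e1] B1 _ B3 _]] := sufmin hA lam_nat ri w2 b0 (orbit_base D lam) lam_ge0 i1 hi.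
exists M; split; first exact: B3.
  have /andP[t0 t1] := ht.
  by exists t; rewrite // e1 (hb t).
by move=> u hu; have /andP[u0 u1] := hu; rewrite (hb u) ?B1.
Qed.

Lemma piece_prefix (l1 l2 : seq (V * R)) x : l = l1 ++ x :: l2 -> exists b,
  [/\ wg 0 l1 b x.1, wg b (x :: l2) 1 lam, h x.2 = h b + (x.2 - b) * coroot i x.1 &
  exists M, [/\ M \is a Num.int \/ (coroot i x.1 < 0 /\ M = h x.2),
   exists2 t, 0 <= t <= x.2 & M = h t & forall t, 0 <= t <= x.2 -> M <= h t]].
Proof.
move=> el; have [b [w1 w2 hx _]] := piece_suffix el; exists b; split=> //.
have [bx ox cx w3] := w2; have b0 := wg_le w1.
have w4 : wg 0 (rcons l1 x) x.2 (hdir lam l2) by rewrite -cats1; apply: (wg_cat (l' := [:: x]) w1).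
have ht t : t <= x.2 -> 0 + H i 0 (rcons l1 x) t = h t.
  move=> tx; cbv beta; rewrite add0r el -cat_rcons (ev_cat _ _ w4) (crD hA) (ev_before w3)// (cr0 hA).
  by rewrite addr0.
have oe := hdir_orb w3 (orbit_base D lam).
have i0 : 0 - 0 * coroot i (hdir (hdir lam l2) (rcons l1 x)) \is a Num.int by rewrite mul0r subr0 rpred0.
have [M [M1 M2 M3 M4]] := premin (N := 0) ri w4 (lexx 0) oe (achain_nil _ _ _ _) i0 (lexx 0) (or_introl (rpred0 _)).
exists M; split.
- case: M4 => [|[_ z2 z3]]; first by left.
  by right; move: z2; rewrite map_rcons last_rcons; split=> //; rewrite z3 ht.
- case: M2 => [->|[t tt ->]]; last by exists t => //; rewrite ht//; case/andP: tt.
  by exists 0; rewrite ?h0// lexx; lra.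
by move=> t tt; rewrite -ht ?M3//; case/andP: tt.
Qed.

Lemma real_min : exists m, [/\ m \is a Num.int, m <= 0, exists2 t, 0 <= t <= 1 & h t = m & forall t, 0 <= t <= 1 -> m <= h t].
Proof.
have i1 : 1 * coroot i lam \is a Num.int by rewrite mul1r lam_int.
have i0 : 0 - 0 * coroot i (hdir lam l) \is a Num.int by rewrite mul0r subr0 rpred0.
have [M [[t ht e1] B1 B2 _ _]] := sufmin hA lam_nat ri w (lexx 0) (orbit_base D lam) lam_ge0 i1 i0.
have B1' u : 0 <= u <= 1 -> M <= h u by move=> /B1; rewrite add0r.
have M0 : M <= 0 by rewrite -h0; apply: B1'; lra.
exists M; split=> //; last by exists t; rewrite // e1 add0r.
by move: M0; rewrite le_eqVlt => /orP[/eqP ->|/B2//]; exact: rpred0.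
Qed.

End OnePath.

End RealStrings.

(** * Root operators on GLS paths *)

Section RealOperators.
Variables (R : realType) (V : lmodType R) (J : eqType) (a : J -> J -> int)
    (alpha : J -> V) (coroot : J -> V -> R).
Hypothesis hA : adm a alpha coroot.
Local Notation D := (@RDat R V J a alpha coroot).
Local Notation rf := (@refl R V D).
Local Notation re := (@is_real R V D).
Local Notation orbit := (@orbit R V D).
Variable lam : V.
Hypothesis lam_nat : forall i, exists n : nat, coroot i lam = n%:R.
Local Notation arrow := (@arrow R V D lam).
Local Notation achain := (@achain R V D lam).
Local Notation wg := (@wg R V J a alpha coroot lam).
Implicit Types (d e v : V) (b p q t k : R).
Local Notation H i a0 l t := (coroot i (ev a0 l t)).
Variables (i : J) (l : seq (V * R)).
Hypotheses (ri : re i) (w : wg 0 l 1 lam).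
Local Notation h := (fun t => H i 0 l t).

Lemma strict_int (x y : R) : x \is a Num.int -> y \is a Num.int -> x < y -> x + 1 <= y.
Proof. by move=> /intrP[m ->] /intrP[n ->]; rewrite ltr_int -[1]/(1%:~R) -intrD ler_int lezD1. Qed.

Lemma split3 p q : 0 <= p -> p < q -> q <= 1 -> exists l1 l2 l3,
  [/\ wg 0 l1 p (hdir lam (l2 ++ l3)), wg p l2 q (hdir lam l3), wg q l3 1 lam,
   wg 0 (l1 ++ l2 ++ l3) 1 lam & forall s, ev 0 l s = ev 0 (l1 ++ l2 ++ l3) s].
Proof.
move=> p0 pq q1; have p1 : p <= 1 by lra.
have [l1 [l23 [w1 w23 _ e1]]] := wg_split w p0 p1.
have [l2 [l3 [w2 w3 e3 e2]]] := wg_split w23 (ltW pq) q1.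
have w1' : wg 0 l1 p (hdir lam (l2 ++ l3)) by rewrite e3.
have w23' : wg p (l2 ++ l3) 1 lam by exact: wg_cat w2 w3.
exists l1, l2, l3; split=> //; first exact: wg_cat w1' w23'.
by move=> s; rewrite e1 (ev_cat _ _ w1') (ev_cat _ _ w2) e2.
Qed.

Lemma wg_ne a0 (l0 : seq (V * R)) a1 e : wg a0 l0 a1 e -> a0 < a1 -> exists x l', l0 = x :: l'.
Proof. by case: l0 => [/= ->|x l' _ _]; [rewrite ltxx|exists x, l']. Qed.

(* reflecting the middle third of a path *)
Lemma replace_mid p q l1 l2 l3 : 0 <= p -> p < q -> q <= 1 ->
  wg 0 l1 p (hdir lam (l2 ++ l3)) -> wg p l2 q (hdir lam l3) -> wg q l3 1 lam ->
  (forall s, ev 0 l s = ev 0 (l1 ++ l2 ++ l3) s) ->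
  wg 0 l1 p (hdir lam [seq (rf i x.1, x.2) | x <- l2]) ->
  wg p [seq (rf i x.1, x.2) | x <- l2] q (hdir lam l3) ->
  exists l', wg 0 l' 1 lam /\ forall t, 0 <= t <= 1 ->
   ev 0 l' t = ev 0 l t - (if t <= p then 0 else if t <= q then H i 0 l t - H i 0 l p else H i 0 l q - H i 0 l p) *: alpha i.
Proof.
move=> p0 pq q1 w1 w2 w3 el w1' w2'; set l2' := [seq _ | x <- l2] in w1' w2' *.
have w23 : wg p (l2' ++ l3) 1 lam by exact: wg_cat w2' w3.
have hd : hdir lam (l2' ++ l3) = hdir lam l2'.
  by rewrite hdir_cat /l2'; have [x [y ->]] := wg_ne w2 pq.
exists (l1 ++ l2' ++ l3); split; first by apply: wg_cat w23; rewrite hd.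
have hh t : H i 0 l t = H i 0 l1 t + H i p l2 t + H i q l3 t.
  by rewrite el (ev_cat _ _ w1) (ev_cat _ _ w2) addrA !(crD hA).
have hp : H i 0 l p = H i 0 l1 p.
  by rewrite [LHS](hh p) (ev_before w2 (lexx p)) (ev_before w3 (ltW pq)) !(cr0 hA) !addr0.
move=> t ht; have -> : (if t <= p then 0 else if t <= q then H i 0 l t - H i 0 l p else H i 0 l q - H i 0 l p) = H i p l2 t.
  have [tp|pt] := leP t p; first by rewrite (ev_before w2 tp) (cr0 hA).
  have e1 : ev 0 l1 t = ev 0 l1 p by rewrite (ev_after w1)// ltW.
  have [tq|qt] := leP t q.
    by rewrite hp hh (ev_before w3 tq) (cr0 hA) addr0 e1 addrC addKr.
  rewrite hp hh (ev_before w3 (lexx q)) (cr0 hA) addr0 (ev_after w1 (ltW pq)) (ev_after w2 (ltW qt)).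
  by rewrite addrC addKr.
rewrite el (ev_cat _ _ w1') (ev_cat _ _ w2') (ev_cat _ _ w1) (ev_cat _ _ w2).
by rewrite (ev_refl hA) rfE !addrA [RHS]addrAC.
Qed.

Lemma mono_pieces k a0 l0 a1 e : wg a0 l0 a1 e -> (forall x, x \in l0 -> 0 < k * coroot i x.1) ->
  forall s t, a0 <= s -> s < t -> t <= a1 -> k * H i a0 l0 s < k * H i a0 l0 t.
Proof.
elim: l0 a0 => [|x l0 IH] a0 w0 hx s t as_ st ta.
  by move: w0 => /= e0; rewrite e0 in as_; lra.
have [ax ox cx w1] := w0; have kx : 0 < k * coroot i x.1 by apply: hx; rewrite mem_head.
have IH' := IH _ w1 (fun y yl => hx y (mem_behead (s := x :: l0) yl)).
have le0 u : x.2 <= u -> u <= a1 -> 0 <= k * H i x.2 l0 u.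
  rewrite le_eqVlt => /orP[/eqP <- _|xu ua]; first by rewrite (ev_before w1)// (cr0 hA) mulr0.
  by have := IH' _ _ (lexx _) xu ua; rewrite (ev_before w1)// (cr0 hA) mulr0 => /ltW.
have k1 u : a0 <= u -> u <= x.2 -> k * H i a0 (x :: l0) u = (u - a0) * (k * coroot i x.1).
  by move=> u0 u1; rewrite (H1 hA i w0)//; ring.
have k2 u : x.2 <= u -> k * H i a0 (x :: l0) u = (x.2 - a0) * (k * coroot i x.1) + k * H i x.2 l0 u.
  by move=> u1; rewrite (H2 hA)//; ring.
have [tx|xt] := leP t x.2; first by rewrite !k1 ?ltr_pM2r//; lra.
rewrite [ltRHS]k2 ?(ltW xt)//; have [sx|xs] := leP x.2 s.
  by rewrite k2// ltrD2l; exact: IH'.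
rewrite k1 ?(ltW xs)//; have := le0 t (ltW xt) ta.
have : (s - a0) * (k * coroot i x.1) < (x.2 - a0) * (k * coroot i x.1) by rewrite ltr_pM2r//; lra.
lra.
Qed.

Lemma hsplit (l0 : seq (V * R)) : (forall s, ev 0 l s = ev 0 l0 s) -> ev 0 l = ev 0 l0.
Proof. by move=> e; apply/funext. Qed.
Variable m : R.
Hypotheses (im : m \is a Num.int) (mb : forall t, 0 <= t <= 1 -> m <= H i 0 l t)
  (ma : exists2 t, 0 <= t <= 1 & H i 0 l t = m).

(** Here [p] is the last time at the minimum and [q] the first later time at [m + 1]. All slopes in
    between are positive, so that part can be reflected; the new joints are chains because the
    height is integral at [p] and [q]. *)
Theorem real_f : H i 0 l 1 <> m -> exists p q, fstr h m p q /\ exists l', wg 0 l' 1 lam /\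
  forall t, 0 <= t <= 1 -> ev 0 l' t = ev 0 l t - th h m p q t *: alpha i.
Proof.
move=> n1; have m1 : m < H i 0 l 1 by rewrite lt_neqAle mb ?ler01 ?lexx// andbT; apply/eqP => e; apply: n1.
have hm1 : m + 1 <= H i 0 l 1 by apply: strict_int => //; exact: (h1_int hA lam_nat i w).
have hl : lip h by exact: (lip_ev hA i 0 l).
have l00 : (0 : R) <= 0 := lexx 0.
have [|p /andP[p0 p1] [hp hap]] := last_hit hl l00 ler01 (lexx 1) (ltW m1).
  by have [t ht et] := ma; exists t; rewrite // et.
have p1' : p < 1 by rewrite lt_neqAle p1 andbT; apply/eqP => e; apply: n1; rewrite -e.
have [||q /andP[pq q1] [hq hbq]] := first_hit_strict (y := - (m + 1)) (lip_opp hl) p0 p1 (lexx 1).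
- by rewrite hp; lra.
- by exists 1; [lra|lra].
have {}hq : H i 0 l q = m + 1 by lra.
have pq' : p < q by rewrite lt_neqAle pq andbT; apply/eqP => e; move: hq; rewrite -e hp; lra.
have [l1 [l2 [l3 [w1 w2 w3 wL eL]]]] := split3 p0 pq' q1.
have hL := hsplit eL.
(* A nonpositive slope would make the minimum over the rest an integer below [m + 1], hence [m]. As
   [m] is not attained after [p], the piece starts at [p], and then the height is at most [m] at its
   end, which is later than [p]. *)
have pos x : x \in l2 -> 0 < coroot i x.1.
  move=> /splitPr xl2; case: xl2 w2 wL eL hL w1 => A B w2 wL eL hL w1.
  have [b' [w2a w2b]] := wg_catE w2.
  have eq : l1 ++ (A ++ x :: B) ++ l3 = (l1 ++ A) ++ x :: (B ++ l3) by rewrite -!catA.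
  have [b [v1 v2 v3 v4]] := piece_suffix hA lam_nat ri wL eq.
  rewrite -hL in v3 v4.
  have w1a : wg 0 (l1 ++ A) b' x.1.
    apply: (wg_cat (b := p)); last exact: w2a.
    by move: w1; rewrite hdir_cat /= hdir_cat /=.
  have bb' : b = b'.
    have wg_fun : forall a0 (l0 : seq (V * R)) t t' e e', wg a0 l0 t e -> wg a0 l0 t' e' -> t = t'.
      move=> a0 l0; elim: l0 a0 => [|y l0 IH] a0 t t' e e' /=; first by move=> -> ->.
      by move=> [_ _ _ u1] [_ _ _ u2]; exact: IH u1 u2.
    exact: wg_fun v1 w1a.
  have [bx _ _ wB] := w2b; have xq := wg_le wB; have pb := wg_le w2a; rewrite -bb' in bx pb.
  rewrite ltNge; apply/negP => xn; have [M [iM [t /andP[t0 t1] Mt] Mb]] := v4 xn.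
  have Mm : M < m + 1.
    have := Mb b; rewrite lexx => /(_ _); have := hbq b pb; have : b < q by lra.
    move=> bq /(_ bq); have b1 : b <= 1 by lra.
    by rewrite b1 => q2 /(_ isT); lra.
  have MM : M = m.
    apply/eqP; rewrite eq_le; apply/andP; split; last by rewrite Mt mb//; lra.
    by rewrite leNgt; apply/negP => /(strict_int im iM); lra.
  have tb : ~ p < t by move=> /hap/(_ t1); rewrite -Mt MM ltxx.
  have : H i 0 l x.2 <= m.
    rewrite v3; have -> : b = p by lra.
    rewrite hp gerDl mulr_ge0_le0//; lra.
  have := hap x.2; have : p < x.2 by lra.
  move=> q2 /(_ q2); have q3 : x.2 <= 1 by lra.
  by move=> /(_ q3); lra.
have [x [l2t el2]] := wg_ne w2 pq'.
have hx : 0 < coroot i x.1 by apply: pos; rewrite el2 mem_head.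
have olam := orbit_base D lam.
have o3 := hdir_orb w3 olam.
have w12 : wg 0 (l1 ++ l2) q (hdir lam l3).
  by apply: wg_cat w2; move: w1; rewrite hdir_cat.
(* Integrality of [m + 1] at time [q] supplies the extra arrow labelled [alpha i] at this joint. *)
have qi : q * coroot i (hdir lam l3) \is a Num.int.
  rewrite -(wg_int hA i w12); have <- : H i 0 l q = H i 0 (l1 ++ l2) q.
    by rewrite hL catA (ev_cat _ _ w12) (ev_before w3 (lexx q)) addr0.
  by rewrite hq rpredD ?int_num1.
have q0 : 0 < q by lra.
have w2' : wg p [seq (rf i x.1, x.2) | x <- l2] q (hdir lam l3).
  apply: (wg_refl hA lam_nat ri p0 w2 pos) => d cd od dp.
  have ci := int_cong (achain_cong hA i cd).
  apply: achain_trans cd; apply: achain1; apply: (arrow_simple hA lam_nat) => //.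
  by rewrite ri ci.
(* The slope just before the minimum is nonpositive and the one after is positive, so [chain_pos]
   lets the chain end at the reflected direction. *)
have w1' : wg 0 l1 p (hdir lam [seq (rf i x.1, x.2) | x <- l2]).
  have hd2 : hdir lam (l2 ++ l3) = x.1 by rewrite el2.
  rewrite hd2 in w1; apply: (wg_end w1).
  have [e1|[l1' [y e1]]] : l1 = [::] \/ exists l1' y, l1 = rcons l1' y.
    by case/lastP: (l1) => [|l1' y]; [left|right; exists l1', y].
    by left.
  have w1y : wg 0 (rcons l1' y) p x.1 by rewrite -e1.
  have cy : achain p y.1 x.1.
    by case: (wg_last w1y) => [|]; [case: (l1')|rewrite map_rcons last_rcons].
  right; rewrite e1 map_rcons last_rcons el2 /=.
  have ox : orbit lam x.1 by apply: (wg_orb w2); rewrite el2 mem_head.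
  have p0' : 0 < p by case: (l1') w1y => [|z s] /wg_lt.
  have [A _] := chain_pos hA lam_nat ri p0' cy ox hx; apply: (A _).1.
  have wc : wg 0 (l1' ++ [:: y]) p x.1 by rewrite cats1.
  have [b0 [_ [yb _ _ yp]]] := wg_catE wc.
  have eq : l1 ++ l2 ++ l3 = l1' ++ y :: (l2 ++ l3) by rewrite e1 cat_rcons.
  have [b [v1 v2 v3 _]] := piece_suffix hA lam_nat ri wL eq.
  rewrite -hL in v3; move: yp => /= yp; rewrite yp hp in v3.
  have [by_ _ _ _] := v2; have b00 := wg_le v1; rewrite yp in by_.
  have := mb (t := b); rewrite b00 => /(_ _) hb.
  have hb' : m <= H i 0 l b by apply: hb; lra.
  by rewrite -(pmulr_rle0 _ (_ : 0 < p - b)); lra.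
have [l' [wl' el']] := replace_mid p0 pq' q1 w1 w2 w3 eL w1' w2'.
have hmid t : p <= t -> t <= q -> H i 0 l t = H i 0 l1 p + H i p l2 t.
  move=> pt tq; rewrite hL (ev_cat _ _ w1) (ev_cat _ _ w2) (ev_before w3 tq) addr0 (crD hA).
  by rewrite (ev_after w1 pt).
have incr s t : p <= s -> s < t -> t <= q -> H i 0 l s < H i 0 l t.
  move=> ps st tq; rewrite !hmid ?ltrD2l; try lra.
  have mp x0 : x0 \in l2 -> 0 < 1 * coroot i x0.1 by move=> x0l; rewrite mul1r pos.
  by have := mono_pieces w2 mp ps st tq; rewrite !mul1r.
exists p, q; split.
  split=> //; split=> //; first by move=> t /andP[t0 tp]; apply: mb; lra.
  have i1 : 1 * coroot i lam \is a Num.int by rewrite mul1r (lam_int lam_nat).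
  have iq : H i 0 l q - q * coroot i (hdir lam l3) \is a Num.int by rewrite rpredB// hq rpredD ?int_num1.
  have [M [[u hu Mu] B1 B2 _ _]] := sufmin hA lam_nat ri w3 (ltW q0) olam (lam_ge0 lam_nat i) i1 iq.
  have hq3 (v : R) : q <= v -> H i 0 l v = H i 0 l q + H i q l3 v.
    move=> qv; rewrite hL catA !(ev_cat _ _ w12) (ev_before w3 (lexx q)) addr0 (crD hA).
    by rewrite (ev_after w12 qv).
  move=> t ht; rewrite (hq3 t); last by case/andP: ht.
  apply: le_trans (B1 t ht); rewrite leNgt; apply/negP => Mq.
  have iM : M \is a Num.int by apply: B2; rewrite hq.
  have : m < M.
    by have /andP[u0 u1] := hu; rewrite Mu -hq3//; apply: hap => //; lra.
  by move=> /(strict_int im iM); lra.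
exists l'; split=> // t ht; rewrite el'//; congr (_ - _ *: _).
by rewrite /th hp hq addrAC subrr add0r.
Qed.

(** Dual to [real_f]: [q] is the first time at the minimum, [p] the last earlier time at [m + 1],
    and [piece_prefix] excludes nonnegative slopes in between. *)
Theorem real_e : m <> 0 -> exists p q, estr h m p q /\ exists l', wg 0 l' 1 lam /\
  forall t, 0 <= t <= 1 -> ev 0 l' t = ev 0 l t +
    (if t <= p then 0 else if t <= q then m + 1 - H i 0 l t else 1) *: alpha i.
Proof.
move=> n1; have z0 : H i 0 l 0 = 0 by exact: (h0 hA i w).
have m0 : m < 0 by rewrite lt_neqAle -{2}z0 mb ?ler01 ?lexx// andbT; apply/eqP.
have m1 : m + 1 <= 0 by apply: strict_int => //; exact: rpred0.
have hl : lip h by exact: (lip_ev hA i 0 l).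
have l00 : (0 : R) <= 0 := lexx 0.
have [||q /andP[q0 q1] [hq hbq]] := first_hit_strict hl l00 ler01 (lexx 1) (y := m).
- by rewrite z0 ltW.
- by have [t ht et] := ma; exists t; rewrite // et.
have q0' : 0 < q by rewrite lt_neqAle q0 andbT; apply/eqP => e; move: hq; rewrite -e z0; lra.
have [||p /andP[p0 pq] [hp hap]] := last_hit (y := - (m + 1)) (lip_opp hl) l00 q0 q1.
- by rewrite hq; lra.
- by exists 0; rewrite ?z0; lra.
have {}hp : H i 0 l p = m + 1 by lra.
have pq' : p < q by rewrite lt_neqAle pq andbT; apply/eqP => e; move: hq; rewrite -e hp; lra.
have [l1 [l2 [l3 [w1 w2 w3 wL eL]]]] := split3 p0 pq' q1.
have hL := hsplit eL.
have neg x : x \in l2 -> coroot i x.1 < 0.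
  move=> /splitPr xl2; case: xl2 w2 wL eL hL w1 => A B w2 wL eL hL w1.
  have [b' [w2a w2b]] := wg_catE w2.
  have eq : l1 ++ (A ++ x :: B) ++ l3 = (l1 ++ A) ++ x :: (B ++ l3) by rewrite -!catA.
  have [b [v1 v2 v3 v4]] := piece_prefix hA lam_nat ri wL eq.
  rewrite -hL in v3 v4.
  have w1a : wg 0 (l1 ++ A) b' x.1.
    apply: (wg_cat (b := p)); last exact: w2a.
    by move: w1; rewrite hdir_cat /= hdir_cat /=.
  have bb' : b = b'.
    have wg_fun : forall a0 (l0 : seq (V * R)) t t' e e', wg a0 l0 t e -> wg a0 l0 t' e' -> t = t'.
      move=> a0 l0; elim: l0 a0 => [|y l0 IH] a0 t t' e e' /=; first by move=> -> ->.
      by move=> [_ _ _ u1] [_ _ _ u2]; exact: IH u1 u2.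
    exact: wg_fun v1 w1a.
  have [bx _ _ wB] := w2b; have xq := wg_le wB; have pb := wg_le w2a; rewrite -bb' in bx pb.
  rewrite ltNge; apply/negP => xn; have [M [iM [t /andP[t0 t1] Mt] Mb]] := v4.
  have x1 : H i 0 l x.2 < m + 1.
    have px : p < x.2 by lra.
    by have := hap _ px xq; lra.
  have {}iM : M \is a Num.int by case: iM => // -[]; rewrite ltNge xn.
  have Mx : M <= H i 0 l x.2 by apply: Mb; rewrite lexx andbT; lra.
  have MM : M = m.
    apply/eqP; rewrite eq_le; apply/andP; split; last by rewrite Mt mb//; lra.
    by rewrite leNgt; apply/negP => /(strict_int im iM); lra.
  have tq : ~ t < q by move=> /(hbq t t0); rewrite -Mt MM ltxx.
  have hx : H i 0 l x.2 = m.
    have -> : x.2 = t by lra.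
    by rewrite -Mt.
  have : H i 0 l b <= m.
    move: v3; rewrite hx; have : 0 <= (x.2 - b) * coroot i x.1 by apply: mulr_ge0 => //; lra.
    lra.
  have := hbq b; have b0 : 0 <= b by lra.
  have bq : b < q by lra.
  by move=> /(_ b0 bq); lra.
have [x [l2t el2]] := wg_ne w2 pq'.
have hx : coroot i x.1 < 0 by apply: neg; rewrite el2 mem_head.
have olam := orbit_base D lam.
have o3 := hdir_orb w3 olam.
have w12 : wg 0 (l1 ++ l2) q (hdir lam l3).
  by apply: wg_cat w2; move: w1; rewrite hdir_cat.
have hq3 (v : R) : q <= v -> H i 0 l v = H i 0 l q + H i q l3 v.
  move=> qv; rewrite hL catA !(ev_cat _ _ w12) (ev_before w3 (lexx q)) addr0 (crD hA).
  by rewrite (ev_after w12 qv).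
(* The path cannot go below [m] after [q]. This sign lets [chain_neg] delete the reflection at the
   right joint. *)
have d3 : 0 <= coroot i (hdir lam l3).
  case: (l3) w3 hq3 => [|y l3'] w3' hq3; first exact: (lam_ge0 lam_nat).
  have [qy _ _ w4] := w3'; have y1 := wg_le w4.
  have hy : H i 0 l y.2 = H i 0 l q + (y.2 - q) * coroot i y.1.
    by rewrite hq3 ?ltW// (H1 hA i w3')// ltW.
  have : m <= H i 0 l y.2 by apply: mb; lra.
  by rewrite hy hq /= lerDl pmulr_rge0//; lra.
have w2' : wg p [seq (rf i x.1, x.2) | x <- l2] q (hdir lam l3).
  apply: (wg_refl_neg hA lam_nat ri p0 w2 neg) => d cd od dp.
  by have [A _] := chain_neg hA lam_nat ri q0' cd o3 dp; exact: (A d3).1.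
have w1' : wg 0 l1 p (hdir lam [seq (rf i x.1, x.2) | x <- l2]).
  have hd2 : hdir lam (l2 ++ l3) = x.1 by rewrite el2.
  rewrite hd2 in w1; apply: (wg_end w1).
  case: (wg_last w1) => [|cy]; first by left.
  have [e1|[y [l1' e1]]] : l1 = [::] \/ exists y l1', l1 = y :: l1'.
    by case: (l1) => [|y l1']; [left|right; exists y, l1'].
    by left.
  right; have p0' : 0 < p by move: w1; rewrite e1 => /wg_lt.
  have ox : orbit lam x.1 by apply: (wg_orb w2); rewrite el2 mem_head.
  rewrite el2 /=; apply: (achain_trans cy); apply: achain1; rewrite -{1}(rfK hA x.1 ri).
  apply: (arrow_simple hA lam_nat) => //; first exact: orbit_step.
    by rewrite (cr_rf_same hA)// oppr_gt0.
  rewrite ri (cr_rf_same hA)// mulrN rpredN -(wg_int hA i w1).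
  have <- : H i 0 l p = H i 0 l1 p.
    by rewrite hL (ev_cat _ _ w1) (ev_cat _ _ w2) (ev_before w2 (lexx p)) (ev_before w3 (ltW pq')) !addr0.
  by rewrite hp rpredD ?int_num1.
have [l' [wl' el']] := replace_mid p0 pq' q1 w1 w2 w3 eL w1' w2'.
have hmid t : p <= t -> t <= q -> H i 0 l t = H i 0 l1 p + H i p l2 t.
  move=> pt tq; rewrite hL (ev_cat _ _ w1) (ev_cat _ _ w2) (ev_before w3 tq) addr0 (crD hA).
  by rewrite (ev_after w1 pt).
exists p, q; split.
  split=> //; split=> //.
  - move=> t /andP[t0 tp]; case: (pselect (p = 0)) => [pe|pn].
      by have -> : t = p; [lra|rewrite hp].
    have p0' : 0 < p by lra.
    have [e1|[l1' [y e1]]] : l1 = [::] \/ exists l1' y, l1 = rcons l1' y.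
      by case/lastP: (l1) => [|l1' y]; [left|right; exists l1', y].
      by move: w1; rewrite e1 /= => e; lra.
    have eq : l1 ++ l2 ++ l3 = l1' ++ y :: (l2 ++ l3) by rewrite e1 cat_rcons.
    have [b [v1 v2 v3 v4]] := piece_prefix hA lam_nat ri wL eq.
    rewrite -hL in v3 v4; have wc := w1; rewrite e1 -cats1 in wc.
    have [b0 [_ [yb _ _ yp]]] := wg_catE wc; move: yp => /= yp; rewrite yp in v4.
    have [M [iM [u /andP[u0 u1] Mu] Mb]] := v4.
    apply: (le_trans _ (Mb t _)); last by rewrite t0.
    case: iM => [iM|[_ ->]]; last by rewrite hp.
    by apply: strict_int => //; rewrite Mu; apply: hbq => //; lra.
  - move=> s t ps st tq; rewrite !hmid ?ltrD2l; try lra.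
    have mp x0 : x0 \in l2 -> 0 < -1 * coroot i x0.1 by move=> x0l; rewrite mulN1r oppr_gt0 neg.
    by have := mono_pieces w2 mp ps st tq; rewrite !mulN1r ltrN2.
  by move=> t /andP[t0 t1]; apply: mb; lra.
exists l'; split=> // t ht; rewrite el'// -scaleNr; congr (_ + _ *: _).
by rewrite hp hq; case: ifP => _; [|case: ifP => _]; lra.
Qed.

End RealOperators.

(** * Merging equal consecutive directions *)

Section WeakStrict.
Variables (R : realType) (V : lmodType R) (J : eqType) (a : J -> J -> int)
    (alpha : J -> V) (coroot : J -> V -> R).
Local Notation D := (@RDat R V J a alpha coroot).
Variable lam : V.
Local Notation gt := (@ord_gt R V D lam).
Local Notation achain := (@achain R V D lam).
Local Notation orbit := (@orbit R V D).
Local Notation wg := (@wg R V J a alpha coroot lam).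
Implicit Types (l : seq (V * R)) (t : R).

Fixpoint gls_from (a0 : R) l (a1 : R) (e : V) : Prop := if l is x :: l' then
  [/\ a0 < x.2, orbit lam x.1, achain x.2 x.1 (hdir e l'),
    (if l' is y :: _ then gt x.1 y.1 else True) & gls_from x.2 l' a1 e] else a0 = a1.

Lemma sg_wg a0 l a1 e : gls_from a0 l a1 e -> wg a0 l a1 e.
Proof. by elim: l a0 => //= x l IH a0 [h1 h2 h3 _ /IH]. Qed.

Lemma wg_sg a0 l a1 e : wg a0 l a1 e -> exists l', [/\ gls_from a0 l' a1 e, hdir e l' = hdir e l &
  forall t, ev a0 l' t = ev a0 l t].
Proof.
elim: l a0 => [|x l IH] a0; first by exists [::].
move=> /= [ax ox cx /IH[l' [s1 s2 s3]]].
case: l' s1 s2 s3 => [|y l'] s1 s2 s3.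
  have cx' : achain x.2 x.1 e by rewrite -[e]/(hdir e [::]) s2.
  by exists [:: x]; split=> // t; rewrite /= -s3.
have [xy|xy] := pselect (x.1 = y.1); last first.
  exists (x :: y :: l'); split=> // [|t]; last by rewrite -s3.
  split=> //; first by rewrite s2.
  by split=> //; have /= := achain_ge cx; rewrite -s2.
have [h1 h2 h3 h4 h5] := s1; exists (y :: l'); split=> // [|t]; first by split=> //; lra.
rewrite -s3 /= addrA xy -scalerDl; congr (_ *: _ + _).
have -> : Num.max x.2 t = if t <= x.2 then x.2 else t by rewrite maxElt; case: ltgtP => // ->.
have -> : Num.max a0 t = if t <= a0 then a0 else t by rewrite maxElt; case: ltgtP => // ->.
case: (lerP t a0) => s0; case: (lerP t x.2) => s4; rewrite !minElt; (repeat case: ifP); lra.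
Qed.

Lemma gls_fun_ev l (u : I01 R) : gls_fun l u = ev 0 l (val u).
Proof.
suff H a0 (y : R) : \sum_(s < size l) (Num.min (nth 0 (map snd l) s) (Num.max (nth 0 (a0 :: map snd l) s) y)
    - nth 0 (a0 :: map snd l) s) *: nth 0 (lams l) s = ev a0 l y by exact: H.
rewrite /lams; elim: l a0 => [|x l IH] a0; first by rewrite big_ord0.
by rewrite big_ord_recl /= -IH.
Qed.

Lemma sg_gls l : is_gls D lam l <-> (0 < size l)%N /\ gls_from 0 l 1 lam.
Proof.
suff H a0 : (0 < size l)%N -> (sorted <%R (a0 :: map snd l) /\ last a0 (map snd l) = 1 /\
  (forall s, (s < size l)%N -> orbit lam (nth 0 (lams l) s)) /\
  (forall s, (s.+1 < size l)%N ->
     gt (nth 0 (lams l) s) (nth 0 (lams l) s.+1) /\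
     achain (nth 0 (map snd l) s) (nth 0 (lams l) s) (nth 0 (lams l) s.+1)) /\
  achain 1 (nth 0 (lams l) (size l).-1) lam) <-> gls_from a0 l 1 lam.
  by split=> [[h1 h2]|[h1 h2]]; split=> //; [apply/(H 0 h1); exact: h2|apply/(H 0 h1)].
elim: l a0 => // x l IH a0 _; case: l IH => [_|y l IH].
  rewrite /= andbT; split=> [[h1 [h2 [h3 [_ h5]]]]|[h1 h2 h3 _ h4]].
    by rewrite h2; split=> //; [rewrite -h2|exact: (h3 0%N isT)].
  by rewrite h4 in h1 h3 *; split=> //; split=> //; split=> [[]|].
have E := IH x.2 isT.
split=> [[h1 [h2 [h3 [h4 h5]]]]|[h1 h2 h3 h4 /E[h5 [h6 [h7 [h8 h9]]]]]].
  have /andP[h11 h12] : (a0 < x.2) && path <%R x.2 (map snd (y :: l)) := h1.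
  split=> //; [exact: (h3 0%N isT)|exact: (h4 0%N isT).2|exact: (h4 0%N isT).1|].
  apply/E; split=> //; split=> //; split; first by move=> s; exact: (h3 s.+1).
  by split=> // s; exact: (h4 s.+1).
split; first by apply/andP; split.
split=> //; split; first by case=> //= s; exact: h7.
by split=> //; case=> //= s; exact: h8.
Qed.

Theorem BsetP b : Bset D lam b <-> exists l, wg 0 l 1 lam /\ forall u : I01 R, b u = ev 0 l (val u).
Proof.
split=> [[l [/sg_gls[_ /sg_wg w] ->]]|[l [/wg_sg[l' [s _ e]] eb]]].
  by exists l; split=> // u; rewrite gls_fun_ev.
exists l'; split; first by apply/sg_gls; split=> //; case: l' s {e} => //= e; move: (@ltr01 R); rewrite e ltxx.
by apply/funext => u; rewrite gls_fun_ev e eb.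
Qed.

End WeakStrict.

(** * Root operators computed from the shape of a height *)

Section Operators.
Variables (R : realType) (V : lmodType R) (J : eqType) (a : J -> J -> int)
    (alpha : J -> V) (coroot : J -> V -> R).
Hypothesis hA : adm a alpha coroot.
Local Notation D := (@RDat R V J a alpha coroot).
Local Notation re := (@is_real R V D).
Implicit Types (i : J) (b : rpath V) (m p q t : R) (u : I01 R).

(** Paths are indexed by the subtype of the unit interval; [cl] turns their heights into functions
    on [R], as the Lipschitz lemmas require. *)
Definition cl t : I01 R := exist _ (clamp t) (clamp01 t).

Lemma cl_val u : cl (val u) = u.
Proof. by apply: val_inj; rewrite /= clamp_id//; exact: (svalP u). Qed.

Lemma val_cl t : 0 <= t <= 1 -> val (cl t) = t.
Proof. exact: clamp_id. Qed.

Definition hf i b t : R := coroot i (b (cl t)).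

Lemma hfE i b t : hf i b t = coroot i (b (cl t)). Proof. by []. Qed.

Lemma HfE i b u : @Hf R V D i b u = hf i b (val u).
Proof. by rewrite /hf cl_val. Qed.

Lemma val01 u : 0 <= val u <= 1. Proof. exact: (svalP u). Qed.

Lemma sup_max (A : set R) x : A x -> (forall y, A y -> y <= x) -> sup A = x.
Proof.
move=> Ax H; apply/eqP; rewrite eq_le; apply/andP; split.
  by apply: ge_sup => //; exists x.
by apply: ub_le_sup => //; exists x => y /H.
Qed.

Lemma inf_min (A : set R) x : A x -> (forall y, A y -> x <= y) -> inf A = x.
Proof.
move=> Ax H; apply/eqP; rewrite eq_le; apply/andP; split; last by apply: lb_le_inf => //; exists x.
by apply: ge_inf => //; exists x => y /H.
Qed.

(** When the true minimum is integral it agrees with [mmin], the infimum of the integral values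
    only. *)
Definition has_min i b m := [/\ m \is a Num.int, exists2 t, 0 <= t <= 1 & hf i b t = m &
  forall t, 0 <= t <= 1 -> m <= hf i b t].

Lemma mmin_eq i b m : has_min i b m -> @mmin R V D i b = m.
Proof.
move=> [/intrP[z ez] [t ht et] H]; apply: inf_min.
  by exists (cl t); split; [exact: et|exists z].
by move=> y [u [<- _]]; rewrite HfE; exact: H (val01 u).
Qed.

Lemma fstr_min i b m p q : m \is a Num.int -> fstr (hf i b) m p q -> has_min i b m.
Proof.
move=> im [p0 pq q1 [hp hq h1 h2 h3]]; split=> //; first by exists p => //; lra.
move=> t /andP[t0 t1]; have [tp|pt] := leP t p; first by apply: h1; rewrite t0.
have [tq|qt] := leP t q; first by rewrite -hp ltW// h2.
by have := h3 t; rewrite (ltW qt) t1 => /(_ isT); lra.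
Qed.

Lemma estr_min i b m p q : m \is a Num.int -> estr (hf i b) m p q -> has_min i b m.
Proof.
move=> im [p0 pq q1 [hp hq h1 h2 h3]]; split=> //; first by exists q => //; lra.
move=> t /andP[t0 t1]; have [tp|pt] := leP t p.
  by have := h1 t; rewrite t0 tp => /(_ isT); lra.
have [qt|tq] := leP q t; first by apply: h3; rewrite qt.
by rewrite -hq ltW// h2// ltW.
Qed.

Lemma froot_fstr i b m p q : m \is a Num.int -> fstr (hf i b) m p q ->
  @froot R V D i b = Some (fun u => b u - th (hf i b) m p q (val u) *: alpha i).
Proof.
move=> im hs; have hm := fstr_min im hs; have em := mmin_eq hm.
case: (hs) => p0 pq q1 [hp hq h1 h2 h3].
have p1 : p <= 1 by lra.
have fp : @fplus R V D i b = p.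
  apply: sup_max; first by exists (cl p); rewrite val_cl ?p0// em.
  move=> _ [u [<-]]; rewrite em HfE => e; rewrite leNgt; apply/negP => pu.
  have /andP[_ u1] := val01 u; have [uq|qu] := leP (val u) q.
    by have := h2 _ _ (lexx p) pu uq; rewrite e hp ltxx.
  by have := h3 (val u); rewrite (ltW qu) u1 => /(_ isT); rewrite e; lra.
have fm : @fminus R V D i b = q.
  apply: inf_min.
    by exists (cl q); rewrite fp em val_cl; [split=> //; split=> //; exact: ltW|lra].
  move=> _ [u [<- []]]; rewrite fp em HfE => pu e; rewrite leNgt; apply/negP => uq.
  by have := h2 _ _ pu uq (lexx q); rewrite e hq ltxx.
rewrite /froot fp fm em; case: ifP => [/eqP e|_]; first by exfalso; lra.
congr Some; apply/funext => u; rewrite /th HfE.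
by case: ifP => _; [rewrite scale0r subr0|case: ifP => _ //; rewrite scale1r].
Qed.

Lemma froot_none i b m : has_min i b m -> hf i b 1 = m -> @froot R V D i b = None.
Proof.
move=> hm e; have em := mmin_eq hm; rewrite /froot.
suff -> : @fplus R V D i b = 1 by rewrite eqxx.
apply: sup_max; first by exists (cl 1); rewrite val_cl ?ler01 ?lexx// em.
by move=> _ [u [<- _]]; have /andP[] := val01 u.
Qed.

Definition eth (h : R -> R) m p q t := if t <= p then 0 else if t <= q then m + 1 - h t else 1.

Lemma eroot_estr i b m p q : m \is a Num.int -> estr (hf i b) m p q ->
  @eroot_re R V D i b = Some (fun u => b u + eth (hf i b) m p q (val u) *: alpha i).
Proof.
move=> im hs; have hm := estr_min im hs; have em := mmin_eq hm.
case: (hs) => p0 pq q1 [hp hq h1 h2 h3].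
have p1 : p <= 1 by lra.
have fp : @eplus R V D i b = q.
  apply: inf_min; first by exists (cl q); rewrite val_cl ?em//; lra.
  move=> _ [u [<-]]; rewrite em HfE => e; rewrite leNgt; apply/negP => uq.
  have /andP[u0 _] := val01 u; have [pu|up] := leP p (val u).
    by have := h2 _ _ pu uq (lexx q); rewrite e hq ltxx.
  by have := h1 (val u); rewrite (ltW up) u0 => /(_ isT); rewrite e; lra.
have fm : @eminus R V D i b = p.
  apply: sup_max.
    by exists (cl p); rewrite fp em val_cl; [split=> //; split=> //; exact: ltW|lra].
  move=> _ [u [<- []]]; rewrite fp em HfE => uq e; rewrite leNgt; apply/negP => pu.
  by have := h2 _ _ (lexx p) pu uq; rewrite e hp ltxx.
rewrite /eroot_re fp fm em; case: ifP => [/eqP e|_]; first by exfalso; lra.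
congr Some; apply/funext => u; rewrite /eth HfE.
case: ifP => _; first by rewrite scale0r addr0.
case: ifP => _; last by rewrite scale1r.
by rewrite -scaleNr; congr (_ + _ *: _); ring.
Qed.

Lemma eroot_none i b : has_min i b 0 -> hf i b 0 = 0 -> @eroot_re R V D i b = None.
Proof.
move=> hm e; have em := mmin_eq hm; rewrite /eroot_re.
suff -> : @eplus R V D i b = 0 by rewrite eqxx.
apply: inf_min; first by exists (cl 0); rewrite val_cl ?ler01 ?lexx// em.
by move=> _ [u [<- _]]; have /andP[] := val01 u.
Qed.

Lemma hf_shift i b (g : R -> R) k t : re i -> 0 <= t <= 1 ->
  hf i (fun u => b u + (k * g (val u)) *: alpha i) t = hf i b t + 2 * k * g t.
Proof.
move=> /re_aii ri ht; rewrite /hf (crD hA) (crZ hA) (adm_al hA) ri val_cl//.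
by congr (_ + _); ring.
Qed.

Lemma f_then_e i b m p q : re i -> m \is a Num.int -> fstr (hf i b) m p q ->
  let b' := fun u => b u - th (hf i b) m p q (val u) *: alpha i in
  estr (hf i b') (m - 1) p q /\ @eroot_re R V D i b' = Some b.
Proof.
move=> ri im hs b'.
have hb' t : 0 <= t <= 1 -> hf i b' t = hf i b t - 2 * th (hf i b) m p q t.
  move=> ht; rewrite -(mulN1r (2 * _)) mulrA -[(-1) * 2]mulrC -(hf_shift b _ (-1) ri)//.
  by rewrite /b' /hf mulN1r scaleNr.
case: (hs) => p0 pq q1 [hp hq h1 h2 h3].
have A t : 0 <= t -> t <= p -> hf i b' t = hf i b t.
  by move=> t0 tp; rewrite hb' /th ?tp; lra.
have B t : p <= t -> t <= q -> hf i b' t = 2 * m - hf i b t.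
  move=> pt tq; rewrite hb' /th ?tq; last by lra.
  by case: ifP => tp; [have -> : t = p by lra|]; rewrite ?hp; ring.
have C t : q <= t -> t <= 1 -> hf i b' t = hf i b t - 2.
  move=> qt t1; rewrite hb' /th; last by lra.
  have -> : (t <= p) = false by apply/negbTE; rewrite -ltNge; lra.
  by case: ifP => tq; [have -> : t = q by lra|]; rewrite ?hq; ring.
have es : estr (hf i b') (m - 1) p q.
  split=> //; split.
  - by rewrite (A p p0 (lexx p)) hp; ring.
  - by rewrite (B q (ltW pq) (lexx q)) hq; ring.
  - by move=> t /andP[t0 tp]; rewrite A// subrK h1 ?t0.
  - by move=> s t ps st tq; have := h2 s t ps st tq; rewrite !B; lra.
  - by move=> t /andP[qt t1]; have := h3 t; rewrite qt t1 C// => /(_ isT); lra.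
split=> //; rewrite (eroot_estr _ es) ?rpredB ?int_num1//; congr Some; apply/funext => u.
rewrite /b' -[RHS]addr0 -addrA; congr (_ + _); rewrite addrC -scalerBl.
rewrite (_ : _ - _ = 0) ?scale0r// /th /eth; case: ifP => [_|up]; first by rewrite subrr.
have pu : p <= val u by move: up => /negbT; rewrite -ltNge => /ltW.
by case: ifP => uq; [rewrite B//; ring|rewrite subrr].
Qed.

Lemma e_then_f i b m p q : re i -> m \is a Num.int -> estr (hf i b) m p q ->
  let b' := fun u => b u + eth (hf i b) m p q (val u) *: alpha i in
  fstr (hf i b') (m + 1) p q /\ @froot R V D i b' = Some b.
Proof.
move=> ri im hs b'.
have hb' t : 0 <= t <= 1 -> hf i b' t = hf i b t + 2 * eth (hf i b) m p q t.
  by move=> ht; rewrite -[2]mulr1 -(hf_shift b _ 1 ri)// /b' /hf mul1r.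
case: (hs) => p0 pq q1 [hp hq h1 h2 h3].
have A t : 0 <= t -> t <= p -> hf i b' t = hf i b t.
  by move=> t0 tp; rewrite hb' /eth ?tp; lra.
have B t : p <= t -> t <= q -> hf i b' t = 2 * m + 2 - hf i b t.
  move=> pt tq; rewrite hb' /eth ?tq; last by lra.
  by case: ifP => tp; [have -> : t = p by lra|]; rewrite ?hp; ring.
have C t : q <= t -> t <= 1 -> hf i b' t = hf i b t + 2.
  move=> qt t1; rewrite hb' /eth; last by lra.
  have -> : (t <= p) = false by apply/negbTE; rewrite -ltNge; lra.
  by case: ifP => tq; [have -> : t = q by lra|]; rewrite ?hq; ring.
have es : fstr (hf i b') (m + 1) p q.
  split=> //; split.
  - by rewrite (A p p0 (lexx p)) hp; ring.
  - by rewrite (B q (ltW pq) (lexx q)) hq; ring.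
  - by move=> t /andP[t0 tp]; rewrite A// h1 ?t0.
  - by move=> s t ps st tq; have := h2 s t ps st tq; rewrite !B; lra.
  - by move=> t /andP[qt t1]; have := h3 t; rewrite qt t1 C// => /(_ isT); lra.
split=> //; rewrite (froot_fstr _ es) ?rpredD ?int_num1//; congr Some; apply/funext => u.
rewrite /b' -[RHS]addr0 -addrA; congr (_ + _); rewrite -scalerBl.
rewrite (_ : _ - _ = 0) ?scale0r// /th /eth; case: ifP => [_|up]; first by rewrite subrr.
have pu : p <= val u by move: up => /negbT; rewrite -ltNge => /ltW.
by case: ifP => uq; [rewrite B//; ring|rewrite subrr].
Qed.

(** The bridge from root operators to Pitman transforms: one application of [e_i] clips at the level
    one above the minimum. *)
Lemma eth_clip (h : R -> R) m p q t : lip h -> estr h m p q -> 0 <= t <= 1 ->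
  eth h m p q t = - clip h (- m - 1) t.
Proof.
move=> hl [p0 pq q1 [hp hq h1 h2 h3]] /andP[t0 t1]; rewrite /eth /clip.
case: ifP => [tp|/negbT]; last rewrite -ltNge => pt.
  rewrite (min_idPl _) ?oppr0//.
  have : m + 1 <= mn h 0 t by apply: mn_ge => // v /andP[v0 vt]; apply: h1; lra.
  lra.
have low v : 0 <= v -> v <= t -> t <= q -> h t <= h v.
  move=> v0 vt tq; have [vp|pv] := leP v p.
    by have := h1 v; have := h2 p t; rewrite v0 vp => /(_ (lexx _) pt tq) h4 /(_ isT); lra.
  by move: vt; rewrite le_eqVlt => /orP[/eqP ->//|vt]; apply/ltW/h2 => //; exact: ltW.
case: ifP => [tq|/negbT]; last rewrite -ltNge => qt.
  have -> : mn h 0 t = h t.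
    by apply: mn_eq => // [v /andP[v0 vt]|]; [exact: low|exists t; rewrite ?t0 ?lexx].
  by have h4 := h2 p t (lexx _) pt tq; rewrite (min_idPr _); lra.
have -> : mn h 0 t = m.
  apply: mn_eq => // [v /andP[v0 vt]|]; last by exists q; rewrite ?hq//; lra.
  have [vq|qv] := leP v q; last by apply: h3; lra.
  have [vp|pv] := leP v p; first by have := h1 v; rewrite v0 vp => /(_ isT); lra.
  by rewrite -hq; move: vq; rewrite le_eqVlt => /orP[/eqP ->//|vq]; apply/ltW/h2 => //; exact: ltW.
by rewrite (min_idPr _); lra.
Qed.

End Operators.

(** * GLS paths are stable under the root operators *)

Section Stability.
Variables (R : realType) (V : lmodType R) (J : eqType) (a : J -> J -> int)
    (alpha : J -> V) (coroot : J -> V -> R).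
Hypothesis hA : adm a alpha coroot.
Local Notation D := (@RDat R V J a alpha coroot).
Local Notation rf := (@refl R V D).
Local Notation re := (@is_real R V D).
Local Notation root_of := (@root_of R V D).
Local Notation corootf := (@corootf R V D).
Local Notation rrefl := (@rrefl R V D).
Local Notation orbit := (@orbit R V D).
Local Notation sumr := (sumr alpha).
Local Notation rd := (@root_data R V D).
Variable lam : V.
Hypothesis lam_nat : forall i, exists n : nat, coroot i lam = n%:R.
Local Notation arrow := (@arrow R V D lam).
Local Notation achain := (@achain R V D lam).
Local Notation wg := (@wg R V J a alpha coroot lam).
Local Notation B := (@Bset R V D lam).
Local Notation hf := (hf coroot).
Local Notation froot := (@froot R V D).
Implicit Types (i j : J) (d e v : V) (p q t k m : R) (l : seq (V * R)) (b : rpath V).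
Local Notation H i a0 l t := (coroot i (ev a0 l t)).

Lemma eq_fstr (h h' : R -> R) m p q : (forall t, 0 <= t <= 1 -> h t = h' t) -> fstr h m p q -> fstr h' m p q.
Proof.
move=> e [p0 pq q1 [hp hq h1 h2 h3]]; split=> //; split.
- by rewrite -e ?hp//; lra.
- by rewrite -e ?hq//; lra.
- by move=> t ht; rewrite -e ?h1//; lra.
- by move=> s t ps st tq; rewrite -!e ?h2//; lra.
- by move=> t ht; rewrite -e ?h3//; lra.
Qed.

Lemma eq_estr (h h' : R -> R) m p q : (forall t, 0 <= t <= 1 -> h t = h' t) -> estr h m p q -> estr h' m p q.
Proof.
move=> e [p0 pq q1 [hp hq h1 h2 h3]]; split=> //; split.
- by rewrite -e ?hp//; lra.
- by rewrite -e ?hq//; lra.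
- by move=> t ht; rewrite -e ?h1//; lra.
- by move=> s t ps st tq; rewrite -!e ?h2//; lra.
- by move=> t ht; rewrite -e ?h3//; lra.
Qed.

Lemma eq_lip (h h' : R -> R) : (forall t, 0 <= t <= 1 -> h t = h' t) -> lip h -> lip h'.
Proof. by move=> e [K K0 hK]; exists K => // s t hs ht; rewrite -!e//; exact: hK. Qed.

Lemma hf_ev i b l : (forall u : I01 R, b u = ev 0 l (val u)) -> forall t, 0 <= t <= 1 -> H i 0 l t = hf i b t.
Proof. by move=> e t ht; rewrite !hfE e val_cl. Qed.

Lemma B_lip i b : B b -> lip (hf i b) /\ hf i b 0 = 0.
Proof.
move=> /BsetP[l [w e]]; have hh := hf_ev i e; split.
  by apply: (eq_lip hh); exact: (lip_ev hA i 0 l).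
by rewrite -hh ?lexx ?ler01// (ev_before w)// (cr0 hA).
Qed.

Lemma B_int i b : B b -> hf i b 1 \is a Num.int.
Proof.
move=> /BsetP[l [w e]]; rewrite -(hf_ev i e) ?lexx ?ler01//.
by rewrite (wg_int hA i w) mul1r (lam_int lam_nat).
Qed.

Lemma B_real i b : re i -> B b -> exists m, [/\ has_min coroot i b m, m <= 0,
  hf i b 1 <> m -> exists p q, fstr (hf i b) m p q /\ B (fun u => b u - th (hf i b) m p q (val u) *: alpha i) &
  m <> 0 -> exists p q, estr (hf i b) m p q /\ B (fun u => b u + eth (hf i b) m p q (val u) *: alpha i)].
Proof.
move=> ri /BsetP[l [w e]]; have hh := hf_ev i e.
have [m [im m0 ma mb]] := real_min hA lam_nat ri w.
exists m; split=> //.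
- by split=> // [|t ht]; [have [t ht et] := ma; exists t; rewrite // -hh|rewrite -hh ?mb].
- rewrite -hh ?ler01 ?lexx// => /(real_f hA lam_nat ri w im mb ma)[p [q [hs [l' [w' e']]]]].
  exists p, q; split; first exact: (eq_fstr hh).
  apply/BsetP; exists l'; split=> // u; have hu := val01 u.
  by rewrite e'// e /th hh.
move=> /(real_e hA lam_nat ri w im mb ma)[p [q [hs [l' [w' e']]]]].
exists p, q; split; first exact: (eq_estr hh).
apply/BsetP; exists l'; split=> // u; have hu := val01 u.
by rewrite e'// e /eth hh.
Qed.

Lemma im_sumr_le0 i (s : seq J) : ~~ re i -> coroot i (sumr s) <= 0.
Proof.
move=> ni; elim: s => [|j s IH]; first by rewrite sumr_nil (cr0 hA).
rewrite sumr_cons (crD hA) (adm_al hA).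
have : a i j <= 0 by have [->|ij] := eqVneq j i; [exact: im_aii hA _ ni|apply: (adm_off hA); rewrite eq_sym].
by rewrite -(lerz0 R); lra.
Qed.

(** Every root pairs with an imaginary coroot in an integer at most 0, so slopes only drop as time
    passes. If the slope changes, the scaled step is at least 1 in absolute value, so the product of
    time and slope before the break is at least 1. *)
Lemma arrow_im i k x y : ~~ re i -> 0 < k -> arrow k x y ->
  coroot i y <= coroot i x /\ (coroot i y = coroot i x \/ 1 <= k * coroot i x).
Proof.
move=> ni k0 ar; have [ox oy] := arrow_orb ar; case: ar => cv [w [j [rdj [ex [pos hk]]]]].
have [s s0 es] := rd_pos hA rdj; have := im_sumr_le0 s ni; rewrite -es => hb.
have ec : coroot i x = coroot i y - corootf w j y * coroot i (root_of w j).
  by rewrite ex (rreflE hA) ?(crB hA) ?(crZ hA)//; case: rdj.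
have y0 := orbit_im hA lam_nat oy ni.
split; first by rewrite ec; have : corootf w j y * coroot i (root_of w j) <= 0 by [apply: mulr_ge0_le0 => //; exact: ltW]; lra.
move: hb; rewrite le_eqVlt => /orP[/eqP z|hb]; first by left; rewrite ec z mulr0 subr0.
right; have [z ez] := root_int hA j i rdj.1.
have z1 : coroot i (root_of w j) <= -1 by move: hb; rewrite ez ltrz0 -[-1]/((-1)%:~R) ler_int => ?; lia.
have k1 : 1 <= k * corootf w j y.
  by move: hk; case: ifP => _ [n]; [move=> [n0 ->]; rewrite ler1n|rewrite n].
rewrite ec mulrBr mulrA; have : 0 <= k * coroot i y by apply: mulr_ge0 => //; exact: ltW.
by nra.
Qed.

Lemma chain_im i k x y : ~~ re i -> 0 < k -> achain k x y ->
  coroot i y <= coroot i x /\ (coroot i y = coroot i x \/ 1 <= k * coroot i x).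
Proof.
move=> ni k0; elim=> [v|x' z y' ar _ [IH1 IH2]]; first by split=> //; left.
have [h1 h2] := arrow_im ni k0 ar; split; first exact: le_trans h1.
by case: h2 => [h2|]; [rewrite -h2|right].
Qed.

Lemma arrow_im_rf i k x y : ~~ re i -> arrow k x y -> coroot i x = coroot i y -> arrow k (rf i x) (rf i y).
Proof.
move=> ni [cv [w [j [rdj [ex [pos hk]]]]]] e.
split; first exact: (im_cover hA lam_nat).
have rw := rdj.1.
have hb : coroot i (root_of w j) = 0.
  have : corootf w j y * coroot i (root_of w j) = 0 by move: e; rewrite ex (rreflE hA)// (crB hA) (crZ hA); lra.
  by move=> /eqP; rewrite mulf_eq0 gt_eqF//= => /eqP.
have c0 := coroot_sym hA hb.
have ecr : corootf w j (rf i y) = corootf w j y.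
  by rewrite rfE -scaleNr (corootfD hA) (corootfZ hA) c0 mulr0 addr0.
exists w, j; rewrite ecr; split=> //; split=> //.
by rewrite (rreflE hA)// ecr rfE e ex (rreflE hA)// rfE addrAC.
Qed.

Lemma chain_im_rf i k x y : ~~ re i -> 0 < k -> achain k x y -> coroot i x = coroot i y -> achain k (rf i x) (rf i y).
Proof.
move=> ni k0; elim=> [v|x' z y' ar ch IH] e; first exact: achain_nil.
have [h1 _] := arrow_im ni k0 ar; have [h2 _] := chain_im ni k0 ch.
have e1 : coroot i x' = coroot i z by lra.
by apply: (achain_cons (arrow_im_rf ni ar e1)); apply: IH; lra.
Qed.

Lemma im_mono i a0 l a1 e t : ~~ re i -> 0 <= a0 -> wg a0 l a1 e ->
  a0 <= t -> t <= a1 -> H i a0 l t <= (t - a0) * coroot i (hdir e l).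
Proof.
move=> ni; elim: l a0 => [|x l IH] a0 p0 w t0 t1.
  move: w => /= w; have ta : t = a0 by lra. rewrite ta (cr0 hA) subrr mul0r. by [].
have [ax ox cx w'] := w; have [tx|xt] := leP t x.2; first by rewrite (H1 hA i w).
have x0 : 0 < x.2 by lra.
have [h1 _] := chain_im ni x0 cx.
rewrite (H2 hA) ?(ltW xt)//; have := IH _ (ltW x0) w' (ltW xt) t1.
have : (t - x.2) * coroot i (hdir e l) <= (t - x.2) * coroot i x.1 by rewrite ler_wpM2l// ; lra.
rewrite /=; lra.
Qed.

Lemma im_incr i a0 l a1 e : ~~ re i -> wg a0 l a1 e ->
  forall s t, a0 <= s -> s <= t -> t <= a1 -> H i a0 l s <= H i a0 l t.
Proof.
move=> ni; elim: l a0 => [|x l IH] a0 w s t s0 st t1 //.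
have [ax ox cx w'] := w; have xpos := orbit_im hA lam_nat ox ni.
have [tx|xt] := leP t x.2.
  by rewrite !(H1 hA i w) ?ler_wpM2r//; lra.
rewrite [leRHS](H2 hA) ?(ltW xt)//; have [sx|xs] := leP s x.2; last first.
  by rewrite (H2 hA) ?(ltW xs)// lerD2l; apply: (IH _ w') => //; exact: ltW.
rewrite (H1 hA i w)//; have := IH _ w' x.2 t (lexx _) (ltW xt) t1.
rewrite (ev_before w')// (cr0 hA); have : (s - a0) * coroot i x.1 <= (x.2 - a0) * coroot i x.1 by rewrite ler_wpM2r//; lra.
lra.
Qed.

(* before the height reaches [1], the [i]-slope of a GLS path is constant *)
Lemma im_slopes i a0 l a1 e : ~~ re i -> 0 <= a0 -> wg a0 l a1 e ->
  a1 * coroot i (hdir e l) = 1 -> forall x : V * R, x \in l -> coroot i x.1 = coroot i (hdir e l).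
Proof.
move=> ni; elim: l a0 => // x l IH a0 p0 [ax ox cx w] h1 y; rewrite inE => /orP[/eqP ->//|yl].
move: h1 => /= h1; case: l w cx IH yl => // z l w cx IH yl; have x0 : 0 < x.2 by lra.
have zpos : 0 <= coroot i z.1 by have [_ oz _ _] := w; exact: (orbit_im hA lam_nat oz ni).
have xa := wg_lt w; have xpos : 0 < coroot i x.1.
  have := orbit_im hA lam_nat ox ni; rewrite le_eqVlt => /orP[/eqP x00|//].
  by move: h1; rewrite -x00 mulr0 => /eqP; rewrite eq_sym oner_eq0.
have [_ [e1|e1]] := chain_im ni x0 cx; last first.
  exfalso; have : x.2 * coroot i x.1 < a1 * coroot i x.1 by rewrite ltr_pM2r.
  by lra.
rewrite /= in e1 *; rewrite -e1; apply: (IH x.2) => //; first exact: ltW.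
by rewrite /= e1.
Qed.

Lemma wg_refl_im i a0 l a1 e e' : ~~ re i -> 0 <= a0 -> wg a0 l a1 e ->
  (forall x y : V * R, x \in l -> y \in l -> coroot i x.1 = coroot i y.1) ->
  (forall d, l <> [::] -> achain a1 d e -> orbit lam d -> d = last e (map fst l) -> achain a1 (rf i d) e') ->
  wg a0 [seq (rf i x.1, x.2) | x <- l] a1 e'.
Proof.
move=> ni; elim: l a0 => //= x l IH a0 p0 [h o c w] eqs he.
split=> //; first exact: orbit_step; last first.
  apply: IH => //; first by lra.
    by move=> y z yl zl; apply: eqs; rewrite inE ?yl ?zl orbT.
  by move=> d ln cd od ed; apply: he => //; rewrite ed; case: (l) ln.
case: l w c eqs he {IH} => /= [e1|y l [_ oy _ _]] c eqs he.
  by rewrite e1 in c *; exact: he.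
have x0 : 0 < x.2 by lra.
by apply: chain_im_rf => //; apply: eqs; rewrite !inE eqxx ?orbT.
Qed.

(** The height is nondecreasing. If the initial slope is 0, it vanishes throughout. Otherwise the
    initial slope [n] is a positive integer and stays constant until the height is 1 ([im_slopes]),
    so the operator reflects exactly the interval from 0 to [q = 1 / n]; the condition [q * n = 1]
    is the one required of an imaginary arrow. *)
Theorem B_im i b : ~~ re i -> B b ->
  (forall t, 0 <= t <= 1 -> hf i b t = 0) \/
  exists q, fstr (hf i b) 0 0 q /\ B (fun u => b u - th (hf i b) 0 0 q (val u) *: alpha i) /\
    (forall t, 0 <= t <= q -> hf i b t = t / q) /\
    (forall s t, 0 <= s -> s <= t -> t <= 1 -> hf i b s <= hf i b t).
Proof.
move=> ni /BsetP[l [w e]]; have hh := hf_ev i e; set n := coroot i (hdir lam l).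
have olam := orbit_base D lam.
have on := hdir_orb w olam; have := orbit_im hA lam_nat on ni; rewrite -/n le_eqVlt => /orP[/eqP n0|n0].
  left=> t ht; have /andP[t0 t1] := ht; apply/eqP; rewrite eq_le -hh//; apply/andP; split.
    by have := im_mono ni (lexx 0) w t0 t1; rewrite -/n -n0 mulr0.
  by have := im_incr ni w (lexx 0) t0 t1; rewrite (ev_before w)// (cr0 hA).
right; have [z ez] := orbit_int hA lam_nat i on; rewrite -/n in ez.
have n1 : 1 <= n by move: n0; rewrite ez ltr0z -[1]/(1%:~R) ler_int => ?; lia.
set q := n^-1; have q0 : 0 < q by rewrite invr_gt0.
have q1 : q <= 1 by rewrite invf_le1.
have qn : q * n = 1 by rewrite mulVf// gt_eqF.
have [l1 [l2 [w1 w2 e3 e2]]] := wg_split w (ltW q0) q1.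
have [x [l1' el1]] := wg_ne w1 q0.
have hd1 : hdir (hdir lam l2) l1 = hdir lam l by rewrite -hdir_cat.
have sl (y : V * R) : y \in l1 -> coroot i y.1 = n.
  move=> yl; rewrite /n -hd1; apply: (im_slopes ni (lexx 0) w1) => //.
  by rewrite hd1.
have w1' : wg 0 [seq (rf i x.1, x.2) | x <- l1] q (hdir lam l2).
  apply: (wg_refl_im ni (lexx 0) w1) => [y y' /sl -> /sl ->//|d ln cd od ed].
  apply: (achain_trans _ cd); apply: achain1.
  have dn : coroot i d = n.
    rewrite ed el1 -(sl (last x l1')) ?el1 ?mem_last//=; congr (coroot i _).
    by elim: (l1') x {el1} => //= y s IH x; rewrite IH.
  by apply: (arrow_simple hA lam_nat); rewrite ?dn// (negbTE ni) qn.
have e2' s : ev 0 l s = ev 0 ([::] ++ l1 ++ l2) s by rewrite e2 /= (ev_cat _ _ w1).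
have w0 : wg 0 [::] 0 (hdir lam (l1 ++ l2)) by [].
have w0' : wg 0 [::] 0 (hdir lam [seq (rf i x.1, x.2) | x <- l1]) by [].
have [l' [wl' el']] := replace_mid (i := i) hA (lexx 0) q0 q1 w0 w1 w2 e2' w0' w1'.
have lin t : 0 <= t -> t <= q -> H i 0 l t = t * n.
  move=> t0 tq; rewrite e2 (ev_before w2 tq) addr0.
  suff K : forall a0 l0 e0, wg a0 l0 q e0 -> (forall y : V * R, y \in l0 -> coroot i y.1 = n) -> a0 <= t -> H i a0 l0 t = (t - a0) * n.
    by rewrite (K _ _ _ w1 sl t0) subr0.
  move=> a0 l0 e0; elim: l0 a0 => [|y l0 IH] a0 w3 sl0 a0t.
    by move: w3 => /= w3; have ta : t = a0 by [lra]; rewrite ta (cr0 hA) subrr mul0r.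
  have [ay _ _ w4] := w3; have ey := sl0 y (mem_head _ _).
  have [ty|yt] := leP t y.2; first by rewrite (H1 hA i w3)// ey.
  rewrite (H2 hA) ?(ltW yt)// (IH _ w4) ?(ltW yt)// ?ey; first by ring.
  by move=> y' yl; apply: sl0; rewrite inE yl orbT.
have h00 : H i 0 l 0 = 0 by rewrite lin ?mul0r// ltW.
have hq : H i 0 l q = 1 by rewrite lin ?qn// ltW.
have fs : fstr (hf i b) 0 0 q.
  apply: (eq_fstr hh); split=> //; split=> //.
  - by rewrite hq add0r.
  - by move=> t ht; have t0 : t = 0 by [lra]; rewrite t0 h00.
  - by move=> s t s0 st tq; rewrite !lin ?ltr_pM2r//; lra.
  - by move=> t /andP[qt t1]; rewrite add0r -hq; apply: (im_incr ni w) => //; exact: ltW.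
exists q; split=> //; split; last split.
- apply/BsetP; exists l'; split=> // u; have hu := val01 u.
  by rewrite el'// e /th h00 hq !subr0 hh.
- by move=> t /andP[t0 tq]; rewrite -hh ?lin /q ?invrK//; lra.
by move=> s t s0 st t1; rewrite -!hh; [apply: (im_incr ni w)|lra|lra].
Qed.

End Stability.

(** * Imaginary raising, and generation from the straight path *)

Section Words.
Variables (R : realType) (V : lmodType R) (J : eqType) (a : J -> J -> int)
    (alpha : J -> V) (coroot : J -> V -> R).
Hypothesis hA : adm a alpha coroot.
Local Notation D := (@RDat R V J a alpha coroot).
Local Notation rf := (@refl R V D).
Local Notation re := (@is_real R V D).
Local Notation root_of := (@root_of R V D).
Local Notation corootf := (@corootf R V D).
Local Notation rrefl := (@rrefl R V D).
Local Notation orbit := (@orbit R V D).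
Local Notation sumr := (sumr alpha).
Local Notation rd := (@root_data R V D).
Variable lam : V.
Hypothesis lam_nat : forall i, exists n : nat, coroot i lam = n%:R.
Local Notation arrow := (@arrow R V D lam).
Local Notation achain := (@achain R V D lam).
Local Notation wg := (@wg R V J a alpha coroot lam).
Local Notation B := (@Bset R V D lam).
Local Notation hf := (hf coroot).
Local Notation froot := (@froot R V D).
Local Notation eroot_im := (@eroot_im R V D).
Implicit Types (i j : J) (d e v : V) (p t k m : R) (l : seq (V * R)) (b : rpath V).
Local Notation H i a0 l t := (coroot i (ev a0 l t)).

Lemma th_end (h : R -> R) m p q : fstr h m p q -> th h m p q 1 = 1.
Proof.
move=> [p0 pq q1 [hp hq _ _ _]]; rewrite /th; have -> : (1 <= p) = false by apply/negbTE; rewrite -ltNge; lra.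
case: ifP => // q1'; have eq : q = 1 by lra.
by rewrite -{1}eq hq addrAC subrr add0r.
Qed.

Lemma B_froot i b b' : B b' -> froot i b' = Some b -> exists m p q,
  [/\ m \is a Num.int, fstr (hf i b') m p q, b = (fun u => b' u - th (hf i b') m p q (val u) *: alpha i) & B b].
Proof.
move=> Bb; have [ri|ni] := boolP (re i).
  have [m [hm m0 hF _]] := B_real hA lam_nat ri Bb.
  have [e|/hF[p [q [hs BB]]]] := pselect (hf i b' 1 = m); first by rewrite (froot_none a alpha hm).
  by have im := let: And3 x _ _ := hm in x; rewrite (froot_fstr a alpha im hs) => -[<-]; exists m, p, q.
have [z|[q [hs [BB _]]]] := B_im hA lam_nat ni Bb.
  rewrite (@froot_none _ _ _ _ _ _ _ _ 0)//; last by rewrite z// ler01 lexx.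
  by split; [exact: rpred0|exists 0; rewrite ?z ?lexx ?ler01|move=> t ht; rewrite z].
by rewrite (froot_fstr a alpha (rpred0 _) hs) => -[<-]; exists 0, 0, q; split=> //; try exact: rpred0.
Qed.

Lemma B_froot_end i b b' : B b' -> froot i b' = Some b -> b (one01 R) = b' (one01 R) - alpha i.
Proof.
by move=> Bb /(B_froot Bb)[m [p [q [_ hs -> _]]]]; rewrite (th_end hs) scale1r.
Qed.

Section ImaginaryE.
Variables (i : J) (b b' : rpath V).
Hypotheses (ni : ~~ re i) (Bb : B b) (Bb' : B b').
Local Notation A := (- (a i i)%:~R : R).

Lemma A0 : 0 <= A. Proof. by rewrite oppr_ge0 lerz0; exact: im_aii hA _ ni. Qed.

Lemma hf_add (c : rpath V) (g : R -> R) t : 0 <= t <= 1 ->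
  hf i (fun u => c u + g (val u) *: alpha i) t = hf i c t - A * g t.
Proof.
by move=> ht; rewrite !hfE (crD hA) (crZ hA) (adm_al hA) val_cl//; ring.
Qed.

(** With [A = - a i i], lowering multiplies the height by [1 + A] up to [q] and adds [A] afterwards.
    So the new height first reaches the threshold [1 - a i i] of the raising operator at the same
    [q] and stays above [- a i i] from there on. *)
Lemma froot_eroot_im : froot i b' = Some b -> eroot_im i b = Some b'.
Proof.
have [z|[q [hs [_ _]]]] := B_im hA lam_nat ni Bb'.
  rewrite (@froot_none _ _ _ _ _ _ _ _ 0)//; last by rewrite z// ler01 lexx.
  by split; [exact: rpred0|exists 0; rewrite ?z ?lexx ?ler01|move=> t ht; rewrite z].
rewrite (froot_fstr a alpha (rpred0 _) hs) => -[eb]; have a0 := A0.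
case: (hs) => _ q0 q1 [h0 hq h1 h2 h3].
have hb t : 0 <= t <= 1 -> hf i b t = hf i b' t + A * th (hf i b') 0 0 q t.
  move=> ht; rewrite -eb; have := hf_add b' (fun s => - th (hf i b') 0 0 q s) ht.
  by rewrite mulrN opprK => <-; congr hf; apply/funext => u; rewrite scaleNr.
have thp t : 0 <= t -> t <= q -> th (hf i b') 0 0 q t = hf i b' t.
  move=> t0 tq; rewrite /th tq subr0; case: ifP => // t00.
  by have -> : t = 0 by [lra]; rewrite h0.
have lo t : 0 <= t -> t <= q -> hf i b t = (1 + A) * hf i b' t.
  by move=> t0 tq; rewrite hb ?thp//; [ring|lra].
have hi t : q < t -> t <= 1 -> hf i b t = hf i b' t + A.
  move=> qt t1; rewrite hb; last by lra.
  rewrite /th; have -> : (t <= 0) = false by apply/negbTE; rewrite -ltNge; lra.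
  by have -> : (t <= q) = false; [apply/negbTE; rewrite -ltNge|rewrite mulr1].
have pos t : 0 < t -> t <= q -> 0 < hf i b' t.
  by move=> t0 tq; have := h2 0 t (lexx _) t0 tq; rewrite h0.
have bq : hf i b q = 1 + A by rewrite (lo q (ltW q0) (lexx q)) hq add0r mulr1.
have b0 : hf i b 0 = 0 by rewrite (lo 0 (lexx 0) (ltW q0)) h0 mulr0.
have hm : has_min coroot i b 0.
  split; [exact: rpred0|by exists 0; rewrite ?b0// lexx ler01|].
  move=> t /andP[t0 t1]; have [tq|qt] := leP t q.
    rewrite lo// mulr_ge0//; first by lra.
    by move: t0; rewrite le_eqVlt => /orP[/eqP <-|t0]; [rewrite h0|rewrite ltW// pos].
  by rewrite hi//; have := h3 t; rewrite (ltW qt) t1 => /(_ isT); lra.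
have em := mmin_eq a alpha hm.
have ep : @fplus R V D i b = 0.
  apply: sup_max; first by exists (cl 0); rewrite val_cl ?lexx ?ler01// em.
  move=> _ [u [<-]]; rewrite em HfE => e; rewrite leNgt; apply/negP => u0.
  have /andP[_ u1] := val01 u; have [uq|qu] := leP (val u) q.
    by move: e; rewrite lo ?(ltW u0)//; have := pos _ u0 uq; nra.
  by move: e; rewrite hi//; have := h3 (val u); rewrite (ltW qu) u1 => /(_ isT); lra.
rewrite /Defs.eroot_im ep em eq_sym oner_eq0 orFb.
have q01 : 0 <= q <= 1 by lra.
case: asboolP => [/(_ (cl q))|_].
  by rewrite HfE val_cl// bq -[@cm R V D i i]/(a i i) => /(_ (ltW q0)); rewrite add0r ltxx.
set S := (X in inf X); have eS : inf S = q.
  apply: inf_min; first by exists (cl q); rewrite HfE val_cl// bq; split=> //; split; [exact: ltW|ring].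
  move=> _ [u [<- []]]; rewrite HfE => u0 e; rewrite leNgt; apply/negP => uq.
  move: e; rewrite lo ?(ltW uq)//; have := h2 _ _ u0 uq (lexx _); rewrite hq; nra.
rewrite eS; case: asboolP => [[u [qu]]|_].
  rewrite HfE; have /andP[_ u1] := val01 u; move: qu; rewrite le_eqVlt => /orP[/eqP <-|qu].
    by rewrite bq -[@cm R V D i i]/(a i i) => hh; exfalso; move: hh; rewrite sub0r gerDr ler10.
  rewrite hi//; have := h3 (val u); rewrite (ltW qu) u1 -[@cm R V D i i]/(a i i) => /(_ isT) k1 k2.
  by exfalso; move: k2; rewrite lerD2r => /(le_trans k1); rewrite add0r ler10.
congr Some; apply/funext => u; have /andP[u0 u1] := val01 u.
rewrite HfE; case: ifP => [u0'|un0].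
  have u00 : val u = 0 by lra.
  by rewrite -eb u00 /th lexx scale0r subr0.
case: ifP => uq.
  rewrite lo// -eb thp// -addrA -scaleNr -scalerDl -[RHS]addr0 subr0.
  have -> : 1 - (a i i)%:~R = 1 + A by [].
  rewrite mulKf ?addNr ?scale0r//; apply: lt0r_neq0; lra.
by rewrite -eb /th un0 uq scale1r subrK.
Qed.

(** Raising divides the height by [1 + A] up to its threshold time, so the new height is 1 there; as
    [b'] is a GLS path, [B_im] identifies this time with the one used by [f_i]. *)
Lemma eroot_im_froot : eroot_im i b = Some b' -> froot i b' = Some b.
Proof.
have a0 := A0; have [hl h00] := B_lip hA i Bb.
have [z|[q0 [hs [_ [_ inc]]]]] := B_im hA lam_nat ni Bb.
  have hm : has_min coroot i b 0.
    by split; [exact: rpred0|exists 0; rewrite ?z ?lexx ?ler01|move=> t ht; rewrite z].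
  rewrite /Defs.eroot_im (mmin_eq a alpha hm).
  have -> : @fplus R V D i b = 1; last by rewrite eqxx.
  apply: sup_max.
    exists (cl 1); rewrite val_cl ?ler01 ?lexx// (mmin_eq a alpha hm); split=> //.
    by apply: z; rewrite ler01 lexx.
  by move=> _ [u [<- _]]; have /andP[] := val01 u.
have hm := fstr_min (rpred0 _) hs; have em := mmin_eq a alpha hm.
case: (hs) => _ q00 q01 [h0 hq h1 h2 h3].
have ep : @fplus R V D i b = 0.
  apply: sup_max; first by exists (cl 0); rewrite val_cl ?lexx ?ler01// em.
  move=> _ [u [<-]]; rewrite em HfE => e; rewrite leNgt; apply/negP => u0.
  have /andP[_ u1] := val01 u; have [uq|qu] := leP (val u) q0.
    by have := h2 _ _ (lexx _) u0 uq; rewrite h0 e ltxx.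
  by have := h3 (val u); rewrite (ltW qu) u1 => /(_ isT); lra.
rewrite /Defs.eroot_im ep em eq_sym oner_eq0 orFb.
case: asboolP => // /existsNP[u0 /not_implyP[_ /negP]]; rewrite -leNgt HfE => hu0.
have hu0' : 1 + A <= hf i b (val u0) by lra.
have [||q /andP[qq0 qq1] [hqq hbq]] := first_hit_strict (y := - (1 + A)) (lip_opp hl) (lexx 0) ler01 (lexx 1).
- by rewrite h00; lra.
- by exists (val u0); [exact: val01|lra].
have {}hqq : hf i b q = 1 + A by lra.
have qpos : 0 < q by rewrite lt_neqAle qq0 andbT; apply/eqP => e; move: hqq; rewrite -e h00; lra.
have q01' : 0 <= q <= 1 by lra.
set S := (X in inf X); have eS : inf S = q.
  apply: inf_min; first by exists (cl q); rewrite HfE val_cl// hqq; split=> //; split=> //; ring.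
  move=> _ [u [<- []]]; rewrite HfE => u1 e; rewrite leNgt; apply/negP => uq.
  by have := hbq _ u1 uq; lra.
rewrite eS; case: asboolP => // _ -[eb'].
have n1 : 1 + A != 0 by apply: lt0r_neq0; lra.
have bE (u : I01 R) : b' u = b u + (if val u <= q then (1 + A)^-1 * hf i b (val u) else 1) *: alpha i.
  rewrite -eb'; cbv beta; rewrite -[coroot i (b u)]/(@Hf R V D i b u) HfE subr0; have /andP[u1 u2] := val01 u; case: ifP => [u3|_].
    have u4 : val u = 0 by apply/eqP; rewrite eq_le u1 andbT; exact: u3.
    by rewrite u4 h00 mulr0 qq0 scale0r addr0.
  by case: ifP => _ //; rewrite scale1r.
have hb' t : 0 <= t <= 1 -> hf i b' t = hf i b t - A * (if t <= q then (1 + A)^-1 * hf i b t else 1).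
  move=> ht; rewrite -(hf_add b (fun s => if s <= q then (1 + A)^-1 * hf i b s else 1) ht).
  by congr hf; apply/funext => u; exact: bE.
have lo t : 0 <= t -> t <= q -> hf i b' t = (1 + A)^-1 * hf i b t.
  by move=> t0 tq; rewrite hb' ?tq; [field|lra].
have b'q : hf i b' q = 1 by rewrite lo ?lexx// hqq mulVf.
have [z|[q' [hs' _]]] := B_im hA lam_nat ni Bb'; first by move: b'q; rewrite z// => /eqP; rewrite eq_sym oner_eq0.
case: (hs') => _ q'0 q'1 [h0' hq' h1' h2' h3'].
have e : q' = q.
  have [lt|lt|//] := ltgtP q' q; last by have := h2' _ _ (ltW qpos) lt (lexx _); rewrite hq' b'q add0r ltxx.
  move: hq'; rewrite lo ?ltW// add0r => e1; have := hbq _ (ltW q'0) lt.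
  have : hf i b q' = 1 + A by rewrite -[LHS](mulKf n1) mulrCA e1 mulr1.
  lra.
rewrite (froot_fstr a alpha (rpred0 _) hs') e; congr Some; apply/funext => u.
have /andP[u0' u1'] := val01 u; rewrite bE /th.
have [t1|t1] := leP (val u) 0.
  have t2 : val u = 0 by apply/eqP; rewrite eq_le u0' andbT.
  by rewrite t2 h00 mulr0 qq0 !scale0r subr0 addr0.
by case: ifP => uq; [rewrite lo// subr0 addrK|rewrite addrK].
Qed.

End ImaginaryE.

Lemma coroot_sym_eq (d : J -> R) : (forall i j, d i * (a i j)%:~R = d j * (a j i)%:~R) ->
  forall w j i, d j * corootf w j (alpha i) = d i * coroot i (root_of w j).
Proof.
move=> ds w j i; have [l [l1 l2]] := sym_coroot hA ds w j.
rewrite l2 l1; elim: (l) => [|p u IH]; first by rewrite !big_nil (cr0 hA) mulr0.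
rewrite !big_cons (crD hA) (crZ hA) mulrDr IH !(adm_al hA) ds.
by congr (_ + _); rewrite /GRing.scale /=; ring.
Qed.

(* the first arrow of a GLS path whose initial direction is dominant *)
Lemma first_arrow k x y : 0 < k -> arrow k x y -> (forall q, re q -> 0 <= coroot q x) ->
  exists j, [/\ ~~ re j, x = rf j y & k * coroot j y = 1].
Proof.
move=> k0 ar dom; have [ox oy] := arrow_orb ar; have [cv [w [j [rdj [ex [pos hk]]]]]] := ar.
have rw := rdj.1; have [s s0 es] := rd_pos hA rdj.
have xE : x = y - corootf w j y *: root_of w j by rewrite ex (rreflE hA).
have [z ez] : exists z : int, corootf w j y = z%:~R.
  by apply: (orbit_int hA lam_nat); exact: orbit_wact.
have [n n0 en] : exists2 n : nat, (0 < n)%N & corootf w j y = n%:R.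
  by move: pos; rewrite ez ltr0z => z0; exists (absz z); rewrite ?absz_gt0 ?gt_eqF// natr_absz gtr0_norm.
have nj : ~~ re j.
  apply/negP => rj.
  have xn i : exists m : nat, coroot i x = m%:R.
    have [q eq] := orbit_int hA lam_nat i ox.
    have h : 0 <= coroot i x by have [/dom//|ni] := boolP (re i); exact: (orbit_im hA lam_nat ox ni).
    by exists (absz q); rewrite eq natr_absz ger0_norm// -(ler0z R) -eq.
  have oxy : orbit x y.
    have -> : y = rrefl w j x.
      have cx : corootf w j x = - corootf w j y.
        by rewrite {1}xE -scaleNr (corootfD hA) (corootfZ hA) (corootf_root hA)// (re_aii rj); ring.
      by rewrite (rreflE hA)// cx {1}xE scaleNr opprK subrK.
    by rewrite rrefl_wact; apply: orbit_wact; exact: orbit_base.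
  have [t et] := orbit_wt hA xn oxy.
  have /(sumr_eq0 hA) : sumr (flatten (nseq n s) ++ t) = 0.
    rewrite sumr_cat sumr_flat -es -en; apply: oppr_inj; rewrite oppr0 opprD.
    by apply: (addrI y); rewrite addrA -xE -et addr0.
  by case: (n) n0 => //= n' _; case: (s) s0.
have hq q : re q -> coroot q (root_of w j) <= 0.
  move=> rq; rewrite leNgt; apply/negP => c0.
  have [c ec] := root_int hA j q rw; have [d [d0 ds]] := adm_sym hA.
  have sy := coroot_sym_eq ds w j q.
  have [e ee] : exists e : int, corootf w j (alpha q) = e%:~R.
    have [u [v euv]] := Qz_wact hA (rev w) (Qz_al alpha q).
    have [z1 e1] := cr_sumr_int hA j u; have [z2 e2] := cr_sumr_int hA j v.
    by exists (z1 - z2); rewrite /Defs.corootf euv /= (crB hA) e1 e2 intrB.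
  have e0 : 0 < corootf w j (alpha q).
    by rewrite -(pmulr_rgt0 _ (d0 j)) sy pmulr_rgt0.
  have c1 : 1 <= coroot q (root_of w j) by move: c0; rewrite ec ltr0z -[1]/(1%:~R) ler_int => ?; lia.
  have e1 : 1 <= corootf w j (alpha q) by move: e0; rewrite ee ltr0z -[1]/(1%:~R) ler_int => ?; lia.
  have hx : coroot q x = coroot q y - n%:R * coroot q (root_of w j) by rewrite xE en (crB hA) (crZ hA).
  have n1 : 0 < n%:R :> R by rewrite ltr0n.
  have s1 := dom q rq.
  have b1 : 0 <= n%:R - coroot q y * corootf w j (alpha q).
    have -> : n%:R - coroot q y * corootf w j (alpha q) = corootf (q :: w) j y.
      by rewrite corootf_cons rfE -[- (_ *: alpha q)]scaleNr (corootfD hA) (corootfZ hA) en; ring.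
    by apply: (orbit_im hA lam_nat) => //; exact: orbit_wact.
  have qy : 0 < coroot q y.
    by have : 0 < n%:R * coroot q (root_of w j) by [apply: mulr_gt0 => //; lra]; lra.
  have x0 : coroot q x = 0.
    apply/eqP; rewrite eq_le s1 andbT.
    have k1 : coroot q y <= coroot q y * corootf w j (alpha q) by rewrite ler_peMr// ltW.
    have k2 : n%:R <= n%:R * coroot q (root_of w j) by rewrite ler_peMr// ltW.
    lra.
  have ne : x <> rf q y.
    move=> e2; have [m em] : exists m : nat, coroot q y = m%:R.
      have [v ev] := orbit_int hA lam_nat q oy.
      by exists (absz v); rewrite ev natr_absz gtr0_norm// -(ltr0z R) -ev.
    have E : sumr (flatten (nseq n s) ++ [::]) = m%:R *: alpha q.
      rewrite cats0 sumr_flat -es -en -em.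
      by move: e2; rewrite rfE xE => /addrI/oppr_inj.
    have := sumr_sub_mult hA E; case: (n) n0 es => // n' _ es.
    have [t et] := root_im hA rw nj.
    have js : j \in s.
      have /perm_mem/(_ j) : perm_eq s (j :: t) by apply: (sumr_inj hA); rewrite -es et sumr_cons.
      by rewrite mem_head.
    move=> al; have : j \in flatten (nseq n'.+1 s) by rewrite /= mem_cat js.
    by rewrite al mem_nseq => /andP[_ /eqP jq]; move: nj; rewrite jq rq.
  by have [sg _] := cover_sign hA rq cv ne; have := sg qy; rewrite x0 ltxx.
have e1 := root_im_min hA rw nj hq.
have [_ ec] := root_simple hA rdj e1.
exists j; split=> //; first by rewrite xE e1 ec rfE.
by move: hk; rewrite (negbTE nj) ec.
Qed.

(** The initial direction is dominant for the real indices, so the first arrow of its chain is an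
    imaginary simple reflection ([first_arrow]). Removing this arrow from the first piece gives the
    preimage, since its label makes the height equal to 1 exactly at the end of that piece. *)
Lemma highest_step b : B b -> (forall q, re q -> has_min coroot q b 0) -> b <> pi_lam lam ->
  exists i b', [/\ ~~ re i, B b' & froot i b' = Some b].
Proof.
move=> Bb hq nb; have /BsetP[l0 [w0 e0]] := Bb; have [l [sl _ el]] := wg_sg w0.
have eb (u : I01 R) : b u = ev 0 l (val u) by rewrite e0 el.
have w := sg_wg sl; have [x [r elx]] := wg_ne w ltr01; subst l.
have [x0 ox cx strict sr] := sl; have wr := sg_wg sr; have x1 := wg_le wr.
have dom q : re q -> 0 <= coroot q x.1.
  move=> rq; have [_ _ h] := hq q rq.
  have x01 : 0 <= x.2 <= 1 by lra.
  have := h _ x01; rewrite -(hf_ev coroot q eb x01) (H1 hA q w (ltW x0) (lexx _)) subr0.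
  by rewrite pmulr_rge0.
have xne : x.1 <> hdir lam r.
  move: strict sr; case er : (r) => [|y r'] /= strict sr exl.
    apply: nb; apply/funext => u; rewrite eb er /= addr0 exl sr subr0 /pi_lam.
    by have /andP[u0 u1] := val01 u; rewrite (max_idPr u0) (min_idPr u1).
  by case: strict => _; apply.
have [ka [ar ch]] : exists ka, arrow x.2 x.1 ka /\ achain x.2 ka (hdir lam r).
  by case: cx xne => // y z t h1 h2 _; exists z.
have [oxx oka] := arrow_orb ar.
have [j [nj ej hj]] := first_arrow x0 ar dom.
have w' : wg 0 ((ka, x.2) :: r) 1 lam by split.
pose b' : rpath V := fun u => ev 0 ((ka, x.2) :: r) (val u).
have Bb' : B b' by apply/BsetP; exists ((ka, x.2) :: r).
exists j, b'; split=> //.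
have hh := hf_ev coroot j (fun u => erefl (b' u)).
have lin t : 0 <= t -> t <= x.2 -> hf j b' t = t * coroot j ka.
  move=> t0 tx; rewrite -hh; last by lra.
  by rewrite (H1 hA j w')// subr0.
have one : hf j b' x.2 = 1 by rewrite (lin _ (ltW x0) (lexx _)) hj.
have [z|[q [hs _]]] := B_im hA lam_nat nj Bb'.
  by move: one; rewrite z => [/eqP|]; [rewrite eq_sym oner_eq0|lra].
case: (hs) => _ q0 q1 [h0' hq' h1' h2' h3'].
have cp : 0 < coroot j ka by rewrite -(pmulr_rgt0 _ x0) hj.
have e : q = x.2.
  have [lt|lt|//] := ltgtP q x.2; last by have := h2' _ _ (ltW x0) lt (lexx _); rewrite hq' one add0r ltxx.
  have : q * coroot j ka < x.2 * coroot j ka by rewrite ltr_pM2r.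
  by rewrite -(lin q (ltW q0) (ltW lt)) hq' hj add0r ltxx.
rewrite (froot_fstr a alpha (rpred0 _) hs) e; congr Some; apply/funext => u.
have /andP[u0 u1] := val01 u; rewrite eb /b' /th.
have [ux|xu] := leP (val u) x.2.
  rewrite (ev1 w)// (ev1 w')// !subr0 lin//= ej rfE scalerBr scalerA.
  case: ifP => // u00; have u1' : val u = 0 by apply/eqP; rewrite eq_le u00.
  by rewrite u1' mul0r.
rewrite !ev2 ?(ltW xu)//=; have -> : (val u <= 0) = false by apply/negbTE; rewrite -ltNge; lra.
by rewrite ej rfE scalerBr scalerA !subr0 hj addrAC.
Qed.

Lemma raise b : B b -> b <> pi_lam lam -> exists i b', B b' /\ froot i b' = Some b.
Proof.
move=> Bb nb; have [[q [rq nq]]|H] := pselect (exists q, re q /\ ~ has_min coroot q b 0); last first.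
  have [q rq|i [b' [_ h1 h2]]] := highest_step Bb _ nb; last by exists i, b'.
  by apply: contrapT => h; apply: H; exists q.
have [m [hm _ _ he]] := B_real hA lam_nat rq Bb.
have [|p [s [hs Be]]] := he _; first by move=> m0; apply: nq; rewrite -m0.
exists q, (fun u => b u + eth (hf q b) m p s (val u) *: alpha q); split=> //.
by have im := let: And3 x _ _ := hm in x; have [] := e_then_f hA rq im hs.
Qed.

(** The endpoint is a convex combination of orbit vectors, all below [lam]; the coefficients
    obtained in this way are real numbers. *)
Lemma B_height b : B b -> exists L : seq (J * R), (forall p : J * R, p \in L -> 0 <= p.2) /\
  b (one01 R) = lam - \sum_(p <- L) p.2 *: alpha p.1.
Proof.
move=> /BsetP[l [w e]].
suff K : forall a0 l a1 e, wg a0 l a1 e -> exists L : seq (J * R), (forall p : J * R, p \in L -> 0 <= p.2) /\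
  ev a0 l a1 = (a1 - a0) *: lam - \sum_(p <- L) p.2 *: alpha p.1.
  by have [L [L0 eL]] := K _ _ _ _ w; exists L; split=> //; rewrite e eL subr0 scale1r.
move=> a0 l1 a1 e1; elim: l1 a0 => [|x l1 IH] a0 w1.
  by exists [::]; split=> //; move: w1 => /= ->; rewrite big_nil subrr scale0r subr0.
have [ax ox _ w2] := w1; have [L [L0 eL]] := IH _ w2.
have [s es] := orbit_wt hA lam_nat ox.
exists ([seq (j, x.2 - a0) | j <- s] ++ L); split.
  move=> p; rewrite mem_cat => /orP[/mapP[j _ ->]|]; last exact: L0.
  by rewrite /=; lra.
have -> : a1 - a0 = (x.2 - a0) + (a1 - x.2) by ring.
rewrite ev2 ?(wg_le w2)// eL es big_cat big_map /= -scaler_sumr -/(sumr s).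
move: (x.2 - a0) (a1 - x.2) => c1 c2.
by rewrite scalerDl scalerBr opprD addrACA.
Qed.

Lemma height_f (L L' : seq (J * R)) i b b' : B b' -> froot i b' = Some b ->
  b (one01 R) = lam - \sum_(p <- L) p.2 *: alpha p.1 -> b' (one01 R) = lam - \sum_(p <- L') p.2 *: alpha p.1 ->
  \sum_(p <- L) p.2 = \sum_(p <- L') p.2 + 1.
Proof.
move=> Bb' /(B_froot_end Bb') e1 e2 e3.
have E : \sum_(p <- L) p.2 *: alpha p.1 = \sum_(p <- (i, 1) :: L') p.2 *: alpha p.1.
  rewrite big_cons scale1r; apply: oppr_inj; apply: (addrI lam).
  by rewrite -e2 e1 e3 opprD addrA addrAC.
have := collect_eq hA (fun=> 1 : R^o) E; rewrite big_cons /GRing.scale /= addrC mulr1.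
by under eq_bigr do rewrite mulr1; under [X in _ = X + _]eq_bigr do rewrite mulr1.
Qed.

Lemma pi_lam_B : B (pi_lam lam).
Proof.
apply/BsetP; exists [:: (lam, 1)]; split.
  by split; [exact: ltr01|exact: orbit_base|exact: achain_nil|].
by move=> u; have /andP[u0 u1] := val01 u; rewrite /= addr0 subr0 (max_idPr u0) (min_idPr u1).
Qed.

(* induction on the height of the weight, in raising direction *)
Lemma B_ind (P : rpath V -> Prop) :
  (forall b, B b -> (forall i b', B b' -> froot i b' = Some b -> P b') -> P b) ->
  forall b, B b -> P b.
Proof.
move=> HP b Bb; have [L [L0 eL]] := B_height Bb.
have [n hn] : exists n : nat, \sum_(p <- L) p.2 < n%:R.
  exists (Num.truncn (\sum_(p <- L) p.2)).+1; exact: truncnS_gt.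
elim: n b L Bb L0 eL hn => [|n IH] b L Bb L0 eL hn.
  by move: hn; rewrite ltNge big_seq sumr_ge0.
apply: HP => // i b' Bb' fb; have [L' [L0' eL']] := B_height Bb'.
apply: (IH b' L' Bb' L0' eL'); have := height_f Bb' fb eL eL'.
by rewrite -natr1 in hn; lra.
Qed.

Lemma Fword_rcons (w : seq J) i (o : option (rpath V)) : @Fword R V D (rcons w i) o = @cf R V D i (@Fword R V D w o).
Proof. by rewrite /Fword -cats1 foldl_cat. Qed.

Theorem B_words b : B b <-> exists w, @Fword R V D w (Some (pi_lam lam)) = Some b.
Proof.
split.
  move: b; apply: B_ind => b Bb IH; have [->|nb] := pselect (b = pi_lam lam); first by exists [::].
  have [i [b' [Bb' fb]]] := raise Bb nb; have [w ew] := IH _ _ Bb' fb.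
  by exists (rcons w i); rewrite Fword_rcons ew /= fb.
move=> [w]; elim/last_ind: w b => [|w i IH] b; first by case=> <-; exact: pi_lam_B.
rewrite Fword_rcons; case E : (Fword _ _) => [b'|] //= fb.
by have [m [p [q []]]] := B_froot (IH _ E) fb.
Qed.

End Words.

(** * Normal sets of paths *)

Section NormalSets.
Variables (R : realType) (V : lmodType R) (J : eqType) (a : J -> J -> int)
    (alpha : J -> V) (coroot : J -> V -> R).
Hypothesis hA : adm a alpha coroot.
Hypothesis all_re : forall i, a i i = 2%:Z.
Local Notation D := (@RDat R V J a alpha coroot).
Local Notation hf := (hf coroot).
Local Notation froot := (@froot R V D).
Local Notation Fword := (@Fword R V D).
Local Notation hmin := (has_min coroot).
Implicit Types (i j : J) (x y z u : rpath V) (k n : nat) (w : seq J) (b : bool).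

(** Raising is expressed through preimages under [froot]. The minimum is written [- k%:R], so that
    [k] is the number of raisings available, and [n_e] describes one raising as a [clip]. The height
    [n_hgt] bounds all raising sequences. *)
Record nset (X : rpath V -> Prop) : Prop := NSet {
  n_lip : forall x i, X x -> lip (hf i x) /\ hf i x 0 = 0;
  n_min : forall x i, X x -> exists k, hmin i x (- k%:R);
  n_f : forall x i m, X x -> hmin i x m -> hf i x 1 <> m -> exists y, froot i x = Some y;
  n_f1 : forall x i m, X x -> hmin i x m -> hf i x 1 = m -> froot i x = None;
  n_e : forall x i k, X x -> hmin i x (- k.+1%:R) -> exists y, [/\ X y, froot i y = Some x, hmin i y (- k%:R) &
    forall t, 0 <= t <= 1 -> y (cl t) = x (cl t) - clip (hf i x) k%:R t *: alpha i];
  n_fe : forall x y i m, X y -> froot i y = Some x -> hmin i y m -> hmin i x (m - 1);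
  n_fX : forall x y i, X y -> froot i y = Some x -> X x;
  n_wt : forall x y i, X y -> froot i y = Some x -> x (one01 R) = y (one01 R) - alpha i;
  n_inj : forall x y y' i, X y -> X y' -> froot i y = Some x -> froot i y' = Some x -> y = y';
  n_hgt : exists h : rpath V -> R, (forall x, X x -> 0 <= h x) /\
    forall x y i, X y -> froot i y = Some x -> h x = h y + 1 }.

Lemma Fword_cat w w' o : Fword (w ++ w') o = Fword w' (Fword w o).
Proof. by rewrite /Defs.Fword foldl_cat. Qed.

Lemma Fword_None w : Fword w None = None.
Proof. by elim: w. Qed.

Lemma Fword_nseqS k i o : Fword (nseq k.+1 i) o = @cf R V D i (Fword (nseq k i) o).
Proof.
elim: k o => [|k IH] o //.
by rewrite -[nseq k.+2 i]/(i :: nseq k.+1 i) -[LHS]/(Fword (nseq k.+1 i) (@cf R V D i o)) IH.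
Qed.

Lemma cl1 : cl (1 : R) = one01 R.
Proof. by apply: val_inj; rewrite val_cl// ler01 lexx. Qed.

Lemma hmin_uniq i x (m m' : R) : hmin i x m -> hmin i x m' -> m = m'.
Proof.
move=> [_ [t ht <-] H1] [_ [t' ht' <-] H2]; apply/eqP.
by rewrite eq_le H2// -[X in _ <= X]/(hf i x t') H1.
Qed.

Lemma hmin_mn i x m : lip (hf i x) -> hmin i x m -> mn (hf i x) 0 1 = m.
Proof.
by move=> hl [_ [t ht et] H]; apply: mn_eq; rewrite ?lexx ?ler01//; exists t; rewrite // et.
Qed.

Section OneSet.
Variable X : rpath V -> Prop.
Hypothesis hX : nset X.

Lemma Fword_X w y x : X y -> Fword w (Some y) = Some x -> X x.
Proof.
elim: w y => [|i w IH] y Xy /=; first by case=> <-.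
rewrite -[Fword _ _]/(Fword w (froot i y)); case E : (froot i y) => [y'|]; last by rewrite Fword_None.
by apply: IH; exact: (n_fX hX Xy E).
Qed.

(** The single clips compose: what remains after clipping at one level is what the next clip sees,
    so a maximal string is one Pitman transform. *)
Lemma emax x i k : X x -> hmin i x (- k%:R) -> exists y, [/\ X y, Fword (nseq k i) (Some y) = Some x,
  hmin i y 0 & forall t, 0 <= t <= 1 -> y (cl t) = x (cl t) - clip (hf i x) 0 t *: alpha i].
Proof.
elim: k x => [|k IH] x Xx hm.
  rewrite oppr0 in hm; exists x; split=> // t ht; have [hl h0] := n_lip hX i Xx.
  have /andP[t0 t1] := ht.
  rewrite /clip addr0 (min_idPl _) ?scale0r ?subr0//; apply: mn_ge => // v /andP[v0 vt].
  by have [_ _ H] := hm; apply: H; lra.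
have [y1 [Xy1 f1 hm1 e1]] := n_e hX Xx hm; have [y [Xy fy hy ey]] := IH _ Xy1 hm1.
exists y; split=> //; first by rewrite Fword_nseqS fy.
have [hl h0] := n_lip hX i Xx.
have hh s : 0 <= s <= 1 -> hf i y1 s = hf i x s - 2 * clip (hf i x) k%:R s.
  move=> hs; rewrite !hfE e1// (crB hA) (crZ hA) (adm_al hA) all_re.
  by rewrite [X in _ - X]mulrC.
move=> t ht; have /andP[t0 t1] := ht; rewrite ey// e1// -addrA -opprD -scalerDl; congr (_ - _ *: _).
have e2 : clip (hf i y1) 0 t = Num.min 0 (mn (hf i x) 0 t - clip (hf i x) k%:R t).
  rewrite /clip addr0; congr Num.min; rewrite -/(clip (hf i x) k%:R t) -run_clip// ?ler0n//.
  by apply: eq_mn => u hu; apply: hh; lra.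
have r0 := mn_start hl h0 t0 t1; rewrite e2 {3}/clip addr0 (min_idPr r0).
rewrite /clip; have k0 : 0 <= k%:R :> R := ler0n _ _.
by case: (lerP 0 (mn (hf i x) 0 t + k%:R)) => h1; rewrite (min_idPr _); lra.
Qed.

Lemma hgt_word h w y x : (forall x y i, X y -> froot i y = Some x -> h x = h y + 1) ->
  X y -> Fword w (Some y) = Some x -> h x = h y + (size w)%:R :> R.
Proof.
move=> hh; elim: w y => [|i w IH] y Xy /=; first by case=> ->; rewrite addr0.
rewrite -[Fword _ _]/(Fword w (froot i y)); case E : (froot i y) => [y'|]; last by rewrite Fword_None.
move=> /(IH _ (n_fX hX Xy E)) ->; rewrite (hh _ _ _ Xy E) -[(size w).+1%:R]natr1; ring.
Qed.

Section RankTwo.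
Variables (i j : J) (c : R) (q : nat) (sg : bool -> R).
Hypotheses (ij : i != j) (c0 : 0 <= c) (cq : c ^+ 2 = q%:R) (sg0 : forall b, 0 < sg b)
  (sgal : forall b, sg (~~ b) * coroot (pr i j (~~ b)) (alpha (pr i j b)) = - (c * sg b)).
Local Notation f := (fun b v => coroot (pr i j b) v).
Local Notation al := (fun b => alpha (pr i j b)).
Local Notation xr x := (fun t : R => x (cl t)).
Local Notation hh x := (hts f sg (xr x)).
Local Notation pp := (ppits f al sg).

Lemma f_lin' b (k : R) (x y : V) : f b (k *: x + y) = k * f b x + f b y.
Proof. by rewrite /= (crD hA) (crZ hA). Qed.

Lemma f_al' b : f b (al b) = 2.
Proof. by rewrite /= (adm_al hA) all_re. Qed.

Lemma good_xr x : X x -> good (hh x).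
Proof.
move=> Xx; split=> b; have [hl h0] := n_lip hX (pr i j b) Xx; first exact: lip_scale.
by rewrite /hts -[coroot _ _]/(hf (pr i j b) x 0) h0 mulr0.
Qed.

Lemma eps_xr x b m : X x -> hmin (pr i j b) x m -> eps (hh x) b = - (sg b * m).
Proof.
move=> Xx hm; have [hl h0] := n_lip hX (pr i j b) Xx.
by rewrite /eps -[hts _ _ _ b]/(fun t => sg b * hf (pr i j b) x t) mn_scale ?ler01 ?lexx ?(hmin_mn hl hm)// ltW.
Qed.

Lemma pe_xr x y b : X x -> (forall t, 0 <= t <= 1 -> y (cl t) = x (cl t) - clip (hf (pr i j b) x) 0 t *: alpha (pr i j b)) ->
  eqp (xr y) (pe f al sg (xr x) b 0).
Proof.
move=> Xx e t ht; have [hl h0] := n_lip hX (pr i j b) Xx; have /andP[t0 t1] := ht.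
rewrite e// /pe; congr (_ - _ *: _).
have sn : sg b != 0 by rewrite gt_eqF.
rewrite -[hts _ _ _ b]/(fun t => sg b * hf (pr i j b) x t) /clip !addr0 mn_scale//; last exact: ltW.
have r0 := mn_start hl h0 t0 t1.
rewrite !(min_idPr _)//; last by rewrite pmulr_rle0.
by rewrite mulKf.
Qed.

Lemma chainX x b : X x -> forall n, exists u, X u /\ eqp (xr u) (pp (xr x) b n).
Proof.
move=> Xx; elim=> [|n [u [Xu eu]]]; first by exists x.
have [k hk] := n_min hX (pr i j (lt_ b n)) Xu.
have [y [Xy _ _ ey]] := emax Xu hk; exists y; split=> //.
apply: (eqp_trans (pe_xr Xu ey)); exact: eqp_pe.
Qed.

(** The string parameters are, up to the scale [sg], numbers of raisings, and their total is bounded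
    by the height of [x]. *)
Lemma strings_end x b : X x -> exists K, forall n, (K <= n)%N -> str c (hh x) b n = 0.
Proof.
move=> Xx; have [h [h0 hf1]] := n_hgt hX.
have st n : exists k, (exists u v, [/\ X u, eqp (xr u) (pp (xr x) b n), X v, eqp (xr v) (pp (xr x) b n.+1) &
   h u = h v + k%:R]) /\ str c (hh x) b n = sg (lt_ b n) * k%:R.
  have [u [Xu eu]] := chainX b Xx n; have [k hk] := n_min hX (pr i j (lt_ b n)) Xu.
  have [y [Xy fy _ ey]] := emax Xu hk; exists k; split.
    exists u, y; split=> //; first by apply: (eqp_trans (pe_xr Xu ey)); exact: eqp_pe.
    by rewrite (hgt_word hf1 Xy fy) size_nseq.
  rewrite /str -(hts_ppits f_lin' f_al' sg0 sgal) -(eqp_eps f sg _ eu) (eps_xr Xu hk).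
  by rewrite mulrN opprK.
have [k Hk] := choice st.
have eqx u v n : eqp (xr u) (pp (xr x) b n) -> eqp (xr v) (pp (xr x) b n) -> u = v.
  move=> e1 e2; apply/funext => s; rewrite -(cl_val s).
  by have := eqp_trans e1 (eqp_sym e2) (val01 s).
have tot n : exists u, [/\ X u, eqp (xr u) (pp (xr x) b n) & h x = h u + (\sum_(l < n) k l)%:R].
  elim: n => [|n [u [Xu eu hu]]]; first by exists x; split=> //; rewrite big_ord0 addr0.
  have [[u' [v [Xu' eu' Xv ev hv]]] _] := Hk n.
  exists v; split=> //; rewrite hu (eqx _ _ _ eu eu') hv big_ord_recr /= natrD; ring.
have [B hB] : exists B : nat, h x < B%:R by exists (Num.truncn (h x)).+1; exact: truncnS_gt.
have bd n : (\sum_(l < n) k l <= B)%N.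
  have [u [Xu _ e]] := tot n; rewrite -(ler_nat R); have := h0 _ Xu; lra.
have [|K HK] := @nat_stab (fun n => (B - \sum_(l < n) k l)%N).
  by move=> n; rewrite leq_sub2l// big_ord_recr /= leq_addr.
exists K => n Kn; have := HK n Kn; have := bd n.+1; rewrite big_ord_recr /= => b1 b2.
have k0 : k n = 0%N by lia.
by rewrite (Hk n).2 k0 mulr0.
Qed.

End RankTwo.

End OneSet.

(** * Uniqueness of components by a diamond argument *)

Section Iso.
Variables X X0 : rpath V -> Prop.
Hypotheses (hX : nset X) (hX0 : nset X0).
Variables z z0 : rpath V.
Hypotheses (Xz : X z) (X0z : X0 z0) (dz : forall i, hmin i z 0) (dz0 : forall i, hmin i z0 0)
  (ez : forall i, hf i z 1 = hf i z0 1).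

Definition rel x x0 := exists w, Fword w (Some z) = Some x /\ Fword w (Some z0) = Some x0.

Lemma rel_X x x0 : rel x x0 -> X x /\ X0 x0.
Proof. by move=> [w [e1 e2]]; split; [exact: (Fword_X hX Xz e1)|exact: (Fword_X hX0 X0z e2)]. Qed.

Lemma rel_word w x x0 y y0 : rel x x0 -> Fword w (Some x) = Some y -> Fword w (Some x0) = Some y0 -> rel y y0.
Proof. by move=> [v [e1 e2]] f1 f2; exists (v ++ w); rewrite !Fword_cat e1 e2. Qed.

Lemma rel_f i x x0 y y0 : rel x x0 -> froot i x = Some y -> froot i x0 = Some y0 -> rel y y0.
Proof. by move=> h f1 f2; apply: (rel_word (w := [:: i]) h). Qed.

Lemma rel_end i x x0 : rel x x0 -> hf i x 1 = hf i x0 1.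
Proof.
move=> [w]; elim/last_ind: w x x0 => [|w j IH] x x0; first by move=> [[<-] [<-]].
rewrite !Fword_rcons; case E : (Fword _ _) => [u|] [] //; case E' : (Fword _ _) => [u0|] //= fu fu0.
have := IH _ _ (conj E E'); rewrite !hfE cl1.
rewrite (n_wt hX (Fword_X hX Xz E) fu) (n_wt hX0 (Fword_X hX0 X0z E') fu0).
by rewrite !(crB hA) => ->.
Qed.

(** Two paths reached by the same word have the same depths, and every raising of the first is
    matched by a raising of the second that is again reached by a common word. *)
Definition claim n := forall w x x0, size w = n -> Fword w (Some z) = Some x -> Fword w (Some z0) = Some x0 ->
  forall i, (exists k, hmin i x (- k%:R) /\ hmin i x0 (- k%:R)) /\
   forall y, X y -> froot i y = Some x -> exists y0, [/\ X0 y0, froot i y0 = Some x0 & rel y y0].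

Section Level.
Variable h : rpath V -> R.
Hypothesis hh1 : forall x y i, X y -> froot i y = Some x -> h x = h y + 1.
Variable n : nat.
Hypothesis IH : forall m, (m < n)%N -> claim m.

Lemma rel_claim x x0 i : rel x x0 -> h x < h z + n%:R -> 
  (exists k, hmin i x (- k%:R) /\ hmin i x0 (- k%:R)) /\
   forall y, X y -> froot i y = Some x -> exists y0, [/\ X0 y0, froot i y0 = Some x0 & rel y y0].
Proof.
move=> [w [e1 e2]] hx; apply: (IH (m := size w) _ (erefl _) e1 e2).
by rewrite -(ltr_nat R); have := hgt_word hX hh1 Xz e1; lra.
Qed.

Lemma rel_down x x0 i k y y0 : rel x x0 -> h x < h z + n%:R -> X y -> X0 y0 ->
  Fword (nseq k i) (Some y) = Some x -> Fword (nseq k i) (Some y0) = Some x0 -> rel y y0.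
Proof.
elim: k x x0 => [|k IHk] x x0 hr hx Xy Xy0; first by move=> [->] [->].
rewrite !Fword_nseqS; case E : (Fword _ _) => [u|] //=; case E' : (Fword _ _) => [u0|] //= fu fu0.
have Xu := Fword_X hX Xy E; have Xu0 := Fword_X hX0 Xy0 E'.
have [_ /(_ _ Xu fu)[u1 [Xu1 fu1 ru]]] := rel_claim i hr hx.
have e := n_inj hX0 Xu1 Xu0 fu1 fu0; subst u1.
apply: (IHk u u0) => //; have := hh1 Xu fu; lra.
Qed.

End Level.

(** Let [i] be the last letter of the word and [j] the direction to be raised. Raising maximally in
    [i] lands in smaller height, where related paths stay related; so both paths have the same
    string starting with [i], and by [string_univ] the same string starting with [j]. The preimages
    under [j] can thus be raised by identical words to the end of that alternating sequence, which
    by confluence is also the end of the one starting with [i], where relatedness is known. *)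
Theorem claim_all n : claim n.
Proof.
elim/ltn_ind: n => n IH w x x0 sw e1 e2 j.
have [h [_ hh1]] := n_hgt hX; have [h' [_ hh1']] := n_hgt hX0.
case/lastP: w sw e1 e2 => [|w i] sw.
  move=> [<-] [<-]; split; first by exists 0%N; rewrite oppr0.
  move=> y Xy fy; have [k hk] := n_min hX j Xy.
  have := hmin_uniq (n_fe hX Xy fy hk) (dz j); have : 0 <= k%:R :> R := ler0n _ _.
  by lra.
rewrite !Fword_rcons; case E : (Fword _ _) => [y|] //=; case E' : (Fword _ _) => [y0|] //= fy fy0.
rewrite size_rcons in sw; have ry : rel y y0 by exists w.
have Xy := Fword_X hX Xz E; have Xy0 := Fword_X hX0 X0z E'.
have Xx := n_fX hX Xy fy; have Xx0 := n_fX hX0 Xy0 fy0.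
have hy := hgt_word hX hh1 Xz E; have hx := hh1 _ _ _ Xy fy.
have hyn : h y < h z + n%:R by rewrite hy -sw -natr1; lra.
have [[k [ky ky0]] _] := rel_claim hh1 IH i ry hyn.
have kx := n_fe hX Xy fy ky; have kx0 := n_fe hX0 Xy0 fy0 ky0.
have kS : - k%:R - 1 = - k.+1%:R :> R by rewrite -natr1; ring.
rewrite kS in kx kx0.
have [eij|ij] := eqVneq i j.
  subst j; split; first by exists k.+1.
  move=> y' Xy' fy'; exists y0; split=> //.
  by rewrite (n_inj hX Xy' Xy fy' fy).
have [c [q [sg [c0 cq sg0 sgal]]]] := rank2 hA ij.
pose f := fun b v => coroot (pr i j b) v; pose al := fun b => alpha (pr i j b).
have dl b (t : R) (v v' : V) : f b (t *: v + v') = t * f b v + f b v' by exact: f_lin'.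
have da b : f b (al b) = 2 by exact: f_al'.
have hts_pp := hts_ppits dl da sg0 sgal.
pose xr := fun (x : rpath V) (t : R) => x (cl t).
pose hh := fun x => hts f sg (xr x).
have eqx u v (x' : R -> V) : eqp (xr u) x' -> eqp (xr v) x' -> u = v.
  move=> q1 q2; apply/funext => s; rewrite -(cl_val s).
  by have := eqp_trans q1 (eqp_sym q2) (val01 s).
have [Y [XY fY hY eY]] := emax hX Xx kx; have [Y0 [XY0 fY0 hY0 eY0]] := emax hX0 Xx0 kx0.
have up (Z : rpath V -> Prop) (hZ : nset Z) u v v' : Z u -> Z v' -> Fword (nseq k.+1 i) (Some u) = Some v ->
   froot i v' = Some v -> Fword (nseq k i) (Some u) = Some v'.
  move=> Zu Zv'; rewrite Fword_nseqS; case E1 : (Fword _ _) => [u1|] //= f1 f2.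
  by rewrite (n_inj hZ (Fword_X hZ Zu E1) Zv' f1 f2).
have rY : rel Y Y0.
  apply: (rel_down (x := y) (x0 := y0) (k := k) (i := i) hh1 IH) => //.
    exact: up hX _ _ _ XY Xy fY fy.
  exact: up hX0 _ _ _ XY0 Xy0 fY0 fy0.
have hYn : h Y < h z + n%:R.
  have := hgt_word hX hh1 XY fY; rewrite size_nseq -natr1; have : 0 <= k%:R :> R := ler0n _ _; lra.
(* the two chains of maximal strings starting in direction [i] stay related *)
have chain N : exists u u0, [/\ eqp (xr u) (ppits f al sg (xr x) true N.+1),
   eqp (xr u0) (ppits f al sg (xr x0) true N.+1), rel u u0, h u < h z + n%:R &
   str c (hh x) true N = str c (hh x0) true N].
  elim: N => [|N [u [u0 [eu eu0 ru hu _]]]].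
    exists Y, Y0; split=> //.
    - exact: (pe_xr (b := true) hX sg0 Xx eY).
    - exact: (pe_xr (b := true) hX0 sg0 Xx0 eY0).
    by rewrite /str /= (eps_xr hX sg0 (b := true) Xx kx) (eps_xr hX0 sg0 (b := true) Xx0 kx0).
  have [Xu Xu0] := rel_X ru; set b := lt_ true N.+1.
  have [[l [lu lu0]] _] := rel_claim hh1 IH (pr i j b) ru hu.
  have [v [Xv fv _ ev]] := emax hX Xu lu; have [v0 [Xv0 fv0 _ ev0]] := emax hX0 Xu0 lu0.
  exists v, v0; split.
  - by apply: (eqp_trans (pe_xr hX sg0 Xu ev)); exact: eqp_pe.
  - by apply: (eqp_trans (pe_xr hX0 sg0 Xu0 ev0)); exact: eqp_pe.
  - exact: (rel_down hh1 IH ru hu Xv Xv0 fv fv0).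
  - have := hgt_word hX hh1 Xv fv; have : 0 <= (size (nseq l (pr i j b)))%:R :> R := ler0n _ _; lra.
  rewrite /str -!hts_pp -(eqp_eps f sg _ eu) -(eqp_eps f sg _ eu0).
  by rewrite (eps_xr hX sg0 Xu lu) (eps_xr hX0 sg0 Xu0 lu0).
have tX : fin_or_term c (chdom c) (hh x) true by move=> _; apply: (strings_end hX); eassumption.
have tX0 : fin_or_term c (chdom c) (hh x0) true by move=> _; apply: (strings_end hX0); eassumption.
have gx : good (hh x) by exact: (good_xr hX i j sg Xx).
have gx0 : good (hh x0) by exact: (good_xr hX0 i j sg Xx0).
(* In finite type [string_univ] speaks of finitely many parameters; those beyond vanish by
   [str_beyond]. *)
have strj N : str c (hh x) false N = str c (hh x0) false N.
  have [rN|] := boolP (rng (chdom c) N).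
    apply: (string_univ (chdom0 c) (@chdom_down R c) (@chdom_pos R c) (chdom_end c0 cq) gx gx0 tX tX0 _ rN) => m _.
    by have [u [u0 []]] := chain m.
  by case: N => // N /= nN; rewrite !(str_beyond c0 cq _ _ nN).
have [l hl] := n_min hX j Xx; have [l0 hl0] := n_min hX0 j Xx0.
have ll : l = l0.
  have := strj 0%N; rewrite /str /= (eps_xr hX sg0 (b := false) Xx hl) (eps_xr hX0 sg0 (b := false) Xx0 hl0).
  move=> /oppr_inj/(mulfI (lt0r_neq0 (sg0 false)))/oppr_inj/eqP; rewrite eqr_nat => /eqP; exact.
subst l0; split; first by exists l.
move=> y' Xy' fy'; have [l' hl'] := n_min hX j Xy'.
have ell : l = l'.+1.
  have := hmin_uniq (n_fe hX Xy' fy' hl') hl => /eqP; rewrite -opprD eqr_opp natr1 eqr_nat.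
  by move=> /eqP.
subst l; have [y0' [Xy0' fy0' hy0' _]] := n_e hX0 Xx0 hl0.
exists y0'; split=> //.
(* Along the sequence starting with [j] the two sides are not yet known to be related; the equal
   string parameters suffice to descend by one common word [W] to the two preimages. *)
have chainj N : exists W u u0, [/\ X u /\ X0 u0, eqp (xr u) (ppits f al sg (xr x) false N.+1),
   eqp (xr u0) (ppits f al sg (xr x0) false N.+1), Fword W (Some u) = Some y' & Fword W (Some u0) = Some y0'].
  elim: N => [|N [W [u [u0 [[Xu Xu0] eu eu0 fu fu0]]]]].
    have [U [XU fU _ eU]] := emax hX Xx hl; have [U0 [XU0 fU0 _ eU0]] := emax hX0 Xx0 hl0.
    exists (nseq l' j), U, U0; split=> //.
    - exact: (pe_xr (b := false) hX sg0 Xx eU).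
    - exact: (pe_xr (b := false) hX0 sg0 Xx0 eU0).
    - move: fU; rewrite Fword_nseqS; case E1 : (Fword _ _) => [u1|] //= f1.
      by rewrite (n_inj hX (Fword_X hX XU E1) Xy' f1 fy').
    move: fU0; rewrite Fword_nseqS; case E1 : (Fword _ _) => [u1|] //= f1.
    by rewrite (n_inj hX0 (Fword_X hX0 XU0 E1) Xy0' f1 fy0').
  set b := lt_ false N.+1.
  have [k1 hk1] := n_min hX (pr i j b) Xu; have [k2 hk2] := n_min hX0 (pr i j b) Xu0.
  have kk : k1 = k2.
    have := strj N.+1; rewrite /str -!hts_pp -(eqp_eps f sg _ eu) -(eqp_eps f sg _ eu0).
    rewrite (eps_xr hX sg0 Xu hk1) (eps_xr hX0 sg0 Xu0 hk2).
    move=> /oppr_inj/(mulfI (lt0r_neq0 (sg0 b)))/oppr_inj/eqP; rewrite eqr_nat => /eqP; exact.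
  subst k2; have [v [Xv fv _ ev]] := emax hX Xu hk1; have [v0 [Xv0 fv0 _ ev0]] := emax hX0 Xu0 hk2.
  exists (nseq k1 (pr i j b) ++ W), v, v0; split=> //.
  - by apply: (eqp_trans (pe_xr hX sg0 Xu ev)); exact: eqp_pe.
  - by apply: (eqp_trans (pe_xr hX0 sg0 Xu0 ev0)); exact: eqp_pe.
  - by rewrite Fword_cat fv.
  - by rewrite Fword_cat fv0.
(* Further transforms fix a dominant path, so the different stopping lengths on the two sides can be
   replaced by their maximum. *)
have stab (xx : R -> V) b m : good (hts f sg xx) -> (forall b', eps (hts f sg (ppits f al sg xx b m)) b' = 0) ->
   forall m', (m <= m')%N -> eqp (ppits f al sg xx b m') (ppits f al sg xx b m).
  move=> gg d; elim=> [|m' IHm]; first by rewrite leqn0 => /eqP ->.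
  rewrite leq_eqVlt => /orP[/eqP -> //|/IHm em].
  apply: (eqp_trans (eqp_pe f al sg _ _ em)) => s hs; have /andP[s0 s1] := hs.
  set xm := ppits f al sg xx b m in d *.
  have gm : good (hts f sg xm) by rewrite hts_pp; exact: good_pits.
  rewrite /pe /clip addr0 (min_idPl _) ?mulr0 ?scale0r ?subr0//.
  have := d (lt_ b m'); rewrite /eps => /eqP; rewrite oppr_eq0 => /eqP d0.
  by have := run_nincr (gm.1 (lt_ b m')) s0 s1 (lexx 1); rewrite d0.
have [m [m1 [em dm]]] := path_confluence c0 cq dl da sg0 sgal gx tX.
have [m' [m1' [em' dm']]] := path_confluence c0 cq dl da sg0 sgal gx0 tX0.
have dm1 b' : eps (hts f sg (ppits f al sg (xr x) false m1)) b' = 0 by rewrite -(eqp_eps f sg _ em).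
have dm1' b' : eps (hts f sg (ppits f al sg (xr x0) false m1')) b' = 0 by rewrite -(eqp_eps f sg _ em').
set M := maxn m m'; set M1 := maxn m1 m1'.
have [u [u0 [eu eu0 ru _ _]]] := chain M.
have [W [v [v0 [_ ev ev0 fW fW0]]]] := chainj M1.
have mM : (m <= M.+1)%N by rewrite leqW// leq_maxl.
have mM' : (m' <= M.+1)%N by rewrite leqW// leq_maxr.
have m1M : (m1 <= M1.+1)%N by rewrite leqW// leq_maxl.
have m1M' : (m1' <= M1.+1)%N by rewrite leqW// leq_maxr.
have uv : u = v.
  apply: (eqx _ _ _ (eqp_trans eu (stab _ _ _ gx dm _ mM))).
  exact: eqp_trans (eqp_trans ev (stab _ _ _ gx dm1 _ m1M)) (eqp_sym em).
have uv0 : u0 = v0.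
  apply: (eqx _ _ _ (eqp_trans eu0 (stab _ _ _ gx0 dm' _ mM'))).
  exact: eqp_trans (eqp_trans ev0 (stab _ _ _ gx0 dm1' _ m1M')) (eqp_sym em').
by subst v v0; exact: rel_word ru fW fW0.
Qed.

Lemma rel_min i x x0 : rel x x0 -> exists k : nat, hmin i x (- k%:R) /\ hmin i x0 (- k%:R).
Proof. by move=> [w [e1 e2]]; have [] := claim_all (erefl (size w)) e1 e2 i. Qed.

Lemma rel_pre i x x0 y : rel x x0 -> X y -> froot i y = Some x ->
  exists y0, [/\ X0 y0, froot i y0 = Some x0 & rel y y0].
Proof. by move=> [w [e1 e2]]; have [_] := claim_all (erefl (size w)) e1 e2 i; apply. Qed.

Lemma rel_froot i x x0 y : rel x x0 -> froot i x = Some y -> exists2 y0, froot i x0 = Some y0 & rel y y0.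
Proof.
move=> r fx; have [Xx Xx0] := rel_X r; have [k [k1 k2]] := rel_min i r.
have [e|ne] := pselect (hf i x 1 = - k%:R); first by rewrite (n_f1 hX Xx k1 e) in fx.
have [|y0 fy0] := n_f hX0 Xx0 k2; first by rewrite -(rel_end i r).
by exists y0 => //; exact: rel_f r fx fy0.
Qed.

(** The last letter of the first word is raised on both sides by [rel_pre]; at the dominant path the
    height forces the second word to be empty. *)
Lemma rel_fun x x0 x0' : rel x x0 -> rel x x0' -> x0 = x0'.
Proof.
move=> [w [e1 e2]]; elim/last_ind: w x x0 x0' e1 e2 => [|w i IH] x x0 x0'.
  move=> [<-] [<-] [w [e1 e2]]; have [h [_ hh1]] := n_hgt hX.
  have := hgt_word hX hh1 Xz e1; move=> /eqP; rewrite -subr_eq0 opprD addrA subrr sub0r oppr_eq0 pnatr_eq0.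
  by move=> /nilP sw; move: e2; rewrite sw => -[].
rewrite !Fword_rcons; case E : (Fword _ _) => [y|] //=; case E' : (Fword _ _) => [y0|] //= fy fy0 r.
have Xy := Fword_X hX Xz E; have Xy0 := Fword_X hX0 X0z E'.
have [y0' [Xy0' fy0' ry]] := rel_pre r Xy fy.
by have e := IH _ _ _ E E' ry; subst y0'; move: fy0'; rewrite fy0 => -[].
Qed.

Lemma rel_dom x x0 : rel x x0 -> (forall i, hmin i x 0) -> x = z.
Proof.
move=> [w]; case/lastP: w => [|w i]; first by case=> -[->].
rewrite Fword_rcons; case E : (Fword _ _) => [y|] [] //= fy _ H.
have Xy := Fword_X hX Xz E; have [k hk] := n_min hX i Xy.
exfalso; have := hmin_uniq (n_fe hX Xy fy hk) (H i); have : 0 <= k%:R :> R := ler0n _ _; lra.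
Qed.

End Iso.

End NormalSets.

(** * Words of root operators *)

Section BsetNormal.
Variables (R : realType) (V : lmodType R) (J : eqType) (a : J -> J -> int)
    (alpha : J -> V) (coroot : J -> V -> R).
Hypothesis hA : adm a alpha coroot.
Hypothesis all_re : forall i, a i i = 2%:Z.
Local Notation D := (@RDat R V J a alpha coroot).
Variable lam : V.
Hypothesis lam_nat : forall i, exists n : nat, coroot i lam = n%:R.

Lemma Bset_nset : nset a alpha coroot (@Bset R V D lam).
Proof.
have re i : @is_real R V D i by apply/eqP; exact: all_re.
split.
- by move=> x i /(B_lip hA i).
- move=> x i Bx; have [m [hm m0 _ _]] := B_real hA lam_nat (re i) Bx.
  have /intrP[z ez] := let: And3 im _ _ := hm in im.
  exists `|z|%N; move: m0 hm; rewrite ez lerz0 => z0.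
  by rewrite natr_absz ler0_norm// intrN opprK.
- move=> x i m Bx hm n1; have [m' [hm' _ hF _]] := B_real hA lam_nat (re i) Bx.
  have e := hmin_uniq hm hm'; subst m'; have im := let: And3 im _ _ := hm in im.
  have [p [q [hs _]]] := hF n1.
  by eexists; exact: (froot_fstr a alpha im hs).
- by move=> x i m Bx hm e; exact: (froot_none a alpha hm e).
- move=> x i k Bx hm; have [m' [hm' _ _ hE]] := B_real hA lam_nat (re i) Bx.
  have e := hmin_uniq hm hm'; subst m'; have im := let: And3 im _ _ := hm in im.
  have [|p [q [hs By]]] := hE _; first by apply/eqP; rewrite oppr_eq0 pnatr_eq0.
  have kS : - k.+1%:R + 1 = - k%:R :> R by rewrite -natr1; ring.
  have [fs fy] := e_then_f hA (re i) im hs; rewrite kS in fs.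
  exists (fun u => x u + eth (hf coroot i x) (- k.+1%:R) p q (val u) *: alpha i); split=> //.
    by apply: (fstr_min _ fs); rewrite rpredN; exact: natr_int.
  move=> t ht; have [hl _] := B_lip hA i Bx; rewrite val_cl// (eth_clip hl hs ht).
  by rewrite scaleNr; congr (_ - clip _ _ _ *: _); rewrite opprK -natr1; ring.
- move=> x y i m By fy hm; have [m' [p [q [im fs -> _]]]] := B_froot hA lam_nat By fy.
  have e := hmin_uniq hm (fstr_min im fs); subst m'.
  have [es _] := f_then_e hA (re i) im fs.
  by apply: (estr_min _ es); rewrite rpredB ?int_num1.
- by move=> x y i By /(B_froot hA lam_nat By)[m' [p [q []]]].
- by move=> x y i; exact: (B_froot_end hA lam_nat).
- move=> x y y' i By By' fy fy'.
  have inv z : @Bset R V D lam z -> froot (D := D) i z = Some x -> eroot_re (D := D) i x = Some z.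
    move=> Bz /(B_froot hA lam_nat Bz)[m' [p [q [im fs -> _]]]].
    by have [] := f_then_e hA (re i) im fs.
  by have := inv _ By fy; rewrite (inv _ By' fy') => -[].
have H x : exists r : R, @Bset R V D lam x -> 0 <= r /\ exists L : seq (J * R), r = \sum_(p <- L) p.2 /\
    x (one01 R) = lam - \sum_(p <- L) p.2 *: alpha p.1.
  (* The height is obtained by choice; its value outside the set of paths is an arbitrary 0. *)
  have [Bx|nB] := pselect (@Bset R V D lam x); last by exists 0 => /nB.
  have [L [L0 eL]] := B_height hA lam_nat Bx; exists (\sum_(p <- L) p.2) => _; split; last by exists L.
  by rewrite big_seq sumr_ge0.
have [h hh] := choice H; exists h; split; first by move=> x /hh[].
move=> x y i By fy; have [_ [L [-> eL]]] := hh y By.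
have Bx : @Bset R V D lam x by have [m' [p [q []]]] := B_froot hA lam_nat By fy.
have [_ [L' [-> eL']]] := hh x Bx.
exact: (height_f hA lam_nat By fy eL' eL).
Qed.

End BsetNormal.

Section Factor.
Variable R : realType.
Implicit Types (h : I01 R -> R).

Definition mminH h : R := inf (fun x : R => exists u, h u = x /\ exists n : int, x = n%:~R).

Definition fplusH h : R := sup (fun t : R => exists u : I01 R, val u = t /\ h u = mminH h).

Definition fminusH h : R := inf (fun t : R => exists u : I01 R, val u = t /\ fplusH h <= t /\ h u = mminH h + 1).

(* the root operator subtracts a multiple of the root that depends on the height function only *)
Definition gfun h : option (I01 R -> R) := if fplusH h == 1 then None else
  Some (fun u => if val u <= fplusH h then 0 else if val u <= fminusH h then h u - mminH h else 1).

Lemma froot_gfun (V : lmodType R) (D : rdat V) i b :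
  @froot R V D i b = omap (fun g u => b u - g u *: sroot i) (gfun (Hf i b)).
Proof.
rewrite /froot /gfun -/(mminH (Hf i b)) -/(fplusH (Hf i b)) -/(fminusH (Hf i b)).
rewrite -[fplus i b]/(fplusH (Hf i b)); case: ifP => // _; congr Some; apply/funext => u /=.
rewrite -[fminus i b]/(fminusH (Hf i b)) -[mmin i b]/(mminH (Hf i b)).
by case: ifP => _; [rewrite scale0r subr0|case: ifP => _ //; rewrite scale1r].
Qed.

(** The multiple of the root subtracted by an imaginary operator when the initial slope of the
    height is [n]. *)
Definition gmin (n : R) (u : I01 R) := Num.min 1 (n * val u).

Lemma gmin_sum (s : seq R) u : (forall n, n \in s -> n * val u <= 1) ->
  \sum_(n <- s) gmin n u = (\sum_(n <- s) n) * val u.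
Proof.
move=> H; rewrite mulr_suml big_seq [RHS]big_seq; apply: eq_bigr => n ns.
by rewrite /gmin (min_idPr _)// H.
Qed.

(** If [n' < n], both sums are linear up to time [1 / n], hence have equal totals. At time [1 / n']
    the second sum is still linear, while in the first the term of [n] has been cut at 1. *)
Lemma gmin_lt (s s' : seq R) n n' : (forall m, m \in rcons s n -> 1 <= m /\ m <= n) ->
  (forall m, m \in rcons s' n' -> 1 <= m /\ m <= n') ->
  (forall u, \sum_(m <- rcons s n) gmin m u = \sum_(m <- rcons s' n') gmin m u) -> n <= n'.
Proof.
move=> H H' E; rewrite leNgt; apply/negP => nn.
have nin : n \in rcons s n by rewrite mem_rcons mem_head.
have nin' : n' \in rcons s' n' by rewrite mem_rcons mem_head.
have [n1 _] := H n nin; have [n1' _] := H' n' nin'.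
have n0 : 0 < n by lra.
have n0' : 0 < n' by lra.
have u01 : 0 <= n^-1 <= 1 by rewrite invr_ge0 ltW//= invf_le1.
have u01' : 0 <= n'^-1 <= 1 by rewrite invr_ge0 ltW//= invf_le1.
have key (w : R) m : 0 < w -> m <= w -> m * w^-1 <= 1 by move=> w0 mw; rewrite ler_pdivrMr// mul1r.
have S : \sum_(m <- rcons s n) m = \sum_(m <- rcons s' n') m.
  have A1 m : m \in rcons s n -> m * val (cl n^-1) <= 1 by move=> /H[_ h]; rewrite val_cl//; apply: key.
  have A2 m : m \in rcons s' n' -> m * val (cl n^-1) <= 1.
    by move=> /H'[_ h]; rewrite val_cl//; apply: key => //; lra.
  have := E (cl n^-1); rewrite (gmin_sum A1) (gmin_sum A2) val_cl// => /(mulIf _); apply.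
  by rewrite invr_eq0 gt_eqF.
have A3 m : m \in rcons s' n' -> m * val (cl n'^-1) <= 1 by move=> /H'[_ h]; rewrite val_cl//; apply: key.
have := E (cl n'^-1); rewrite [RHS](gmin_sum A3) val_cl// -S -cats1 !big_cat !big_seq1 /= mulrDl => e.
have l1 : \sum_(m <- s) gmin m (cl n'^-1) <= (\sum_(m <- s) m) * n'^-1.
  by rewrite mulr_suml; apply: ler_sum => m _; rewrite /gmin val_cl// ge_min lexx orbT.
have l2 : gmin n (cl n'^-1) = 1 by rewrite /gmin val_cl// (min_idPl _)// ler_pdivlMr// mul1r ltW.
have l3 : 1 < n * n'^-1 by rewrite ltr_pdivlMr// mul1r.
by rewrite l2 in e; lra.
Qed.

Lemma gmin_inj (s s' : seq R) : sorted <=%R s -> sorted <=%R s' -> (forall m, m \in s -> 1 <= m) ->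
  (forall m, m \in s' -> 1 <= m) -> (forall u, \sum_(m <- s) gmin m u = \sum_(m <- s') gmin m u) -> s = s'.
Proof.
have one (t : seq R) : (forall m, m \in t -> 1 <= m) -> \sum_(m <- t) gmin m (one01 R) = (size t)%:R.
  move=> H; rewrite -sum1_size natr_sum big_seq [RHS]big_seq; apply: eq_bigr => m mt.
  by rewrite /gmin /= mulr1 (min_idPl _)// H.
elim/last_ind: s s' => [|s n IH] s' so so' H H' E.
  by have := E (one01 R); rewrite !one//= => /eqP; rewrite eq_sym pnatr_eq0 => /nilP.
case/lastP: s' so' H' E => [|s' n'] so' H' E.
  by have := E (one01 R); rewrite !one// size_rcons => /eqP; rewrite pnatr_eq0.
have top (t : seq R) k : sorted <=%R (rcons t k) -> (forall m, m \in rcons t k -> 1 <= m) ->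
  forall m, m \in rcons t k -> 1 <= m /\ m <= k.
  move=> st Ht m mt; split; first exact: Ht.
  move: mt; rewrite mem_rcons inE => /orP[/eqP ->//|mt].
  have := st; rewrite -cats1 (sorted_pairwise le_trans) pairwise_cat => /and3P[/allrelP al _ _].
  by apply: al => //; rewrite inE.
have T := top _ _ so H; have T' := top _ _ so' H'.
have nn : n = n'.
  by apply/eqP; rewrite eq_le (gmin_lt T T' E) (gmin_lt T' T (fun u => esym (E u))).
subst n'; congr rcons; apply: IH.
- by move: so; rewrite -cats1 (sorted_pairwise le_trans) pairwise_cat -(sorted_pairwise le_trans) => /and3P[].
- by move: so'; rewrite -cats1 (sorted_pairwise le_trans) pairwise_cat -(sorted_pairwise le_trans) => /and3P[].
- by move=> m ms; apply: H; rewrite mem_rcons inE ms orbT.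
- by move=> m ms; apply: H'; rewrite mem_rcons inE ms orbT.
by move=> u; have := E u; rewrite -!cats1 !big_cat !big_seq1 => /addIr.
Qed.

End Factor.

Section Run.
Variables (R : realType) (V : lmodType R) (J : eqType) (a : J -> J -> int)
    (alpha : J -> V) (coroot : J -> V -> R).
Hypothesis hA : adm a alpha coroot.
Local Notation D := (@RDat R V J a alpha coroot).
Local Notation re := (@is_real R V D).
Local Notation Fword := (@Fword R V D).
Local Notation gl := (seq (J * (I01 R -> R))).
Variable v : V.
Hypothesis v_nat : forall i, exists n : nat, coroot i v = n%:R.
Implicit Types (w : seq J) (i j : J) (M : gl) (u : I01 R).

Definition dpath M : rpath V := fun u => val u *: v - \sum_(q <- M) q.2 u *: alpha q.1.

Definition rstep (o : option gl) i := obind (fun M => omap (fun g => rcons M (i, g)) (gfun (@Hf R V D i (dpath M)))) o.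

Definition run w : option gl := foldl rstep (Some [::]) w.

Lemma run_rcons w i : run (rcons w i) = rstep (run w) i.
Proof. by rewrite /run -cats1 foldl_cat. Qed.

Lemma Fword_run w : Fword w (Some (pi_lam v)) = omap dpath (run w).
Proof.
elim/last_ind: w => [|w i IH].
  by congr Some; apply/funext => u; rewrite /dpath big_nil subr0.
rewrite Fword_rcons run_rcons IH; case: (run w) => //= M; rewrite froot_gfun.
case: (gfun _) => //= g; congr Some; apply/funext => u.
by rewrite /dpath -cats1 big_cat big_seq1 /= opprD addrA.
Qed.

Lemma run_letters w M : run w = Some M -> map fst M = w.
Proof.
elim/last_ind: w M => [|w i IH] M; first by case=> <-.
rewrite run_rcons; case E : (run w) => [M'|] //=; case: (gfun _) => //= g [<-].
by rewrite map_rcons (IH _ E).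
Qed.

Lemma run_B w M : run w = Some M -> @Bset R V D v (dpath M).
Proof. by move=> e; apply/(B_words hA v_nat); exists w; rewrite Fword_run e. Qed.

Lemma scal_inj j (k k' : R) : k *: alpha j = k' *: alpha j -> k = k'.
Proof.
move=> e; apply/eqP; rewrite -subr_eq0; apply/eqP.
have h : \sum_(q <- [:: j]) (k - k') *: alpha q = 0 by rewrite big_seq1 scalerBl e subrr.
by have := adm_free hA (c := fun=> k - k') (isT : uniq [:: j]) h; move=> /(_ j (mem_head _ _)).
Qed.

Lemma rstep_th w M i g : run w = Some M -> gfun (@Hf R V D i (dpath M)) = Some g ->
  exists m p q, fstr (hf coroot i (dpath M)) m p q /\ g = fun u => th (hf coroot i (dpath M)) m p q (val u).
Proof.
move=> e eg; have Bb := run_B e.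
have fb : @froot R V D i (dpath M) = Some (fun u => dpath M u - g u *: alpha i) by rewrite froot_gfun eg.
have [m [p [q [im fs eb _]]]] := B_froot hA v_nat Bb fb.
exists m, p, q; split=> //; apply/funext => u.
have := congr1 (fun f => f u) eb; move=> /addrI/oppr_inj; exact: scal_inj.
Qed.

Lemma th_ge0 (h : R -> R) m p q u : fstr h m p q -> 0 <= th h m p q (val u).
Proof.
move=> [p0 pq q1 [hp hq h1 h2 h3]]; rewrite /th; case: ifP => // /negbT; rewrite -ltNge => pu; case: ifP => // uq.
by rewrite subr_ge0 -hp ltW// h2.
Qed.

Definition Gs i M := [seq q.2 | q <- M & q.1 == i].

Lemma run_imag w M i : run w = Some M -> ~~ re i -> exists ns : seq R,
  [/\ Gs i M = map (@gmin R) ns, sorted <=%R ns, forall n, n \in ns -> 1 <= n &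
   forall n, n \in ns -> forall u, gmin n u <= @Hf R V D i (dpath M) u].
Proof.
move=> + ni; elim/last_ind: w M => [|w j IH] M; first by case=> <-; exists [::].
rewrite run_rcons; case E : (run w) => [M'|] //=; case eg : (gfun _) => [g|] //= [<-].
have [ns [e1 e2 e3 e4]] := IH _ E; have [m [p [q [fs eg']]]] := rstep_th E eg.
have Bb := run_B E.
have mono u : @Hf R V D i (dpath M') u <= @Hf R V D i (dpath (rcons M' (j, g))) u.
  rewrite /Hf /dpath -cats1 big_cat big_seq1 /= opprD addrA [X in _ <= X](crB hA) (crZ hA) (adm_al hA).
  have g0 : 0 <= g u by rewrite eg'; exact: th_ge0.
  have aij : (a i j)%:~R <= 0 :> R.
    by rewrite lerz0; have [->|ij] := eqVneq j i; [exact: im_aii hA _ ni|apply: (adm_off hA); rewrite eq_sym].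
  by have : g u * (a i j)%:~R <= 0 by [exact: mulr_ge0_le0]; lra.
have gs : Gs i (rcons M' (j, g)) = Gs i M' ++ (if j == i then [:: g] else [::]).
  by rewrite /Gs -cats1 filter_cat map_cat /=; case: ifP.
have [ji|ji] := eqVneq j i; last first.
  exists ns; rewrite gs (negbTE ji) cats0; split=> // n nn u; exact: le_trans (e4 _ nn u) (mono u).
subst j; have [z|[s [hs [_ [lin inc]]]]] := B_im hA v_nat ni Bb.
  exfalso; have fb : @froot R V D i (dpath M') = Some (fun u => dpath M' u - g u *: alpha i) by rewrite froot_gfun eg.
  move: fb; rewrite (@froot_none _ _ _ _ _ _ _ _ 0)//; last by rewrite z// ler01 lexx.
  by split; [exact: rpred0|exists 0; rewrite ?z ?lexx ?ler01|move=> t ht; rewrite z].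
case: (hs) => _ s0 s1 [h0 hq h1 h2 h3].
have gE : g = gmin s^-1.
  have fb : @froot R V D i (dpath M') = Some (fun u => dpath M' u - g u *: alpha i) by rewrite froot_gfun eg.
  move: fb; rewrite (froot_fstr a alpha (rpred0 _) hs) => -[eb]; apply/funext => u.
  have := congr1 (fun f => f u) eb; move=> /addrI/oppr_inj/scal_inj <-.
  have /andP[u0 u1] := val01 u; rewrite /th /gmin; have [u0'|u0'] := leP (val u) 0.
    have -> : val u = 0 by apply/eqP; rewrite eq_le u0'.
    by rewrite mulr0 (min_idPr _).
  have [us|us] := leP (val u) s.
    rewrite subr0 lin ?u0// (min_idPr _) 1?mulrC//.
    by rewrite ler_pdivrMr// mul1r.
  by rewrite (min_idPl _)// mulrC ler_pdivlMr// mul1r ltW.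
have s1' : 1 <= s^-1 by rewrite invf_ge1.
have gH u : gmin s^-1 u <= @Hf R V D i (dpath M') u.
  have /andP[u0 u1] := val01 u; rewrite HfE /gmin; have [us|su] := leP (val u) s.
    by rewrite lin ?u0// mulrC ge_min lexx orbT.
  by have := h3 (val u); rewrite (ltW su) u1 add0r => /(_ isT) h; rewrite ge_min h.
(* At time [1 / n] the height is at least 1, so it reaches 1 no later, which means an initial slope
   of at least [n]. *)
have big n : n \in ns -> n <= s^-1.
  move=> nn; rewrite leNgt; apply/negP => sn; have n1 := e3 _ nn.
  have n0 : 0 < n by lra.
  have n01 : 0 <= n^-1 <= 1 by rewrite invr_ge0 ltW//= invf_le1.
  have ns_ : n^-1 < s by rewrite -[s]invrK ltf_pV2// posrE invr_gt0.
  have := e4 _ nn (cl n^-1); rewrite HfE val_cl// lin; last by move: n01 => /andP[-> _]; exact: ltW.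
  rewrite /gmin val_cl// mulfV ?gt_eqF// minxx leNgt => /negP; apply.
  by rewrite ltr_pdivrMr// mul1r.
exists (rcons ns s^-1); rewrite gs eqxx; split.
- by rewrite map_rcons -cats1 e1 gE.
- case: (ns) e2 big => //= n ns' e2 big.
  by rewrite rcons_path e2 big// mem_last.
- by move=> n; rewrite mem_rcons inE => /orP[/eqP ->//|]; exact: e3.
move=> n; rewrite mem_rcons inE => /orP[/eqP ->|nn] u; first exact: le_trans (gH u) (mono u).
exact: le_trans (e4 _ nn u) (mono u).
Qed.

(* the coefficient functions of a path do not depend on the word producing it *)
Lemma run_unique w w' M M' : run w = Some M -> run w' = Some M' -> dpath M = dpath M' ->
  (forall i u, \sum_(g <- Gs i M) g u = \sum_(g <- Gs i M') g u) /\ (forall i, ~~ re i -> Gs i M = Gs i M').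
Proof.
move=> e e' eM.
have S i u : \sum_(g <- Gs i M) g u = \sum_(g <- Gs i M') g u.
  have E : \sum_(q <- M) q.2 u *: alpha q.1 = \sum_(q <- M') q.2 u *: alpha q.1.
    by have := congr1 (fun f => f u) eM; move=> /addrI/oppr_inj.
  have K (N : gl) : \sum_(g <- Gs i N) g u = \sum_(q <- N) q.2 u * (q.1 == i)%:R.
    rewrite /Gs big_map big_filter big_mkcond; apply: eq_bigr => q _.
    by case: ifP => _; rewrite ?mulr1 ?mulr0.
  rewrite !K; have := @collect_eq _ _ _ _ _ _ hA R^o (fun k => (k == i)%:R) [seq (q.1, q.2 u) | q <- M] [seq (q.1, q.2 u) | q <- M'].
  by rewrite !big_map => /(_ E).
split=> // i ni; have [ns [e1 e2 e3 _]] := run_imag e ni; have [ns' [e1' e2' e3' _]] := run_imag e' ni.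
rewrite e1 e1'; congr map; apply: gmin_inj => // u.
by have := S i u; rewrite e1 e1' !big_map.
Qed.

End Run.

(** * Lifting to real indices *)

Section Lift.
Variables (R : realType) (V : lmodType R) (J : eqType) (a : J -> J -> int)
    (alpha : J -> V) (coroot : J -> V -> R).
Variables (Vt : lmodType R) (K : eqType) (at_ : K -> K -> int)
    (alphat : K -> Vt) (coroott : K -> Vt -> R).
Hypotheses (hA : adm a alpha coroot) (hAt : adm at_ alphat coroott).
Variable pj : K -> J.
Local Notation D := (@RDat R V J a alpha coroot).
Local Notation Dt := (@RDat R Vt K at_ alphat coroott).
Local Notation re := (@is_real R V D).
Hypotheses (at_re : forall p, at_ p p = 2%:Z)
  (at_eq : forall p q, p != q -> at_ p q = a (pj p) (pj q))
  (real_inj : forall p q, re (pj p) -> pj p = pj q -> p = q).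
Variables (v : V) (vt : Vt) (G : pred K).
Hypothesis hG : forall p, G p -> coroott p vt = coroot (pj p) v.
Local Notation runt := (run at_ alphat coroott vt).
Local Notation run := (run a alpha coroot v).
Local Notation FD w := (@Fword R V D w (Some (pi_lam v))).
Local Notation FT w := (@Fword R Vt Dt w (Some (pi_lam vt))).
Implicit Types (w : seq K) (p q : K) (i j : J) (u : I01 R).

(** Labels in [G] pair with [vt] as their letters pair with [v]. An imaginary label may be used once
    only, because its lifted diagonal entry is 2 and not that of the letter. *)
Definition good_lab w := all G w && uniq [seq p <- w | ~~ re (pj p)].

(** The two matrices differ only at equal imaginary labels, so the heights agree in every direction
    that is real or not yet used. Since an operator depends only on its height, a word and its lift
    subtract the same coefficient functions. *)
Lemma H_lift p w (M : seq (J * (I01 R -> R))) u : map fst M = map pj w -> G p -> re (pj p) || (p \notin w) ->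
  coroott p (dpath alphat vt (zip w (unzip2 M)) u) = coroot (pj p) (dpath alpha v M u).
Proof.
move=> e Gp hp; rewrite /dpath (crB hAt) (crB hA) (crZ hAt) (crZ hA) hG//; congr (_ - _).
elim: w M e hp => [|q w IH] [|[j g] M] //=; first by rewrite !big_nil (cr0 hA) (cr0 hAt).
move=> [-> e]; rewrite inE negb_or => hp.
rewrite !big_cons (crD hA) (crD hAt) (crZ hA) (crZ hAt) (adm_al hA) (adm_al hAt) /= IH//; last first.
  by move: hp; case: (re (pj p)) => //= /andP[].
congr (_ * _ + _); have [pq|pq] := eqVneq p q; last by rewrite at_eq.
subst q; rewrite at_re; move: hp; rewrite eqxx andFb orbF => /re_aii ->.
by [].
Qed.

Lemma lift_run w : good_lab w -> runt w = omap (fun M => zip w (unzip2 M)) (run (map pj w)).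
Proof.
elim/last_ind: w => // w p IH; rewrite /good_lab all_rcons filter_rcons => /andP[/andP[Gp Gw] un].
have hp : re (pj p) || (p \notin w).
  have [rp|np] := boolP (re (pj p)) => //=; move: un; rewrite np rcons_uniq mem_filter np /= => /andP[].
  by [].
have gw : good_lab w.
  by rewrite /good_lab Gw /=; move: un; case: ifP => // _; rewrite rcons_uniq => /andP[].
rewrite run_rcons map_rcons run_rcons (IH gw); case E : (run _) => [M|] //=.
have eM := run_letters E.
have -> : @Hf R Vt Dt p (dpath alphat vt (zip w (unzip2 M))) = @Hf R V D (pj p) (dpath alpha v M).
  by apply/funext => u; exact: H_lift.
case: (gfun _) => //= g; congr Some; rewrite /unzip2 map_rcons zip_rcons ?size_map//.
by have := congr1 size eM; rewrite !size_map => ->.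
Qed.

Lemma lift_some w b : good_lab w -> FD (map pj w) = Some b -> exists bt, FT w = Some bt.
Proof.
move=> gw; rewrite (Fword_run a alpha coroot v) (Fword_run at_ alphat coroott vt) lift_run//.
by case: (run _) => //= M _; eexists.
Qed.

Lemma unlift_some w bt : good_lab w -> FT w = Some bt -> exists b, FD (map pj w) = Some b.
Proof.
move=> gw; rewrite (Fword_run a alpha coroot v) (Fword_run at_ alphat coroott vt) lift_run//.
by case: (run _) => //= M _; eexists.
Qed.

Lemma lift_H w b bt p u : good_lab w -> FD (map pj w) = Some b -> FT w = Some bt -> G p ->
  re (pj p) || (p \notin w) -> coroott p (bt u) = coroot (pj p) (b u).
Proof.
move=> gw; rewrite (Fword_run a alpha coroot v) (Fword_run at_ alphat coroott vt) lift_run//.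
by case E : (run _) => [M|] //= [<-] [<-] Gp hp; apply: H_lift => //; exact: run_letters E.
Qed.

(* the lifted path determines the original one, by independence of the lifted roots *)
Lemma unlift_unique w w' bt : good_lab w -> good_lab w' -> FT w = Some bt -> FT w' = Some bt ->
  FD (map pj w) = FD (map pj w').
Proof.
move=> gw gw'; rewrite !(Fword_run a alpha coroot v) !(Fword_run at_ alphat coroott vt) !lift_run//.
case E : (run _) => [M|] //=; case E' : (run (map pj w')) => [M'|] //= [<-] [e].
congr Some; apply/funext => u; rewrite /dpath; congr (_ - _).
have S : \sum_(q <- zip w' (unzip2 M')) q.2 u *: alphat q.1 = \sum_(q <- zip w (unzip2 M)) q.2 u *: alphat q.1.
  by have := congr1 (fun f => f u) e; move=> /addrI/oppr_inj.
have := @collect_eq _ _ _ _ _ _ hAt V (fun p => alpha (pj p)) [seq (x.1, x.2 u) | x <- zip w' (unzip2 M')]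
   [seq (x.1, x.2 u) | x <- zip w (unzip2 M)].
rewrite !big_map => /(_ S) /= S'.
have T w0 (N : seq (J * (I01 R -> R))) : map fst N = map pj w0 ->
   \sum_(q <- N) q.2 u *: alpha q.1 = \sum_(q <- zip w0 (unzip2 N)) q.2 u *: alpha (pj q.1).
  elim: w0 N => [|p w0 IH] [|[j g] N] //=; first by rewrite !big_nil.
  by move=> [-> e0]; rewrite !big_cons IH.
by rewrite (T w M (run_letters E)) (T w' M' (run_letters E')) S'.
Qed.

Section Canonical.
Variable lab : J -> nat -> K.
Hypotheses (labK : forall i n, pj (lab i n) = i) (labG : forall i n, G (lab i n))
  (lab_inj : forall i, ~~ re i -> injective (lab i)).
Hypothesis v_nat : forall i, exists n : nat, coroot i v = n%:R.

Fixpoint clift (seen : seq J) (x : seq J) : seq K :=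
  if x is i :: x' then lab i (count_mem i seen) :: clift (i :: seen) x' else [::].

Lemma clift_pj seen x : map pj (clift seen x) = x.
Proof. by elim: x seen => //= i x IH seen; rewrite labK IH. Qed.

Lemma clift_lab seen x p : p \in clift seen x -> exists2 n, (count_mem (pj p) seen <= n)%N & p = lab (pj p) n.
Proof.
elim: x seen => //= i x IH seen; rewrite inE => /orP[/eqP ->|/IH[n h e]].
  by exists (count_mem i seen); rewrite !labK.
by exists n => //; move: h => /=; lia.
Qed.

Lemma clift_good seen x : good_lab (clift seen x).
Proof.
rewrite /good_lab; apply/andP; split; first by elim: x seen => //= i x IH seen; rewrite labG IH.
elim: x seen => //= i x IH seen; rewrite labK; case: ifP => // ni; rewrite /= IH andbT mem_filter labK ni /=.
apply/negP => /clift_lab[n]; rewrite labK /= eqxx => h /(lab_inj ni) e; lia.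
Qed.

Lemma clift_cat seen x y : clift seen (x ++ y) = clift seen x ++ clift (rev x ++ seen) y.
Proof.
elim: x seen => //= i x IH seen; rewrite IH; congr (_ :: _ ++ clift _ _).
by rewrite rev_cons cat_rcons.
Qed.

(** Grouping by letters: the [m]-th coefficient function of [i] meets the [m]-th label of [i] that
    [seen] leaves free. *)
Lemma labsum (U : seq J) seen (M : seq (J * (I01 R -> R))) u : uniq U -> {subset map fst M <= U} ->
  \sum_(q <- zip (clift seen (map fst M)) (unzip2 M)) q.2 u *: alphat q.1 =
  \sum_(i <- U) \sum_(m < size (Gs i M)) (nth (fun=> 0) (Gs i M) m) u *: alphat (lab i (count_mem i seen + m)).
Proof.
move=> uU; elim: M seen => [|[i g] M IH] seen hM.
  by rewrite big_nil big1// => i _; rewrite big_ord0.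
rewrite /= big_cons IH; last by move=> x xM; apply: hM; rewrite inE xM orbT.
have iU : i \in U by apply: hM; rewrite mem_head.
rewrite (bigD1_seq i)//= [RHS](bigD1_seq i)//= addrA; congr (_ + _); last first.
  by apply: eq_bigr => j ji; rewrite /Gs /= eq_sym (negbTE ji).
have -> : Gs i ((i, g) :: M) = g :: Gs i M by rewrite /Gs /= eqxx.
rewrite [RHS]big_ord_recl /= addn0; congr (_ + _).
by apply: eq_bigr => m _; rewrite /bump /= eqxx add1n addnS addSn.
Qed.

(** For an imaginary letter the whole sequence of coefficient functions depends only on the path, so
    its labels agree term by term. A real letter has a single label, and only the sum of its
    functions matters. *)
Theorem lift_unique x y b : FD x = Some b -> FD y = Some b ->
  FT (clift [::] x) = FT (clift [::] y).
Proof.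
rewrite !(Fword_run a alpha coroot v) !(Fword_run at_ alphat coroott vt) !lift_run ?clift_good// !clift_pj.
case E : (run x) => [M|] //=; case E' : (run y) => [M'|] //= [eb] [eb'].
have [S I] := run_unique hA v_nat E E' (etrans eb (esym eb')).
congr Some; apply/funext => u; rewrite /dpath; congr (_ - _).
rewrite -{1}(run_letters E) -{1}(run_letters E').
set U := undup (map fst M ++ map fst M').
rewrite !(@labsum U) ?undup_uniq//; last 2 first.
- by move=> z zM; rewrite mem_undup mem_cat zM orbT.
- by move=> z zM; rewrite mem_undup mem_cat zM.
apply: eq_bigr => i _; have [ri|/I -> //] := boolP (re i).
have cst n : lab i n = lab i 0 by apply: real_inj; rewrite !labK.
have T (N : seq (J * (I01 R -> R))) : \sum_(m < size (Gs i N)) (nth (fun=> 0) (Gs i N) m) u *: alphat (lab i (count_mem i [::] + m)) =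
   (\sum_(g <- Gs i N) g u) *: alphat (lab i 0).
  under eq_bigr do rewrite cst; rewrite -scaler_suml; congr (_ *: _).
  by rewrite (big_nth (fun=> 0)) big_mkord.
by rewrite !T S.
Qed.

End Canonical.

End Lift.

(** * Raising in a GLS crystal *)

Section CrystalSpec.
Variables (R : realType) (V : lmodType R) (J : eqType) (a : J -> J -> int)
    (alpha : J -> V) (coroot : J -> V -> R).
Hypothesis hA : adm a alpha coroot.
Local Notation D := (@RDat R V J a alpha coroot).
Local Notation re := (@is_real R V D).
Variable lam : V.
Hypothesis lam_nat : forall i, exists n : nat, coroot i lam = n%:R.
Local Notation B := (@Bset R V D lam).
Local Notation froot := (@froot R V D).
Local Notation Fword := (@Fword R V D).

(** With this description, compatibility with raising follows from compatibility with lowering and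
    bijectivity. *)
Lemma ce_spec i b b' : B b -> @ce R V D B i (Some b) = Some b' <-> B b' /\ froot i b' = Some b.
Proof.
move=> Bb; rewrite /ce /=; have [ri|ni] := boolP (re i).
  split=> [eb|[Bb' fb]].
    have [m [hm _ _ he]] := B_real hA lam_nat ri Bb; have im := let: And3 x _ _ := hm in x.
    have [m0|/he[p [q [hs Be]]]] := pselect (m = 0).
      by subst m; have [_ h0] := B_lip hA i Bb; rewrite (eroot_none a alpha hm h0) in eb.
    move: eb; rewrite (eroot_estr a alpha im hs) => -[<-]; split=> //.
    by have [] := e_then_f hA ri im hs.
  have [m [p [q [im fs -> _]]]] := B_froot hA lam_nat Bb' fb.
  by have [] := f_then_e hA ri im fs.
split=> [|[Bb' fb]].
  case E : (eroot_im _ _) => [c|] //; case: asboolP => // Bc [<-]; split=> //.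
  exact: (eroot_im_froot hA lam_nat ni Bb Bc E).
by rewrite (froot_eroot_im hA lam_nat ni Bb' fb); case: asboolP.
Qed.

Lemma B_Fword w b c : B b -> Fword w (Some b) = Some c -> B c.
Proof.
move=> /(B_words hA lam_nat)[x ex] fc; apply/(B_words hA lam_nat); exists (x ++ w).
by rewrite Fword_cat ex.
Qed.

Lemma Fword_end w b c : B b -> Fword w (Some b) = Some c -> c (one01 R) = b (one01 R) - sumr alpha w.
Proof.
elim/last_ind: w c => [|w i IH] c Bb; first by case=> <-; rewrite sumr_nil subr0.
rewrite Fword_rcons; case E : (Fword _ _) => [d|] //= fd.
rewrite (B_froot_end hA lam_nat (B_Fword Bb E) fd) (IH _ Bb E).
by rewrite -cats1 sumr_cat sumr_cons sumr_nil addr0 opprD addrA.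
Qed.

End CrystalSpec.

(** * Restriction to a subset of the indices *)

Section Restriction.
Variables (R : realType) (V : lmodType R) (J : eqType) (a : J -> J -> int)
    (alpha : J -> V) (coroot : J -> V -> R) (S : pred J).

Lemma adm_sub : adm a alpha coroot ->
  adm (fun i j : {i | S i} => a (val i) (val j)) (fun i => alpha (val i)) (fun i => coroot (val i)).
Proof.
move=> hA; split.
- by move=> i j; exact: adm_al hA _ _.
- by move=> i; exact: adm_diag hA _.
- by move=> i j ij; apply: (adm_off hA); rewrite val_eqE.
- by move=> i j; exact: adm_zero hA _ _.
- move=> s c us e i is_.
  have us' : uniq (map val s) by rewrite map_inj_uniq//; exact: val_inj.
  have z : \sum_(x <- map val s) oapp c 0 (insub x) *: alpha x = 0.
    by rewrite big_map -[RHS]e; apply: eq_bigr => j _; rewrite valK.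
  by have := adm_free hA us' z (map_f val is_); rewrite valK.
- by move=> i; exact: adm_lin hA _.
by have [d [d0 ds]] := adm_sym hA; exists (fun i => d (val i)); split=> *; [exact: d0|exact: ds].
Qed.

(** Each condition concerns one letter at a time. This is what makes LS paths for the full lifted
    datum comparable with LS paths for the subset. *)
Lemma nset_sub X : nset a alpha coroot X ->
  nset (fun i j : {i | S i} => a (val i) (val j)) (fun i => alpha (val i)) (fun i => coroot (val i)) X.
Proof.
case=> h1 h2 h3 h4 h5 h6 h7 h8 h9 [h [h10 h11]]; split.
- by move=> x i; exact: h1.
- by move=> x i; exact: h2.
- by move=> x i; exact: h3.
- by move=> x i; exact: h4.
- by move=> x i; exact: h5.
- by move=> x y i; exact: h6.
- by move=> x y i; exact: h7.
- by move=> x y i; exact: h8.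
- by move=> x y y' i; exact: h9.
by exists h; split=> // x y i; exact: h11.
Qed.

Lemma Fword_val (v : seq {i | S i}) o :
  @Fword R V (@RDat R V J a alpha coroot) (map val v) o =
  @Fword R V (@RDat R V {i | S i} (fun i j => a (val i) (val j)) (fun i => alpha (val i)) (fun i => coroot (val i))) v o.
Proof. by elim: v o => //= i v IH o; rewrite /Fword /= -/(Fword _ _) -IH. Qed.

End Restriction.

Section RelExtra.
Variables (R : realType) (V : lmodType R) (J : eqType) (a : J -> J -> int)
    (alpha : J -> V) (coroot : J -> V -> R).
Hypothesis hA : adm a alpha coroot.
Hypothesis all_re : forall i, a i i = 2%:Z.
Local Notation D := (@RDat R V J a alpha coroot).
Local Notation Fword := (@Fword R V D).
Local Notation rel := (@rel R V J a alpha coroot).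
Variables X X0 : rpath V -> Prop.
Hypotheses (hX : nset a alpha coroot X) (hX0 : nset a alpha coroot X0).
Variables z z0 : rpath V.
Hypotheses (Xz : X z) (X0z : X0 z0) (dz : forall i, has_min coroot i z 0) (dz0 : forall i, has_min coroot i z0 0)
  (ez : forall i, hf coroot i z 1 = hf coroot i z0 1).

Lemma rel_base : rel z z0 z z0.
Proof. by exists [::]. Qed.

Lemma rel_sym x x0 : rel z z0 x x0 -> rel z0 z x0 x.
Proof. by move=> [w [h1 h2]]; exists w. Qed.

Lemma rel_total w x : Fword w (Some z) = Some x -> exists2 x0, Fword w (Some z0) = Some x0 & rel z z0 x x0.
Proof.
elim/last_ind: w x => [|w i IH] x; first by case=> <-; exists z0 => //; exact: rel_base.
rewrite Fword_rcons; case E : (Fword _ _) => [y|] //= fy; have [y0 e0 ry] := IH _ E.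
have [x0 fx0 rx] := rel_froot hA all_re hX hX0 Xz X0z dz dz0 ez ry fy.
by exists x0 => //; rewrite Fword_rcons e0.
Qed.

Lemma rel_strip w y x x0 : rel z z0 x x0 -> X y -> Fword w (Some y) = Some x -> exists y0, rel z z0 y y0.
Proof.
elim/last_ind: w x x0 => [|w i IH] x x0 r Xy; first by case=> ->; exists x0.
rewrite Fword_rcons; case E : (Fword _ _) => [u|] //= fu.
have [u0 [_ _ ru]] := rel_pre hA all_re hX hX0 Xz X0z dz dz0 r (Fword_X hX Xy E) fu.
exact: IH ru Xy E.
Qed.

End RelExtra.

(** * Decomposition over a subset of the indices *)

Section Decomposition.
Variables (R : realType) (V : lmodType R) (I : countType)
  (a : I -> I -> int) (alpha : I -> V) (coroot : I -> V -> R) (lam : V) (S : pred I)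
  (Vt : lmodType R) (alphat : Itil a -> Vt) (coroott : Itil a -> Vt -> R) (lamt : Vt).
Hypotheses (hA : adm a alpha coroot) (hAt : adm (@Atil I a) alphat coroott).
Hypothesis lam_nat : forall i, exists n : nat, coroot i lam = n%:R.
Hypothesis lamt_lam : forall p : Itil a, coroott p lamt = coroot (val p).1 lam.
Local Notation K := (Itil a).
Local Notation D := (@RDat R V I a alpha coroot).
Local Notation Dt := (@RDat R Vt K (@Atil I a) alphat coroott).
Local Notation re := (@is_real R V D).
Implicit Types (i j : I) (p q : K) (u : I01 R) (w x y : seq I).

Definition pj p : I := (val p).1.

Lemma lab_proof i n : (0 < (i, if a i i == 2%:Z then 1%N else n.+1).2)%N &&
  ((a (i, if a i i == 2%:Z then 1%N else n.+1).1 (i, if a i i == 2%:Z then 1%N else n.+1).1 == 2%:Z)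
    ==> ((i, if a i i == 2%:Z then 1%N else n.+1).2 == 1%N)).
Proof. by rewrite /=; case: ifP. Qed.

Definition lab i n : K :=
  exist (fun p : I * nat => (0 < p.2)%N && ((a p.1 p.1 == 2%:Z) ==> (p.2 == 1%N))) _ (lab_proof i n).

Lemma labK i n : pj (lab i n) = i. Proof. by []. Qed.

Lemma lab_inj i : ~~ re i -> injective (lab i).
Proof. by rewrite reE => ni m n /(congr1 val) /=; rewrite (negbTE ni) => -[]. Qed.

Lemma at_re p : Atil p p = 2%:Z. Proof. by rewrite /Atil eqxx. Qed.

Lemma at_eq p q : p != q -> Atil p q = a (pj p) (pj q).
Proof. by rewrite /Atil => /negbTE ->. Qed.

Lemma real_inj p q : re (pj p) -> pj p = pj q -> p = q.
Proof.
rewrite reE; case: p q => [[i m] hp] [[j n] hq]; rewrite /pj /= => ri e; subst j; apply: val_inj => /=.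
move: (hp) (hq); rewrite /= ri /= => /andP[_ /eqP e1] /andP[_ /eqP e2].
by rewrite e1 e2.
Qed.

Lemma lift_wordE w : lift_word a w = clift lab [::] w.
Proof.
rewrite /lift_word /mseq; elim: w [::] => //= i w IH seen; rewrite -IH /=.
case: insubP => [p _ e|]; last by rewrite /=; case: ifP.
by congr (_ :: _); apply: val_inj; rewrite e.
Qed.

Lemma lamt_nat p : exists n : nat, coroott p lamt = n%:R.
Proof. by rewrite lamt_lam; exact: lam_nat. Qed.
Local Notation F w := (@Fword R V D w (Some (pi_lam lam))).
Local Notation Ft w := (@Fword R Vt Dt w (Some (pi_lam lamt))).
Local Notation B := (@Bset R V D lam).
Local Notation X := (@Bset R Vt Dt lamt).
Local Notation cl0 := (clift lab [::]).

Let hG0 p : predT p -> coroott p lamt = coroot (pj p) lam. Proof. by move=> _; exact: lamt_lam. Qed.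

Let good0 seen w : good_lab a alpha coroot pj predT (clift lab seen w).
Proof. exact: (clift_good labK (fun _ _ => isT) lab_inj). Qed.

Let hX : nset (@Atil I a) alphat coroott X. Proof. exact: (Bset_nset hAt at_re lamt_nat). Qed.

Definition tdm (pit : rpath Vt) := forall p, S (pj p) -> forall u, 0 <= coroott p (pit u).

Definition top (pi : rpath V) w (pit : rpath Vt) := [/\ F w = Some pi, Ft (cl0 w) = Some pit & tdm pit].

Lemma clift_fresh seen w p : p \in clift lab seen w -> exists2 n,
  (n < count_mem (pj p) seen + count_mem (pj p) w)%N & p = lab (pj p) n.
Proof.
elim: w seen => //= i w IH seen; rewrite inE => /orP[/eqP ->|/IH[n h e]].
  exists (count_mem i seen); rewrite labK //= eqxx -[X in (X < _)%N]addn0 ltn_add2l; by [].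
exists n => //; apply: leq_trans h _.
by rewrite /= addnCA addnA.
Qed.

Lemma lab_fresh i n w : (count_mem i w <= n)%N -> re i || (lab i n \notin cl0 w).
Proof.
move=> h; have [//|ni] := boolP (re i); apply/negP => /clift_fresh[m]; rewrite labK /= add0n => hm /(lab_inj ni) e.
by move: h; rewrite e leqNgt hm.
Qed.

Section AboveTop.
Variables (pi : rpath V) (w : seq I) (pit : rpath Vt).
Hypothesis ht : top pi w pit.
Local Notation JS := {i : I | S i}.
Local Notation KS := {p : K | S (pj p)}.
Local Notation aS := (fun i j : JS => a (val i) (val j)).
Local Notation alS := (fun i : JS => alpha (val i)).
Local Notation crS := (fun i : JS => coroot (val i)).
Local Notation atS := (fun p q : KS => Atil (val p) (val q)).
Local Notation altS := (fun p : KS => alphat (val p)).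
Local Notation crtS := (fun p : KS => coroott (val p)).
Local Notation DS := (@RDat R V JS aS alS crS).
Local Notation DtS := (@RDat R Vt KS atS altS crtS).
Local Notation mu := (pi (one01 R)).
Local Notation mut := (pit (one01 R)).
Implicit Types (v : seq JS).

Let hAS := adm_sub S hA.

Let hAtS := adm_sub (fun p => S (pj p)) hAt.

Let hXS := nset_sub (fun p => S (pj p)) hX.

Lemma top_H p u : re (pj p) || (p \notin cl0 w) -> coroott p (pit u) = coroot (pj p) (pi u).
Proof.
have [f1 f2 _] := ht => hp.
by apply: (lift_H hA hAt at_re at_eq hG0 u (good0 [::] w)) => //; rewrite clift_pj.
Qed.

Lemma top_X : X pit.
Proof. by have [_ f2 _] := ht; apply/(B_words hAt lamt_nat); exists (cl0 w). Qed.

Lemma top_B : B pi.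
Proof. by have [f1 _ _] := ht; apply/(B_words hA lam_nat); exists w. Qed.

Lemma int_nat (r : R) : r \is a Num.int -> 0 <= r -> exists n : nat, r = n%:R.
Proof. by move=> /intrP[z ->]; rewrite ler0z => z0; exists `|z|%N; rewrite natr_absz ger0_norm. Qed.

Lemma mut_nat (p : KS) : exists n : nat, coroott (val p) mut = n%:R.
Proof.
apply: int_nat; last by have [_ _ d] := ht; exact: d (valP p) _.
by have := B_int hAt lamt_nat (val p) top_X; rewrite /hf cl1.
Qed.

Lemma mu_nat (i : JS) : exists n : nat, coroot (val i) mu = n%:R.
Proof.
apply: int_nat; first by have := B_int hA lam_nat (val i) top_B; rewrite /hf cl1.
have <- := @top_H (lab (val i) (count_mem (val i) w)) (one01 R) (lab_fresh (leqnn _)).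
by have [_ _ d] := ht; apply: d; exact: (valP i).
Qed.

Definition pjS (p : KS) : JS := exist _ (pj (val p)) (valP p).

Definition GS (p : KS) := re (pj (val p)) || (val p \notin cl0 w).

(** Numbering continues after the occurrences in [w], so a word above [pi] receives the labels it
    has as a continuation of [w] ([clS_val]). *)
Definition labS (i : JS) n : KS := exist (fun p => S (pj p)) (lab (val i) (count_mem (val i) w + n)) (valP i).

Lemma hGS (p : KS) : GS p -> coroott (val p) mut = coroot (val (pjS p)) mu.
Proof. exact: top_H. Qed.

Lemma labSK (i : JS) n : pjS (labS i n) = i. Proof. exact: val_inj. Qed.

Lemma labSG (i : JS) n : GS (labS i n). Proof. by apply: lab_fresh; rewrite leq_addr. Qed.

Lemma labS_inj (i : JS) : ~~ @is_real R V DS i -> injective (labS i).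
Proof. by move=> ni m n /(congr1 val)/(lab_inj ni)/addnI. Qed.

Lemma atS_re (p : KS) : atS p p = 2%:Z. Proof. exact: at_re. Qed.

Lemma atS_eq (p q : KS) : p != q -> atS p q = aS (pjS p) (pjS q).
Proof. by move=> pq; apply: at_eq; rewrite val_eqE. Qed.

Lemma realS_inj (p q : KS) : @is_real R V DS (pjS p) -> pjS p = pjS q -> p = q.
Proof. by move=> rp /(congr1 val) e; apply: val_inj; exact: real_inj rp e. Qed.
Local Notation clS := (clift labS [::]).

Lemma goodS v : good_lab aS alS crS pjS GS (clS v).
Proof. exact: (clift_good labSK labSG labS_inj). Qed.

Lemma clS_val v : map val (clS v) = clift lab (rev w) (map val v).
Proof.
rewrite -[rev w]cat0s -[[::] in RHS]/(map val ([::] : seq JS)).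
elim: v ([::] : seq JS) => //= i v IH seen; rewrite IH; congr (lab _ _ :: _).
rewrite count_cat count_rev addnC; congr (_ + _)%N.
by rewrite count_map; apply: eq_count => j /=; rewrite val_eqE.
Qed.
Local Notation Fp v := (@Fword R V D (map val v) (Some pi)).
Local Notation Fpt v := (@Fword R Vt DtS (clS v) (Some pit)).
Local Notation FS v := (@Fword R V DS v (Some (pi_lam mu))).
Local Notation FSt v := (@Fword R Vt DtS (clS v) (Some (pi_lam mut))).

Lemma Fp_cat v : F (w ++ map val v) = Fp v.
Proof. by have [f1 _ _] := ht; rewrite Fword_cat f1. Qed.

Lemma Fpt_cat v : Ft (cl0 (w ++ map val v)) = Fpt v.
Proof.
have [_ f2 _] := ht; rewrite clift_cat cats0 -clS_val Fword_cat f2.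
exact: (@Fword_val R Vt K (@Atil I a) alphat coroott (fun p => S (pj p))).
Qed.

Lemma Fp_lift v b : Fp v = Some b -> exists bt, Fpt v = Some bt.
Proof.
rewrite -Fp_cat -Fpt_cat => f; apply: (lift_some hA hAt at_re at_eq hG0 (good0 _ _)).
by rewrite (clift_pj labK); exact: f.
Qed.

Lemma Fp_unlift v bt : Fpt v = Some bt -> exists b, Fp v = Some b.
Proof.
rewrite -Fp_cat -Fpt_cat => f; have := unlift_some hA hAt at_re at_eq hG0 (good0 _ _) f.
by rewrite (clift_pj labK).
Qed.

Lemma FS_lift v r : FS v = Some r -> exists rt, FSt v = Some rt.
Proof.
move=> f; apply: (lift_some hAS hAtS atS_re atS_eq hGS (goodS v)).
by rewrite (clift_pj labSK); exact: f.
Qed.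

Lemma FS_unlift v rt : FSt v = Some rt -> exists r, FS v = Some r.
Proof.
move=> f; have := unlift_some hAS hAtS atS_re atS_eq hGS (goodS v) f.
by rewrite (clift_pj labSK).
Qed.
Local Notation X0 := (@Bset R Vt DtS mut).

Let hX0 : nset atS altS crtS X0. Proof. exact: (Bset_nset hAtS atS_re mut_nat). Qed.

Let X0z : X0 (pi_lam mut). Proof. exact: (pi_lam_B _ _ _ mut). Qed.

Let dz (p : KS) : has_min crtS p pit 0.
Proof.
have [_ _ d] := ht; split; first exact: rpred0.
  exists 0; first by rewrite lexx ler01.
  by have [_ h] := B_lip hAt (val p) top_X; exact: h.
by move=> t _; exact: d (valP p) _.
Qed.

Let dz0 (p : KS) : has_min crtS p (pi_lam mut) 0.
Proof.
split; first exact: rpred0.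
  exists 0; first by rewrite lexx ler01.
  by have [_ h] := B_lip hAtS p X0z; exact: h.
move=> t /andP[t0 t1]; rewrite /hf /pi_lam (crZ hAtS) mulr_ge0//.
  by have /andP[] := val01 (cl t).
by have [n ->] := mut_nat p; exact: ler0n.
Qed.

Let ez (p : KS) : hf crtS p pit 1 = hf crtS p (pi_lam mut) 1.
Proof. by rewrite /hf cl1 /pi_lam /= scale1r. Qed.
Local Notation rl := (rel atS altS crtS pit (pi_lam mut)).

Lemma Fpt_rel v bt : Fpt v = Some bt -> exists2 rt, FSt v = Some rt & rl bt rt.
Proof. exact: (rel_total hAtS atS_re hXS hX0 top_X X0z dz dz0 ez). Qed.

Lemma FSt_rel v rt : FSt v = Some rt -> exists2 bt, Fpt v = Some bt & rl bt rt.
Proof.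
move=> f; have [bt e r] := rel_total hAtS atS_re hX0 hXS X0z top_X dz0 dz (fun p : KS => esym (ez p)) f.
by exists bt => //; exact: rel_sym.
Qed.

(** The detour that carries every comparison: lift the word above [pi], pass through the normal sets
    to the straight path ending at the endpoint of [pit], and go down to the Levi datum. *)
Lemma Fp_FS v b : Fp v = Some b -> exists r, FS v = Some r.
Proof. by move=> /Fp_lift[bt /Fpt_rel[rt /FS_unlift]]. Qed.

Lemma FS_Fp v r : FS v = Some r -> exists b, Fp v = Some b.
Proof. by move=> /FS_lift[rt /FSt_rel[bt /Fp_unlift]]. Qed.

(** Two words with one result have one lift ([lift_unique]), which is related to one path only
    ([rel_fun]), which in turn descends to one path ([unlift_unique]). *)
Lemma FS_unique v v' b r r' : Fp v = Some b -> Fp v' = Some b -> FS v = Some r -> FS v' = Some r' -> r = r'.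
Proof.
move=> f f' g g'; have [bt e] := Fp_lift f; have [bt' e'] := Fp_lift f'.
have bb : bt = bt'.
  have := lift_unique hA hAt at_re at_eq real_inj hG0 labK (fun _ _ => isT) lab_inj lam_nat
    (etrans (Fp_cat v) f) (etrans (Fp_cat v') f').
  by rewrite !Fpt_cat e e' => -[].
subst bt'; have [rt er r1] := Fpt_rel e; have [rt' er' r2] := Fpt_rel e'.
have rr := rel_fun hAtS atS_re hXS hX0 top_X X0z dz dz0 r1 r2; subst rt'.
have := unlift_unique hAS hAtS atS_re atS_eq hGS (goodS v) (goodS v') er er'.
by rewrite !clift_pj ?g ?g'; [case|exact: labSK|exact: labSK].
Qed.

Lemma Fp_unique v v' b b' r : Fp v = Some b -> Fp v' = Some b' -> FS v = Some r -> FS v' = Some r -> b = b'.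
Proof.
move=> f f' g g'; have [rt e] := FS_lift g; have [rt' e'] := FS_lift g'.
have rr : rt = rt'.
  have := lift_unique hAS hAtS atS_re atS_eq realS_inj hGS labSK labSG labS_inj mu_nat g g'.
  by rewrite e e' => -[].
subst rt'; have [bt eb r1] := FSt_rel e; have [bt' eb' r2] := FSt_rel e'.
have bb := rel_fun hAtS atS_re hX0 hXS X0z top_X dz0 dz (rel_sym r1) (rel_sym r2); subst bt'.
have := unlift_unique hA hAt at_re at_eq hG0 (good0 [::] (w ++ map val v)) (good0 [::] (w ++ map val v')).
move=> /(_ bt); rewrite !Fpt_cat => /(_ eb eb'); rewrite !clift_pj// !Fp_cat f f'.
by case.
Qed.

Lemma Fp_mmin v b r (i : JS) : re (val i) -> Fp v = Some b -> FS v = Some r ->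
  @mmin R V D (val i) b = @mmin R V DS i r.
Proof.
move=> ri f g; have [bt e] := Fp_lift f; have [rt er rr] := Fpt_rel e.
have H1 u : coroott (lab (val i) 0) (bt u) = coroot (val i) (b u).
  apply: (lift_H hA hAt at_re at_eq hG0 u (good0 [::] (w ++ map val v)) (p := lab (val i) 0)) => //.
  - by rewrite clift_pj// Fp_cat.
  - by rewrite Fpt_cat.
  by rewrite labK ri.
have H2 u : crtS (labS i 0) (rt u) = crS i (r u).
  have := lift_H hAS hAtS atS_re atS_eq hGS u (goodS v) (b := r) (bt := rt) (p := labS i 0).
  rewrite clift_pj ?g//; last exact: labSK.
  move=> /(_ erefl er (labSG i 0)); rewrite labSK; apply.
  by apply/orP; left; exact: ri.
have lb : lab (val i) 0 = val (labS i 0) by apply: real_inj.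
have [k [k1 k2]] := rel_min hAtS atS_re hXS hX0 top_X X0z dz dz0 (labS i 0) rr.
have m1 : has_min coroot (val i) b (- k%:R).
  have [x1 [t t01 x2] x3] := k1; split=> //.
    by exists t => //; rewrite -x2 /hf -H1 lb.
  by move=> t' t'01; have := x3 t' t'01; rewrite /hf -H1 lb.
have m2 : has_min crS i r (- k%:R).
  have [x1 [t t01 x2] x3] := k2; split=> //.
    by exists t => //; rewrite -x2 /hf -H2.
  by move=> t' t'01; have := x3 t' t'01; rewrite /hf -H2.
by rewrite (mmin_eq a alpha m1) (mmin_eq aS alS m2).
Qed.

(* [pit] is the only dominant path of its component *)
Lemma top_unique pi' w' pit' (v v' : seq JS) b : top pi' w' pit' -> Fp v = Some b ->
  @Fword R V D (map val v') (Some pi') = Some b -> pi' = pi.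
Proof.
move=> ht' f f'; have [f1 f2 _] := ht; have [f1' f2' d'] := ht'.
have [bt e] := Fp_lift f; have [rt er rr] := Fpt_rel e.
have Xpit' : X pit' by apply/(B_words hAt lamt_nat); exists (cl0 w').
have E : Ft (cl0 (w' ++ map val v')) = Some bt.
  rewrite -e -Fpt_cat; apply: (lift_unique hA hAt at_re at_eq real_inj hG0 labK (fun _ _ => isT) lab_inj lam_nat (b := b)).
    by rewrite Fword_cat f1'.
  by rewrite Fp_cat.
rewrite clift_cat Fword_cat f2' cats0 in E.
have [u eu] : exists u : seq KS, map val u = clift lab (rev w') (map val v').
  elim: (v') (rev w') => [|i s IH] seen; first by exists [::].
  have [t et] := IH (val i :: seen).
  by exists (exist (fun p => S (pj p)) (lab (val i) (count_mem (val i) seen)) (valP i) :: t); rewrite /= et.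
rewrite -eu (@Fword_val R Vt K (@Atil I a) alphat coroott (fun p => S (pj p))) in E.
have [y0 r0] := rel_strip hAtS atS_re hXS hX0 top_X X0z dz dz0 rr Xpit' E.
have pp : pit' = pit.
  apply: (rel_dom hXS top_X r0) => p; split; first exact: rpred0.
    exists 0; first by rewrite lexx ler01.
    by have [_ h] := B_lip hAt (val p) Xpit'; exact: h.
  by move=> t _; exact: d' (valP p) _.
subst pit'; have := unlift_unique hA hAt at_re at_eq hG0 (good0 [::] w) (good0 [::] w') f2 f2'.
by rewrite !clift_pj// f1 f1' => -[].
Qed.

End AboveTop.

(** If the lift is not dominant, some label [p] has a negative height. For a real letter the
    original path can be raised directly. For an imaginary one the lifted path is raised, giving a
    lifted word ending in [p], and this word is projected back. *)
Lemma top_or_pre b : B b -> (exists w pit, top b w pit) \/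
  exists i b', [/\ S i, B b' & @froot R V D i b' = Some b].
Proof.
move=> Bb; have /(B_words hA lam_nat)[w fw] := Bb.
have [|bt fbt] := lift_some hA hAt at_re at_eq hG0 (good0 [::] w) (b := b); first by rewrite clift_pj.
have Xbt : X bt by apply/(B_words hAt lamt_nat); exists (cl0 w).
have [d|nd] := pselect (tdm bt); first by left; exists w, bt.
right; have [p [u [Sp up]]] : exists p u, S (pj p) /\ coroott p (bt u) < 0.
  apply: contrapT => H; apply: nd => p Sp u; rewrite leNgt; apply/negP => h.
  by apply: H; exists p, u.
have lH q : re (pj q) || (q \notin cl0 w) -> coroott q (bt u) = coroot (pj q) (b u).
  by move=> hq; apply: (lift_H hA hAt at_re at_eq hG0 u (good0 [::] w)) => //; rewrite clift_pj.
have [rp|np] := boolP (re (pj p)).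
  have [m [hm m0 _ hE]] := B_real hA lam_nat rp Bb.
  have [|s [t [hs Be]]] := hE _.
    move=> mz; have [_ _ H] := hm; have := H _ (val01 u).
    by rewrite mz /hf cl_val leNgt -lH ?rp// up.
  have im := let: And3 y _ _ := hm in y.
  have [_ fe] := e_then_f hA rp im hs.
  by exists (pj p); eexists; split; [exact: Sp|exact: Be|exact: fe].
have rt : @is_real R Vt Dt p by apply/eqP; exact: at_re.
have [m [hm m0 _ hE]] := B_real hAt lamt_nat rt Xbt.
have [|s [t [hs Be]]] := hE _.
  move=> mz; have [_ _ H] := hm; have := H _ (val01 u).
  by rewrite mz /hf cl_val leNgt up.
have im := let: And3 y _ _ := hm in y.
have [_ fe] := e_then_f hAt rt im hs.
have /(B_words hAt lamt_nat)[w2 f2] := Be.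
have f3 : Ft (rcons w2 p) = Some bt by rewrite Fword_rcons f2 /= fe.
(* Equal endpoints force equal multisets of labels. So the new word also uses each imaginary label
   at most once, and it may be projected. *)
have pe : perm_eq (rcons w2 p) (cl0 w).
  apply: (sumr_inj hAt); apply: oppr_inj; apply: (addrI (pi_lam lamt (one01 R))).
  by rewrite -(Fword_end hAt lamt_nat (pi_lam_B _ _ _ lamt) f3) (Fword_end hAt lamt_nat (pi_lam_B _ _ _ lamt) fbt).
have g3 : good_lab a alpha coroot pj predT (rcons w2 p).
  have := good0 [::] w; rewrite /good_lab !all_predT /=.
  by rewrite -(perm_uniq (perm_filter _ pe)).
have := unlift_unique hA hAt at_re at_eq hG0 g3 (good0 [::] w) f3 fbt.
rewrite clift_pj// fw map_rcons Fword_rcons; case E : (Fword _ _) => [b'|] //= fb'.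
exists (pj p), b'; split=> //; apply/(B_words hA lam_nat); by exists (map pj w2).
Qed.

Lemma to_top b : B b -> exists pi w pit (v : seq {i : I | S i}), top pi w pit /\
  @Fword R V D (map val v) (Some pi) = Some b.
Proof.
move: b; apply: (B_ind hA lam_nat) => b Bb IH.
have [[w [pit h]]|[i [b' [Si Bb' fb]]]] := top_or_pre Bb; first by exists b, w, pit, [::].
have [pi [w [pit [v [h fv]]]]] := IH _ _ Bb' fb.
by exists pi, w, pit, (rcons v (exist _ i Si)); split=> //; rewrite map_rcons Fword_rcons fv /= fb.
Qed.

End Decomposition.

(** * The correspondence and the crystal operators *)

Section Isomorphism.
Variables (R : realType) (V : lmodType R) (I : countType)
  (a : I -> I -> int) (alpha : I -> V) (coroot : I -> V -> R) (lam : V) (S : pred I)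
  (Vt : lmodType R) (alphat : Itil a -> Vt) (coroott : Itil a -> Vt -> R) (lamt : Vt).
Hypotheses (hA : adm a alpha coroot) (hAt : adm (@Atil I a) alphat coroott).
Hypothesis lam_nat : forall i, exists n : nat, coroot i lam = n%:R.
Hypothesis lamt_lam : forall p : Itil a, coroott p lamt = coroot (val p).1 lam.
Local Notation JS := {i : I | S i}.
Local Notation D := (@RDat R V I a alpha coroot).
Local Notation DS := (@RDat R V JS (fun i j => a (val i) (val j)) (fun i => alpha (val i)) (fun i => coroot (val i))).
Local Notation B := (@Bset R V D lam).
Local Notation top := (top alpha coroot lam S alphat coroott lamt).
Local Notation BS x := (@Bset R V DS (x.1 (one01 R))).
Implicit Types (i : JS) (v : seq JS) (b : rpath V) (x : rpath V * rpath V).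

Let hAS := adm_sub S hA.

(* one word leads from the dominant path [x.1] to [b] and, for the Levi datum,
   from the straight path ending at the endpoint of [x.1] to [x.2] *)
Definition corr x b := exists v w pit, [/\ top x.1 w pit,
  @Fword R V D (map val v) (Some x.1) = Some b &
  @Fword R V DS v (Some (pi_lam (x.1 (one01 R)))) = Some x.2].

Lemma corr_ex b : B b -> exists x, corr x b.
Proof.
move=> /(to_top S hA hAt lam_nat lamt_lam)[pi [w [pit [v [h f]]]]].
by have [r g] := Fp_FS hA hAt lam_nat lamt_lam h f; exists (pi, r), v, w, pit.
Qed.

Lemma corr_B x b : corr x b -> B b.
Proof.
by move=> [v [w [pit [h f _]]]]; exact: (B_Fword hA lam_nat (top_B hA lam_nat h) f).
Qed.

Lemma corr_fun x x' b : corr x b -> corr x' b -> x = x'.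
Proof.
case: x x' => [p r] [p' r'] [v [w [pit [h f g]]]] [v' [w' [pit' [h' f' g']]]].
have e : p' = p := top_unique hA hAt lam_nat lamt_lam h h' f f'.
move: (f') (g'); rewrite /= e => f2 g2.
have er : r = r' := FS_unique hA hAt lam_nat lamt_lam h f f2 g g2.
by rewrite er -[p]e.
Qed.

Lemma corr_inj x b b' : corr x b -> corr x b' -> b = b'.
Proof.
move=> [v [w [pit [h f g]]]] [v' [w' [pit' [h' f' g']]]].
exact: (Fp_unique hA hAt lam_nat lamt_lam h f f' g g').
Qed.

Lemma corr_sur x w pit : top x.1 w pit -> BS x x.2 -> exists b, corr x b.
Proof.
move=> h /(B_words hAS (mu_nat hA hAt lam_nat lamt_lam h))[v g].
by have [b f] := FS_Fp hA hAt lam_nat lamt_lam h g; exists b, v, w, pit.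
Qed.

Lemma corr_nat x b : corr x b -> forall i, exists n : nat, coroot (val i) (x.1 (one01 R)) = n%:R.
Proof. by move=> [v [w [pit [h _ _]]]] i; exact: (mu_nat hA hAt lam_nat lamt_lam h i). Qed.

Lemma corr_BS x b : corr x b -> BS x x.2.
Proof.
move=> c; apply/(B_words hAS (corr_nat c)).
by have [v [w [pit [_ _ g]]]] := c; exists v.
Qed.

Lemma corr_wt x b : corr x b -> x.2 (one01 R) = b (one01 R).
Proof.
move=> c; have [v [w [pit [h f g]]]] := c.
rewrite (Fword_end hA lam_nat (top_B hA lam_nat h) f).
rewrite (Fword_end hAS (corr_nat c) (pi_lam_B _ _ _ _) g).
by rewrite /pi_lam /= scale1r /sumr big_map.
Qed.

Lemma corr_mmin x b i : corr x b -> @is_real R V DS i -> @mmin R V DS i x.2 = @mmin R V D (val i) b.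
Proof.
move=> [v [w [pit [h f g]]]] ri.
by rewrite (Fp_mmin hA hAt lam_nat lamt_lam h (i := i) ri f g).
Qed.

Lemma corr_eps x b i : corr x b -> @ceps R V DS i x.2 = @ceps R V D (val i) b.
Proof.
move=> c; rewrite /ceps -[@is_real R V D (val i)]/(@is_real R V DS i); case: ifP => // ri.
by rewrite (corr_mmin c ri).
Qed.

Lemma corr_phi x b i : corr x b -> @cphi R V DS i x.2 = @cphi R V D (val i) b.
Proof.
move=> c; rewrite /cphi -[@is_real R V D (val i)]/(@is_real R V DS i) /Hf (corr_wt c).
by case: ifP => // ri; rewrite (corr_mmin c ri).
Qed.

Lemma corr_froot x b i b1 : corr x b -> @froot R V D (val i) b = Some b1 ->
  exists r, @froot R V DS i x.2 = Some r /\ corr (x.1, r) b1.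
Proof.
move=> [v [w [pit [h f g]]]] fb.
have f1 : @Fword R V D (map val (rcons v i)) (Some x.1) = Some b1.
  by rewrite map_rcons Fword_rcons f.
have [r g1] := Fp_FS hA hAt lam_nat lamt_lam h f1; exists r; split.
  by rewrite Fword_rcons g in g1.
by exists (rcons v i), w, pit.
Qed.

Lemma froot_corr x b i r : corr x b -> @froot R V DS i x.2 = Some r ->
  exists b1, @froot R V D (val i) b = Some b1 /\ corr (x.1, r) b1.
Proof.
move=> [v [w [pit [h f g]]]] fb.
have g1 : @Fword R V DS (rcons v i) (Some (pi_lam (x.1 (one01 R)))) = Some r.
  by rewrite Fword_rcons g.
have [b1 f1] := FS_Fp hA hAt lam_nat lamt_lam h g1; exists b1; split.
  by rewrite map_rcons Fword_rcons f in f1.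
by exists (rcons v i), w, pit.
Qed.

(** By [ce_spec] the raised path lowers back to [b]; its partner lowers to a partner of [b], and
    uniqueness of partners identifies it with [x]. *)
Lemma corr_ce x b i b1 : corr x b -> @ce R V D B (val i) (Some b) = Some b1 ->
  exists r, @ce R V DS (BS x) i (Some x.2) = Some r /\ corr (x.1, r) b1.
Proof.
move=> c /(ce_spec hA lam_nat (val i) b1 (corr_B c))[Bb1 f1].
have [[y1 y2] cy] := corr_ex Bb1; have [r [fr cr]] := corr_froot cy f1.
have e := corr_fun c cr; subst x; exists y2; split=> //.
by apply/(ce_spec hAS (corr_nat c) i _ (corr_BS c)); split=> //; exact: corr_BS cy.
Qed.

Lemma ce_corr x b i r : corr x b -> @ce R V DS (BS x) i (Some x.2) = Some r ->
  exists b1, @ce R V D B (val i) (Some b) = Some b1 /\ corr (x.1, r) b1.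
Proof.
case: x => x1 x2 c /(ce_spec hAS (corr_nat c) i r (corr_BS c))[Br fr].
have [v [w [pit [h _ _]]]] := c.
have [b1 c1] := @corr_sur (x1, r) w pit h Br.
have [b2 [f2 c2]] := froot_corr c1 fr.
have e := corr_inj c2 c; subst b2; exists b1; split=> //.
by apply/(ce_spec hA lam_nat (val i) b1 (corr_B c)); split=> //; exact: corr_B c1.
Qed.

End Isomorphism.

Theorem theorem7p2p2 (R : realType) (V : lmodType R) (I : countType)
  (a : I -> I -> int) (alpha : I -> V) (coroot : I -> V -> R) (P : set V)
  (lam : V) (S : pred I)
  (Vt : lmodType R) (alphat : Itil a -> Vt) (coroott : Itil a -> Vt -> R)
  (Pt : set Vt) (lamt : Vt) :
  BC_datum a alpha coroot P ->
  symmetrizable a -> even_cm a ->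
  P lam -> (forall i, 0 <= coroot i lam) ->
  BC_datum (@Atil I a) alphat coroott Pt ->
  Pt lamt -> (forall p : Itil a, coroott p lamt = coroot (val p).1 lam) ->
  let D := @RDat R V I a alpha coroot in
  let Dt := @RDat R Vt (Itil a) (@Atil I a) alphat coroott in
  let DS := @levi R V D S in
  let B := Bset D lam in
  (* pi~ (image of pi in B~(lam~)) is g~_{S~}-dominant *)
  let tdom (pi : rpath V) : Prop :=
    exists w : seq I, @Fword R V D w (Some (pi_lam lam)) = Some pi /\
      exists pit, @Fword R Vt Dt (lift_word a w) (Some (pi_lam lamt)) = Some pit /\
        forall p : Itil a, S (val p).1 -> forall u, 0 <= coroott p (pit u) in
  (* the disjoint union of the B_S(pi(1)) *)
  let U (x : rpath V * rpath V) : Prop :=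
    B x.1 /\ tdom x.1 /\ Bset DS (x.1 (one01 R)) x.2 in
  exists Phi : rpath V -> rpath V * rpath V,
    (forall b, B b -> U (Phi b)) /\
    (forall b b', B b -> B b' -> Phi b = Phi b' -> b = b') /\
    (forall x, U x -> exists b, B b /\ Phi b = x) /\
    (forall b, B b -> wt (Phi b).2 = wt b) /\
    (forall (i : idx DS) b, B b ->
       ceps i (Phi b).2 = ceps (val i : idx D) b /\
       cphi i (Phi b).2 = cphi (val i : idx D) b /\
       omap Phi (cf (val i : idx D) (Some b))
         = omap (pair (Phi b).1) (cf i (Some (Phi b).2)) /\
       omap Phi (ce B (val i : idx D) (Some b))
         = omap (pair (Phi b).1)
                (ce (Bset DS ((Phi b).1 (one01 R))) i (Some (Phi b).2))).
Proof.
move=> hD [d [d0 ds]] _ Plam lam0 hDt _ lamt_lam D Dt DS B tdom U.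
have [al [dg [off [zr [fr [_ [lin [_ [_ [_ hint]]]]]]]]]] := hD.
have [alt [dgt [offt [zrt [frt [_ [lint _]]]]]]] := hDt.
pose d' i : R := ratr (d i).
have d'0 i : 0 < d' i by rewrite ltr0q.
have d's i j : d' i * (a i j)%:~R = d' j * (a j i)%:~R.
  by rewrite -!(ratr_int R) -!rmorphM ds.
have hA : adm a alpha coroot.
  by split=> //; [move=> i j /zr|exists d'].
have hAt : adm (@Atil I a) alphat coroott.
  split=> //; first by move=> p q /zrt.
  (* A lifted index inherits the symmetrizer of its letter; the changed diagonal entries are
     compared only with themselves. *)
  exists (fun p => d' (val p).1); split=> [p|p q]; first exact: d'0.
  by rewrite /Atil eq_sym; case: eqP => [->|_].
have lam_nat i : exists n : nat, coroot i lam = n%:R.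
  have [z e] := hint i _ Plam; apply: int_nat (lam0 i).
  by rewrite e; exact: intr_int.
pose C := corr alpha coroot lam S alphat coroott lamt.
have [Phi hPhi] : exists Phi, forall b, B b -> C (Phi b) b.
  have /choice[Phi h] : forall b, exists x, B b -> C x b.
    (* Outside [B] the map takes an arbitrary value. *)
    move=> b; have [Bb|nB] := pselect (B b); last by exists (b, b).
    by have [x c] := corr_ex S hA hAt lam_nat lamt_lam Bb; exists x.
  by exists Phi.
have PhiE b x : C x b -> Phi b = x.
  by move=> c; apply: (corr_fun hA hAt lam_nat lamt_lam _ c); exact: hPhi (corr_B hA lam_nat c).
have tdomP pi : tdom pi <-> exists w pit, top alpha coroot lam S alphat coroott lamt pi w pit.
  split=> [[w [fw [pit [ft dm]]]]|[w [pit [fw ft dm]]]].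
    by exists w, pit; split=> //; rewrite -lift_wordE.
  by exists w; split=> //; exists pit; split=> //; rewrite lift_wordE.
exists Phi; split; [|split; [|split; [|split]]].
- move=> b /hPhi c; have [v [w [pit [h _ _]]]] := c.
  split; first exact: (top_B hA lam_nat h).
  by split; [apply/tdomP; exists w, pit|exact: (corr_BS hA hAt lam_nat lamt_lam c)].
- move=> b b' /hPhi c /hPhi c' e; rewrite -e in c'.
  exact: (corr_inj hA hAt lam_nat lamt_lam c c').
- move=> x [_ [/tdomP[w [pit h]] Bx]].
  have [b c] := corr_sur hA hAt lam_nat lamt_lam h Bx.
  by exists b; split; [exact: (corr_B hA lam_nat c)|exact: PhiE].
- by move=> b /hPhi c; exact: (corr_wt hA hAt lam_nat lamt_lam c).
move=> i b /hPhi c; split; first exact: (corr_eps hA hAt lam_nat lamt_lam i c).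
split; first exact: (corr_phi hA hAt lam_nat lamt_lam i c).
split.
  rewrite /=; case E : (froot (val i : idx D) b) => [b1|].
    have [r [fr' c1]] := corr_froot hA hAt lam_nat lamt_lam c E.
    by rewrite [froot i _]fr' /= (PhiE _ _ c1).
  case E' : (froot i _) => [r|] //.
  have [b1 [fb1 _]] := froot_corr hA hAt lam_nat lamt_lam c E'.
  by move: fb1; rewrite [froot _ _]E.
case E : (ce B (val i : idx D) (Some b)) => [b1|].
  have [r [fr' c1]] := corr_ce hA hAt lam_nat lamt_lam c E.
  by rewrite [ce _ i _]fr' /= (PhiE _ _ c1).
case E' : (ce _ i _) => [r|] //.
have [b1 [fb1 _]] := ce_corr hA hAt lam_nat lamt_lam c E'.
by move: fb1; rewrite [ce _ _ _]E.
Qed.
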